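(* Let $T>0$ be fixed and $h_n=T/n$. Assume that each of the drifts $B_1,\dots,B_4$ is globally Lipschitz and of class $C^4$ with all partial derivatives of order $0$ to $4$ of polynomial growth, and that $\sup_t\mathbb{E}[|Y_t|^{\ell}]<\infty$ for all $\ell\ge 0$ and each $Y\in\{\xi_0,\delta_0,\varepsilon_0,\zeta_0\}$. Assume $H_0$: there is $\theta_0\in\operatorname{Int}\Theta$ with $\mathbf{\Sigma}_0=\mathbf{\Sigma}(\theta_0)$. Suppose that $\mathbf{\Sigma}(\theta_1)=\mathbf{\Sigma}(\theta_2)$ implies $\theta_1=\theta_2$ for $\theta_1,\theta_2\in\Theta$, and that $\operatorname{rank}\Delta=q$, where $\Delta=\partial_\theta\operatorname{vech}\mathbf{\Sigma}(\theta)|_{\theta=\theta_0}\in\mathbb{R}^{\bar p\times q}$. Then, as $h_n\to0$ (that is, $n\to\infty$), the quasi-likelihood ratio statistic $\mathbb{T}_n=n\mathbb{F}_n(\hat\theta_n)$ converges in distribution to $\chi^2_{\bar p-q}$.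
   Context: Notation: $\operatorname{vech}$ is half-vectorization; $\chi^2_r$ is the chi-squared distribution with $r$ degrees of freedom (degrees of freedom are understood to be positive). True model and data: $p_1,p_2,k_1,k_2,r_1,\dots,r_4\ge 1$ are fixed integers with $k_1\le p_1$, $k_2\le p_2$; $p=p_1+p_2$, $\bar p=p(p+1)/2$. $W_1,\dots,W_4$ are independent standard Wiener processes of dimensions $r_1,\dots,r_4$. The latent processes $\xi_0,\delta_0,\varepsilon_0,\zeta_0$, with values in $\mathbb{R}^{k_1},\mathbb{R}^{p_1},\mathbb{R}^{p_2},\mathbb{R}^{k_2}$, solve $d\xi_{0,t}=B_1(\xi_{0,t})dt+\mathbf{S}_{1,0}dW_{1,t}$, $d\delta_{0,t}=B_2(\delta_{0,t})dt+\mathbf{S}_{2,0}dW_{2,t}$, $d\varepsilon_{0,t}=B_3(\varepsilon_{0,t})dt+\mathbf{S}_{3,0}dW_{3,t}$, $d\zeta_{0,t}=B_4(\zeta_{0,t})dt+\mathbf{S}_{4,0}dW_{4,t}$ on $[0,T]$, with deterministic initial values $c_1,\dots,c_4$ and constant matrices $\mathbf{S}_{i,0}$. Put $\mathbf{\Sigma}_{\xi\xi,0}=\mathbf{S}_{1,0}\mathbf{S}_{1,0}^\top$, $\mathbf{\Sigma}_{\delta\delta,0}=\mathbf{S}_{2,0}\mathbf{S}_{2,0}^\top$, $\mathbf{\Sigma}_{\varepsilon\varepsilon,0}=\mathbf{S}_{3,0}\mathbf{S}_{3,0}^\top$, $\mathbf{\Sigma}_{\zeta\zeta,0}=\mathbf{S}_{4,0}\mathbf{S}_{4,0}^\top$;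 $\mathbf{\Sigma}_{\delta\delta,0}$ and $\mathbf{\Sigma}_{\varepsilon\varepsilon,0}$ are positive definite. Constant matrices: $\mathbf{\Lambda}_{x_1,0}\in\mathbb{R}^{p_1\times k_1}$ of full column rank, $\mathbf{\Lambda}_{x_2,0}\in\mathbb{R}^{p_2\times k_2}$, $\mathbf{\Gamma}_0\in\mathbb{R}^{k_2\times k_1}$, $\mathbf{B}_0\in\mathbb{R}^{k_2\times k_2}$ with zero diagonal, $\mathbf{\Psi}_0=\mathbb{I}_{k_2}-\mathbf{B}_0$ non-singular. The observed process is $\mathbb{X}_t=(\mathbb{X}_{1,t}^\top,\mathbb{X}_{2,t}^\top)^\top$ with $\mathbb{X}_{1,t}=\mathbf{\Lambda}_{x_1,0}\xi_{0,t}+\delta_{0,t}$, $\mathbb{X}_{2,t}=\mathbf{\Lambda}_{x_2,0}\eta_{0,t}+\varepsilon_{0,t}$, $\eta_{0,t}=\mathbf{B}_0\eta_{0,t}+\mathbf{\Gamma}_0\xi_{0,t}+\zeta_{0,t}$. With $t_i^n=ih_n$, $T=nh_n$, $\mathbb{Q}_{\mathbb{XX}}=\frac1T\sum_{i=1}^n(\mathbb{X}_{t_i^n}-\mathbb{X}_{t_{i-1}^n})(\mathbb{X}_{t_i^n}-\mathbb{X}_{t_{i-1}^n})^\top$. Parametric model: $\Theta\subset\mathbb{R}^q$ is convex and compact. For $\theta\in\Theta$ there are matrices $\mathbf{\Lambda}_{x_1},\mathbf{\Lambda}_{x_2},\mathbf{\Gamma},\mathbf{\Psi}=\mathbb{I}_{k_2}-\mathbf{B}$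 ($\mathbf{B}$ with zero diagonal), $\mathbf{\Sigma}_{\xi\xi},\mathbf{\Sigma}_{\delta\delta},\mathbf{\Sigma}_{\varepsilon\varepsilon},\mathbf{\Sigma}_{\zeta\zeta}$ of respective sizes $p_1\times k_1$, $p_2\times k_2$, $k_2\times k_1$, $k_2\times k_2$, $k_1\times k_1$, $p_1\times p_1$, $p_2\times p_2$, $k_2\times k_2$, each entry being either a known constant or a coordinate of $\theta$ ($\theta$ collects the unknown, non-duplicated entries); $\mathbf{\Lambda}_{x_1}$ has full column rank, $\mathbf{\Psi}$ is non-singular, $\mathbf{\Sigma}_{\xi\xi},\mathbf{\Sigma}_{\zeta\zeta}$ are positive semidefinite, $\mathbf{\Sigma}_{\delta\delta},\mathbf{\Sigma}_{\varepsilon\varepsilon}$ positive definite. $\mathbf{\Sigma}(\theta)$ is the symmetric $p\times p$ matrix with blocks $\mathbf{\Sigma}^{11}=\mathbf{\Lambda}_{x_1}\mathbf{\Sigma}_{\xi\xi}\mathbf{\Lambda}_{x_1}^\top+\mathbf{\Sigma}_{\delta\delta}$, $\mathbf{\Sigma}^{12}=\mathbf{\Lambda}_{x_1}\mathbf{\Sigma}_{\xi\xi}\mathbf{\Gamma}^\top\mathbf{\Psi}^{-1\top}\mathbf{\Lambda}_{x_2}^\top$, $\mathbf{\Sigma}^{22}=\mathbf{\Lambda}_{x_2}\mathbf{\Psi}^{-1}(\mathbf{\Gamma}\mathbf{\Sigma}_{\xi\xi}\mathbf{\Gamma}^\top+\mathbf{\Sigma}_{\zeta\zeta})\mathbf{\Psi}^{-1\top}\mathbf{\Lambda}_{x_2}^\top+\mathbf{\Sigma}_{\varepsilon\varepsilon}$;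 $\mathbf{\Sigma}_0$ is the same expression evaluated at the true matrices (subscript $0$). Contrast and estimator: $\mathrm{F}(Q,\mathbf{\Sigma})=\log\det\mathbf{\Sigma}-\log\det Q+\operatorname{tr}(\mathbf{\Sigma}^{-1}Q)-p$ for $Q,\mathbf{\Sigma}$ positive definite. $\mathbb{F}_n(\theta)=\mathrm{F}(\mathbb{Q}_{\mathbb{XX}},\mathbf{\Sigma}(\theta))$ if $\mathbb{Q}_{\mathbb{XX}}$ is non-singular and $\mathbb{F}_n(\theta)=|\operatorname{vech}\mathbb{Q}_{\mathbb{XX}}-\operatorname{vech}\mathbf{\Sigma}(\theta)|^2$ otherwise. $\hat\theta_n\in\Theta$ is a minimum contrast estimator: $\mathbb{F}_n(\hat\theta_n)=\inf_{\theta\in\Theta}\mathbb{F}_n(\theta)$. *)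

(* Defs.v *)
From HB Require Import structures.
From mathcomp Require Import all_boot all_order all_algebra.
From mathcomp Require Import all_classical all_reals all_analysis.

Set Implicit Arguments.
Unset Strict Implicit.
Unset Printing Implicit Defensive.

Import Order.TTheory GRing.Theory Num.Theory.
Import numFieldNormedType.Exports.

Local Open Scope classical_set_scope.
Local Open Scope ring_scope.

(* The norm `|x| of the library is the max norm on matrices; this is the
   Euclidean one. *)
Definition enorm (R : realType) (d : nat) (x : 'cV[R]_d) : R :=
  Num.sqrt (\sum_i x i 0 ^+ 2).

Definition psd (R : realType) (d : nat) (A : 'M[R]_d) : Prop :=
  A^T = A /\ forall x : 'cV[R]_d, 0 <= (x^T *m A *m x) 0 0.

Definition posdef (R : realType) (d : nat) (A : 'M[R]_d) : Prop :=
  A^T = A /\ forall x : 'cV[R]_d, x != 0 -> 0 < (x^T *m A *m x) 0 0.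

(* Columns of the lower triangle (diagonal included), stacked left to right. *)
Definition vech_seq (R : realType) (p : nat) (A : 'M[R]_p) : seq R :=
  [seq A i j | j <- enum 'I_p, i <- [seq i : 'I_p <- enum 'I_p | (j <= i)%N]].

Lemma size_vech_seq (R : realType) (p : nat) (A : 'M[R]_p) :
  size (vech_seq A) = (p * p.+1)./2.
Proof.
rewrite size_allpairs_dep sumnE big_map big_enum /=.
have cnt (j : 'I_p) :
    size [seq i : 'I_p <- enum 'I_p | (j <= i)%N] = (p - j)%N.
  rewrite -(size_map val) -(filter_map val (leq j)) val_enum_ord.
  have -> : iota 0 p = iota 0 (j + (p - j)) by rewrite subnKC// ltnW.
  rewrite iotaD filter_cat size_cat /=.
  rewrite (eq_in_filter (a2 := pred0)) ?filter_pred0 => [|i]; last first.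
    by rewrite mem_iota /= add0n => ij; rewrite leqNgt ij.
  rewrite (eq_in_filter (a2 := predT)) ?filter_predT ?size_iota // => i.
  by rewrite mem_iota => /andP[].
under eq_bigr => j _ do rewrite cnt.
rewrite -(big_mkord predT (fun j => p - j)%N).
rewrite mulnC -bin2 -bin2_sum big_nat_rev big_nat_recl //= add0n.
by rewrite big_nat_cond [RHS]big_nat_cond; apply: eq_bigr => i;
  rewrite andbT => /andP[_ ip]; rewrite subKn.
Qed.

Definition vech (R : realType) (p : nat) (A : 'M[R]_p) :
  'cV[R]_(p * p.+1)./2 := \col_k nth 0 (vech_seq A) k.

Definition pderiv (R : realType) (d : nat) (f : 'cV[R]_d -> R) (i : 'I_d) :
  'cV[R]_d -> R := fun x => 'D_(delta_mx i 0) f x.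

Definition iter_pderiv (R : realType) (d : nat) (f : 'cV[R]_d -> R)
  (s : seq 'I_d) : 'cV[R]_d -> R := foldl (@pderiv R d) f s.

Definition poly_growth (R : realType) (d : nat) (f : 'cV[R]_d -> R) : Prop :=
  exists (C : R) (m : nat), forall x, `|f x| <= C * (1 + enorm x) ^+ m.

Definition Ck_poly_growth (R : realType) (k d : nat) (f : 'cV[R]_d -> R) :=
  (forall s i x, (size s < k)%N ->
     derivable (iter_pderiv f s) x (delta_mx i 0)) /\
  (forall s, (size s <= k)%N ->
     continuous (iter_pderiv f s) /\ poly_growth (iter_pderiv f s)).

Definition globally_lipschitz (R : realType) (d : nat)
  (B : 'cV[R]_d -> 'cV[R]_d) : Prop :=
  exists L : R, forall x y, enorm (B x - B y) <= L * enorm (x - y).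

Definition regular_drift (R : realType) (d : nat)
  (B : 'cV[R]_d -> 'cV[R]_d) : Prop :=
  globally_lipschitz B /\ forall j, Ck_poly_growth 4 (fun x => B x j 0).

Section Probability.
Context (R : realType) (dd : measure_display) (Omega : measurableType dd)
  (P : probability Omega R).

Definition sigma_generated (J : Type) (D : set J) (X : J -> Omega -> R) :
  set_system Omega :=
  <<s \bigcup_(j in D) preimage_set_system setT (X j) measurable >>.

Definition mutually_independent (I : finType) (G : I -> set_system Omega) :
  Prop :=
  forall (J : {set I}) (E : I -> set Omega),
    (forall i, i \in J -> G i (E i)) ->
    P (\bigcap_(i in [set i | i \in J]) E i) =
      (\prod_(i in J) fine (P (E i)))%:E.

Definition random_vector (d : nat) (Y : Omega -> 'cV[R]_d) : Prop :=
  forall i, measurable_fun setT (fun w => Y w i 0).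

Definition wiener1 (W : R -> Omega -> R) : Prop :=
  [/\ forall t : R, 0 <= t -> measurable_fun setT (W t),
      {ae P, forall w, W 0 w = 0 /\
        {within `[0, +oo[, continuous (fun t => W t w)}},
      forall (s t : R) (A : set R), 0 <= s -> s < t -> measurable A ->
        P ((fun w => W t w - W s w) @^-1` A) =
          normal_prob 0 (Num.sqrt (t - s)) A &
      forall (n : nat) (t : nat -> R), 0 <= t 0%N ->
        {homo t : i j / (i <= j)%N >-> i <= j} ->
        mutually_independent (fun i : 'I_n =>
          sigma_generated [set: unit] (fun _ w => W (t i.+1) w - W (t i) w))].

Definition wiener (r : nat) (W : R -> Omega -> 'cV[R]_r) : Prop :=
  (forall i, wiener1 (fun t w => W t w i 0)) /\
  mutually_independent (fun i : 'I_r =>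
    sigma_generated [set t | 0 <= t] (fun t w => W t w i 0)).

Definition process_sigma (r : nat) (W : R -> Omega -> 'cV[R]_r) :
  set_system Omega :=
  sigma_generated [set ti : R * 'I_r | 0 <= ti.1]
    (fun ti w => W ti.1 w ti.2 0).

Definition independent4 (r1 r2 r3 r4 : nat)
  (W1 : R -> Omega -> 'cV[R]_r1) (W2 : R -> Omega -> 'cV[R]_r2)
  (W3 : R -> Omega -> 'cV[R]_r3) (W4 : R -> Omega -> 'cV[R]_r4) : Prop :=
  mutually_independent (fun i : 'I_4 => nth set0
    [:: process_sigma W1; process_sigma W2; process_sigma W3; process_sigma W4]
    i).

(* The diffusion coefficient is constant, so the stochastic integral of
   dX = B(X) dt + S dW is S (W_t - W_0) = S W_t and the equation is pathwise. *)
Definition sde_solution (d r : nat) (T : R) (B : 'cV[R]_d -> 'cV[R]_d)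
  (S : 'M[R]_(d, r)) (c : 'cV[R]_d) (W : R -> Omega -> 'cV[R]_r)
  (X : R -> Omega -> 'cV[R]_d) : Prop :=
  (forall t : R, 0 <= t <= T -> random_vector (X t)) /\
  {ae P, forall w, {within `[0, T], continuous (fun t => X t w)} /\
    forall t : R, 0 <= t <= T ->
      X t w = c
        + \col_i (\int[lebesgue_measure]_(s in `[0%R, t]) B (X s w) i 0)
        + S *m W t w}.

Definition bounded_moments (d : nat) (T : R) (X : R -> Omega -> 'cV[R]_d) :
  Prop :=
  forall l : R, 0 <= l ->
    (ereal_sup [set 'E_P[(fun w => enorm (X t w) `^ l)%R] | t in `[0%R, T]]
      < +oo)%E.

(* A point x is a continuity point of the limiting distribution function iff
   mu [set x] = 0. *)
Definition cvg_in_distribution (X : nat -> Omega -> R) (mu : set R -> \bar R) :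
  Prop :=
  forall x, mu [set x] = 0%E ->
    P (X n @^-1` `]-oo, x]) @[n --> \oo] --> mu `]-oo, x]%classic.

End Probability.

Definition Gamma (R : realType) (a : R) : R :=
  \int[lebesgue_measure]_(x in `]0%R, +oo[) (x `^ (a - 1) * expR (- x)).

Definition chi2_pdf (R : realType) (r : nat) (x : R) : R :=
  if 0 < x then
    x `^ (r%:R / 2 - 1) * expR (- x / 2) / (2 `^ (r%:R / 2) * Gamma (r%:R / 2))
  else 0.

Definition chi2_prob (R : realType) (r : nat) (A : set R) : \bar R :=
  (\int[lebesgue_measure]_(x in A) (chi2_pdf r x)%:E)%E.

(* [E := R] gives actual coefficient matrices, [E := R + 'I_q] a specification
   of the matrices of a parametric model; [sem_Psi] stands for I - B. *)
Record sem (E : Type) (p1 p2 k1 k2 : nat) := Sem {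
  sem_L1 : 'M[E]_(p1, k1);
  sem_L2 : 'M[E]_(p2, k2);
  sem_Gamma : 'M[E]_(k2, k1);
  sem_Psi : 'M[E]_k2;
  sem_Sxi : 'M[E]_k1;
  sem_Sdelta : 'M[E]_p1;
  sem_Seps : 'M[E]_p2;
  sem_Szeta : 'M[E]_k2 }.

Definition sem_cov (R : realType) (p1 p2 k1 k2 : nat) (M : sem R p1 p2 k1 k2) :
  'M[R]_(p1 + p2) :=
  let L1 := sem_L1 M in let L2 := sem_L2 M in
  let G := sem_Gamma M in let Pinv := invmx (sem_Psi M) in
  let Sxi := sem_Sxi M in
  let S12 := L1 *m Sxi *m G^T *m Pinv^T *m L2^T in
  block_mx
    (L1 *m Sxi *m L1^T + sem_Sdelta M) S12
    S12^T
    (L2 *m Pinv *m (G *m Sxi *m G^T + sem_Szeta M) *m Pinv^T *m L2^T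
      + sem_Seps M).

(* [inl c]: known constant c; [inr j]: the j-th coordinate of theta. *)
Definition entry_val (R : realType) (q : nat) (theta : 'rV[R]_q)
  (e : R + 'I_q) : R :=
  match e with inl c => c | inr j => theta 0 j end.

Definition sem_at (R : realType) (p1 p2 k1 k2 q : nat)
  (M : sem (R + 'I_q) p1 p2 k1 k2) (theta : 'rV[R]_q) : sem R p1 p2 k1 k2 :=
  let v m n (A : 'M[R + 'I_q]_(m, n)) := map_mx (entry_val theta) A in
  Sem (v _ _ (sem_L1 M)) (v _ _ (sem_L2 M)) (v _ _ (sem_Gamma M))
      (v _ _ (sem_Psi M)) (v _ _ (sem_Sxi M)) (v _ _ (sem_Sdelta M))
      (v _ _ (sem_Seps M)) (v _ _ (sem_Szeta M)).

Definition Sigma (R : realType) (p1 p2 k1 k2 q : nat)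
  (M : sem (R + 'I_q) p1 p2 k1 k2) (theta : 'rV[R]_q) : 'M[R]_(p1 + p2) :=
  sem_cov (sem_at M theta).

Definition sem_unknown (R : realType) (p1 p2 k1 k2 q : nat)
  (M : sem (R + 'I_q) p1 p2 k1 k2) (j : 'I_q) : Prop :=
  let occ m n (A : 'M[R + 'I_q]_(m, n)) := exists a b, A a b = inr j in
  occ _ _ (sem_L1 M) \/ occ _ _ (sem_L2 M) \/ occ _ _ (sem_Gamma M) \/
  occ _ _ (sem_Psi M) \/ occ _ _ (sem_Sxi M) \/ occ _ _ (sem_Sdelta M) \/
  occ _ _ (sem_Seps M) \/ occ _ _ (sem_Szeta M).

Definition sem_admissible (R : realType) (p1 p2 k1 k2 : nat)
  (M : sem R p1 p2 k1 k2) : Prop :=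
  [/\ \rank (sem_L1 M) = k1,
      forall i, (1%:M - sem_Psi M) i i = 0,
      sem_Psi M \in unitmx,
      psd (sem_Sxi M) /\ psd (sem_Szeta M) &
      posdef (sem_Sdelta M) /\ posdef (sem_Seps M)].

(* Coordinates of theta are the distinct unknown entries: each occurs in the
   model, possibly at several positions (symmetric entries of a covariance). *)
Definition sem_model (R : realType) (p1 p2 k1 k2 q : nat)
  (Theta : set 'rV[R]_q) (M : sem (R + 'I_q) p1 p2 k1 k2) : Prop :=
  (forall j, sem_unknown M j) /\
  forall theta, Theta theta -> sem_admissible (sem_at M theta).

Definition Delta (R : realType) (p1 p2 k1 k2 q : nat)
  (M : sem (R + 'I_q) p1 p2 k1 k2) (theta0 : 'rV[R]_q) :
  'M[R]_(((p1 + p2) * (p1 + p2).+1)./2, q) :=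
  \matrix_(i, j) 'D_(delta_mx 0 j) (fun theta => vech (Sigma M theta) i 0) theta0.

Definition quad_var (R : realType) (p : nat) (T : R) (n : nat)
  (x : R -> 'cV[R]_p) : 'M[R]_p :=
  let h := T / n%:R in
  T^-1 *: \sum_(1 <= i < n.+1)
    ((x (i%:R * h) - x (i.-1%:R * h)) *m (x (i%:R * h) - x (i.-1%:R * h))^T).

Definition qlik (R : realType) (p : nat) (Q S : 'M[R]_p) : R :=
  ln (\det S) - ln (\det Q) + \tr (invmx S *m Q) - p%:R.

Definition contrast (R : realType) (p : nat) (Q S : 'M[R]_p) : R :=
  if Q \in unitmx then qlik Q S else enorm (vech Q - vech S) ^+ 2.

Definition min_contrast (R : realType) (p1 p2 k1 k2 q : nat)
  (Theta : set 'rV[R]_q) (M : sem (R + 'I_q) p1 p2 k1 k2)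
  (Q : 'M[R]_(p1 + p2)) (theta : 'rV[R]_q) : Prop :=
  Theta theta /\
  contrast Q (Sigma M theta) =
    inf [set contrast Q (Sigma M theta') | theta' in Theta].

(* Main.v *)
Require Import Defs.
From HB Require Import structures.
From mathcomp Require Import all_boot all_order all_algebra.
From mathcomp Require Import all_classical all_reals all_analysis.
From mathcomp Require Import measurable_realfun ring lra.
Import Order.TTheory GRing.Theory Num.Theory.
Import numFieldNormedType.Exports.
Local Open Scope classical_set_scope.
Local Open Scope ring_scope.
Set Implicit Arguments.
Unset Strict Implicit.
Unset Printing Implicit Defensive.

(* Write Sigma_0 = K K^T. Conjugation by K^-1 leaves the contrast unchanged, and a
   Schur complement induction for C |-> tr C - p - ln det C shows that near the
   identity F(Q, S) is |Q - S|^2 / 2 up to a small relative error. Hence, as long as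
   x = vec (sqrt n (K^-1 Q K^-T - 1)) stays bounded, identifiability and minimality
   give n F_n = |x Pi|^2 / 2 + o(1) uniformly, where Pi projects orthogonally to the
   derivative J of the normalised model at theta_0.

   Since the diffusion coefficients are constant, the normalised observed path is
   a C^1 path plus a linear image of the Wiener processes. The C^1 part changes
   sqrt n Q by o(1) pathwise, without moments or adaptedness, so that x may be
   replaced by a normalised sum S of iid centred quadratic Gaussian vectors
   whose covariance is twice the projector Sym onto symmetric matrices. By Stein's method
   g(l) = E exp (- l |S Pi|^2 / 2) satisfies (1 + 2 l) g' = - D g up to O(n^(-1/2)),
   with D = tr (Sym Pi) = p(p+1)/2 - q, hence tends to (1 + 2 l)^(- D / 2), the Laplace
   transform of chi^2_D. Distribution functions are recovered by approximating
   indicators by the functions (1 - exp (- N y))^M of y. *)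

(** * Frobenius norm and positive definite matrices *)

(** The limit law involves only the length of S Pi, not the vector. For a centred Gaussian vector
    whose covariance is a projector of trace D, integration by parts closes into a first order
    equation for the Laplace transform of the squared length, so no multivariate limit theorem is
    required. The degrees of freedom are a trace: the rows of J are symmetric matrices, hence Sym
    fixes J and commutes with Pi, and Sym Pi projects onto the symmetric matrices orthogonal to the
    q tangent directions. The obstacle on the path side is the cross term between smooth and noisy
    increments. It has n summands of order n^(-1) * n^(-1/2), so that after multiplication by sqrt n
    absolute values leave a bound of order 1. It vanishes because the slope of the smooth part is
    nearly constant over long blocks of the grid, on which the noise increments telescope.
    Boundedness of x also makes Q positive definite for large n, so that the likelihood branch of
    the contrast is the one in force. *)

Definition fro (R : realType) (m n : nat) (A : 'M[R]_(m, n)) : R :=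
  \sum_i \sum_j A i j ^+ 2.

(** Both the square and its root are kept: [fro] is additive over blocks and orthogonal sums, which
    the expansions use, while [nf] satisfies the triangle inequality and is submultiplicative. *)
Definition nf (R : realType) (m n : nat) (A : 'M[R]_(m, n)) : R :=
  Num.sqrt (fro A).

Lemma sum_cauchy_schwarz (R : realType) (I : finType) (a b : I -> R) :
  (\sum_i a i * b i) ^+ 2 <= (\sum_i a i ^+ 2) * (\sum_i b i ^+ 2).
Proof.
set A := \sum_i a i ^+ 2; set B := \sum_i b i ^+ 2; set C := \sum_i a i * b i.
have B0 : 0 <= B by apply: sumr_ge0 => i _; exact: sqr_ge0.
have [B00|Bn0] := eqVneq B 0.
  have b0 i : b i = 0.
    have /psumr_eq0P := B00 => /(_ (fun i _ => sqr_ge0 _)) /(_ i isT) /eqP.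
    by rewrite sqrf_eq0 => /eqP.
  by rewrite B00 /C big1 ?expr0n ?mulr0// => i _; rewrite b0 mulr0.
have : 0 <= \sum_i (B * a i - C * b i) ^+ 2.
  by apply: sumr_ge0 => i _; exact: sqr_ge0.
have -> : \sum_i (B * a i - C * b i) ^+ 2 = B * (A * B - C ^+ 2).
  have expand x y : \sum_i (x * a i - y * b i) ^+ 2 =
      x ^+ 2 * A - 2 * x * y * C + y ^+ 2 * B.
    rewrite /A /B /C !mulr_sumr -sumrB -big_split /=.
    by apply: eq_bigr => i _; ring.
  by rewrite expand; ring.
by rewrite pmulr_rge0 ?subr_ge0// lt_def Bn0.
Qed.

Section Frobenius.
Variable R : realType.
Implicit Types m n p : nat.

Lemma fro_ge0 m n (A : 'M[R]_(m, n)) : 0 <= fro A.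
Proof. by apply: sumr_ge0 => i _; apply: sumr_ge0 => j _; exact: sqr_ge0. Qed.

Lemma fro_sum m n (A : 'M[R]_(m, n)) : fro A = \sum_ij A ij.1 ij.2 ^+ 2.
Proof. by rewrite /fro pair_big. Qed.

Lemma fro_entry m n (A : 'M[R]_(m, n)) i j : A i j ^+ 2 <= fro A.
Proof.
rewrite fro_sum (bigD1 (i, j))//= lerDl; apply: sumr_ge0 => k _.
exact: sqr_ge0.
Qed.

Lemma fro_eq0 m n (A : 'M[R]_(m, n)) : fro A = 0 -> A = 0.
Proof.
move=> A0; apply/matrixP => i j; rewrite mxE; apply/eqP.
by rewrite -sqrf_eq0 eq_le sqr_ge0 andbT -A0 fro_entry.
Qed.

Lemma fro_trmx m n (A : 'M[R]_(m, n)) : fro A^T = fro A.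
Proof.
rewrite /fro exchange_big; apply: eq_bigr => i _; apply: eq_bigr => j _.
by rewrite mxE.
Qed.

Lemma fro_tr m n (A : 'M[R]_(m, n)) : fro A = \tr (A *m A^T).
Proof.
by apply: eq_bigr => i _; rewrite mxE; apply: eq_bigr => j _; rewrite mxE expr2.
Qed.

Lemma froZ m n a (A : 'M[R]_(m, n)) : fro (a *: A) = a ^+ 2 * fro A.
Proof.
rewrite !fro_sum mulr_sumr; apply: eq_bigr => i _.
by rewrite mxE exprMn.
Qed.

Lemma sqr_nf m n (A : 'M[R]_(m, n)) : nf A ^+ 2 = fro A.
Proof. by rewrite sqr_sqrtr// fro_ge0. Qed.

Lemma nf_ge0 m n (A : 'M[R]_(m, n)) : 0 <= nf A.
Proof. exact: sqrtr_ge0. Qed.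

Lemma nf0 m n : nf (0 : 'M[R]_(m, n)) = 0.
Proof.
rewrite /nf fro_sum big1 ?sqrtr0// => i _; by rewrite mxE expr0n.
Qed.

Lemma nf_eq0 m n (A : 'M[R]_(m, n)) : nf A = 0 -> A = 0.
Proof. by move=> A0; apply: fro_eq0; rewrite -sqr_nf A0 expr0n. Qed.

Lemma nf_trmx m n (A : 'M[R]_(m, n)) : nf A^T = nf A.
Proof. by rewrite /nf fro_trmx. Qed.

Lemma nfZ m n a (A : 'M[R]_(m, n)) : nf (a *: A) = `|a| * nf A.
Proof. by rewrite /nf froZ sqrtrM ?sqr_ge0// sqrtr_sqr. Qed.

Lemma nfN m n (A : 'M[R]_(m, n)) : nf (- A) = nf A.
Proof. by rewrite -scaleN1r nfZ normrN1 mul1r. Qed.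

Lemma nf_entry m n (A : 'M[R]_(m, n)) i j : `|A i j| <= nf A.
Proof. by rewrite -sqrtr_sqr ler_wsqrtr// fro_entry. Qed.

Lemma nf_dot m n (A B : 'M[R]_(m, n)) :
  `|\sum_ij A ij.1 ij.2 * B ij.1 ij.2| <= nf A * nf B.
Proof.
rewrite -sqrtr_sqr /nf -sqrtrM ?fro_ge0// ler_wsqrtr// !fro_sum.
exact: sum_cauchy_schwarz.
Qed.

Lemma nf_trace m n (A : 'M[R]_(m, n)) (B : 'M[R]_(n, m)) :
  `|\tr (A *m B)| <= nf A * nf B.
Proof.
rewrite -(nf_trmx B); apply: le_trans (nf_dot _ _).
rewrite le_eqVlt; apply/orP; left; apply/eqP; congr (`| _ |).
rewrite -(pair_big predT predT (fun i j => A i j * B^T i j)) /=.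
apply: eq_bigr => i _; rewrite mxE; apply: eq_bigr => j _.
by rewrite mxE.
Qed.

Lemma froD m n (A B : 'M[R]_(m, n)) :
  fro (A + B) = fro A + fro B + 2 * \sum_ij A ij.1 ij.2 * B ij.1 ij.2.
Proof.
rewrite !fro_sum mulr_sumr -!big_split /=; apply: eq_bigr => i _.
by rewrite mxE; ring.
Qed.

Lemma nfD m n (A B : 'M[R]_(m, n)) : nf (A + B) <= nf A + nf B.
Proof.
rewrite -(@ler_pXn2r _ 2)// ?nnegrE ?addr_ge0 ?nf_ge0// sqr_nf froD.
rewrite sqrrD !sqr_nf.
have := le_trans (ler_norm _) (nf_dot A B); lra.
Qed.

Lemma nfB m n (A B : 'M[R]_(m, n)) : nf (A - B) <= nf A + nf B.
Proof. by rewrite -(nfN B) nfD. Qed.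

Lemma nf_sub m n (A B : 'M[R]_(m, n)) : `|nf A - nf B| <= nf (A - B).
Proof.
rewrite ler_norml; apply/andP; split.
  by have := nfB A (A - B); rewrite opprB addrCA subrr addr0; lra.
by have := nfD (A - B) B; rewrite subrK; lra.
Qed.

Lemma nf_distC m n (A B : 'M[R]_(m, n)) : nf (A - B) = nf (B - A).
Proof. by rewrite -nfN opprB. Qed.

Lemma nfM m n p (A : 'M[R]_(m, n)) (B : 'M[R]_(n, p)) :
  nf (A *m B) <= nf A * nf B.
Proof.
rewrite /nf -sqrtrM ?fro_ge0// ler_wsqrtr// -(fro_trmx B) /fro mulr_suml.
apply: ler_sum => i _; rewrite mulr_sumr; apply: ler_sum => k _.
rewrite mxE; under [X in _ <= _ * X]eq_bigr do rewrite mxE.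
exact: sum_cauchy_schwarz.
Qed.

Lemma fro_block m1 m2 n1 n2 (A : 'M[R]_(m1, n1)) (B : 'M[R]_(m1, n2))
    (C : 'M[R]_(m2, n1)) (D : 'M[R]_(m2, n2)) :
  fro (block_mx A B C D) = fro A + fro B + (fro C + fro D).
Proof.
rewrite /fro big_split_ord /=; congr (_ + _); rewrite -big_split /=;
  apply: eq_bigr => i _; rewrite big_split_ord /=; congr (_ + _);
  apply: eq_bigr => j _.
- by rewrite block_mxEul.
- by rewrite block_mxEur.
- by rewrite block_mxEdl.
- by rewrite block_mxEdr.
Qed.

Lemma fro_subI m n (A B : 'M[R]_(m, n)) :
  `|fro (A - B) - fro A| <= nf B * (2 * nf A + nf B).
Proof.
rewrite -!sqr_nf subr_sqr normrM.
have h1 := nf_sub (A - B) A; have h2 := nfB A B.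
have h3 := nf_ge0 (A - B); have h4 := nf_ge0 A; have h5 := nf_ge0 B.
apply: ler_pM => //.
  by move: h1; rewrite [A - B - A]addrAC subrr add0r nfN.
by rewrite ger0_norm ?addr_ge0//; lra.
Qed.

Lemma fro_outer n (b : 'M[R]_(n, 1)) : fro (b *m b^T) = fro b ^+ 2.
Proof.
rewrite /fro expr2 mulr_suml; apply: eq_bigr => i _.
rewrite mulr_sumr big_ord1; apply: eq_bigr => j _.
by rewrite !mxE !big_ord1 mxE exprMn.
Qed.

End Frobenius.

(** * The scalar function a - 1 - ln a *)

Section ScalarLog.
Variable R : realType.

Lemma mvt_bound0 (f df : R -> R) (x M : R) :
  (forall y : R, `|y| <= `|x| -> is_derive y 1 f (df y)) ->
  (forall y : R, `|y| <= `|x| -> `|df y| <= M) ->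
  `|f x - f 0| <= M * `|x|.
Proof.
move=> fdf dfM.
have cf a b : (forall y, y \in `[a, b] -> `|y| <= `|x|) ->
    {within `[a, b], continuous f}.
  move=> ab; apply: derivable_within_continuous => y yab.
  by have [] := fdf y (ab _ yab).
have [x0|x0] := leP 0 x.
- have hin y : y \in `[0, x] -> `|y| <= `|x|.
    by rewrite in_itv /= => /andP[y0 yx]; rewrite !ger0_norm.
  have [||c cx ->] := @MVT_segment R f df 0 x x0.
  + by move=> y /subset_itv_oo_cc; move=> /hin /fdf.
  + exact: cf.
  + by rewrite subr0 normrM ler_wpM2r// dfM// hin.
- have hin y : y \in `[x, 0] -> `|y| <= `|x|.
    by rewrite in_itv /= => /andP[y0 yx]; rewrite !ler0_norm ?lerN2// ltW.
  have [||c cx] := @MVT_segment R f df x 0 (ltW x0).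
  + by move=> y /subset_itv_oo_cc; move=> /hin /fdf.
  + exact: cf.
  + by rewrite distrC => ->; rewrite sub0r normrM normrN ler_wpM2r// dfM// hin.
Qed.

(** The remainder has derivative exactly - y^2 / (1 + y), which is at most 2 x^2 in absolute value
    for |y| <= |x| <= 1/2; the mean value theorem supplies the third factor. *)
Lemma ln_taylor2 (x : R) : `|x| <= 1 / 2 ->
  `|x - ln (1 + x) - x ^+ 2 / 2| <= 2 * `|x| ^+ 3.
Proof.
move=> hx.
pose f (y : R) := y - ln (1 + y) - 2^-1 * (y * y).
have f0 : f 0 = 0 by rewrite /f addr0 ln1 mulr0; lra.
have df (y : R) : `|y| <= `|x| -> is_derive y 1 f (- (y ^+ 2 / (1 + y))).
  move=> hy; have : `|y| <= 1 / 2 by exact: le_trans hx.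
  rewrite ler_norml => {}hy.
  have y0 : 0 < 1 + y by lra.
  have h1 : is_derive y 1 (fun z : R => 1 + z) 1.
    exact: (is_derive_eq (is_deriveD (is_derive_cst (1 : R) y 1)
      (is_derive_id y 1)) (add0r 1)).
  have h2 : is_derive y 1 (fun z : R => ln (1 + z)) ((1 + y)^-1 * 1).
    exact: (is_derive1_comp (f := @ln R) (g := fun z => 1 + z)
      (is_derive1_ln y0) h1).
  have h3 := is_deriveZ 2^-1 (is_deriveM (is_derive_id y 1) (is_derive_id y 1)).
  have h4 := is_deriveB (is_deriveB (is_derive_id y 1) h2) h3.
  apply: (is_derive_eq h4); rewrite /GRing.scale /=; field; lra.
have := @mvt_bound0 f _ x (2 * `|x| ^+ 2) df.
have -> : x - ln (1 + x) - x ^+ 2 / 2 = f x by rewrite /f; field.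
rewrite f0 subr0 => H; apply: le_trans (H _) _; last by rewrite -mulrA -exprSr.
move=> y hy; rewrite normrN normrM normrX normfV.
have : `|y| <= 1 / 2 by exact: le_trans hx.
rewrite ler_norml => hy2.
rewrite mulrC ler_pM ?invr_ge0 ?exprn_ge0 ?lerXn2r ?nnegrE//.
clear H df f0; have y0 : 0 < 1 + y by lra.
rewrite gtr0_norm// -[leRHS]invrK lef_pV2 ?posrE ?invr_gt0//; lra.
Qed.

Lemma scalar_psi_local (e : R) : 0 < e -> exists2 d : R, 0 < d & forall a : R,
  `|a - 1| <= d -> `|a - 1 - ln a - (a - 1) ^+ 2 / 2| <= e * (a - 1) ^+ 2.
Proof.
move=> e0; exists (Num.min (1 / 2) (e / 2)); first by rewrite lt_min; apply/andP; split; lra.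
move=> a; rewrite le_min => /andP[a1 a2].
have := ln_taylor2 a1; rewrite [1 + _]addrC subrK => /le_trans; apply.
rewrite exprS mulrA -(real_normK (num_real (a - 1))) ler_wpM2r ?exprn_ge0//; lra.
Qed.

(** With s = sqrt a, the difference of the two sides is 2 (s - 1 - ln s), nonnegative by ln (1 + x)
    <= x. The bound is global on a > 0, which a Taylor expansion at 1 would not give. *)
Lemma scalar_psi_ge (a : R) : 0 < a ->
  (Num.sqrt a - 1) ^+ 2 <= a - 1 - ln a.
Proof.
move=> a0; have s0 : 0 < Num.sqrt a by rewrite sqrtr_gt0.
have h : ln (Num.sqrt a) <= Num.sqrt a - 1.
  have -> : ln (Num.sqrt a) = ln (1 + (Num.sqrt a - 1)) by congr ln; ring.
  by apply: le_ln1Dx; lra.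
have : ln a = 2 * ln (Num.sqrt a).
  by rewrite -[in LHS](sqr_sqrtr (ltW a0)) expr2 lnM ?posrE//; lra.
have := sqr_sqrtr (ltW a0); nra.
Qed.

Lemma scalar_psi_ge0 (a : R) : 0 < a -> 0 <= a - 1 - ln a.
Proof. by move=> /scalar_psi_ge; apply: le_trans; exact: sqr_ge0. Qed.

Lemma scalar_psi_control (e : R) : 0 < e -> exists2 d : R, 0 < d &
  forall a : R, 0 < a -> a - 1 - ln a <= d -> `|a - 1| <= e.
Proof.
move=> e0; set u := Num.min 1 (e / 3).
have u0 : 0 < u by rewrite lt_min; apply/andP; split; lra.
have u1 : u <= 1 by rewrite ge_min lexx.
have ue : 3 * u <= e.
  by have : u <= e / 3 by [rewrite ge_min lexx orbT]; lra.
exists (u ^+ 2); first by rewrite exprn_gt0.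
move=> a a0 ha; have := le_trans (scalar_psi_ge a0) ha.
rewrite -[leLHS]real_normK ?num_real// ler_pXn2r ?nnegrE ?(ltW u0)// => h.
rewrite -{1}(sqr_sqrtr (ltW a0)) subr_sqr_1 normrM.
apply: le_trans ue; rewrite mulrC; apply: ler_pM => //.
move: h; rewrite !ler_norml => /andP[h1 h2].
have := sqrtr_ge0 a; lra.
Qed.

End ScalarLog.

Section PosDef.
Variable R : realType.

Lemma posdef_tr n (A : 'M[R]_n) : posdef A -> A^T = A.
Proof. by case. Qed.

Lemma mulmx_tr_inj m n (A : 'M[R]_(m, n)) : A^T *m A = 0 -> A = 0.
Proof.
move=> /(congr1 mxtrace); rewrite mxtrace_mulC -fro_tr mxtrace0.
exact: fro_eq0.
Qed.

Lemma posdef_congr n (K A : 'M[R]_n) : K \in unitmx -> posdef A ->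
  posdef (K *m A *m K^T).
Proof.
move=> Ku [AT A0]; split; first by rewrite !trmx_mul trmxK AT mulmxA.
move=> x x0; have : K^T *m x != 0.
  apply: contra_neq x0 => h.
  by rewrite -(mul1mx x) -(mulVmx (_ : K^T \in unitmx)) ?unitmx_tr// -mulmxA h mulmx0.
by move=> /A0; rewrite trmx_mul trmxK !mulmxA.
Qed.

Lemma qf_block n (a t : R) (b y : 'cV[R]_n) (D : 'M[R]_n) :
  ((col_mx t%:M y)^T *m block_mx a%:M b^T b D *m col_mx t%:M y) 0 0 =
  a * t ^+ 2 + 2 * t * (b^T *m y) 0 0 + (y^T *m D *m y) 0 0.
Proof.
rewrite tr_col_mx mul_row_block mul_row_col tr_scalar_mx !mulmxDl.
rewrite !mul_scalar_mx -!scalemxAl !mul_mx_scalar.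
have -> : y^T *m b = b^T *m y.
  by rewrite -[LHS]trmxK trmx_mul trmxK [b^T *m y]mx11_scalar tr_scalar_mx.
by rewrite !mxE /= !mulr1n; ring.
Qed.

Lemma posdef_block n (C : 'M[R]_(1 + n)) : posdef C -> exists a b D,
  [/\ C = block_mx a%:M b^T b D, 0 < a & posdef (D - a^-1 *: (b *m b^T))].
Proof.
move=> [CT C0].
set a := ulsubmx C 0 0; set b := dlsubmx C; set D := drsubmx C.
have CE : C = block_mx a%:M b^T b D.
  rewrite -[LHS]submxK; congr block_mx; first by rewrite [LHS]mx11_scalar.
  by rewrite /b trmx_dlsub CT.
have DT : D^T = D by rewrite /D trmx_drsub CT.
have a0 : 0 < a.
  have /C0 : col_mx 1%:M 0 != 0 :> 'cV[R]_(1 + n).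
    apply/eqP => /(congr1 usubmx)/matrixP/(_ 0 0)/eqP.
    by rewrite col_mxKu linear0 !mxE oner_eq0.
  by rewrite CE qf_block !mulmx0 !mxE; lra.
exists a, b, D; split => //; split.
  by rewrite linearB linearZ /= trmx_mul trmxK DT.
move=> y y0.
(* The minimiser in t of the quadratic form at the vector (t, y); the minimum is the form of the
   Schur complement at y. *)
pose t := - a^-1 * (b^T *m y) 0 0.
have /C0 : col_mx t%:M y != 0 :> 'cV[R]_(1 + n).
  apply: contra_neq y0 => /(congr1 dsubmx).
  by rewrite col_mxKd linear0.
rewrite CE qf_block => h.
rewrite mulmxBr mulmxBl -scalemxAr -scalemxAl [_ 0 0]mxE.
rewrite [in X in _ < _ + X]mxE [in X in _ < _ - X]mxE.
have -> : (y^T *m (b *m b^T) *m y) 0 0 = (b^T *m y) 0 0 ^+ 2.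
  have -> : y^T *m (b *m b^T) *m y = (b^T *m y)^T *m (b^T *m y).
    by rewrite trmx_mul trmxK !mulmxA.
  by rewrite [in LHS]mxE big_ord1 mxE expr2.
suff -> : (y^T *m D *m y) 0 0 - a^-1 * (b^T *m y) 0 0 ^+ 2 =
   a * t ^+ 2 + 2 * t * (b^T *m y) 0 0 + (y^T *m D *m y) 0 0 by [].
by rewrite /t; field; rewrite gt_eqF.
Qed.

Lemma det_block_schur n (a : R) (b : 'cV[R]_n) (D : 'M[R]_n) : a != 0 ->
  \det (block_mx a%:M b^T b D) = a * \det (D - a^-1 *: (b *m b^T)).
Proof.
move=> a0.
have -> : block_mx a%:M b^T b D = block_mx 1%:M 0 (a^-1 *: b) 1%:M *m
    block_mx a%:M b^T 0 (D - a^-1 *: (b *m b^T)).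
  rewrite mulmx_block !mul1mx !mul0mx !addr0 mul_mx_scalar scalerA divff//.
  by rewrite scale1r -scalemxAl addrC subrK.
by rewrite det_mulmx det_lblock det_ublock !det1 !mul1r det_scalar1.
Qed.

Lemma cholesky n (A : 'M[R]_n) : posdef A ->
  exists2 K : 'M[R]_n, K \in unitmx & A = K *m K^T.
Proof.
elim: n A => [A _|n IH A].
  by exists 1%:M; rewrite ?unitmx1// !(flatmx0 _).
move=> /(@posdef_block n)[a [b [D [-> a0 /IH[K Ku KE]]]]].
have s0 : Num.sqrt a != 0 by rewrite gt_eqF// sqrtr_gt0.
exists (block_mx (Num.sqrt a)%:M 0 ((Num.sqrt a)^-1 *: b) K: 'M[R]_(1 + n)).
  rewrite unitmxE (@det_lblock _ 1 n) det_scalar1 unitrM unitfE s0 /=.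
  by move: Ku; rewrite unitmxE.
rewrite (@tr_block_mx _ 1 n 1 n) (@mulmx_block _ 1 n 1 n 1 n) !trmx0 !mul0mx !mulmx0 !addr0.
rewrite linearZ /= tr_scalar_mx -scalar_mxM -expr2 sqr_sqrtr ?(ltW a0)//.
rewrite mul_scalar_mx mul_mx_scalar !scalerA divff// !scale1r.
rewrite -scalemxAl -scalemxAr scalerA -invfM -expr2 sqr_sqrtr ?(ltW a0)//.
by rewrite -KE [_ + (D - _)]addrC subrK.
Qed.

Lemma posdef_det n (A : 'M[R]_n) : posdef A -> 0 < \det A.
Proof.
move=> /cholesky[K Ku ->]; rewrite det_mulmx det_tr -expr2 exprn_even_gt0//=.
by move: Ku; rewrite unitmxE unitfE.
Qed.

Lemma posdef_unit n (A : 'M[R]_n) : posdef A -> A \in unitmx.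
Proof. by move=> /posdef_det; rewrite unitmxE unitfE => /gt_eqF ->. Qed.

Lemma posdefMtr n (K : 'M[R]_n) : K \in unitmx -> posdef (K *m K^T).
Proof.
move=> Ku; rewrite -{1}(mulmx1 K); apply: posdef_congr => //; split.
  by rewrite tr_scalar_mx.
move=> x x0; rewrite mulmx1 mxE lt_def; apply/andP; split; last first.
  by apply: sumr_ge0 => i _; rewrite mxE -expr2 sqr_ge0.
apply: contra_neq x0 => h; apply: mulmx_tr_inj.
by apply/matrixP => i j; rewrite !ord1 mxE [RHS]mxE.
Qed.

(** The form at x is |x|^2 plus the trace of (A - 1) x x^T, which is at most nf (A - 1) * |x|^2 in
    absolute value. *)
Lemma posdef_near1 n (A : 'M[R]_n) : A^T = A -> nf (A - 1%:M) < 1 ->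
  posdef A.
Proof.
move=> AT A1; split=> // x x0.
have fx : 0 < fro x.
  rewrite lt_def fro_ge0 andbT; apply: contra_neq x0; exact: fro_eq0.
have -> : (x^T *m A *m x) 0 0 = fro x + \tr ((A - 1%:M) *m x *m x^T).
  rewrite mxtrace_mulC mulmxA mulmxBr mulmx1 mulmxBl raddfB /=.
  rewrite fro_tr [X in _ + (_ - X)]mxtrace_mulC addrCA subrr addr0.
  by rewrite [in RHS](mx11_scalar (x^T *m A *m x)) mxtrace_scalar mulr1n.
have := nf_trace ((A - 1%:M) *m x) x^T.
rewrite nf_trmx => /le_trans /(_ (ler_wpM2r (nf_ge0 x) (nfM _ _))).
rewrite -mulrA -expr2 sqr_nf ler_norml => /andP[h _].
have : nf (A - 1%:M) * fro x < fro x by rewrite gtr_pMl.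
lra.
Qed.

Lemma fro1_split n (a : R) (b : 'cV[R]_n) (D : 'M[R]_n) :
  fro (block_mx a%:M b^T b D - 1%:M: 'M[R]_(1 + n)) =
  (a - 1) ^+ 2 + 2 * fro b + fro (D - 1%:M).
Proof.
rewrite scalar_mx_block opp_block_mx add_block_mx !subr0 fro_block fro_trmx.
rewrite -raddfB /= /fro !big_ord1 mxE mulr1n; ring.
Qed.

(** The contrast of [C] against the identity, that is, twice the Kullback divergence between two
    centred Gaussian laws. It is the sum of a - 1 - ln a over the eigenvalues a of [C]; the
    recursion [psi_block] takes the place of a diagonalisation. *)
Definition psi n (C : 'M[R]_n) : R := \tr C - n%:R - ln (\det C).

Lemma psi_block n (a : R) (b : 'cV[R]_n) (D : 'M[R]_n) : 0 < a ->
  posdef (D - a^-1 *: (b *m b^T)) ->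
  psi (block_mx a%:M b^T b D: 'M[R]_(1 + n)) =
  (a - 1 - ln a) + a^-1 * fro b + psi (D - a^-1 *: (b *m b^T)).
Proof.
move=> a0 /posdef_det S0.
rewrite /psi det_block_schur ?gt_eqF// lnM ?posrE//.
rewrite (@mxtrace_block _ 1 n) mxtrace_scalar mulr1n raddfB /= mxtraceZ -fro_tr.
by rewrite natrD; ring.
Qed.

Lemma psi_ge0 n (C : 'M[R]_n) : posdef C -> 0 <= psi C.
Proof.
elim: n C => [C _|n IH C].
  by rewrite /psi det_mx00 ln1 subr0 subr0 /mxtrace big_ord0.
move=> /(@posdef_block n)[a [b [D [-> a0 S0]]]].
rewrite psi_block// addr_ge0 ?IH// addr_ge0 ?scalar_psi_ge0//.
by rewrite mulr_ge0 ?fro_ge0// invr_ge0 ltW.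
Qed.

(** The three terms of [psi_block] are nonnegative, so a small sum makes each of them small: the
    first controls a, the second b, and the induction hypothesis applied to the third controls the
    Schur complement. *)
Lemma psi_control n (e : R) : 0 < e -> exists2 d : R, 0 < d &
  forall C : 'M[R]_n, posdef C -> psi C <= d -> nf (C - 1%:M) <= e.
Proof.
elim: n e => [|n IH] e e0.
  exists 1 => // C _ _; rewrite /nf /fro big_ord0 sqrtr0; exact: ltW.
have e30 : 0 < Num.min (1 / 2) (e / 6) by rewrite lt_min; apply/andP; split; lra.
have [d1 d10 H1] := scalar_psi_control e30.
have e60 : 0 < e / 6 by lra.
have [d2 d20 H2] := IH _ e60.
(* With this choice the corner, the two off-diagonal blocks and the block [D] contribute at most
   e^2/36, e^2/18 and e^2/16 to [fro (C - 1%:M)]. *)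
pose d3 := Num.min (e ^+ 2 / 72) (e / 12).
have d30 : 0 < d3 by rewrite lt_min; apply/andP; split; [rewrite divr_gt0 ?exprn_gt0//|lra].
exists (Num.min d1 (Num.min d2 d3)); first by rewrite lt_min d10 lt_min d20.
move=> C /(@posdef_block n)[a [b [D [-> a0 S0]]]].
rewrite psi_block// le_min => /andP[h1]; rewrite le_min => /andP[h2 h3].
have p1 := scalar_psi_ge0 a0; have p2 := psi_ge0 S0.
have fb0 := fro_ge0 b.
have ai0 : 0 < a^-1 by rewrite invr_gt0.
have p3 : 0 <= a^-1 * fro b by rewrite mulr_ge0// ltW.
have : `|a - 1| <= Num.min (1 / 2) (e / 6) by apply: H1 => //; lra.
rewrite le_min => /andP[a1 a2].
have {}H2 : nf (D - a^-1 *: (b *m b^T) - 1%:M) <= e / 6 by apply: H2 => //; lra.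
have ab : a^-1 * fro b <= d3 by lra.
have a32 : a <= 3 / 2 by move: a1; rewrite ler_norml; lra.
have fb : fro b <= 2 * d3.
  have -> : fro b = a * (a^-1 * fro b) by rewrite mulrA divff ?mul1r// gt_eqF.
  apply: le_trans (_ : 3 / 2 * d3 <= _); last lra.
  by rewrite ler_pM// ltW.
have fD : nf (D - 1%:M) <= e / 6 + d3.
  have -> : D - 1%:M = D - a^-1 *: (b *m b^T) - 1%:M + a^-1 *: (b *m b^T).
    by rewrite addrAC subrK.
  apply: le_trans (nfD _ _) _; apply: lerD => //.
  by rewrite nfZ gtr0_norm// /nf fro_outer sqrtr_sqr ger0_norm.
have d3e : d3 <= e ^+ 2 / 72 by rewrite ge_min lexx.
have d3e2 : d3 <= e / 12 by rewrite ge_min lexx orbT.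
rewrite -(@ler_pXn2r _ 2)// ?nnegrE ?nf_ge0 ?(ltW e0)// sqr_nf fro1_split -(sqr_nf (D - 1%:M)).
have : (a - 1) ^+ 2 <= (e / 6) ^+ 2.
  by rewrite -(real_normK (num_real (a - 1))) lerXn2r ?nnegrE//; lra.
have : nf (D - 1%:M) ^+ 2 <= (e / 6 + e / 12) ^+ 2.
  by rewrite lerXn2r ?nnegrE ?nf_ge0//; lra.
have -> : (e / 6) ^+ 2 = e ^+ 2 / 36 by field.
have -> : (e / 6 + e / 12) ^+ 2 = e ^+ 2 / 16 by field.
have := sqr_ge0 e; clear -fb d3e; lra.
Qed.

(** Bookkeeping for the induction step of [psi_local]: s = (a - 1)^2 with contribution u, f = |b|^2
    with contribution g = f / a, F and FS the squared distances to the identity of [D] and of the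
    Schur complement, and w the value of [psi] at the latter. *)
Lemma psi_local_arith (e d u s f g F FS w : R) : 0 <= e -> 0 <= s -> 0 <= f ->
  0 <= F -> `|u - s / 2| <= e * s -> `|w - FS / 2| <= e / 8 * FS ->
  `|FS - F| <= 6 * d * f -> `|g - f| <= 2 * d * f -> d * f <= e / 16 * f ->
  d * f <= 1 / 8 * f -> `|u + g + w - (s + 2 * f + F) / 2| <= e * (s + 2 * f + F).
Proof.
move=> e0 s0 f0 F0; rewrite !ler_norml => /andP[u1 u2] /andP[w1 w2].
move=> /andP[v1 v2] /andP[g1 g2] d1 d2.
have p : e / 8 * FS <= e / 8 * (F + f) by rewrite ler_wpM2l//; lra.
have : 0 <= e * f by rewrite mulr_ge0.
have : 0 <= e * F by rewrite mulr_ge0.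
move=> *; apply/andP; split; lra.
Qed.

(** In [psi_block] the first term is close to (a - 1)^2 / 2 and the second to |b|^2, which is half
    of the contribution of the two off-diagonal blocks. The Schur complement differs from [D] only
    by a term of order |b|^2, so the third is close to |D - 1|^2 / 2. *)
Lemma psi_local n (e : R) : 0 < e -> exists2 d : R, 0 < d &
  forall C : 'M[R]_n, posdef C -> nf (C - 1%:M) <= d ->
    `|psi C - fro (C - 1%:M) / 2| <= e * fro (C - 1%:M).
Proof.
elim: n e => [|n IH] e e0.
  exists 1 => // C _ _; rewrite /psi det_mx00 ln1 subr0 subr0 /mxtrace /fro !big_ord0.
  by rewrite mul0r mulr0 subr0 normr0.
have [d1 d10 H1] := scalar_psi_local e0.
have e80 : 0 < e / 8 by lra.
have [d2 d20 H2] := IH _ e80.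
pose d := Num.min (Num.min (1 / 8) (e / 16)) (Num.min d1 (d2 / 3)).
have d0 : 0 < d by rewrite !lt_min d10; apply/and3P; split=> //; [apply/andP; split|]; lra.
have d_1 : d <= 1 / 8 by rewrite !ge_min lexx.
have d_e : d <= e / 16 by rewrite !ge_min lexx !orbT.
have d_d1 : d <= d1 by rewrite !ge_min lexx !orbT.
have d_d2 : d <= d2 / 3 by rewrite !ge_min lexx !orbT.
exists d => // C /(@posdef_block n)[a [b [D [-> a0 S0]]]].
move=> hC.
have: fro (block_mx a%:M b^T b D - 1%:M: 'M[R]_(1 + n)) <= d ^+ 2.
  by rewrite -sqr_nf lerXn2r ?nnegrE ?nf_ge0 ?(ltW d0).
rewrite fro1_split psi_block// => hfro.
have fb0 := fro_ge0 b; have fD0 := fro_ge0 (D - 1%:M).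
have sa := sqr_ge0 (a - 1).
have a1 : `|a - 1| <= d.
  by rewrite -(@ler_pXn2r _ 2)// ?nnegrE ?(ltW d0)// real_normK ?num_real//; lra.
have D1 : nf (D - 1%:M) <= d.
  by rewrite -(@ler_pXn2r _ 2)// ?nnegrE ?nf_ge0 ?(ltW d0)// sqr_nf; lra.
have ad : 1 - d <= a <= 1 + d by move: a1; rewrite ler_norml; lra.
have ai : `|a^-1 - 1| <= 2 * d.
  have -> : a^-1 - 1 = (1 - a) * a^-1 by field; rewrite gt_eqF.
  rewrite normrM distrC mulrC; apply: ler_pM => //.
  rewrite gtr0_norm ?invr_gt0// invf_ple ?posrE//; lra.
set B := a^-1 *: (b *m b^T).
have nB : nf B <= 2 * fro b.
  rewrite nfZ /nf fro_outer sqrtr_sqr (ger0_norm fb0) ler_wpM2r//.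
  rewrite ger0_norm ?invr_ge0 ?(ltW a0)//; move: ai; rewrite ler_norml; lra.
have fB := nB.
have hS : D - B - 1%:M = D - 1%:M - B by rewrite addrAC.
have S1 : nf (D - B - 1%:M) <= d2.
  rewrite hS; apply: le_trans (nfB _ _) _.
  have : d ^+ 2 <= d by rewrite expr2 ger_pMl//; lra.
  lra.
have {}H2 : `|psi (D - B) - fro (D - B - 1%:M) / 2| <= e / 8 * fro (D - B - 1%:M).
  exact: H2 _ S0 S1.
have {}H1 := H1 a (le_trans a1 d_d1).
have H3 : `|fro (D - B - 1%:M) - fro (D - 1%:M)| <= 6 * d * fro b.
  rewrite hS; apply: le_trans (fro_subI _ _) _.
  have -> : 6 * d * fro b = (2 * fro b) * (3 * d) by ring.
  apply: ler_pM => //; rewrite ?nf_ge0 ?addr_ge0 ?mulr_ge0 ?nf_ge0//.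
  have : d ^+ 2 <= d / 8 by rewrite expr2 ler_pM2l//; lra.
  lra.
have H4 : `|(a^-1 - 1) * fro b| <= 2 * d * fro b.
  by rewrite normrM (ger0_norm fb0) ler_wpM2r.
have p5 : d * fro b <= e / 16 * fro b by rewrite ler_wpM2r.
have p6 : d * fro b <= 1 / 8 * fro b by rewrite ler_wpM2r.
rewrite mulrBl mul1r in H4.
exact: (psi_local_arith (ltW e0) sa fb0 fD0 H1 H2 H3 H4 p5 p6).
Qed.

End PosDef.

(** * The likelihood contrast *)

Section Qlik.
Variable R : realType.

Lemma invmx_mul n (A B : 'M[R]_n) : A \in unitmx -> B \in unitmx ->
  invmx (A *m B) = invmx B *m invmx A.
Proof.
move=> Au Bu; have ABu : A *m B \in unitmx by rewrite unitmx_mul Au.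
have ABV : A *m B *m (invmx B *m invmx A) = 1%:M.
  by rewrite -mulmxA (mulmxA B) mulmxV// mul1mx mulmxV.
by rewrite -[RHS](mulKmx ABu) ABV mulmx1.
Qed.

Lemma qlik_congr n (K Q S : 'M[R]_n) : K \in unitmx -> posdef Q -> posdef S ->
  qlik (K *m Q *m K^T) (K *m S *m K^T) = qlik Q S.
Proof.
move=> Ku Qp Sp; have Su := posdef_unit Sp.
have KTu : K^T \in unitmx by rewrite unitmx_tr.
have dK : 0 < \det K ^+ 2.
  by rewrite exprn_even_gt0//=; move: Ku; rewrite unitmxE unitfE.
have dE (A : 'M[R]_n) : \det (K *m A *m K^T) = \det K ^+ 2 * \det A.
  by rewrite !det_mulmx det_tr; ring.
have lE (A : 'M[R]_n) : posdef A ->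
    ln (\det K ^+ 2 * \det A) = ln (\det K ^+ 2) + ln (\det A).
  by move=> /posdef_det A0; apply: lnM; rewrite posrE.
rewrite /qlik !dE !lE//.
have -> : invmx (K *m S *m K^T) = invmx K^T *m invmx S *m invmx K.
  by rewrite !invmx_mul ?unitmx_mul ?Ku ?Su// !mulmxA.
have -> : \tr (invmx K^T *m invmx S *m invmx K *m (K *m Q *m K^T)) =
    \tr (invmx S *m Q).
  rewrite -!mulmxA mulKmx// mxtrace_mulC -!mulmxA mulmxA mulmxV// mulmx1//.
by ring.
Qed.

Lemma qlik_psi n (K Q S : 'M[R]_n) : K \in unitmx -> S = K *m K^T ->
  posdef Q -> qlik Q S = psi (invmx K *m Q *m (invmx K)^T).
Proof.
move=> Ku SE Qp; have Sp : posdef S by rewrite SE; exact: posdefMtr.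
rewrite -(@qlik_congr _ (invmx K) Q S) ?unitmx_inv//.
have -> : invmx K *m S *m (invmx K)^T = 1%:M.
  by rewrite SE !mulmxA mulVmx// mul1mx -trmx_mul mulVmx// trmx1.
by rewrite /qlik /psi det1 ln1 invmx1 mul1mx; ring.
Qed.

Lemma posdef_invK n (K Q : 'M[R]_n) : K \in unitmx -> posdef Q ->
  posdef (invmx K *m Q *m (invmx K)^T).
Proof. by move=> Ku; apply: posdef_congr; rewrite unitmx_inv. Qed.

Lemma invK_sub1 n (K Q S : 'M[R]_n) : K \in unitmx -> S = K *m K^T ->
  invmx K *m Q *m (invmx K)^T - 1%:M = invmx K *m (Q - S) *m (invmx K)^T.
Proof.
move=> Ku ->; rewrite mulmxBr mulmxBl; congr (_ - _).
by rewrite !mulmxA mulVmx// mul1mx -trmx_mul mulVmx// trmx1.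
Qed.

Lemma qlik_ge0 n (Q S : 'M[R]_n) : posdef Q -> posdef S -> 0 <= qlik Q S.
Proof.
move=> Qp /cholesky[K Ku SE]; rewrite (qlik_psi Ku SE Qp).
exact/psi_ge0/posdef_invK.
Qed.

(** Undoing the conjugation by a factor [K] of S costs |K|^2 = tr S. The trace stays in the bound
    because S is not yet known to be bounded; [qlik_control_near1] removes it. *)
Lemma qlik_control n (e : R) : 0 < e -> exists2 d : R, 0 < d &
  forall Q S : 'M[R]_n, posdef Q -> posdef S -> qlik Q S <= d ->
    nf (Q - S) <= e * \tr S.
Proof.
move=> /(@psi_control R n)[d d0 H]; exists d => // Q S Qp /cholesky[K Ku SE].
rewrite (qlik_psi Ku SE Qp) => /(H _ (posdef_invK Ku Qp)).
rewrite (invK_sub1 Q Ku SE) => h.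
have -> : Q - S = K *m (invmx K *m (Q - S) *m (invmx K)^T) *m K^T.
  by rewrite !mulmxA mulmxV// mul1mx -mulmxA -trmx_mul mulmxV// trmx1 mulmx1.
have -> : \tr S = nf K * nf K by rewrite -expr2 sqr_nf fro_tr SE.
apply: le_trans (nfM _ _) _; rewrite nf_trmx mulrA ler_wpM2r ?nf_ge0//.
apply: le_trans (nfM _ _) _; rewrite mulrC ler_wpM2r ?nf_ge0//.
Qed.

(** S^-1 - 1 = (1 - S) - (S^-1 - 1)(S - 1), and the last product is at most half of the left
    side. *)
Lemma nf_invmx_sub1 n (S : 'M[R]_n) : S \in unitmx -> nf (S - 1%:M) <= 1 / 2 ->
  nf (invmx S - 1%:M) <= 2 * nf (S - 1%:M).
Proof.
move=> Su S1.
have : invmx S - 1%:M = (1%:M - S) - (invmx S - 1%:M) *m (S - 1%:M).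
  rewrite mulmxBl mul1mx mulmxBr mulVmx// mulmx1.
  by apply/matrixP => i k; rewrite !mxE; ring.
move=> /(congr1 (@nf R n n)) E.
have := nfB (1%:M - S) ((invmx S - 1%:M) *m (S - 1%:M)).
rewrite -E (nf_distC 1%:M) => h.
have h2 := nfM (invmx S - 1%:M) (S - 1%:M).
have h3 : nf (invmx S - 1%:M) * nf (S - 1%:M) <= nf (invmx S - 1%:M) * (1 / 2).
  by rewrite ler_wpM2l// nf_ge0.
lra.
Qed.

(** The right side depends on [K] only through K K^T. Hence the Cholesky factor, whose dependence on
    S is not controlled, never has to be estimated. *)
Lemma fro_invK n (K A : 'M[R]_n) : K \in unitmx -> A^T = A ->
  fro (invmx K *m A *m (invmx K)^T) =
  \tr ((A *m invmx (K *m K^T)) *m (A *m invmx (K *m K^T))).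
Proof.
move=> Ku AT; have KTu : K^T \in unitmx by rewrite unitmx_tr.
rewrite fro_tr !trmx_mul trmxK AT invmx_mul// trmx_inv.
by rewrite -!mulmxA mxtrace_mulC -!mulmxA.
Qed.

Lemma fro_weight n (A S : 'M[R]_n) : A^T = A -> S \in unitmx ->
  nf (S - 1%:M) <= 1 / 2 ->
  `|\tr ((A *m invmx S) *m (A *m invmx S)) - fro A| <=
  8 * nf (S - 1%:M) * fro A.
Proof.
move=> AT Su S1; have := nf_invmx_sub1 Su S1.
have SE : invmx S = 1%:M + (invmx S - 1%:M) by rewrite addrC subrK.
rewrite {2 3}SE; move: (invmx S - 1%:M) => E {SE} hE.
rewrite mulmxDr mulmx1 mulmxDl !mulmxDr !raddfD /=.
have -> : \tr (A *m A) = fro A by rewrite fro_tr AT.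
rewrite [_ - _](_ : _ = \tr (A *m (A *m E)) + (\tr (A *m E *m A) + \tr (A *m E *m (A *m E)))); last by ring.
rewrite -sqr_nf.
have nA := nf_ge0 A; have nE := nf_ge0 E; have nAE := nfM A E.
have h1 := nf_trace A (A *m E); have h2 := nf_trace (A *m E) A.
have h3 := nf_trace (A *m E) (A *m E).
have h4 : nf A * nf (A *m E) <= nf A * (nf A * nf E) by rewrite ler_wpM2l.
have h5 : nf (A *m E) * nf (A *m E) <= (nf A * nf E) * (nf A * nf E).
  by rewrite ler_pM// nf_ge0.
have h6 : nf E <= 1 by lra.
have h7 : 0 <= nf A ^+ 2 * nf E by rewrite mulr_ge0// sqr_ge0.
have h8 : (nf A * nf E) * (nf A * nf E) <= nf A ^+ 2 * nf E.
  have -> : (nf A * nf E) * (nf A * nf E) = (nf A ^+ 2 * nf E) * nf E by ring.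
  by rewrite ler_piMr.
have h9 : nf A ^+ 2 * nf E <= nf A ^+ 2 * (2 * nf (S - 1%:M)).
  by rewrite ler_wpM2l// sqr_ge0.
apply: le_trans (ler_normD _ _) _.
have := ler_normD (\tr (A *m E *m A)) (\tr (A *m E *m (A *m E))).
clear -h1 h2 h3 h4 h5 h6 h7 h8 h9; lra.
Qed.

Lemma qlik_local n (e : R) : 0 < e -> exists2 d : R, 0 < d &
  forall Q S : 'M[R]_n, posdef Q -> posdef S ->
    nf (Q - 1%:M) <= d -> nf (S - 1%:M) <= d ->
    `|qlik Q S - fro (Q - S) / 2| <= e * fro (Q - S).
Proof.
move=> e0; have e20 : 0 < e / 6 by lra.
have [d1 d10 H] := @psi_local R n _ e20.
pose d := Num.min (Num.min (1 / 8) (e / 8)) (d1 / 4).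
have d0 : 0 < d by rewrite !lt_min; apply/andP; split; [apply/andP; split|]; lra.
have d_1 : d <= 1 / 8 by rewrite !ge_min lexx.
have d_e : d <= e / 8 by rewrite !ge_min lexx !orbT.
have d_d1 : d <= d1 / 4 by rewrite !ge_min lexx !orbT.
exists d => // Q S Qp Sp Q1 S1.
have Su := posdef_unit Sp; have AT : (Q - S)^T = Q - S.
  by rewrite linearB /= (posdef_tr Qp) (posdef_tr Sp).
have [K Ku SE] := cholesky Sp.
have f0 := fro_ge0 (Q - S).
have hw : `|fro (invmx K *m (Q - S) *m (invmx K)^T) - fro (Q - S)| <=
    8 * d * fro (Q - S).
  rewrite fro_invK// -SE.
  apply: le_trans (fro_weight AT Su _) _; first lra.
  by rewrite ler_wpM2r// ler_wpM2l.
have hf : fro (invmx K *m (Q - S) *m (invmx K)^T) <= 2 * fro (Q - S).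
  have : d * fro (Q - S) <= 1 / 8 * fro (Q - S) by rewrite ler_wpM2r.
  by move: hw; rewrite ler_norml; clear; lra.
have hn : nf (invmx K *m Q *m (invmx K)^T - 1%:M) <= d1.
  rewrite (invK_sub1 Q Ku SE).
  rewrite -(@ler_pXn2r _ 2)// ?nnegrE ?nf_ge0 ?(ltW d10)// sqr_nf.
  apply: le_trans hf _; rewrite -sqr_nf.
  have : nf (Q - S) <= 2 * d.
    have -> : Q - S = (Q - 1%:M) - (S - 1%:M) by rewrite opprB addrA subrK.
    by have := nfB (Q - 1%:M) (S - 1%:M); lra.
  move=> hh; have : nf (Q - S) ^+ 2 <= (2 * (d1 / 4)) ^+ 2.
    by rewrite lerXn2r ?nnegrE ?nf_ge0//; lra.
  have -> : (2 * (d1 / 4)) ^+ 2 = d1 ^+ 2 / 4 by field.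
  by have := sqr_ge0 d1; clear; lra.
have := H _ (posdef_invK Ku Qp) hn; rewrite -(qlik_psi Ku SE Qp).
rewrite (invK_sub1 Q Ku SE).
have : d * fro (Q - S) <= e / 8 * fro (Q - S) by rewrite ler_wpM2r.
have : e / 6 * fro (invmx K *m (Q - S) *m (invmx K)^T) <=
    e / 6 * (2 * fro (Q - S)) by rewrite ler_wpM2l// ltW.
have : 0 <= e * fro (Q - S) by rewrite mulr_ge0// ltW.
move: hw; rewrite !ler_norml.
set F1 := fro (invmx _ *m _ *m _); set F := fro (Q - S); set q := qlik Q S.
clear; move=> *; lra.
Qed.


(** For Q near the identity, tr S is bounded by a constant plus a multiple of |Q - S|. The constant
    [k] is small enough for that multiple to be absorbed by the left side. *)
Lemma qlik_control_near1 n (e : R) : 0 < e -> exists2 d : R, 0 < d &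
  forall Q S : 'M[R]_n, posdef Q -> posdef S -> nf (Q - 1%:M) <= 1 ->
    qlik Q S <= d -> nf (Q - S) <= e.
Proof.
move=> e0; pose c : R := nf (1%:M : 'M[R]_n); have c0 : 0 <= c := nf_ge0 _.
pose t : R := n%:R + c; have t0 : 0 <= t by rewrite addr_ge0.
pose k := Num.min (1 / (2 * (c + 1))) (e / (2 * (t + 1))).
have k0 : 0 < k by rewrite lt_min; apply/andP; split; apply: divr_gt0 => //; lra.
have [d d0 H] := @qlik_control n _ k0; exists d => // Q S Qp Sp Q1 /(H _ _ Qp Sp).
have kc : k * c <= 1 / 2.
  apply: (@le_trans _ _ (1 / (2 * (c + 1)) * c)).
    by rewrite ler_wpM2r// ge_min lexx.
  by rewrite mulrAC ler_pdivrMr; [lra|lra].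
have kt : k * t <= e / 2.
  apply: (@le_trans _ _ (e / (2 * (t + 1)) * t)).
    by rewrite ler_wpM2r// ge_min lexx orbT.
  rewrite mulrAC ler_pdivrMr; last lra.
  have -> : e / 2 * (2 * (t + 1)) = e * t + e by field.
  lra.
have -> : \tr S = n%:R + \tr (Q - 1%:M) - \tr (Q - S).
  by rewrite !raddfB /= mxtrace1; ring.
have h1 := nf_trace (Q - 1%:M) 1%:M; rewrite mulmx1 -/c in h1.
have h2 := nf_trace (Q - S) 1%:M; rewrite mulmx1 -/c in h2.
have h3 : nf (Q - 1%:M) * c <= c by rewrite ler_piMl.
move: h1 h2; rewrite !ler_norml => /andP[_ h1] /andP[h2 _].
move=> h; have h4 : k * (n%:R + \tr (Q - 1%:M) - \tr (Q - S)) <=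
    k * (nf (Q - S) * c + t).
  by rewrite ler_pM2l// /t; clear -h1 h2 h3; lra.
have h5 : k * c * nf (Q - S) <= 1 / 2 * nf (Q - S) by rewrite ler_wpM2r// nf_ge0.
by clear -h h4 h5 kt; lra.
Qed.

End Qlik.

Section MatrixNorms.
Variable R : realType.

Lemma nf_le_sum m n (A : 'M[R]_(m, n)) : nf A <= \sum_i \sum_j `|A i j|.
Proof.
have S0 : 0 <= \sum_i \sum_j `|A i j|.
  by apply: sumr_ge0 => i _; apply: sumr_ge0.
rewrite -(@ler_pXn2r _ 2)// ?nnegrE ?nf_ge0// sqr_nf expr2 {1}/fro mulr_suml.
apply: ler_sum => i _; rewrite mulr_suml; apply: ler_sum => j _.
rewrite -real_normK ?num_real// expr2 ler_wpM2l//.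
rewrite (bigD1 i)//= (bigD1 j)//= -addrA lerDl addr_ge0 ?sumr_ge0// => k _.
exact: sumr_ge0.
Qed.

Lemma entry_le_norm m n (A : 'M[R]_(m, n)) i j : `|A i j| <= `|A|.
Proof.
rewrite [leRHS]/Num.Def.normr /= mx_normrE.
exact: (le_bigmax _ (fun ij : 'I_m * 'I_n => `|A ij.1 ij.2|) (i, j)).
Qed.

Lemma nf_le_norm m n (A : 'M[R]_(m, n)) : nf A <= (m * n)%:R * `|A|.
Proof.
apply: le_trans (nf_le_sum _) _.
apply: le_trans (_ : \sum_(i < m) \sum_(j < n) `|A| <= _).
  by apply: ler_sum => i _; apply: ler_sum => j _; exact: entry_le_norm.
rewrite !sumr_const !card_ord -mulrnA mulr_natl mulnC//.
Qed.

Lemma norm_le_nf m n (A : 'M[R]_(m, n)) : `|A| <= nf A.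
Proof.
rewrite [leLHS]/Num.Def.normr /= mx_normrE.
apply/bigmax_leP; split; first exact: nf_ge0.
by move=> [i j] _; exact: nf_entry.
Qed.

Lemma nf_near (T : topologicalType) (F : set_system T) m n (f : T -> 'M[R]_(m, n))
    (A : 'M[R]_(m, n)) : Filter F ->
  f x @[x --> F] --> A -> nf (f x - A) @[x --> F] --> 0.
Proof.
move=> FF fA; apply/cvgrPdist_le => e e0.
have e1 : 0 < e / ((m * n)%:R + 1) by rewrite divr_gt0.
have := @cvgr_dist_le _ _ _ _ FF _ _ fA _ e1.
apply: filterS => x; rewrite sub0r normrN distrC => h.
rewrite ger0_norm ?nf_ge0//; apply: le_trans (nf_le_norm _) _.
apply: le_trans (ler_wpM2l _ h) _ => //.
by rewrite mulrCA ger_pMr// ler_pdivrMr ?mul1r ?lerDl.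
Qed.

Lemma nf_cvg (T : topologicalType) (F : set_system T) m n (f : T -> 'M[R]_(m, n))
    (A : 'M[R]_(m, n)) : Filter F ->
  f x @[x --> F] --> A -> nf (f x) @[x --> F] --> nf A.
Proof.
move=> FF fA; apply/cvgrPdist_le => e e0.
have := @cvgr_dist_le _ _ _ _ FF _ _ (@nf_near _ _ _ _ _ _ FF fA) _ e0.
apply: filterS => x; rewrite sub0r normrN (ger0_norm (nf_ge0 _)) => h.
by apply: le_trans (nf_sub _ _) _; rewrite nf_distC.
Qed.

Lemma mxvec_nf m n (A : 'M[R]_(m, n)) : nf (mxvec A) = nf A.
Proof.
congr Num.sqrt; rewrite /fro big_ord1.
rewrite pair_big (reindex _ (curry_mxvec_bij m n)) /=.
by apply: eq_bigr => -[i j] _ /=; rewrite mxvecE.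
Qed.

Lemma interior_shift n (A : set 'rV[R]_n) (a : 'rV[R]_n) : A° a ->
  exists2 d : R, 0 < d & forall x, nf (x - a) <= d -> A x.
Proof.
move=> /nbhs_ballP[d /= d0 H]; exists (d / 2); first lra.
move=> x xa; apply: H; rewrite -ball_normE /= distrC.
apply: le_lt_trans (norm_le_nf _) _; lra.
Qed.

(** In [argmin_expansion], a is the residual norm, b a bound on it, y a scaled distance |s (Q -
    Sg)|, and e is at once the relative error of the contrast and of the linearisation. The bracket
    multiplying e on the right is an envelope free of e, so that e can be chosen after it. *)
Lemma sqr_expand_up (e a b c y : R) : 0 <= e <= 1 -> 0 <= a <= b -> 0 <= c ->
  0 <= y -> y <= a + e * c ->
  (1 / 2 + e) * y ^+ 2 <= a ^+ 2 / 2 + e * (b ^+ 2 + 3 * b * c + 2 * c ^+ 2).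
Proof.
move=> /andP[e0 e1] /andP[a0 ab] c0 y0 yac.
have h1 : y ^+ 2 <= (a + e * c) ^+ 2.
  by rewrite lerXn2r ?nnegrE ?addr_ge0 ?mulr_ge0.
have h2 : (1 / 2 + e) * y ^+ 2 <= (1 / 2 + e) * (a + e * c) ^+ 2.
  by rewrite ler_wpM2l//; lra.
apply: le_trans h2 _.
have ec : 0 <= e * c by rewrite mulr_ge0.
have h3 : a ^+ 2 <= b ^+ 2 by rewrite lerXn2r ?nnegrE//; lra.
have h4 : a * c <= b * c by rewrite ler_wpM2r.
have h5 : 0 <= a * c by rewrite mulr_ge0.
have c2 : 0 <= c ^+ 2 by rewrite sqr_ge0.
have e2 : e * e <= e by rewrite ler_piMl.
have h6 : (1 / 2 + e) * (a + e * c) ^+ 2 = a ^+ 2 / 2 + e * (a ^+ 2 +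
  (1 + 2 * e) * (a * c) + (1 / 2 + e) * (e * c ^+ 2)) by field.
rewrite h6 lerD2l ler_wpM2l//.
have h7 : (1 + 2 * e) * (a * c) <= 3 * (a * c) by rewrite ler_wpM2r//; lra.
have h8 : (1 / 2 + e) * (e * c ^+ 2) <= 2 * c ^+ 2.
  rewrite ler_pM ?mulr_ge0//; [lra|lra|].
  by rewrite ler_piMl.
clear -h3 h4 h7 h8; lra.
Qed.

Lemma sqr_expand_down (e a b c y : R) : 0 <= e <= 1 / 2 -> 0 <= a <= b -> 0 <= c ->
  0 <= y -> a - e * c <= y ->
  a ^+ 2 / 2 - e * (b ^+ 2 + 3 * b * c + 2 * c ^+ 2) <= (1 / 2 - e) * y ^+ 2.
Proof.
move=> /andP[e0 e1] /andP[a0 ab] c0 y0 yac.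
have ec : 0 <= e * c by rewrite mulr_ge0.
have h1 : a ^+ 2 - 2 * (a * (e * c)) <= y ^+ 2.
  (* When e c exceeds a, squaring the hypothesis is impossible, but then a^2 - 2 a e c is at most
     0. *)
  have [h|h] := leP (e * c) a.
    have : (a - e * c) ^+ 2 <= y ^+ 2 by rewrite lerXn2r ?nnegrE//; lra.
    have := sqr_ge0 (e * c); lra.
  have : a ^+ 2 <= a * (e * c) by rewrite expr2 ler_wpM2l// ltW.
  have := sqr_ge0 y; have : 0 <= a * (e * c) by rewrite mulr_ge0.
  lra.
have h2 : (1 / 2 - e) * (a ^+ 2 - 2 * (a * (e * c))) <= (1 / 2 - e) * y ^+ 2.
  by rewrite ler_wpM2l//; lra.
apply: le_trans h2.
have h3 : a ^+ 2 <= b ^+ 2 by rewrite lerXn2r ?nnegrE//; lra.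
have h4 : a * c <= b * c by rewrite ler_wpM2r.
have h5 : 0 <= a * c by rewrite mulr_ge0.
have c2 : 0 <= c ^+ 2 by rewrite sqr_ge0.
have h6 : (1 / 2 - e) * (a ^+ 2 - 2 * (a * (e * c))) = a ^+ 2 / 2 -
  e * (a ^+ 2 + (1 - 2 * e) * (a * c)) by field.
rewrite h6 lerD2l lerN2 ler_wpM2l//.
have h7 : (1 - 2 * e) * (a * c) <= 1 * (a * c) by rewrite ler_wpM2r//; lra.
clear -h3 h4 h5 h7 c2; lra.
Qed.

End MatrixNorms.

(** * Expansion of the minimum of the contrast *)

Section Argmin.
Variables (R : realType) (p q : nat) (Theta : set 'rV[R]_q).
Variables (Sg : 'rV[R]_q -> 'M[R]_p) (theta0 : 'rV[R]_q).
Variable J : 'M[R]_(q, p * p).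
Hypothesis hcomp : compact Theta.
Hypothesis hint : Theta° theta0.
Hypothesis hpos : forall theta, Theta theta -> posdef (Sg theta).
Hypothesis hcont : forall theta, Theta theta -> {for theta, continuous Sg}.
Hypothesis Sg0 : Sg theta0 = 1%:M.
Hypothesis hinj : forall theta, Theta theta -> Sg theta = 1%:M -> theta = theta0.
Hypothesis hdiff : forall e : R, 0 < e -> exists2 d : R, 0 < d &
  forall theta, nf (theta - theta0) <= d ->
    nf (mxvec (Sg theta - 1%:M) - (theta - theta0) *m J) <= e * nf (theta - theta0).
Hypothesis Jfree : J *m J^T \in unitmx.

(* Vectors are rows: [x *m resid_proj] is the component of [x] orthogonal to the
   rows of [J]. *)
Definition resid_proj : 'M[R]_(p * p) := 1%:M - J^T *m invmx (J *m J^T) *m J.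
Let Pi := resid_proj.

Lemma mul_J_proj : J *m Pi = 0.
Proof. by rewrite /Pi /resid_proj mulmxBr mulmx1 !mulmxA mulmxV// mul1mx subrr. Qed.

Lemma proj_tr : Pi^T = Pi.
Proof.
rewrite /Pi /resid_proj linearB /= trmx1 !trmx_mul trmxK trmx_inv trmx_mul trmxK.
by rewrite mulmxA.
Qed.

Lemma proj_idem : Pi *m Pi = Pi.
Proof. by rewrite {1}/Pi /resid_proj mulmxBl mul1mx -!mulmxA mul_J_proj !mulmx0 subr0. Qed.

Lemma fro_proj (x : 'rV[R]_(p * p)) : fro (x *m Pi) <= fro x.
Proof.
have {2}-> : x = x *m Pi + (x - x *m Pi) by rewrite addrC subrK.
have E : x *m Pi *m (x - x *m Pi)^T = 0.
  rewrite [(_ - _)^T]raddfB /= trmx_mul proj_tr mulmxBr -!mulmxA.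
  by rewrite (mulmxA Pi Pi) proj_idem subrr.
have E2 : (x - x *m Pi) *m (x *m Pi)^T = 0 by rewrite -[LHS]trmxK trmx_mul trmxK E trmx0.
set y := x *m Pi in E E2 *; set z := x - y in E E2 *; clearbody z; clearbody y.
rewrite [leRHS]fro_tr [(_ + _)^T]raddfD /= mulmxDl !mulmxDr !mxtraceD -!fro_tr.
by rewrite E E2 mxtrace0 addr0 add0r lerDl fro_ge0.
Qed.

Lemma nf_proj (x : 'rV[R]_(p * p)) : nf (x *m Pi) <= nf x.
Proof. by rewrite ler_wsqrtr// fro_proj. Qed.

(** By compactness: on the parameters at distance at least e from [theta0], the continuous function
    nf (Sg - 1) has a compact image, which misses 0 by identifiability and hence a neighbourhood of
    0. *)
Lemma consistency (e : R) : 0 < e -> exists2 d : R, 0 < d &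
  forall theta, Theta theta -> nf (Sg theta - 1%:M) <= d -> nf (theta - theta0) <= e.
Proof.
move=> e0; pose A := Theta `&` [set theta | e <= nf (theta - theta0)].
pose f theta := nf (Sg theta - 1%:M).
have cnf : continuous (fun theta : 'rV[R]_q => nf (theta - theta0)).
  move=> t; apply: (@nf_cvg _ _ (nbhs t) 1 q (fun x => x - theta0)).
  by apply: cvgB; [exact: cvg_id|exact: cvg_cst].
have cA : compact A.
  apply: (@subclosed_compact _ _ Theta) => //; last by move=> ? [].
  apply: closedI; first exact: (compact_closed (@norm_hausdorff _ _)).
  have -> : [set theta | e <= nf (theta - theta0)] =
    (fun theta => nf (theta - theta0)) @^-1` [set r | e <= r] by [].
  by apply: preimage_closed => [? _|]; [exact: cnf|exact: closed_ge].
have cfA : compact (f @` A).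
  apply: continuous_compact => //; apply: continuous_in_subspaceT => t.
  rewrite inE => -[tT _]; apply: (@nf_cvg _ _ (nbhs t) p p (fun x => Sg x - 1%:M)).
  by apply: cvgB; [exact: hcont|exact: cvg_cst].
have clfA : closed (f @` A) by exact: (compact_closed (@Rhausdorff R)).
have nf0A : (~` (f @` A)) 0.
  move=> [t [tT et] ft]; have : Sg t = 1%:M.
    by apply/eqP; rewrite -subr_eq0; apply/eqP/nf_eq0.
  move=> /(hinj tT) tt; move: et; rewrite /= tt subrr nf0; lra.
have := open_nbhs_nbhs (conj (closed_openC clfA) nf0A).
move=> /nbhs_ballP[d /= d0 H]; exists (d / 2); first lra.
move=> t tT td; rewrite leNgt; apply/negP => et.
have : (~` (f @` A)) (f t).
  apply: H; rewrite -ball_normE /= sub0r normrN ger0_norm ?nf_ge0//.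
  by apply: le_lt_trans td _; lra.
by apply; exists t => //; split => //; exact: ltW.
Qed.

Lemma nf_le_mulJ (v : 'rV[R]_q) : nf v <= nf (J^T *m invmx (J *m J^T)) * nf (v *m J).
Proof.
have {1}-> : v = v *m J *m (J^T *m invmx (J *m J^T)).
  by rewrite -!mulmxA (mulmxA J) mulmxV// mulmx1.
by rewrite mulrC nfM.
Qed.

End Argmin.

(** The upper bound evaluates the contrast at the minimiser of the linearised problem, which belongs
    to [Theta] because [theta0] is interior. The lower bound says that no point of the tangent space
    is closer to x than its projection. It requires the actual minimiser to be within order 1/s of
    [theta0], and this rate is itself extracted from a crude form of the upper bound. *)
Lemma argmin_expansion (R : realType) (p q : nat) (Theta : set 'rV[R]_q)
    (Sg : 'rV[R]_q -> 'M[R]_p) (theta0 : 'rV[R]_q) (J : 'M[R]_(q, p * p))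
    (e K : R) :
  compact Theta -> Theta° theta0 ->
  (forall theta, Theta theta -> posdef (Sg theta)) ->
  (forall theta, Theta theta -> {for theta, continuous Sg}) ->
  Sg theta0 = 1%:M ->
  (forall theta, Theta theta -> Sg theta = 1%:M -> theta = theta0) ->
  (forall e : R, 0 < e -> exists2 d : R, 0 < d &
    forall theta, nf (theta - theta0) <= d ->
      nf (mxvec (Sg theta - 1%:M) - (theta - theta0) *m J) <= e * nf (theta - theta0)) ->
  J *m J^T \in unitmx -> 0 < e -> 0 < K ->
  exists2 s0 : R, 0 < s0 & forall (s : R) (Q : 'M[R]_p) (theta : 'rV[R]_q),
    s0 <= s -> Q^T = Q -> nf (s *: (Q - 1%:M)) <= K -> Theta theta ->
    (forall theta', Theta theta' -> qlik Q (Sg theta) <= qlik Q (Sg theta')) ->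
    `|s ^+ 2 * qlik Q (Sg theta) - fro (mxvec (s *: (Q - 1%:M)) *m resid_proj J) / 2| <= e.
Proof.
move=> hcomp hint hpos hcont Sg0 hinj hdiff Jfree e0 K0.
pose CJ := nf (J^T *m invmx (J *m J^T)).
set Pi := resid_proj J.
have CJ0 : 0 <= CJ by exact: nf_ge0.
(* [C2] will bound |s (Q - Sg t)| at the minimiser t, [C] the scaled parameter error |s (t -
   theta0)|, and [D] is the envelope of [sqr_expand_up]. The relative error [h] is then chosen with
   h D <= e and with h CJ <= 1/2, so that the linearisation error can be absorbed. *)
pose C2 := 3 * K * (1 + CJ); have C20 : 0 <= C2 by rewrite mulr_ge0// ?mulr_ge0 ?addr_ge0// ltW.
pose C := CJ * (2 * (C2 + K)).
have C0 : 0 <= C by rewrite mulr_ge0// mulr_ge0// addr_ge0// ltW.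
have KCJ : K * CJ <= C.
  rewrite mulrC ler_wpM2l//; lra.
pose D := K ^+ 2 + 3 * K * C + 2 * C ^+ 2.
have D0 : 0 <= D.
  have := mulr_ge0 (ltW K0) C0; have := sqr_ge0 K; have := sqr_ge0 C.
  by rewrite /D; lra.
pose h := Num.min (1 / 4) (Num.min (e / (D + 1)) (1 / (2 * (CJ + 1)))).
have h0 : 0 < h by rewrite !lt_min; apply/and3P; split; rewrite ?divr_gt0 ?mulr_gt0//; lra.
have h4 : h <= 1 / 4 by rewrite ge_min lexx.
have hD : h * D <= e.
  apply: (@le_trans _ _ (e / (D + 1) * D)).
    by rewrite ler_wpM2r// !ge_min lexx orbT.
  by rewrite mulrAC ler_pdivrMr ?ler_pM2l//; lra.
have hCJ : h * CJ <= 1 / 2.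
  apply: (@le_trans _ _ (1 / (2 * (CJ + 1)) * CJ)).
    by rewrite ler_wpM2r// !ge_min lexx !orbT.
  by rewrite mulrAC ler_pdivrMr; lra.
have [d1 d10 H1] := @qlik_local R p _ h0.
have [d2 d20 H2] := hdiff _ h0.
have [d3 d30 H3] := interior_shift hint.
have d120 : 0 < Num.min (d1 / 2) (d2 / 1) by rewrite lt_min; apply/andP; split; lra.
have [d4 d40 H4] := consistency hcomp hcont hinj d20.
have hd4 : 0 < Num.min (d1 / 2) (d4 / 2) by rewrite lt_min; apply/andP; split; lra.
have [d5 d50 H5] := @qlik_control_near1 R p _ hd4.
have [d6 d60 H6] : exists2 d : R, 0 < d & forall t, nf (t - theta0) <= d -> nf (Sg t - 1%:M) <= d1.
  have cS := hcont _ (interior_subset hint); rewrite -Sg0.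
  have cS' : nf (Sg x - Sg theta0) @[x --> theta0] --> 0.
    exact: (@nf_near R _ (nbhs theta0) p p Sg (Sg theta0) (nbhs_filter theta0) cS).
  have /interior_shift[d dd0 Hd] : \forall t \near theta0, `|0 - nf (Sg t - Sg theta0)| <= d1.
    exact: (@cvgr_dist_le _ _ _ _ (nbhs_filter theta0) _ _ cS' _ d10).
  exists d => // t /Hd; by rewrite sub0r normrN ger0_norm// nf_ge0.
pose dm := Num.min (Num.min (1 / 2) (Num.min (d1 / 2) (d4 / 2))) (Num.min d2 (Num.min d3 d6)).
have dm0 : 0 < dm.
  by rewrite !lt_min d20 d30 d60 /= andbT; clear -d10 d40; apply/and3P; split; lra.
pose C1 := (K * (1 + CJ)) ^+ 2.
have C10 : 0 <= C1 by exact: sqr_ge0.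
exists (Num.max 1 (Num.max ((K + C) / dm) (C1 / d5))).
  by rewrite lt_max ltr01.
move=> s Q t; rewrite !ge_max => /and3P[s1 sK sC] QT QK tT tmin.
have s0 : 0 < s by lra.
have Qdm' : (K + C) / s <= dm by rewrite ler_pdivrMr// mulrC -ler_pdivrMr.
have Kdm : K / s <= dm by apply: le_trans Qdm'; rewrite ler_pM2r ?invr_gt0//; lra.
have Cdm : C / s <= dm by apply: le_trans Qdm'; rewrite ler_pM2r ?invr_gt0//; lra.
have Qs : nf (Q - 1%:M) <= K / s.
  by rewrite ler_pdivlMr// mulrC -[s in X in X <= _](gtr0_norm s0) -nfZ.
have Qdm : nf (Q - 1%:M) <= dm by exact: le_trans Qs Kdm.
move: (Qdm) (Cdm); rewrite !le_min => /andP[/and3P[Q_1 Q_d1 Q_d4] _] /andP[_ /and3P[C_d2 C_d3 C_d6]].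
have Qp : posdef Q by apply: posdef_near1 => //; clear -Q_1; lra.
have Qd1 : nf (Q - 1%:M) <= d1 by clear -Q_d1 d10; lra.
set x := mxvec (s *: (Q - 1%:M)).
have xK : nf x <= K by rewrite mxvec_nf.
set a := nf (x *m Pi).
have a0K : 0 <= a <= K by rewrite nf_ge0 (le_trans (nf_proj Jfree _)).
have aE : fro (x *m Pi) = a ^+ 2 by rewrite sqr_nf.
have sfro (S : 'M[R]_p) : s ^+ 2 * fro (Q - S) = nf (s *: (Q - S)) ^+ 2.
  by rewrite sqr_nf froZ.
pose rho t' := s *: (mxvec (Sg t' - 1%:M) - (t' - theta0) *m J).
have rhoE t' : nf (t' - theta0) <= d2 -> nf (rho t') <= h * nf (s *: (t' - theta0)).
  move=> /H2 hh; rewrite /rho !nfZ mulrCA ler_wpM2l//.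
have decomp t' : mxvec (s *: (Q - Sg t')) = x - (s *: (t' - theta0)) *m J - rho t'.
  have -> : s *: (Q - Sg t') = s *: (Q - 1%:M) - s *: (Sg t' - 1%:M).
    by rewrite -scalerBr opprB addrA subrK.
  rewrite [LHS]raddfB /= -/x /rho -scalemxAl [mxvec (s *: (Sg t' - 1%:M))]linearZ /=.
  move: (mxvec _) ((t' - theta0) *m J) (x) => A B X.
  by apply/matrixP => i k; rewrite !mxE; ring.
(* [t1] minimises the linearised problem: there [x - u *m J] is [x *m Pi]. *)
pose u := x *m (J^T *m invmx (J *m J^T)).
have uK : nf u <= K * CJ.
  by apply: le_trans (nfM _ _) _; rewrite ler_wpM2r.
pose t1 := theta0 + s^-1 *: u.
have t1E : s *: (t1 - theta0) = u.
  by rewrite /t1 addrAC subrr add0r scalerA divff ?scale1r// gt_eqF.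
have t1d : nf (t1 - theta0) <= C / s.
  rewrite ler_pdivlMr// mulrC -[s in X in X <= _](gtr0_norm s0) -nfZ t1E.
  exact: le_trans uK KCJ.
have t1T : Theta t1 by apply: H3; exact: le_trans t1d C_d3.
have S1d : nf (Sg t1 - 1%:M) <= d1 by apply: H6; exact: le_trans t1d C_d6.
have y1 : nf (s *: (Q - Sg t1)) <= a + h * (K * CJ).
  rewrite -mxvec_nf decomp t1E.
  have -> : x - u *m J = x *m Pi.
    by rewrite /Pi /resid_proj mulmxBr mulmx1 /u !mulmxA.
  apply: le_trans (nfB _ _) _; rewrite lerD2l.
  apply: le_trans (rhoE _ (le_trans t1d C_d2)) _.
  by rewrite t1E ler_pM2l.
have q1 : s ^+ 2 * qlik Q (Sg t1) <= (1 / 2 + h) * nf (s *: (Q - Sg t1)) ^+ 2.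
  rewrite -sfro mulrCA ler_wpM2l ?sqr_ge0//.
  have := H1 Q _ Qp (hpos _ t1T) Qd1 S1d; rewrite ler_norml; clear; lra.
have qm : s ^+ 2 * qlik Q (Sg t) <= (1 / 2 + h) * nf (s *: (Q - Sg t1)) ^+ 2.
  by apply: le_trans q1; rewrite ler_wpM2l ?sqr_ge0//; exact: tmin.
have KCJ0 : 0 <= K * CJ by rewrite mulr_ge0// ltW.
(* A crude consequence of minimality: the minimum is of order s^(-2). This is enough to bring Q - Sg
   t, and then t - theta0, below the radii of the local expansions. *)
have q2 : s ^+ 2 * qlik Q (Sg t) <= 3 / 4 * C1.
  apply: le_trans qm _; apply: ler_pM; rewrite ?sqr_ge0//; [clear -h0; lra|clear -h4; lra|].
  rewrite /C1 lerXn2r ?nnegrE ?nf_ge0//; first by rewrite mulr_ge0 ?addr_ge0// ltW.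
  apply: le_trans y1 _; have : h * (K * CJ) <= K * CJ by rewrite ler_piMl//; clear -h4; lra.
  have /andP[_ aK] := a0K; rewrite mulrDr mulr1 => hh; clear -hh aK; lra.
have St := hpos _ tT.
have qs : qlik Q (Sg t) <= d5.
  have s2 : 0 < s ^+ 2 by rewrite exprn_gt0.
  rewrite -(ler_pM2l s2); apply: le_trans q2 _.
  have h1 : C1 <= s * d5 by rewrite -ler_pdivrMr.
  have h2 : s * d5 <= s ^+ 2 * d5 by rewrite ler_wpM2r ?(ltW d50)// expr2 ler_peMl// ltW.
  clear -h1 h2 C10; lra.
have Q_1' : nf (Q - 1%:M) <= 1 by clear -Q_1; lra.
move: (H5 Q _ Qp St Q_1' qs); rewrite le_min => /andP[QS1 QS4].
have S1 : nf (Sg t - 1%:M) <= nf (Q - 1%:M) + nf (Q - Sg t).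
  have -> : Sg t - 1%:M = (Q - 1%:M) - (Q - Sg t).
    by apply/matrixP => i k; rewrite !mxE; ring.
  exact: nfB.
have td2 : nf (t - theta0) <= d2 by apply: H4 => //; clear -S1 Q_d4 QS4; lra.
set y := nf (s *: (Q - Sg t)).
have y0 : 0 <= y by exact: nf_ge0.
have q3 : (1 / 2 - h) * y ^+ 2 <= s ^+ 2 * qlik Q (Sg t).
  rewrite -sfro mulrCA ler_wpM2l ?sqr_ge0//.
  have S1d' : nf (Sg t - 1%:M) <= d1 by clear -S1 Q_d1 QS1; lra.
  have := H1 Q _ Qp St Qd1 S1d'; rewrite ler_norml; clear; lra.
have yC2 : y <= C2.
  rewrite -(@ler_pXn2r _ 2)// ?nnegrE//.
  have -> : C2 ^+ 2 = 9 * C1 by rewrite /C2 /C1; ring.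
  have : 1 / 4 * y ^+ 2 <= (1 / 2 - h) * y ^+ 2 by rewrite ler_wpM2r ?sqr_ge0//; clear -h4; lra.
  clear -q2 q3 C10; lra.
pose v := s *: (t - theta0).
have hrho := rhoE t td2.
(* The rate: the linearisation error [rho t] is at most half of |v J| and is moved to the left
   side. *)
have vJ : nf (v *m J) <= 2 * (C2 + K).
  have h1 := nfB (x - mxvec (s *: (Q - Sg t))) (rho t).
  have h2 := nfB x (mxvec (s *: (Q - Sg t))); rewrite (mxvec_nf (s *: (Q - Sg t))) -/y in h2.
  have h3 : h * nf v <= 1 / 2 * nf (v *m J).
    apply: (@le_trans _ _ (h * CJ * nf (v *m J))).
      by rewrite -mulrA ler_pM2l// (nf_le_mulJ Jfree).
    by rewrite ler_wpM2r// nf_ge0.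
  have E : v *m J = x - mxvec (s *: (Q - Sg t)) - rho t.
    rewrite decomp -/v; move: (v *m J) (rho t) (x) => A1 A2 A3.
    by apply/matrixP => i k; rewrite !mxE; ring.
  rewrite -E in h1; rewrite -/v in hrho; rewrite -/x in h2.
  by clear -h1 h2 h3 hrho xK yC2; lra.
have rhoC : nf (rho t) <= h * C.
  apply: le_trans hrho _; rewrite ler_pM2l//.
  by apply: le_trans (nf_le_mulJ Jfree v) _; rewrite ler_wpM2l.
(* [Pi] annihilates v J, so the residual of x is at most its distance to any point v J of the
   tangent space. *)
have ay : a - h * C <= y.
  have : a <= nf (x - v *m J).
    have -> : a = nf ((x - v *m J) *m Pi).
      by rewrite mulmxBl -mulmxA (mul_J_proj Jfree) mulmx0 subr0.
    exact: (nf_proj Jfree).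
  have -> : x - v *m J = mxvec (s *: (Q - Sg t)) + rho t by rewrite decomp subrK.
  have := nfD (mxvec (s *: (Q - Sg t))) (rho t); rewrite mxvec_nf -/y.
  by clear -rhoC; lra.
have h01 : 0 <= h <= 1 by clear -h0 h4; lra.
have h02 : 0 <= h <= 1 / 2 by clear -h0 h4; lra.
have y1' : nf (s *: (Q - Sg t1)) <= a + h * C.
  by apply: le_trans y1 _; rewrite lerD2l ler_pM2l.
have up := sqr_expand_up h01 a0K C0 (nf_ge0 _) y1'.
have dn := sqr_expand_down h02 a0K C0 y0 ay.
rewrite -/D in up dn; rewrite aE ler_norml.
by clear -up dn q3 qm hD; apply/andP; split; lra.
Qed.

(** * Expectation and independence *)

Section Expectation.
Context (d : measure_display) (T : measurableType d) (R : realType).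
Variable P : probability T R.
Implicit Types f g U V : T -> R.

Definition intg f : Prop := P.-integrable setT (EFin \o f).

Definition ex f : R := \int[P]_w f w.

Lemma intg_meas f : intg f -> measurable_fun setT f.
Proof. by move=> /measurable_int/measurable_EFinP. Qed.

Lemma intg_cst r : intg (fun=> r).
Proof. exact: finite_measure_integrable_cst. Qed.

Lemma ex_cst r : ex (fun=> r) = r.
Proof.
rewrite /ex Rintegral_cst//; transitivity (r * fine (P setT)) => //.
by rewrite probability_setT mulr1.
Qed.

Lemma intgD f g : intg f -> intg g -> intg (fun w => f w + g w).
Proof. by move=> fi gi; have := integrableD measurableT fi gi. Qed.

Lemma exD f g : intg f -> intg g -> ex (fun w => f w + g w) = ex f + ex g.
Proof. by move=> fi gi; exact: RintegralD. Qed.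

Lemma intgZ r f : intg f -> intg (fun w => r * f w).
Proof. by move=> fi; have := integrableZl measurableT r fi. Qed.

Lemma exZ r f : intg f -> ex (fun w => r * f w) = r * ex f.
Proof. by move=> fi; exact: RintegralZl. Qed.

Lemma intgB f g : intg f -> intg g -> intg (fun w => f w - g w).
Proof.
move=> fi gi; have := intgD fi (intgZ (-1) gi).
by under eq_fun do rewrite mulN1r.
Qed.

Lemma exB f g : intg f -> intg g -> ex (fun w => f w - g w) = ex f - ex g.
Proof. by move=> fi gi; exact: RintegralB. Qed.

Lemma intg_sum (I : Type) (s : seq I) (F : I -> T -> R) :
  (forall i, intg (F i)) -> intg (fun w => \sum_(i <- s) F i w).
Proof.
move=> Fi; elim: s => [|i s IH].
  under eq_fun do rewrite big_nil; exact: intg_cst.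
by under eq_fun do rewrite big_cons; exact: intgD.
Qed.

Lemma ex_sum (I : Type) (s : seq I) (F : I -> T -> R) :
  (forall i, intg (F i)) -> ex (fun w => \sum_(i <- s) F i w) = \sum_(i <- s) ex (F i).
Proof.
move=> Fi; elim: s => [|i s IH].
  by under eq_fun do rewrite big_nil; rewrite ex_cst big_nil.
under eq_fun do rewrite big_cons.
by rewrite exD// ?IH ?big_cons//; exact: intg_sum.
Qed.

Lemma le_intg f g : measurable_fun setT f -> (forall w, `|f w| <= g w) ->
  intg g -> intg f.
Proof.
move=> mf fg; apply: le_integrable => //; first exact/measurable_EFinP.
by move=> w _; rewrite lee_fin (le_trans (fg w))// ler_norm.
Qed.

Lemma intg_abs f : intg f -> intg (fun w => `|f w|).
Proof. by move=> fi; have := integrable_norm fi. Qed.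

Lemma intg_bounded f c : measurable_fun setT f -> (forall w, `|f w| <= c) -> intg f.
Proof. by move=> mf fc; exact: (le_intg mf fc (intg_cst c)). Qed.

Lemma le_ex f g : intg f -> intg g -> (forall w, f w <= g w) -> ex f <= ex g.
Proof. by move=> fi gi fg; apply: le_Rintegral. Qed.

Lemma ex_ge0 f : (forall w, 0 <= f w) -> 0 <= ex f.
Proof. by move=> f0; apply: Rintegral_ge0. Qed.

Lemma ex_abs f : intg f -> `|ex f| <= ex (fun w => `|f w|).
Proof. by move=> fi; apply: le_normr_Rintegral. Qed.

Lemma ex_le_abs f g : intg f -> intg g -> (forall w, `|f w| <= g w) -> `|ex f| <= ex g.
Proof.
move=> fi gi fg; apply: le_trans (ex_abs fi) _.
exact: (le_ex (intg_abs fi) gi fg).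
Qed.

Lemma intgM f g : measurable_fun setT f -> measurable_fun setT g ->
  intg (fun w => f w ^+ 2) -> intg (fun w => g w ^+ 2) -> intg (fun w => f w * g w).
Proof.
move=> mf mg f2 g2; apply: (le_intg _ _ (intgD f2 g2)).
  exact: measurable_funM.
move=> w; rewrite normrM -(real_normK (num_real (f w))) -(real_normK (num_real (g w))).
have := sqr_ge0 (`|f w| - `|g w|); have := mulr_ge0 (normr_ge0 (f w)) (normr_ge0 (g w)).
lra.
Qed.

(** Independence makes the law of the pair agree with the product of the marginal laws on
    rectangles, hence on all measurable sets. Tonelli then gives integrability of the product and
    Fubini its value. *)
Lemma ex_mul_indep U V : intg U -> intg V ->
  (forall A B : set R, measurable A -> measurable B ->
    P ((U @^-1` A) `&` (V @^-1` B)) = (P (U @^-1` A) * P (V @^-1` B))%E) ->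
  intg (fun w => U w * V w) /\ ex (fun w => U w * V w) = ex U * ex V.
Proof.
move=> Ui Vi UV; have mU := intg_meas Ui; have mV := intg_meas Vi.
pose U' : {mfun T >-> R} := mfun_Sub (mem_set mU).
pose V' : {mfun T >-> R} := mfun_Sub (mem_set mV).
have mW : measurable_fun setT (fun w => (U w, V w)) by exact: measurable_fun_pair.
pose W' : {mfun T >-> (R * R)%type} := mfun_Sub (mem_set mW).
pose f (z : R * R) : \bar R := (z.1 * z.2)%:E.
have mf : measurable_fun setT f.
  by apply/measurable_EFinP; apply: measurable_funM; [exact: measurable_fst|exact: measurable_snd].
have mabsf : measurable_fun setT (abse \o f) by exact: measurableT_comp.
have DE (A : set (R * R)) : measurable A ->
    (distribution P U' \x distribution P V')%E A = distribution P W' A.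
  apply: product_measure_unique => A1 A2 m1 m2.
  rewrite /distribution /pushforward /= -UV//; congr (P _).
have DUi : (distribution P U').-integrable setT (EFin \o id).
  by apply: (integrable_pushforward mU) => //; exact: EFin_measurable.
have DVi : (distribution P V').-integrable setT (EFin \o id).
  by apply: (integrable_pushforward mV) => //; exact: EFin_measurable.
have absf_fin : (\int[distribution P U' \x distribution P V']_z `|f z| < +oo)%E.
  rewrite (fubini_tonelli1 (abse \o f))//; last by move=> x; exact: abse_ge0.
  have h x : (fubini_F (distribution P V') (abse \o f) x =
     `|x%:E| * \int[distribution P V']_y `|y%:E|)%E.
    rewrite /fubini_F /= -ge0_integralZl//; last exact: measurableT_comp.
    by apply: eq_integral => y _; rewrite /f /= normrM EFinM.
  under eq_integral do rewrite h.
  have /integrableP[_ h1] := DUi; have /integrableP[_ h2] := DVi.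
  rewrite ge0_integralZr//.
  - apply: lte_mul_pinfty => //; first exact: integral_ge0.
    by rewrite ge0_fin_numE//; exact: integral_ge0.
  - exact: measurableT_comp.
  - exact: integral_ge0.
have fi : (distribution P U' \x distribution P V')%E.-integrable setT f.
  by apply/integrableP; split; [exact: mf|exact: absf_fin].
have intUV : P.-integrable setT (f \o W').
  apply/integrableP; split; first exact: measurableT_comp.
  rewrite -(ge0_integral_distribution W' (f := abse \o f))//; last by move=> y; exact: abse_ge0.
  rewrite (eq_measure_integral (distribution P U' \x distribution P V')%E) => [//|A mA _].
  exact/esym/DE.
split; first exact: intUV.
rewrite /ex /Rintegral.
have -> : (\int[P]_w (U w * V w)%:E = \int[P]_w (f \o W') w)%E by [].
rewrite -(integral_distribution (X := W') mf intUV).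
rewrite (eq_measure_integral (distribution P U' \x distribution P V')%E) => [|A mA _]; last exact/esym/DE.
rewrite -integral12_prod_meas1//.
have EU : (\int[distribution P U']_x x%:E = \int[P]_w (U w)%:E)%E.
  by rewrite (integral_distribution (X := U') (f := EFin)).
have EV : (\int[distribution P V']_x x%:E = \int[P]_w (V w)%:E)%E.
  by rewrite (integral_distribution (X := V') (f := EFin)).
have finV : (\int[P]_w (V w)%:E)%E \is a fin_num by exact: integrable_fin_num.
have finU : (\int[P]_w (U w)%:E)%E \is a fin_num by exact: integrable_fin_num.
rewrite (eq_integral (fun x : R => x%:E * \int[P]_w (V w)%:E)%E).
  rewrite -(fineK finV) integralZr// EU fineM//.
move=> x _; rewrite /fubini_F /f /= -EV -integralZl//.
Qed.

End Expectation.

Section SigmaIndependence.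
Context (d : measure_display) (T : measurableType d) (R : realType).
Variable P : probability T R.
Implicit Types G H : set_system T.

Definition indep_sys G H : Prop := forall A B, G A -> H B ->
  P (A `&` B) = (P A * P B)%E.

Lemma indep_sysC G H : indep_sys G H -> indep_sys H G.
Proof. by move=> GH A B HA GB; rewrite setIC muleC GH. Qed.

(** For fixed B, the measures A |-> P (A & B) and A |-> P B * P A agree on the generating system
    [G], which is stable under intersection, hence on the generated sigma-algebra. *)
Lemma indep_sigma_half G H : G `<=` measurable -> H `<=` measurable ->
  setI_closed G -> G setT -> indep_sys G H -> indep_sys <<s G>> H.
Proof.
move=> mG mH GI GT GH A B sA HB; have mB := mH _ HB.
have PBfin : P B \is a fin_num by exact: fin_num_measure.
have PB0 : 0 <= fine (P B) by exact: fine_ge0.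
pose m1 := mrestr P mB; pose m2 := mscale (NngNum PB0) P.
have : m1 A = m2 A.
  apply: (@g_sigma_algebra_measure_unique _ _ _ G mG (fun=> setT)) => //.
  - by rewrite bigcup_const//; exists 0%N.
  - move=> C GC; change (P (C `&` B) = ((fine (P B))%:E * P C)%E).
    by rewrite fineK// muleC GH.
  - move=> k; change (P (setT `&` B) < +oo)%E; rewrite setTI ltey_eq PBfin//.
change (P (A `&` B) = ((fine (P B))%:E * P A)%E -> P (A `&` B) = (P A * P B)%E).
by rewrite fineK// muleC.
Qed.

Lemma sub_sigma_measurable G : G `<=` measurable -> <<s G>> `<=` measurable.
Proof. by move=> mG; apply: smallest_sub => //; exact: sigma_algebra_measurable. Qed.

Lemma indep_sigma G H : G `<=` measurable -> H `<=` measurable ->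
  setI_closed G -> setI_closed H -> G setT -> H setT ->
  indep_sys G H -> indep_sys <<s G>> <<s H>>.
Proof.
move=> mG mH GI HI GT HT GH; apply/indep_sysC/indep_sigma_half => //.
  exact: sub_sigma_measurable.
by apply/indep_sysC/indep_sigma_half.
Qed.

End SigmaIndependence.

Section SigmaMeasurable.
Context (d : measure_display) (T : measurableType d) (R : realType).
Variable P : probability T R.
Implicit Types (G H : set_system T) (U V : T -> R).

(** Measurability is stated on the type carrying the sigma-algebra generated by [G], so that the
    closure properties of measurable functions apply verbatim. *)
Definition smeas G U : Prop :=
  measurable_fun (setT : set (g_sigma_algebraType G)) (U : g_sigma_algebraType G -> R).

Lemma smeas_preimage G U (A : set R) : smeas G U -> measurable A ->
  <<s G>> (U @^-1` A).
Proof. by move=> mU mA; have := mU measurableT A mA; rewrite setTI. Qed.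

Lemma smeas_measurable G U : G `<=` measurable -> smeas G U -> measurable_fun setT U.
Proof.
move=> mG mU _ A mA; rewrite setTI.
by apply: (sub_sigma_measurable mG); exact: smeas_preimage.
Qed.

Lemma ex_mul_smeas G H U V : indep_sys P <<s G>> <<s H>> ->
  smeas G U -> smeas H V -> intg P U -> intg P V ->
  intg P (fun w => U w * V w) /\ ex P (fun w => U w * V w) = ex P U * ex P V.
Proof.
move=> GH mU mV Ui Vi; apply: ex_mul_indep => // A B mA mB.
by apply: GH; exact: smeas_preimage.
Qed.

End SigmaMeasurable.

Section Family.
Context (d : measure_display) (T : measurableType d) (R : realType).
Variable P : probability T R.
Variables (I : finType) (X : I -> T -> R).
Hypothesis mX : forall i, measurable_fun setT (X i).
Hypothesis indX : forall E : I -> set R, (forall i, measurable (E i)) ->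
  fine (P (\bigcap_i (X i @^-1` E i))) = \prod_i fine (P (X i @^-1` E i)).

(** A system stable under intersection that generates the sigma-algebra of the [X i] with i in [J].
    The constraints run over the whole index type and are trivial off [J], so that cylinders over
    [J] and over its complement intersect coordinatewise. *)
Definition cyl (J : pred I) : set_system T := [set A | exists E : I -> set R,
  [/\ forall i, measurable (E i), forall i, ~~ J i -> E i = setT &
      A = \bigcap_i (X i @^-1` E i)]].

Lemma cyl_measurable J : cyl J `<=` measurable.
Proof.
move=> A [E [mE _ ->]]; apply: fin_bigcap_measurable => // i _.
by rewrite -[_ @^-1` _]setTI; exact: mX.
Qed.

Lemma cyl_setI J : setI_closed (cyl J).
Proof.
move=> A B [E [mE EJ ->]] [F [mF FJ ->]]; exists (fun i => E i `&` F i); split.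
- by move=> i; exact: measurableI.
- by move=> i iJ; rewrite EJ// FJ// setTI.
- by rewrite -bigcapI; apply: eq_bigcapr => i _; rewrite preimage_setI.
Qed.

Lemma cyl_setT J : cyl J setT.
Proof.
exists (fun=> setT); split => //.
by rewrite bigcapT// => i _; rewrite preimage_setT.
Qed.

Lemma cyl_indep J : indep_sys P <<s cyl J>> <<s cyl (predC J)>>.
Proof.
apply: indep_sigma; [exact: cyl_measurable|exact: cyl_measurable|
  exact: cyl_setI|exact: cyl_setI|exact: cyl_setT|exact: cyl_setT|].
move=> A B [E [mE EJ ->]] [F [mF FJ ->]].
have fP (C : set T) : measurable C -> P C = (fine (P C))%:E.
  by move=> mC; rewrite fineK// fin_num_measure.
have mb (C : I -> set R) : (forall i, measurable (C i)) ->
    measurable (\bigcap_i (X i @^-1` C i)).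
  move=> mC; apply: fin_bigcap_measurable => // i _.
  by rewrite -[_ @^-1` _]setTI; exact: mX.
rewrite -bigcapI (_ : \bigcap_i _ = \bigcap_i (X i @^-1` (E i `&` F i))); last first.
  by apply: eq_bigcapr => i _; rewrite preimage_setI.
have mEF i : measurable (E i `&` F i) by exact: measurableI.
rewrite fP; last exact: mb.
rewrite (fP (\bigcap_i (X i @^-1` E i))); last exact: mb.
rewrite (fP (\bigcap_i (X i @^-1` F i))); last exact: mb.
rewrite !indX// -EFinM -big_split /=; congr EFin; apply: eq_bigr => i _.
have [iJ|iJ] := boolP (J i).
  by rewrite FJ /= ?iJ// setIT preimage_setT probability_setT mulr1.
by rewrite EJ// setTI preimage_setT probability_setT mul1r.
Qed.

Lemma smeas_cyl (J : pred I) i : J i -> smeas (cyl J) (X i).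
Proof.
move=> iJ _ A mA; rewrite setTI; apply: sub_sigma_algebra.
exists (fun k => if k == i then A else setT); split.
- by move=> k; case: ifP.
- by move=> k kJ; case: eqP => // ki; rewrite ki iJ in kJ.
- apply/seteqP; split => [w Aw k _|w /(_ i Logic.I)]; last by rewrite /= eqxx.
  by rewrite /=; case: eqP => // ->.
Qed.

End Family.

(** * A central limit theorem for squared norms *)

Section SteinTaylor.
Variable R : realType.
Implicit Types (l s t x y a b : R).

Lemma is_derive_mul (f g : R -> R) t df dg : is_derive t 1 f df ->
  is_derive t 1 g dg -> is_derive t 1 (fun s => f s * g s) (f t * dg + g t * df).
Proof. by move=> hf hg; exact: (is_deriveM hf hg). Qed.

Lemma is_derive_sqr (f : R -> R) t df : is_derive t 1 f df ->
  is_derive t 1 (fun s => f s ^+ 2) (2 * f t * df).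
Proof.
by move=> hf; apply: (is_derive_eq (is_derive_mul hf hf)); ring.
Qed.

Lemma is_derive_affine (f : R -> R) t df c k : is_derive t 1 f df ->
  is_derive t 1 (fun s => c + k * f s) (k * df).
Proof.
move=> hf; have h := is_deriveD (is_derive_cst c t 1) (is_deriveZ k hf).
by apply: (is_derive_eq h); rewrite add0r.
Qed.

(** Even powers come from u exp (- u) <= 1, used for the fourth power at half the exponent and then
    squared. Odd powers lie between the neighbouring even ones. *)
Lemma gauss_bounds l0 l s : 0 < l0 -> l0 <= l -> 0 <= s ->
  [/\ s ^+ 2 * expR (- (l * s ^+ 2)) <= 1 / l0,
      s ^+ 4 * expR (- (l * s ^+ 2)) <= 4 / l0 ^+ 2,
      s * expR (- (l * s ^+ 2)) <= 1 + 1 / l0 &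
      s ^+ 3 * expR (- (l * s ^+ 2)) <= 1 / l0 + 4 / l0 ^+ 2].
Proof.
move=> l00 l0l s0; set e := expR _.
have e0 : 0 < e := expR_gt0 _.
have e1 : e <= 1.
  by rewrite -expR0 ler_expR oppr_le0 mulr_ge0 ?sqr_ge0// (le_trans (ltW l00)).
have s2 : 0 <= s ^+ 2 := sqr_ge0 _.
have ls : l0 * s ^+ 2 <= l * s ^+ 2 by rewrite ler_wpM2r.
have h1 : l0 * s ^+ 2 * e <= 1.
  rewrite /e expRN ler_pdivrMr ?expR_gt0// mul1r.
  by have := expR_ge1Dx (l * s ^+ 2); lra.
have h2 : s ^+ 2 * e <= 1 / l0 by rewrite ler_pdivlMr// mulrC mulrA.
have h3 : s ^+ 4 * e <= 4 / l0 ^+ 2.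
  have q : (l0 * s ^+ 2 / 2) ^+ 2 * e <= 1.
    have -> : e = expR (- (l * s ^+ 2 / 2)) ^+ 2.
      by rewrite /e -expRM_natl; congr expR; field.
    rewrite -exprMn exprn_ile1//; first by rewrite mulr_ge0 ?expR_ge0 ?mulr_ge0// ltW.
    rewrite expRN ler_pdivrMr ?expR_gt0// mul1r.
    have := expR_ge1Dx (l * s ^+ 2 / 2); lra.
  have -> : s ^+ 4 * e = 4 / l0 ^+ 2 * ((l0 * s ^+ 2 / 2) ^+ 2 * e).
    by field; rewrite gt_eqF.
  by rewrite ler_piMr// divr_ge0// sqr_ge0.
have hs1 : s <= 1 + s ^+ 2 by have := sqr_ge0 (s - 1); nra.
have hs3 : s ^+ 3 <= s ^+ 2 + s ^+ 4.
  have := mulr_ge0 s2 (sqr_ge0 (s - 1)); have := mulr_ge0 s2 s2.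
  have -> : s ^+ 3 = s ^+ 2 * s by ring. have -> : s ^+ 4 = s ^+ 2 * s ^+ 2 by ring.
  have : s ^+ 2 * s <= s ^+ 2 * (1 + s ^+ 2) by rewrite ler_wpM2l.
  lra.
split => //.
  have : s * e <= (1 + s ^+ 2) * e by rewrite ler_pM2r.
  lra.
have : s ^+ 3 * e <= (s ^+ 2 + s ^+ 4) * e by rewrite ler_pM2r.
lra.
Qed.

(** The weight exp (- l |x + t y|^2) along a segment, where u, v, w stand for |x|^2, the scalar
    product of x and y, and |y|^2. *)
Let E l (u v w : R) t := expR (- (l * (u + 2 * v * t + w * t ^+ 2))).

Lemma is_derive_E l u v w t :
  is_derive t 1 (E l u v w) (E l u v w t * (- (l * (2 * v + 2 * w * t)))).
Proof.
have h1 : is_derive t 1 (fun t : R => - (l * (u + 2 * v * t + w * t ^+ 2)))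
    (- (l * (2 * v + 2 * w * t))).
  have h := is_deriveN (is_deriveZ l (is_deriveD (is_deriveD (is_derive_cst u t 1)
    (is_deriveZ (2 * v) (is_derive_id t 1))) (is_deriveZ w (is_deriveX 2 (is_derive_id t 1))))).
  by apply: (is_derive_eq h); rewrite /GRing.scale /=; ring.
exact: (is_derive1_comp (f := @expR R)
  (g := fun t : R => - (l * (u + 2 * v * t + w * t ^+ 2))) (is_derive_expR _) h1).
Qed.

(** First order expansion at t = 0, taken at t = 1, of the scalar product of y and x + t y times the
    Gaussian weight at x + t y. Only the lengths x, y and the scalar product a enter, related by
    Cauchy-Schwarz, so the vector statement reduces to two applications of the mean value theorem on
    the line. *)
Lemma stein_taylor (l0 L l x y a : R) : 0 < l0 -> l0 <= l <= L -> 0 <= x -> 0 <= y ->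
  `|a| <= x * y ->
  `|(a + y ^+ 2) * expR (- (l * (x ^+ 2 + 2 * a + y ^+ 2)))
    - (a + y ^+ 2 - 2 * l * a ^+ 2) * expR (- (l * x ^+ 2))| <=
  (6 * L * (1 + 1 / l0) + 4 * L ^+ 2 * (1 / l0 + 4 / l0 ^+ 2)) * y ^+ 3.
Proof.
move=> l00 /andP[l0l lL] x0 y0 axy; set C := _ + _ * (_ + _).
have l0' : 0 < l by exact: lt_le_trans l0l.
have L0 : 0 < L by exact: lt_le_trans lL.
pose e := E l (x ^+ 2) a (y ^+ 2).
pose b t := a + y ^+ 2 * t.
pose f t := b t * e t.
pose f1 t := (y ^+ 2 - 2 * l * b t ^+ 2) * e t.
pose f2 t := (b t * (- (6 * l * y ^+ 2) + 4 * l ^+ 2 * b t ^+ 2)) * e t.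
have de t : is_derive t 1 e (e t * (- (2 * l * b t))).
  by apply: (is_derive_eq (is_derive_E _ _ _ _ _)); rewrite /e /b; ring.
have db t : is_derive t 1 b (y ^+ 2).
  have h := is_deriveD (is_derive_cst a t 1) (is_deriveZ (y ^+ 2) (is_derive_id t 1)).
  by apply: (is_derive_eq h); rewrite /GRing.scale /=; ring.
have df t : is_derive t 1 f (f1 t).
  by apply: (is_derive_eq (is_deriveM (db t) (de t))); rewrite /f1 /GRing.scale /=; ring.
have df1 t : is_derive t 1 f1 (f2 t).
  have h := is_derive_mul (is_derive_affine (y ^+ 2) (- (2 * l)) (is_derive_sqr (db t))) (de t).
  have -> : f1 = (fun t => (y ^+ 2 + - (2 * l) * b t ^+ 2) * e t).
    by apply/funext => s; rewrite /f1; ring.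
  by apply: (is_derive_eq h); rewrite /f2; ring.
have f2b t : `|f2 t| <= C * y ^+ 3.
  (* The root s of [s2] plays the part of |x + t y|. Cauchy-Schwarz gives |b t| <= y s; this
     accounts for the factor y^3, while the powers of s are absorbed by the weight. *)
  pose s2 := x ^+ 2 + 2 * a * t + y ^+ 2 * t ^+ 2.
  have a2 : a ^+ 2 <= x ^+ 2 * y ^+ 2.
    rewrite -exprMn -[leLHS]real_normK ?num_real// lerXn2r ?nnegrE// mulr_ge0//.
  have s20 : 0 <= s2.
    have h1 : `|a * t| <= x * (y * `|t|) by rewrite normrM mulrA ler_wpM2r.
    have h2 := sqr_ge0 (x - y * `|t|).
    have h3 : (y * `|t|) ^+ 2 = y ^+ 2 * t ^+ 2 by rewrite exprMn real_normK ?num_real.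
    by move: h1; rewrite /s2 ler_norml => /andP[h1 _]; move: h2; rewrite sqrrB h3; lra.
  pose s := Num.sqrt s2; have s0 : 0 <= s := sqrtr_ge0 _.
  have sE : s ^+ 2 = s2 by exact: sqr_sqrtr.
  have bs : `|b t| <= y * s.
    rewrite -(@ler_pXn2r _ 2)// ?nnegrE ?mulr_ge0// real_normK ?num_real// exprMn sE.
    by rewrite /b /s2; lra.
  have [_ _ g1 g3] := gauss_bounds l00 l0l s0.
  have eE : e t = expR (- (l * s ^+ 2)) by rewrite sE.
  have e0 : 0 < e t by exact: expR_gt0.
  rewrite -eE in g1 g3.
  rewrite /f2 !normrM (gtr0_norm e0).
  have h1 : `|- (6 * l * y ^+ 2) + 4 * l ^+ 2 * b t ^+ 2| <=
     y ^+ 2 * (6 * L + 4 * L ^+ 2 * s ^+ 2).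
    apply: le_trans (ler_normD _ _) _; rewrite normrN.
    have n1 : 0 <= 6 * l * y ^+ 2 by rewrite mulr_ge0 ?sqr_ge0// mulr_ge0// ltW.
    have n2 : 0 <= 4 * l ^+ 2 * b t ^+ 2 by rewrite mulr_ge0 ?sqr_ge0// mulr_ge0// sqr_ge0.
    rewrite (ger0_norm n1) (ger0_norm n2) mulrDr; apply: lerD.
      by rewrite mulrC ler_wpM2l ?sqr_ge0// ler_pM2l.
    have h2 : `|b t| ^+ 2 <= (y * s) ^+ 2 by rewrite lerXn2r ?nnegrE ?mulr_ge0.
    have h3 : l ^+ 2 <= L ^+ 2 by rewrite lerXn2r ?nnegrE// ltW.
    have -> : y ^+ 2 * (4 * L ^+ 2 * s ^+ 2) = 4 * L ^+ 2 * (y * s) ^+ 2 by ring.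
    rewrite -(real_normK (num_real (b t))).
    have h5 : 4 * l ^+ 2 <= 4 * L ^+ 2 by rewrite ler_pM2l.
    have h6 : 0 <= 4 * l ^+ 2 by rewrite mulr_ge0// sqr_ge0.
    by apply: ler_pM => //; exact: exprn_ge0.
  apply: le_trans (_ : (y * s) * (y ^+ 2 * (6 * L + 4 * L ^+ 2 * s ^+ 2)) * e t <= _).
    by rewrite ler_pM2r//; apply: ler_pM.
  have -> : y * s * (y ^+ 2 * (6 * L + 4 * L ^+ 2 * s ^+ 2)) * e t =
    (6 * L * (s * e t) + 4 * L ^+ 2 * (s ^+ 3 * e t)) * y ^+ 3 by ring.
  rewrite ler_wpM2r ?exprn_ge0// /C; apply: lerD.
    by rewrite ler_pM2l// mulr_gt0.
  by rewrite ler_pM2l// mulr_gt0// exprn_gt0.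
have C0 : 0 <= C * y ^+ 3 by apply: le_trans (f2b 0).
have H1 t : `|t| <= `|1 : R| -> `|f1 t - f1 0| <= C * y ^+ 3.
  move=> t1; apply: le_trans (@mvt_bound0 _ f1 f2 t (C * y ^+ 3) _ _) _ => //.
  by rewrite ler_piMr// -(normr1 R).
pose g t := f t - f1 0 * t.
have dg t : is_derive t 1 g (f1 t - f1 0).
  have h := is_deriveB (df t) (is_deriveZ (f1 0) (is_derive_id t 1)).
  by apply: (is_derive_eq h); rewrite /GRing.scale /=; ring.
have := @mvt_bound0 _ g (fun t => f1 t - f1 0) 1 (C * y ^+ 3) (fun t _ => dg t) H1.
rewrite normr1 mulr1; apply: le_trans; rewrite le_eqVlt; apply/orP; left; apply/eqP.
congr (`| _ |); rewrite /g /f /f1 /e /E /b.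
by rewrite !mulr0 !mulr1 !addr0 expr0n /= mulr0 addr0 expr1n !mulr1; ring.
Qed.

Lemma stein_lip (l0 L l x z y : R) : 0 < l0 -> l0 <= l <= L -> 0 <= x -> 0 <= z ->
  `|z - x| <= y ->
  `|expR (- (l * z ^+ 2)) - expR (- (l * x ^+ 2))| <= 2 * L * (1 + 1 / l0) * y /\
  `|z ^+ 2 * expR (- (l * z ^+ 2)) - x ^+ 2 * expR (- (l * x ^+ 2))| <=
    (2 * (1 + 1 / l0) + 2 * L * (1 / l0 + 4 / l0 ^+ 2)) * y.
Proof.
move=> l00 /andP[l0l lL] x0 z0 zxy.
have l0' : 0 < l by exact: lt_le_trans l0l.
have L0 : 0 < L by exact: lt_le_trans lL.
pose e s := expR (- (l * s ^+ 2)).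
have eE : e = E l 0 0 1.
  by apply/funext => s; rewrite /e /E; congr (expR (- (l * _))); ring.
have de s : is_derive s 1 e (- (2 * l * (s * e s))).
  by rewrite eE; apply: (is_derive_eq (is_derive_E _ _ _ _ _)); ring.
have d2 s : is_derive s 1 (fun s => s ^+ 2 * e s) (2 * (s * e s) - 2 * l * (s ^+ 3 * e s)).
  have h := is_derive_mul (is_derive_sqr (is_derive_id s 1)) (de s).
  by apply: (is_derive_eq h); ring.
have aux (f df : R -> R) (C : R) : 0 <= C -> (forall s, is_derive s 1 f (df s)) ->
    (forall s, 0 <= s -> `|df s| <= C) -> `|f z - f x| <= C * y.
  move=> C0 fdf dfC.
  have H u v : 0 <= u -> u <= v -> `|f v - f u| <= C * (v - u).
    move=> u0 uv; have [|c] := @MVT_segment _ f df u v uv (fun s _ => fdf s).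
      apply: derivable_within_continuous => s _; by have [] := fdf s.
    rewrite in_itv /= => /andP[uc _] ->; rewrite normrM (ger0_norm (_ : 0 <= v - u)) ?subr_ge0//.
    by rewrite ler_wpM2r ?subr_ge0// dfC// (le_trans u0).
  have [xz|zx] := leP x z.
    by apply: le_trans (H _ _ x0 xz) _; rewrite ler_wpM2l// -(ger0_norm (_ : 0 <= z - x)) ?subr_ge0.
  rewrite distrC; apply: le_trans (H _ _ z0 (ltW zx)) _; rewrite ler_wpM2l//.
  by rewrite -(ger0_norm (_ : 0 <= x - z)) ?subr_ge0 ?(ltW zx)// distrC.
have il0 : 0 <= 1 / l0 by rewrite divr_ge0// ltW.
have il2 : 0 <= 4 / l0 ^+ 2 by rewrite divr_ge0// sqr_ge0.
split.
  apply: (aux e _ _ _ de).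
    by rewrite mulr_ge0 ?addr_ge0// mulr_ge0// ltW.
  move=> s s0; have [_ _ g1 _] := gauss_bounds l00 l0l s0.
  rewrite normrN !normrM (ger0_norm s0) (ger0_norm (expR_ge0 _)) (ger0_norm (ltW l0')) normr_nat.
  by apply: ler_pM; rewrite ?mulr_ge0 ?expR_ge0 ?(ltW l0')// ler_pM2l.
apply: (aux (fun s => s ^+ 2 * e s) _ _ _ d2).
  by rewrite addr_ge0// mulr_ge0 ?addr_ge0// mulr_ge0// ltW.
move=> s s0; have [_ _ g1 g3] := gauss_bounds l00 l0l s0.
apply: le_trans (ler_normB _ _) _; apply: lerD.
  by rewrite normrM normr_nat ger0_norm ?ler_pM2l// mulr_ge0// expR_ge0.
rewrite normrM ger0_norm ?mulr_ge0 ?(ltW l0')// ger0_norm; last first.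
  by rewrite mulr_ge0 ?exprn_ge0// expR_ge0.
by apply: ler_pM; rewrite ?mulr_ge0 ?exprn_ge0 ?expR_ge0 ?(ltW l0')// ler_pM2l.
Qed.

End SteinTaylor.

Section RowVectors.
Variables (R : realType) (m : nat).
Implicit Types x y : 'rV[R]_m.

Definition dotp x y : R := \sum_j x 0 j * y 0 j.

Lemma fro_row x : fro x = \sum_j x 0 j ^+ 2.
Proof. by rewrite /fro big_ord1. Qed.

Lemma dotpp x : dotp x x = fro x.
Proof. by rewrite fro_row; apply: eq_bigr => j _; rewrite expr2. Qed.

Lemma dotpDr x y z : dotp x (y + z) = dotp x y + dotp x z.
Proof. by rewrite -big_split; apply: eq_bigr => j _; rewrite mxE mulrDr. Qed.

Lemma fro_rowD x y : fro (x + y) = fro x + 2 * dotp y x + fro y.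
Proof.
rewrite !fro_row mulr_sumr -!big_split /=; apply: eq_bigr => j _.
by rewrite mxE; ring.
Qed.

Lemma dotp_nf x y : `|dotp x y| <= nf x * nf y.
Proof.
rewrite -sqrtr_sqr /nf -sqrtrM ?fro_ge0// ler_wsqrtr// !fro_row.
exact: sum_cauchy_schwarz.
Qed.

Definition gs (l : R) x : R := expR (- (l * fro x)).

Lemma gs_le1 l x : 0 <= l -> gs l x <= 1.
Proof. by move=> l0; rewrite -expR0 ler_expR oppr_le0 mulr_ge0// fro_ge0. Qed.

Lemma fro_gs l x : 0 < l -> fro x * gs l x <= 1 / l.
Proof.
by move=> l0; have [h _ _ _] := gauss_bounds l0 (lexx l) (nf_ge0 x); rewrite sqr_nf in h.
Qed.

Lemma nf_gs l x : 0 < l -> nf x * gs l x <= 1 + 1 / l.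
Proof.
by move=> l0; have [_ _ h _] := gauss_bounds l0 (lexx l) (nf_ge0 x); rewrite sqr_nf in h.
Qed.

Lemma measurable_gs (d : measure_display) (T : measurableType d) (l : R)
    (x : T -> 'rV[R]_m) : (forall j, measurable_fun setT (fun w => x w 0 j)) ->
  measurable_fun setT (fun w => gs l (x w)).
Proof.
move=> mx; apply: measurableT_comp => //; apply: measurableT_comp => //.
apply: measurable_funM => //; under eq_fun do rewrite fro_row.
by apply: measurable_sum => j; apply: measurable_funX.
Qed.

Lemma measurable_fro (d : measure_display) (T : measurableType d)
    (x : T -> 'rV[R]_m) : (forall j, measurable_fun setT (fun w => x w 0 j)) ->
  measurable_fun setT (fun w => fro (x w)).
Proof.
move=> mx; under eq_fun do rewrite fro_row.
by apply: measurable_sum => j; apply: measurable_funX.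
Qed.

End RowVectors.

(* By [clt_range], [Gm] acts as the identity on the summands, so the Gaussian
   limit is standard on the range of [Gm]. *)
Record clt_array (d : measure_display) (T : measurableType d) (R : realType)
    (P : probability T R) (m n : nat) (xi : 'I_n -> T -> 'rV[R]_m)
    (Gm : 'M[R]_m) (M : R) : Prop := CltArray {
  clt_indep : forall i, exists G H : set_system T,
    [/\ G `<=` measurable, H `<=` measurable, indep_sys P <<s G>> <<s H>>,
        forall j, smeas G (fun w => xi i w 0 j) &
        forall k j, k != i -> smeas H (fun w => xi k w 0 j)];
  clt_sqr : forall i j, intg P (fun w => xi i w 0 j ^+ 2);
  clt_mean : forall i j, ex P (fun w => xi i w 0 j) = 0;
  clt_cov : forall i j k, ex P (fun w => xi i w 0 j * xi i w 0 k) = Gm j k;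
  clt_cube : forall i, intg P (fun w => nf (xi i w) ^+ 3) /\
    ex P (fun w => nf (xi i w) ^+ 3) <= M;
  clt_range : forall i w, xi i w *m Gm = xi i w }.

(** One summand of [stein_identity], with r = n^(-1/2): t is the expectation of the scalar product
    of r xi_i and S times the weight at S; u and v are the expectations of the weight and of squared
    length times weight for the sum without its i-th term, a and b the same for the full sum S. *)
Lemma stein_combine (R : realType) (t u v a b r D l L C1 C2 C3 M : R) :
  0 <= r -> 0 <= D -> 0 <= l -> l <= L ->
  `|t - (r ^+ 2 * D * u - 2 * l * (r ^+ 2 * v))| <= C1 * (r ^+ 3 * M) ->
  `|u - a| <= C2 * (r * (1 + M)) -> `|v - b| <= C3 * (r * (1 + M)) ->
  `|t - r ^+ 2 * (D * a - 2 * l * b)| <=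
    r ^+ 2 * (r * (C1 * M + (D * C2 + 2 * L * C3) * (1 + M))).
Proof.
move=> r0 D0 l0 lL ht hu hv.
have ha : `|r ^+ 2 * D * (u - a)| <= r ^+ 2 * D * (C2 * (r * (1 + M))).
  rewrite normrM (ger0_norm (_ : 0 <= r ^+ 2 * D)) ?mulr_ge0 ?sqr_ge0//.
  by rewrite ler_wpM2l// mulr_ge0 ?sqr_ge0.
have hb : `|r ^+ 2 * (2 * l) * (v - b)| <= r ^+ 2 * (2 * L) * (C3 * (r * (1 + M))).
  have rl : 0 <= r ^+ 2 * (2 * l) by rewrite mulr_ge0 ?sqr_ge0// mulr_ge0.
  rewrite normrM (ger0_norm rl).
  by apply: ler_pM => //; rewrite ler_wpM2l ?sqr_ge0// ler_wpM2l.
have -> : t - r ^+ 2 * (D * a - 2 * l * b) =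
  (t - (r ^+ 2 * D * u - 2 * l * (r ^+ 2 * v))) + r ^+ 2 * D * (u - a) -
  r ^+ 2 * (2 * l) * (v - b) by ring.
have -> : r ^+ 2 * (r * (C1 * M + (D * C2 + 2 * L * C3) * (1 + M))) =
   (C1 * (r ^+ 3 * M) + r ^+ 2 * D * (C2 * (r * (1 + M)))) +
   r ^+ 2 * (2 * L) * (C3 * (r * (1 + M))) by ring.
apply: le_trans (ler_normB _ _) _; apply: lerD => //.
by apply: le_trans (ler_normD _ _) _; exact: lerD.
Qed.

Section SteinStep.
Context (d : measure_display) (T : measurableType d) (R : realType).
Variables (P : probability T R) (m n : nat) (xi : 'I_n -> T -> 'rV[R]_m).
Variables (Gm : 'M[R]_m) (M l0 L : R).
Hypothesis n0 : (0 < n)%N.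
Hypothesis xiP : clt_array P xi Gm M.
Hypothesis l00 : 0 < l0.

Let r : R := (Num.sqrt n%:R)^-1.

Definition nsum (w : T) : 'rV[R]_m := r *: \sum_i xi i w.

Let S := nsum.

Let r0 : 0 < r.
Proof. by rewrite invr_gt0 sqrtr_gt0 ltr0n. Qed.

Let r2 : n%:R * r ^+ 2 = 1.
Proof. by rewrite /r exprVn sqr_sqrtr// divff// pnatr_eq0 -lt0n. Qed.

Lemma xi_meas i j : measurable_fun setT (fun w => xi i w 0 j).
Proof. by have [G [H [mG _ _ hG _]]] := clt_indep xiP i; exact: smeas_measurable (hG j). Qed.

Lemma xi_intg i j : intg P (fun w => xi i w 0 j).
Proof.
have := intgM (xi_meas i j) (@measurable_cst _ _ _ _ setT (1 : R)) (clt_sqr xiP i j) (intg_cst P (1 ^+ 2)).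
by under eq_fun do rewrite /= mulr1.
Qed.

Lemma nsum_meas j : measurable_fun setT (fun w => S w 0 j).
Proof.
under eq_fun do rewrite mxE summxE.
by apply: measurable_funM => //; apply: measurable_sum => i; exact: xi_meas.
Qed.

(** The leave-one-out sum, which depends only on the summands other than the i-th and is therefore
    independent of it. *)
Let x i w := S w - r *: xi i w.

Let x_range i w : x i w *m Gm = x i w.
Proof.
rewrite /x /S /nsum mulmxBl -!scalemxAl (clt_range xiP) mulmx_suml.
by congr (_ *: _ - _); apply: eq_bigr => k _; rewrite (clt_range xiP).
Qed.

Let xE i w j : x i w 0 j = r * \sum_(k | k != i) xi k w 0 j.
Proof.
rewrite /x /S /nsum !mxE summxE (bigD1 i)//= mulrDr addrC addrA addNr add0r.
by [].
Qed.

Let x_smeas G i j : (forall k j, k != i -> smeas G (fun w => xi k w 0 j)) ->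
  smeas G (fun w => x i w 0 j).
Proof.
move=> h; rewrite /smeas; under eq_fun do rewrite xE big_mkcond.
apply: measurable_funM => //; apply: measurable_sum => k.
by have [ki|ki] := boolP (k != i); [exact: h|exact: measurable_cst].
Qed.

Let x_meas i j : measurable_fun setT (fun w => x i w 0 j).
Proof.
have [G [H [_ mH _ _ hH]]] := clt_indep xiP i.
exact: (smeas_measurable mH (x_smeas _ hH)).
Qed.

Section OneStep.
Variables (l : R) (i : 'I_n).
Hypothesis lL : l0 <= l <= L.
Let lp : 0 < l. Proof. by case/andP: lL => h _; exact: lt_le_trans h. Qed.

(** Measurability of [v] composed with a vector is required over every measurable type, because it
    is used both over [T] and over the sigma-algebra generated by the other summands. *)
Let factor (u : T -> R) (v : 'rV[R]_m -> R) (c : R) :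
  (forall G, (forall j, smeas G (fun w => xi i w 0 j)) -> smeas G u) -> intg P u ->
  (forall (d' : measure_display) (T' : measurableType d') (z : T' -> 'rV[R]_m),
     (forall j, measurable_fun setT (fun w => z w 0 j)) ->
     measurable_fun setT (fun w => v (z w))) ->
  (forall z, `|v z| <= c) ->
  [/\ intg P (fun w => v (x i w)), intg P (fun w => u w * v (x i w)) &
    ex P (fun w => u w * v (x i w)) = ex P u * ex P (fun w => v (x i w))].
Proof.
move=> um ui vm vc; have [G [H [mG mH GH hG hH]]] := clt_indep xiP i.
have vi : intg P (fun w => v (x i w)).
  by apply: (@intg_bounded _ _ _ _ _ c) => //; apply: vm => j; exact: x_meas.
have vs : smeas H (fun w => v (x i w)).
  by apply: (vm _ (g_sigma_algebraType H) (x i)) => j; exact: x_smeas.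
by have [h1 h2] := ex_mul_smeas GH (um _ hG) vs ui vi.
Qed.

Let gs_v : forall (d' : measure_display) (T' : measurableType d') (z : T' -> 'rV[R]_m),
     (forall j, measurable_fun setT (fun w => z w 0 j)) ->
     measurable_fun setT (fun w => gs l (z w)).
Proof. by move=> d' T' z; exact: measurable_gs. Qed.

Let gs_abs (z : 'rV[R]_m) : `|gs l z| <= 1.
Proof. by rewrite ger0_norm ?expR_ge0// gs_le1// ltW. Qed.

Lemma ex_lin : intg P (fun w => dotp (r *: xi i w) (x i w) * gs l (x i w)) /\
  ex P (fun w => dotp (r *: xi i w) (x i w) * gs l (x i w)) = 0.
Proof.
have h j := @factor (fun w => r * xi i w 0 j) (fun z => z 0 j * gs l z) (1 + 1 / l).
have {}h j : intg P (fun w => (r * xi i w 0 j) * (x i w 0 j * gs l (x i w))) /\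
    ex P (fun w => (r * xi i w 0 j) * (x i w 0 j * gs l (x i w))) = 0.
  have [||||_ h1 ->] := h j; last by rewrite exZ ?(clt_mean xiP) ?mulr0 ?mul0r//; exact: xi_intg.
  - by move=> G hG; apply: measurable_funM => //; exact: hG.
  - by apply: intgZ; exact: xi_intg.
  - by move=> d' T' z mz; apply: measurable_funM; [exact: mz|exact: gs_v].
  - move=> z; rewrite normrM (ger0_norm (expR_ge0 _)).
    by apply: le_trans (nf_gs z lp); rewrite ler_wpM2r ?expR_ge0// nf_entry.
have E : (fun w => dotp (r *: xi i w) (x i w) * gs l (x i w)) =
    (fun w => \sum_j (r * xi i w 0 j) * (x i w 0 j * gs l (x i w))).
  by apply/funext => w; rewrite /dotp mulr_suml; apply: eq_bigr => j _; rewrite mxE mulrA.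
rewrite E; split; first by apply: intg_sum => j; case: (h j).
by rewrite ex_sum => [|j]; [rewrite big1// => j _; case: (h j)|case: (h j)].
Qed.

Lemma ex_quad : intg P (fun w => fro (r *: xi i w) * gs l (x i w)) /\
  ex P (fun w => fro (r *: xi i w) * gs l (x i w)) =
    r ^+ 2 * \tr Gm * ex P (fun w => gs l (x i w)).
Proof.
have h j : intg P (fun w => (r ^+ 2 * xi i w 0 j ^+ 2) * gs l (x i w)) /\
    ex P (fun w => (r ^+ 2 * xi i w 0 j ^+ 2) * gs l (x i w)) =
    r ^+ 2 * Gm j j * ex P (fun w => gs l (x i w)).
  have [||//|//|_ h1 ->] := @factor (fun w => r ^+ 2 * xi i w 0 j ^+ 2) (gs l) 1.
  - by move=> G hG; apply: measurable_funM => //; apply: measurable_funX; exact: hG.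
  - by apply: intgZ; exact: (clt_sqr xiP).
  - split=> //; rewrite exZ; last exact: (clt_sqr xiP).
    by rewrite -(clt_cov xiP i).
have E : (fun w => fro (r *: xi i w) * gs l (x i w)) =
    (fun w => \sum_j (r ^+ 2 * xi i w 0 j ^+ 2) * gs l (x i w)).
  by apply/funext => w; rewrite fro_row mulr_suml; apply: eq_bigr => j _; rewrite mxE exprMn.
rewrite E; split; first by apply: intg_sum => j; case: (h j).
rewrite ex_sum => [|j]; last by case: (h j).
by rewrite /mxtrace mulr_sumr mulr_suml; apply: eq_bigr => j _; case: (h j).
Qed.

Lemma ex_quad2 : intg P (fun w => dotp (r *: xi i w) (x i w) ^+ 2 * gs l (x i w)) /\
  ex P (fun w => dotp (r *: xi i w) (x i w) ^+ 2 * gs l (x i w)) =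
    r ^+ 2 * ex P (fun w => fro (x i w) * gs l (x i w)).
Proof.
have h j k : [/\ intg P (fun w => x i w 0 j * x i w 0 k * gs l (x i w)),
    intg P (fun w => (r ^+ 2 * (xi i w 0 j * xi i w 0 k)) * (x i w 0 j * x i w 0 k * gs l (x i w))) &
    ex P (fun w => (r ^+ 2 * (xi i w 0 j * xi i w 0 k)) * (x i w 0 j * x i w 0 k * gs l (x i w))) =
    r ^+ 2 * Gm j k * ex P (fun w => x i w 0 j * x i w 0 k * gs l (x i w))].
  have ii : intg P (fun w => xi i w 0 j * xi i w 0 k).
    by apply: intgM; [exact: xi_meas|exact: xi_meas|exact: (clt_sqr xiP)|exact: (clt_sqr xiP)].
  have [||||h0 h1 ->] := @factor (fun w => r ^+ 2 * (xi i w 0 j * xi i w 0 k))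
    (fun z => z 0 j * z 0 k * gs l z) (1 / l).
  - move=> G hG; apply: measurable_funM => //.
    by apply: measurable_funM; exact: hG.
  - exact: intgZ.
  - by move=> d' T' z mz; apply: measurable_funM; [apply: measurable_funM; exact: mz|exact: gs_v].
  - move=> z; rewrite !normrM (ger0_norm (expR_ge0 _)).
    apply: le_trans (fro_gs z lp); rewrite ler_wpM2r ?expR_ge0//.
    by rewrite -sqr_nf expr2; apply: ler_pM => //; exact: nf_entry.
  - by split=> //; rewrite exZ// (clt_cov xiP).
have E : (fun w => dotp (r *: xi i w) (x i w) ^+ 2 * gs l (x i w)) =
    (fun w => \sum_j \sum_k (r ^+ 2 * (xi i w 0 j * xi i w 0 k)) *
       (x i w 0 j * x i w 0 k * gs l (x i w))).
  apply/funext => w; rewrite /dotp expr2 mulr_suml mulr_suml; apply: eq_bigr => j _.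
  rewrite mulr_sumr mulr_suml; apply: eq_bigr => k _; rewrite !mxE.
  by ring.
rewrite E; split.
  by apply: intg_sum => j; apply: intg_sum => k; case: (h j k).
rewrite ex_sum => [|j]; last by apply: intg_sum => k; case: (h j k).
(* As [x i w *m Gm = x i w], the quadratic form of [Gm] at the leave-one-out sum is its squared
   length. This is what closes the equation. *)
have -> : (fun w => fro (x i w) * gs l (x i w)) =
    (fun w => \sum_j \sum_k Gm j k * (x i w 0 j * x i w 0 k * gs l (x i w))).
  apply/funext => w; rewrite fro_row mulr_suml exchange_big /=; apply: eq_bigr => k _.
  rewrite -{1}(x_range i w) expr2 {1}mxE !mulr_suml; apply: eq_bigr => j _.
  by rewrite x_range; ring.
rewrite ex_sum => [|j]; last first.
  by apply: intg_sum => k; apply: intgZ; case: (h j k).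
rewrite mulr_sumr; apply: eq_bigr => j _.
rewrite ex_sum => [|k]; last by case: (h j k).
rewrite ex_sum => [|k]; last by apply: intgZ; case: (h j k).
rewrite mulr_sumr; apply: eq_bigr => k _.
by rewrite exZ; case: (h j k) => // _ _ ->; rewrite mulrA.
Qed.

End OneStep.

Lemma dotp_suml (F : 'I_n -> 'rV[R]_m) y : dotp (\sum_i F i) y = \sum_i dotp (F i) y.
Proof.
rewrite /dotp exchange_big; apply: eq_bigr => j _.
by rewrite summxE mulr_suml.
Qed.

Lemma nsum_sumE w : S w = \sum_i r *: xi i w.
Proof. by rewrite /S /nsum scaler_sumr. Qed.

Lemma measurable_dotp (u v : T -> 'rV[R]_m) :
  (forall j, measurable_fun setT (fun w => u w 0 j)) ->
  (forall j, measurable_fun setT (fun w => v w 0 j)) ->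
  measurable_fun setT (fun w => dotp (u w) (v w)).
Proof. by move=> mu mv; apply: measurable_sum => j; exact: measurable_funM. Qed.

Lemma y_meas i j : measurable_fun setT (fun w => (r *: xi i w) 0 j).
Proof.
by under eq_fun do rewrite mxE; apply: measurable_funM => //; exact: xi_meas.
Qed.

Lemma ex_fro_nsum : intg P (fun w => fro (S w)) /\ ex P (fun w => fro (S w)) = \tr Gm.
Proof.
have hh i k j : intg P (fun w => xi i w 0 j * xi k w 0 j) /\
    ex P (fun w => xi i w 0 j * xi k w 0 j) = if i == k then Gm j j else 0.
  have ii : intg P (fun w => xi i w 0 j * xi k w 0 j).
    by apply: intgM; [exact: xi_meas|exact: xi_meas|exact: (clt_sqr xiP)|exact: (clt_sqr xiP)].
  split=> //; case: eqVneq => [<-|ik]; first exact: (clt_cov xiP).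
  have [G [H [_ _ GH hG hH]]] := clt_indep xiP i.
  rewrite eq_sym in ik.
  have [_ ->] := ex_mul_smeas GH (hG j) (hH k j ik) (xi_intg i j) (xi_intg k j).
  by rewrite (clt_mean xiP) mul0r.
have E : (fun w => fro (S w)) =
    (fun w => \sum_j \sum_i \sum_k r ^+ 2 * (xi i w 0 j * xi k w 0 j)).
  apply/funext => w; rewrite fro_row; apply: eq_bigr => j _.
  rewrite /S /nsum mxE summxE exprMn expr2 [X in _ * X]expr2 mulr_suml mulr_sumr.
  by apply: eq_bigr => i _; rewrite mulr_sumr mulr_sumr.
have i3 j i k : intg P (fun w => r ^+ 2 * (xi i w 0 j * xi k w 0 j)).
  by apply: intgZ; case: (hh i k j).
have i2 j i : intg P (fun w => \sum_k r ^+ 2 * (xi i w 0 j * xi k w 0 j)).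
  exact: intg_sum.
have i1 j : intg P (fun w => \sum_i \sum_k r ^+ 2 * (xi i w 0 j * xi k w 0 j)).
  exact: intg_sum.
rewrite E; split; first exact: intg_sum.
rewrite ex_sum// /mxtrace; apply: eq_bigr => j _; rewrite ex_sum//.
rewrite (eq_bigr (fun=> r ^+ 2 * Gm j j)) => [|i _].
  by rewrite sumr_const card_ord -mulr_natl mulrA r2 mul1r.
rewrite ex_sum// (bigD1 i)//= big1 ?addr0 => [|k ki].
  by have [h1 h2] := hh i i j; rewrite exZ// h2 eqxx.
by have [h1 h2] := hh i k j; rewrite exZ// h2 eq_sym (negbTE ki) mulr0.
Qed.

Definition stein_cst : R :=
  (6 * L * (1 + 1 / l0) + 4 * L ^+ 2 * (1 / l0 + 4 / l0 ^+ 2)) * M +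
  (\tr Gm * (2 * L * (1 + 1 / l0)) +
   2 * L * (2 * (1 + 1 / l0) + 2 * L * (1 / l0 + 4 / l0 ^+ 2))) * (1 + M).

Lemma gs_nsum_intg l : 0 < l -> intg P (fun w => gs l (S w)) /\
  intg P (fun w => fro (S w) * gs l (S w)).
Proof.
move=> lp; split.
  apply: (@intg_bounded _ _ _ _ _ 1); first exact: (measurable_gs l nsum_meas).
  by move=> w; rewrite ger0_norm ?expR_ge0// gs_le1// ltW.
apply: (@intg_bounded _ _ _ _ _ (1 / l)).
  apply: measurable_funM; [exact: (measurable_fro nsum_meas)|exact: (measurable_gs l nsum_meas)].
by move=> w; rewrite ger0_norm ?fro_gs// mulr_ge0 ?fro_ge0 ?expR_ge0.
Qed.

(** For a Gaussian vector this is an equality, obtained by integration by parts. Here |S|^2 is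
    written as the sum of the scalar products of r xi_i and S, and each term is expanded about the
    leave-one-out sum: the linear term vanishes by independence and centring, and the quadratic ones
    produce the trace and the term 2 l E (|S|^2 weight). *)
Lemma stein_identity l : l0 <= l <= L -> 0 <= \tr Gm ->
  `|(1 + 2 * l) * ex P (fun w => fro (S w) * gs l (S w)) -
    \tr Gm * ex P (fun w => gs l (S w))| <= stein_cst * r.
Proof.
move=> lL D0; set D := \tr Gm; rewrite /stein_cst -/D.
set C1 := 6 * L * _ + _; set C2 := 2 * L * (1 + 1 / l0); set C3 := 2 * (1 + _) + _.
have lp : 0 < l by case/andP: lL => h _; exact: lt_le_trans h.
have Lp : 0 < L by case/andP: lL => _; exact: lt_le_trans.
have [ia ib] := gs_nsum_intg lp.
set a := ex P (fun w => gs l (S w)); set b := ex P (fun w => fro (S w) * gs l (S w)).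
have il0 : 0 <= 1 / l0 by rewrite divr_ge0// ltW.
have il2 : 0 <= 4 / l0 ^+ 2 by rewrite divr_ge0// sqr_ge0.
have C10 : 0 <= C1 by rewrite addr_ge0 ?mulr_ge0 ?addr_ge0 ?sqr_ge0// ltW.
have C20 : 0 <= C2 by rewrite mulr_ge0 ?addr_ge0// mulr_ge0// ltW.
have C30 : 0 <= C3 by rewrite addr_ge0 ?mulr_ge0 ?addr_ge0// ltW.
pose t i w := dotp (r *: xi i w) (S w) * gs l (S w).
pose q i w := dotp (r *: xi i w) (x i w) * gs l (x i w) + fro (r *: xi i w) * gs l (x i w)
   - (2 * l) * (dotp (r *: xi i w) (x i w) ^+ 2 * gs l (x i w)).
have Sx i w : S w = x i w + r *: xi i w by rewrite /x subrK.
have nfy i w : nf (r *: xi i w) = r * nf (xi i w) by rewrite nfZ gtr0_norm.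
have tq i w : `|t i w - q i w| <= C1 * (r ^+ 3 * nf (xi i w) ^+ 3).
  have hd : `|dotp (r *: xi i w) (x i w)| <= nf (x i w) * nf (r *: xi i w).
    by rewrite mulrC dotp_nf.
  have := stein_taylor l00 lL (nf_ge0 (x i w)) (nf_ge0 (r *: xi i w)) hd.
  rewrite !sqr_nf nfy exprMn; apply: le_trans.
  rewrite le_eqVlt; apply/orP; left; apply/eqP; congr (`| _ |).
  by rewrite /t /q (Sx i w) /gs fro_rowD dotpDr dotpp; ring.
have [qi exq] : (forall i, intg P (q i)) /\ (forall i, ex P (q i) =
    r ^+ 2 * D * ex P (fun w => gs l (x i w)) -
    (2 * l) * (r ^+ 2 * ex P (fun w => fro (x i w) * gs l (x i w)))).
  have hq i := conj (ex_lin i lL) (conj (ex_quad i lL) (ex_quad2 i lL)).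
  split=> i; have [[h1 e1] [[h2 e2] [h3 e3]]] := hq i.
    by apply: intgB; [exact: intgD|exact: intgZ].
  by rewrite exB ?exD ?exZ ?e1 ?e2 ?e3 ?add0r//; [exact: intgD|exact: intgZ].
have mt i : measurable_fun setT (t i).
  apply: measurable_funM; last exact: (measurable_gs l nsum_meas).
  by apply: measurable_dotp; [exact: y_meas|exact: nsum_meas].
have ni i := (clt_cube xiP i).1; have nM i := (clt_cube xiP i).2.
have bi i : intg P (fun w => C1 * (r ^+ 3 * nf (xi i w) ^+ 3)).
  by apply: intgZ; exact: intgZ.
have tqi i : intg P (fun w => t i w - q i w).
  apply: (le_intg _ (tq i) (bi i)); apply: measurable_funB => //.
  exact: intg_meas (qi i).
have ti i : intg P (t i).
  have := intgD (tqi i) (qi i); by under eq_fun do rewrite subrK.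
have etq i : `|ex P (t i) - ex P (q i)| <= C1 * (r ^+ 3 * M).
  rewrite -exB//; apply: le_trans (ex_le_abs (tqi i) (bi i) (tq i)) _.
  rewrite !exZ//; last exact: intgZ.
  by rewrite ler_wpM2l// ler_wpM2l// exprn_ge0// ltW.
have bE : b = \sum_i ex P (t i).
  rewrite -ex_sum//; congr (ex P _); apply/funext => w.
  by rewrite /t -mulr_suml -dotp_suml -nsum_sumE dotpp.
have nlip i w : nf (r *: xi i w) <= r * (1 + nf (xi i w) ^+ 3).
  rewrite nfy ler_pM2l//; have n_ge := nf_ge0 (xi i w).
  have [h|h] := leP (nf (xi i w)) 1; first by rewrite -[leLHS]addr0 lerD// exprn_ge0.
  by rewrite -[leLHS]add0r lerD// ler_eXnr// ltW.
have lip i w : `|gs l (x i w) - gs l (S w)| <= C2 * (r * (1 + nf (xi i w) ^+ 3)) /\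
    `|fro (x i w) * gs l (x i w) - fro (S w) * gs l (S w)| <=
      C3 * (r * (1 + nf (xi i w) ^+ 3)).
  have hz : `|nf (x i w) - nf (S w)| <= nf (r *: xi i w).
    by apply: le_trans (nf_sub _ _) _; rewrite /x addrAC subrr add0r nfN.
  have [h1 h2] := stein_lip l00 lL (nf_ge0 (S w)) (nf_ge0 (x i w)) hz.
  rewrite !sqr_nf in h1 h2; split.
    by apply: le_trans h1 _; rewrite ler_wpM2l.
  by apply: le_trans h2 _; rewrite ler_wpM2l.
have ix i : intg P (fun w => gs l (x i w)).
  apply: (@intg_bounded _ _ _ _ _ 1); first by apply: measurable_gs => j; exact: x_meas.
  by move=> w; rewrite ger0_norm ?expR_ge0// gs_le1// ltW.
have ifx i : intg P (fun w => fro (x i w) * gs l (x i w)).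
  apply: (@intg_bounded _ _ _ _ _ (1 / l)).
    by apply: measurable_funM; [apply: measurable_fro|apply: measurable_gs] => j; exact: x_meas.
  by move=> w; rewrite ger0_norm ?fro_gs// mulr_ge0 ?fro_ge0 ?expR_ge0.
have i1 i : intg P (fun w => r * (1 + nf (xi i w) ^+ 3)).
  by apply: intgZ; apply: intgD => //; exact: intg_cst.
have e1 i : ex P (fun w => r * (1 + nf (xi i w) ^+ 3)) <= r * (1 + M).
  rewrite exZ; last by apply: intgD => //; exact: intg_cst.
  by rewrite ler_pM2l// exD ?ex_cst ?lerD2l//; exact: intg_cst.
have ea i : `|ex P (fun w => gs l (x i w)) - a| <= C2 * (r * (1 + M)).
  rewrite -exB//; apply: le_trans (ex_le_abs (intgB (ix i) ia) (intgZ C2 (i1 i)) _) _.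
    by move=> w; case: (lip i w).
  by rewrite exZ// ler_wpM2l.
have eb i : `|ex P (fun w => fro (x i w) * gs l (x i w)) - b| <= C3 * (r * (1 + M)).
  rewrite -exB//; apply: le_trans (ex_le_abs (intgB (ifx i) ib) (intgZ C3 (i1 i)) _) _.
    by move=> w; case: (lip i w).
  by rewrite exZ// ler_wpM2l.
have main i : `|ex P (t i) - r ^+ 2 * (D * a - 2 * l * b)| <=
    r ^+ 2 * (r * (C1 * M + (D * C2 + 2 * L * C3) * (1 + M))).
  have /andP[_ lL'] := lL; have := etq i; rewrite exq => h.
  exact: (stein_combine (ltW r0) D0 (ltW lp) lL' h (ea i) (eb i)).
have -> : (1 + 2 * l) * b - D * a = \sum_i (ex P (t i) - r ^+ 2 * (D * a - 2 * l * b)).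
  rewrite sumrB -bE sumr_const card_ord -[_ *+ n]mulr_natl mulrA r2 mul1r.
  by ring.
apply: le_trans (ler_norm_sum _ _ _) _.
apply: le_trans (ler_sum _ (fun i _ => main i)) _.
rewrite sumr_const card_ord -[_ *+ n]mulr_natl [n%:R * _]mulrA r2 mul1r mulrC.
by rewrite lexx.
Qed.

End SteinStep.

(** * The differential equation for the Laplace transform *)

Section LaplaceLimit.
Context (d : measure_display) (T : measurableType d) (R : realType).
Variables (P : probability T R).

(** Differentiation under the integral: for parameters above l / 2, the integrand |S|^2 exp (- x
    |S|^2) is bounded by the constant 2 / l. *)
Lemma derive_laplace m (S : T -> 'rV[R]_m) (l : R) :
  (forall j, measurable_fun setT (fun w => S w 0 j)) -> 0 < l ->
  is_derive l 1 (fun l => ex P (fun w => gs l (S w)))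
    (- ex P (fun w => fro (S w) * gs l (S w))).
Proof.
move=> mS l0.
pose f (l : R) (w : T) := gs l (S w).
have df (x : R) w : is_derive x 1 (f ^~ w) (- (fro (S w) * gs x (S w))).
  have h : is_derive x 1 (fun x : R => - (x * fro (S w))) (- fro (S w)).
    have h1 := is_deriveN (is_derive_affine 0 (fro (S w)) (is_derive_id x 1)).
    have -> : (fun x : R => - (x * fro (S w))) = (fun x => - (0 + fro (S w) * x)).
      by apply/funext => z; rewrite add0r mulrC.
    by apply: (is_derive_eq h1); rewrite mulr1.
  have h2 := is_derive1_comp (f := @expR R) (g := fun x : R => - (x * fro (S w)))
    (is_derive_expR _) h.
  by apply: (is_derive_eq h2); rewrite /gs; ring.
have p1 (x : R) w : partial1of2 f x w = - (fro (S w) * gs x (S w)).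
  by rewrite partial1of2E ?derive1E; apply: derive_val.
have Il : `]l / 2, l + 1[%classic l by rewrite /= in_itv /=; lra.
have intf (x : R) : `]l / 2, l + 1[%classic x -> P.-integrable setT (EFin \o f x).
  rewrite /= in_itv /= => /andP[x0 _].
  apply: (@intg_bounded _ _ _ _ _ 1); first exact: measurable_gs.
  by move=> w; rewrite ger0_norm ?expR_ge0// gs_le1//; lra.
have dd (x : R) w : `]l / 2, l + 1[%classic x -> [set: T] w -> derivable (f ^~ w) x 1.
  by move=> _ _; have [] := df x w.
have G0 (w : T) : 0 <= 2 / l by rewrite divr_ge0// ltW.
have iG : P.-integrable setT (EFin \o (fun _ : T => 2 / l)) by exact: intg_cst.
have Gub (x : R) w : `]l / 2, l + 1[%classic x -> [set: T] w -> `|partial1of2 f x w| <= 2 / l.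
  rewrite /= in_itv /= => /andP[x0 _] _; rewrite p1 normrN ger0_norm; last first.
    by rewrite mulr_ge0 ?fro_ge0 ?expR_ge0.
  have x00 : 0 < x by clear -x0 l0; lra.
  apply: le_trans (fro_gs (S w) x00) _.
  rewrite div1r -[leRHS]invrK invf_div lef_pV2 ?posrE ?divr_gt0//; clear -x0; lra.
have D1 := derivable_under_integral measurableT Il intf dd G0 iG Gub.
have D2 := differentiation_under_integral measurableT Il intf dd G0 iG Gub.
split; first exact: D1.
rewrite -derive1E D2 /ex -[RHS]mulN1r -RintegralZl//.
- by apply: eq_Rintegral => w _; rewrite p1 mulN1r.
- apply: (@intg_bounded _ _ _ _ _ (1 / l)).
    by apply: measurable_funM; [exact: measurable_fro|exact: measurable_gs].
  by move=> w; rewrite ger0_norm ?fro_gs// mulr_ge0 ?fro_ge0 ?expR_ge0.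
Qed.

(** The function (1 + 2 l)^(- D / 2), which for D a positive integer is the Laplace transform of the
    chi-squared law at [l]. *)
Definition chi2_mgf (D l : R) : R := expR (- (D / 2 * ln (1 + 2 * l))).

(* [E exp(- l |S|^2)] almost solves [(1 + 2 l) g' = - \tr Gm * g] with [g 0 = 1]. *)
Lemma laplace_limit m (Gm : 'M[R]_m) (M l e : R) :
  0 <= \tr Gm -> 0 < l -> 0 < e -> exists N : nat, forall n (xi : 'I_n -> T -> 'rV[R]_m),
    (N <= n)%N -> clt_array P xi Gm M ->
    `|ex P (fun w => gs l (nsum xi w)) - chi2_mgf (\tr Gm) l| <= e.
Proof.
move=> D0 l0 e0; set D := \tr Gm.
(* The integrating factor: K times the Laplace transform has derivative of order n^(-1/2). *)
pose K (l : R) := expR (D / 2 * ln (1 + 2 * l)).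
have KE : chi2_mgf D l = (K l)^-1 by rewrite /chi2_mgf /K expRN.
have K1 x : 0 <= x -> 1 <= K x.
  move=> x0; rewrite -expR0 ler_expR mulr_ge0 ?divr_ge0// ln_ge0//; lra.
have Kmono x y : 0 <= x -> x <= y -> K x <= K y.
  move=> x0 xy; rewrite ler_expR ler_wpM2l ?divr_ge0// ler_ln ?posrE; lra.
have Kup x : 0 <= x -> D * x <= 1 / 2 -> K x <= 1 + 2 * (D * x).
  move=> x0 Dx; apply: le_trans (_ : expR (D * x) <= _).
    rewrite ler_expR -mulrA ler_wpM2l//.
    by have := le_ln1Dx (_ : -1 < 2 * x) => /(_ _); lra.
  have Dx0 : 0 <= D * x by rewrite mulr_ge0.
  have := expR_ge1Dx (- (D * x)); rewrite expRN => h.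
  have h2 : expR (D * x) * (1 - D * x) <= 1.
    by rewrite -ler_pdivlMl ?expR_gt0// mulr1.
  have h3 : (1 + 2 * (D * x)) * (1 - D * x) >= 1.
    have : (D * x) * (D * x) <= (D * x) * (1 / 2) by rewrite ler_wpM2l.
    lra.
  by rewrite -(@ler_pM2r _ (1 - D * x)); lra.
(* The constant of [stein_identity] blows up at 0, so the equation is integrated from a small a > 0
   only. There the value lies between 1 - a D and 1, since E |S|^2 = D. *)
pose a := Num.min l (Num.min (1 / (2 * (D + 1))) (e / (8 * (D + 1)))).
have a0 : 0 < a by rewrite !lt_min l0 /=; apply/andP; split; apply: divr_gt0 => //; lra.
have al : a <= l by rewrite ge_min lexx.
have Da : D * a <= 1 / 2.
  apply: le_trans (_ : D * (1 / (2 * (D + 1))) <= _).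
    by rewrite ler_wpM2l// !ge_min lexx orbT.
  by rewrite mulrA ler_pdivrMr; lra.
have Dae : D * a <= e / 8.
  apply: le_trans (_ : D * (e / (8 * (D + 1))) <= _).
    by rewrite ler_wpM2l// !ge_min lexx !orbT.
  rewrite mulrA ler_pdivrMr; last lra.
  have -> : e / 8 * (8 * (D + 1)) = D * e + e by field.
  by lra.
pose C := K l * `|stein_cst Gm M a l| * l.
have C0 : 0 <= C by rewrite !mulr_ge0// ?expR_ge0// ltW.
exists (Num.truncn ((2 * C / e) ^+ 2)).+1 => n xi Nn xiP.
have n0 : (0 < n)%N by exact: leq_trans Nn.
pose r : R := (Num.sqrt n%:R)^-1.
have r0 : 0 < r by rewrite invr_gt0 sqrtr_gt0 ltr0n.
have Cr : C * r <= e / 2.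
  rewrite ler_pdivrMr ?sqrtr_gt0 ?ltr0n// -ler_pdivrMl ?divr_gt0//.
  have -> : (e / 2)^-1 * C = 2 * C / e by field; rewrite gt_eqF.
  have h0 : 0 <= 2 * C / e by apply: divr_ge0; [exact: mulr_ge0|exact: ltW].
  rewrite -(ger0_norm h0).
  rewrite -sqrtr_sqr ler_wsqrtr// ltW//.
  apply: lt_le_trans (_ : (Num.truncn ((2 * C / e) ^+ 2)).+1%:R <= _).
    exact: truncnS_gt.
  by rewrite ler_nat.
pose F x := ex P (fun w => gs x (nsum xi w)).
pose G x := ex P (fun w => fro (nsum xi w) * gs x (nsum xi w)).
have mS := nsum_meas xiP.
have dF (x : R) : 0 < x -> is_derive x 1 F (- G x).
  by move=> x0; exact: derive_laplace.
have dK (x : R) : 0 < x -> is_derive x 1 K (K x * (D / (1 + 2 * x))).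
  move=> x0; have h1 : is_derive x 1 (fun z : R => 1 + 2 * z) (2 * 1).
    exact: is_derive_affine.
  have h2 : is_derive x 1 (fun z : R => ln (1 + 2 * z)) ((1 + 2 * x)^-1 * (2 * 1)).
    apply: (is_derive1_comp (f := @ln R) (g := fun z => 1 + 2 * z)) => //.
    apply: is_derive1_ln; lra.
  have h3 : is_derive x 1 (fun z : R => D / 2 * ln (1 + 2 * z)) (D / (1 + 2 * x)).
    have := is_derive_affine 0 (D / 2) h2.
    under [X in is_derive _ _ X _]eq_fun do rewrite add0r.
    by move=> h; apply: (is_derive_eq h); field; lra.
  exact: (is_derive1_comp (f := @expR R) (g := fun z => D / 2 * ln (1 + 2 * z))
    (is_derive_expR _) h3).
pose H x := K x * F x.
have dH (x : R) : 0 < x -> is_derive x 1 H (K x * - G x + F x * (K x * (D / (1 + 2 * x)))).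
  by move=> x0; exact: is_derive_mul (dK _ x0) (dF _ x0).
have dHb (x : R) : a <= x <= l -> `|K x * - G x + F x * (K x * (D / (1 + 2 * x)))| <=
    K l * `|stein_cst Gm M a l| * r.
  move=> axl; have x0 : 0 < x by case/andP: axl => h _; exact: lt_le_trans h.
  have := stein_identity n0 xiP a0 axl D0; rewrite -/r -/D -/(F x) -/(G x) => h.
  have -> : K x * - G x + F x * (K x * (D / (1 + 2 * x))) =
    - (K x * (1 + 2 * x)^-1 * ((1 + 2 * x) * G x - D * F x)) by field; lra.
  rewrite normrN normrM -mulrA; apply: ler_pM => //.
    rewrite ger0_norm; last by rewrite mulr_ge0 ?expR_ge0 ?invr_ge0//; lra.
    apply: le_trans (_ : K x * 1 <= _).
      rewrite ler_wpM2l ?expR_ge0// invf_le1; lra.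
    by rewrite mulr1; apply: Kmono; [exact: ltW|case/andP: axl].
  apply: le_trans h _; rewrite ler_wpM2r ?(ltW r0)//; exact: ler_norm.
have HH : `|H l - H a| <= e / 2.
  have [||c] := @MVT_segment _ H (fun x => K x * - G x + F x * (K x * (D / (1 + 2 * x)))) a l al.
  - move=> x; rewrite in_itv /= => /andP[ax _]; apply: dH; exact: lt_trans ax.
  - apply: derivable_within_continuous => x; rewrite in_itv /= => /andP[ax _].
    by have [] := dH x (lt_le_trans a0 ax).
  - rewrite in_itv /= => acl ->; rewrite normrM.
    apply: le_trans Cr.
    have -> : C * r = K l * `|stein_cst Gm M a l| * r * l by rewrite /C; ring.
    apply: ler_pM => //; first exact: dHb.
    by rewrite ger0_norm ?subr_ge0//; lra.
have [fi fE] := ex_fro_nsum n0 xiP.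
have Fa : 1 - a * D <= F a <= 1.
  have [ig _] := gs_nsum_intg xiP a0.
  apply/andP; split.
    have i1 : intg P (fun w => 1 - a * fro (nsum xi w)).
      by apply: intgB; [exact: intg_cst|exact: intgZ].
    have := le_ex i1 ig; rewrite exB ?exZ ?ex_cst ?fE//; [|exact: intg_cst|exact: intgZ].
    apply => w; exact: expR_ge1Dx.
  have := le_ex ig (intg_cst P 1); rewrite ex_cst; apply => w.
  by apply: gs_le1; exact: ltW.
have Ha : `|H a - 1| <= e / 2.
  have k1 := K1 a (ltW a0); have k2 := Kup a (ltW a0) Da.
  have Da0 : 0 <= D * a by rewrite mulr_ge0// ltW.
  have k3 : K a * F a <= K a * 1 by rewrite ler_wpM2l ?expR_ge0//; case/andP: Fa.
  have k4 : K a * (1 - a * D) <= K a * F a by rewrite ler_wpM2l ?expR_ge0//; case/andP: Fa.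
  have k5 : K a * (a * D) <= 2 * (a * D).
    by rewrite ler_wpM2r//; [rewrite mulrC|lra].
  by rewrite ler_norml /H; apply/andP; split; lra.
have Kl1 := K1 l (ltW l0).
have -> : ex P (fun w => gs l (nsum xi w)) - chi2_mgf D l = (K l)^-1 * (H l - 1).
  by rewrite KE /H -/(F l); field; rewrite gt_eqF// expR_gt0.
rewrite normrM; apply: le_trans (_ : 1 * `|H l - 1| <= _).
  by rewrite ler_wpM2r// ger0_norm ?invr_ge0 ?expR_ge0// invf_le1// expR_gt0.
rewrite mul1r (_ : H l - 1 = (H l - H a) + (H a - 1)); last by rewrite addrA subrK.
by apply: le_trans (ler_normD _ _) _; lra.
Qed.

End LaplaceLimit.

(** * Increments of smooth and continuous paths *)

Section UniformOnSegment.
Context (R : realType).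
Implicit Types (f D b N : R -> R) (T e : R).

Lemma segment_unif f T e : {within `[0, T], continuous f} -> 0 < e ->
  exists2 d, 0 < d & forall s t, 0 <= s <= T -> 0 <= t <= T -> `|t - s| <= d -> `|f t - f s| <= e.
Proof.
move=> cf e0.
have e2 : 0 < e / 2 by rewrite divr_gt0.
have cov := (compact_near_coveringP _).1 (@segment_compact R 0 T).
pose P (d s : R) := 0 <= s <= T ->
  forall t, 0 <= t <= T -> `|t - s| <= d -> `|f t - f s| <= e.
have h : \forall d \near (0 : R)^'+, `[0, T]%classic `<=` P d.
  apply: cov.
  move=> x xT.
  have /subspace_continuousP/(_ x xT)/cvgrPdist_le/(_ _ e2) := cf.
  rewrite /prop_near1 /within /= => /nbhs_ballP[r /= r0 hr].
  have r2 : 0 < r / 2 by rewrite divr_gt0.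
  exists (ball x (r / 2), [set d | d < r / 2]); first split => /=.
  - exact: nbhsx_ballx.
  - exact: nbhs_right_lt.
  move=> [s d] /= [xs dr] sT t tT td.
  have hs : `|f x - f s| <= e / 2.
    apply: hr; last by rewrite /= in_itv.
    by rewrite /ball /= in xs *; apply: lt_trans xs _; lra.
  have ht : `|f x - f t| <= e / 2.
    apply: hr; last by rewrite /= in_itv.
    rewrite /ball /= in xs *.
    rewrite (_ : x - t = (x - s) - (t - s)); last by ring.
    by apply: le_lt_trans (ler_normB _ _) _; lra.
  rewrite (_ : f t - f s = (f x - f s) - (f x - f t)); last by ring.
  by apply: le_trans (ler_normB _ _) _; lra.
near (0 : R)^'+ => d.
have d0 : 0 < d by [].
have hd : `[0, T]%classic `<=` P d by near: d.
by exists d => // s t sT; apply: hd => //; rewrite /= in_itv.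
Unshelve. all: by end_near. Qed.

Lemma segment_bounded f T : {within `[0, T], continuous f} ->
  exists2 B, 0 < B & forall s, 0 <= s <= T -> `|f s| <= B.
Proof.
move=> cf.
have /compact_bounded/pinfty_ex_gt0[B B0 hB] := continuous_compact cf (@segment_compact R 0 T).
by exists B => // s sT; apply: hB; exists s => //; rewrite /= in_itv.
Qed.

(** A C^1 function on the closed segment, encoded by a first order expansion uniform in the base
    point. It avoids one-sided derivatives at the ends and is stable under linear combinations. *)
Definition uniform_C1 T D b := {within `[0, T], continuous b} /\
  forall e, 0 < e -> exists2 d, 0 < d & forall s t, 0 <= s -> s <= t -> t <= T ->
    t - s <= d -> `|D t - D s - (t - s) * b s| <= e * (t - s).

Lemma uniform_C1_int T D b : {within `[0, T], continuous b} ->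
  (forall t, 0 <= t <= T -> D t = D 0 + \int[lebesgue_measure]_(s in `[0, t]) b s) ->
  uniform_C1 T D b.
Proof.
move=> cb Db; split=> // e e0; have [d d0 hd] := segment_unif cb e0.
exists d => // s t s0 st tT td.
have bi : lebesgue_measure.-integrable `[0, T] (EFin \o b).
  by apply: continuous_compact_integrable => //; exact: segment_compact.
have bit : lebesgue_measure.-integrable `[0, t] (EFin \o b).
  apply: integrableS bi => //; apply: subset_itvl; rewrite bnd_simp//.
have sT : 0 <= s <= T by rewrite s0 (le_trans st).
have tT' : 0 <= t <= T by rewrite tT (le_trans s0).
have bist : lebesgue_measure.-integrable `]s, t] (EFin \o b).
  apply: integrableS bit => //; apply: subset_itvr; rewrite bnd_simp//.
have cint r : lebesgue_measure.-integrable `]s, t] (EFin \o (fun=> r : R)).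
  have : lebesgue_measure.-integrable `[0, T] (EFin \o (fun=> r : R)).
    apply: continuous_compact_integrable; first exact: segment_compact.
    by apply: continuous_subspaceT => x; exact: cvg_cst.
  apply: integrableS => //; apply: subset_itv; rewrite bnd_simp//.
have mst : fine (lebesgue_measure (`]s, t]%classic : set R)) = t - s.
  rewrite lebesgue_measure_itv/= lte_fin; have [//|ts] := ltP s t.
  by rewrite (@le_anti _ _ s t) ?st// subrr.
have bs : \int[lebesgue_measure]_(u in `]s, t]) (b u - b s) = D t - D s - (t - s) * b s.
  rewrite RintegralB// Rintegral_cst//= mst -(@Rintegral_itvB R b (BLeft 0) (BRight t) s)//.
  by rewrite (Db t tT') (Db s sT); ring.
have int1 : lebesgue_measure.-integrable `]s, t] (EFin \o (fun u => b u - b s)).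
  by have := @integrableB _ _ _ lebesgue_measure _ (measurable_itv `]s, t]) _ _ bist (cint (b s)).
rewrite -bs; apply: le_trans (le_normr_Rintegral _ int1) _ => //.
rewrite -mst -(Rintegral_cst lebesgue_measure (measurable_itv _)).
apply: le_Rintegral => //; first by have := integrable_norm int1.
move=> u; rewrite /= in_itv/= => /andP[su ut].
apply: hd => //; first by rewrite (le_trans s0 (ltW su)) (le_trans ut).
by rewrite ger0_norm ?subr_ge0 ?(ltW su)//; apply: le_trans td; rewrite lerD2r.
Qed.

Lemma uniform_C1D T D b D' b' : uniform_C1 T D b -> uniform_C1 T D' b' ->
  uniform_C1 T (fun t => D t + D' t) (fun t => b t + b' t).
Proof.
move=> [cb hb] [cb' hb']; split; first by move=> x; apply: cvgD; [exact: cb|exact: cb'].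
move=> e e0; have e2 : 0 < e / 2 by rewrite divr_gt0.
have [d d0 hd] := hb _ e2; have [d' d0' hd'] := hb' _ e2.
exists (Num.min d d'); first by rewrite lt_min d0.
move=> s t s0 st tT; rewrite le_min => /andP[h1 h2].
have g1 := hd s t s0 st tT h1; have g2 := hd' s t s0 st tT h2.
rewrite (_ : _ - _ = (D t - D s - (t - s) * b s) + (D' t - D' s - (t - s) * b' s)); last by ring.
apply: le_trans (ler_normD _ _) _; apply: le_trans (lerD g1 g2) _.
by rewrite -mulrDl -splitr.
Qed.

Lemma uniform_C1Z T D b k : uniform_C1 T D b ->
  uniform_C1 T (fun t => k * D t) (fun t => k * b t).
Proof.
move=> [cb hb]; split; first by move=> x; apply: cvgM; [exact: cvg_cst|exact: cb].
move=> e e0.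
have k0 : 0 < `|k| + 1 by rewrite ltr_wpDl.
have ek : 0 < e / (`|k| + 1) by rewrite divr_gt0.
have [d d0 hd] := hb _ ek; exists d => // s t s0 st tT h1.
have g1 := hd s t s0 st tT h1.
rewrite (_ : _ - _ = k * (D t - D s - (t - s) * b s)); last by ring.
rewrite normrM; apply: (@le_trans _ _ (`|k| * (e / (`|k| + 1) * (t - s)))).
  by rewrite ler_wpM2l.
rewrite mulrA; apply: ler_wpM2r; first by rewrite subr_ge0.
by rewrite mulrCA ler_piMr ?(ltW e0)// ler_pdivrMr// mul1r lerDl.
Qed.

Lemma uniform_C1_cst T k : uniform_C1 T (fun=> k) (fun=> 0).
Proof.
split; first by move=> x; exact: cvg_cst.
move=> e e0; exists 1 => // s t s0 st _ _.
by rewrite subrr mulr0 subrr normr0 mulr_ge0 ?subr_ge0// ltW.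
Qed.

Lemma uniform_C1_sum T (I : finType) (D b : I -> R -> R) :
  (forall i, uniform_C1 T (D i) (b i)) ->
  uniform_C1 T (fun t => \sum_i D i t) (fun t => \sum_i b i t).
Proof.
move=> h; elim: (index_enum I) => [|i s IH].
  have -> : (fun t => \sum_(i <- [::]) D i t) = fun=> 0.
    by apply/funext => t; rewrite big_nil.
  have -> : (fun t => \sum_(i <- [::]) b i t) = fun=> 0.
    by apply/funext => t; rewrite big_nil.
  exact: uniform_C1_cst.
have -> : (fun t => \sum_(j <- i :: s) D j t) = fun t => D i t + \sum_(j <- s) D j t.
  by apply/funext => t; rewrite big_cons.
have -> : (fun t => \sum_(j <- i :: s) b j t) = fun t => b i t + \sum_(j <- s) b j t.
  by apply/funext => t; rewrite big_cons.
exact: uniform_C1D.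
Qed.

(** Summation by parts against a step function: the coefficient changes only where k does, which
    happens at most k n times, and each change costs at most 2 B S. *)
Lemma abel_step (phi : nat -> R) (k : nat -> nat) (N : nat -> R) (B S : R) (m n : nat) :
  0 <= B -> (forall j, (j <= m)%N -> `|phi j| <= B) -> (forall i, (i <= n)%N -> `|N i| <= S) ->
  (forall i, (k i <= k i.+1)%N) -> (k n <= m)%N ->
  `|\sum_(i < n) phi (k i) * (N i.+1 - N i) - phi (k n) * N n| <=
    B * S * (1 + 2 * (k n)%:R).
Proof.
move=> B0 hphi; elim: n => [|n IH] hN kS knm.
  rewrite big_ord0 sub0r normrN normrM.
  have S0 : 0 <= S by apply: le_trans (hN 0%N _).
  apply: (@le_trans _ _ (B * S)); first by rewrite ler_pM// ?hphi// hN.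
  by rewrite ler_peMr ?mulr_ge0// lerDl.
have S0 : 0 <= S by apply: le_trans (hN 0%N _).
have {}IH := IH (fun i ip => hN i (leqW ip)) kS (leq_trans (kS n) knm).
rewrite big_ord_recr /=.
set A := \sum_(i < n) _ in IH *.
rewrite (_ : _ - _ = (A - phi (k n) * N n) + (phi (k n) - phi (k n.+1)) * N n.+1); last by ring.
apply: le_trans (ler_normD _ _) _; apply: le_trans (lerD IH (_ : _ <= B * S * (2 * (k n.+1 - k n)%:R))) _.
  have [->|kk] := eqVneq (k n) (k n.+1).
    by rewrite subrr mul0r normr0 !mulr_ge0.
  have k1 : (1 : R) <= (k n.+1 - k n)%:R by rewrite ler1n subn_gt0 ltn_neqAle kk kS.
  rewrite normrM (_ : B * S * _ = (B + B) * (k n.+1 - k n)%:R * S); last by ring.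
  apply: ler_pM => //; last exact: hN.
  apply: (@le_trans _ _ (B + B)); last by rewrite ler_peMr// addr_ge0.
  apply: le_trans (ler_normB _ _) _; apply: lerD; apply: hphi => //.
  exact: leq_trans (kS n) knm.
by rewrite natrB// -mulrDr; apply: ler_wpM2l; [exact: mulr_ge0|lra].
Qed.

Lemma sum_norm_le n (x : 'I_n -> R) :
  \sum_i `|x i| <= Num.sqrt n%:R * Num.sqrt (\sum_i x i ^+ 2).
Proof.
have s0 : 0 <= \sum_i `|x i| by apply: sumr_ge0.
rewrite -[leLHS](ger0_norm s0) -sqrtr_sqr -sqrtrM// ler_wsqrtr//.
have := sum_cauchy_schwarz (fun i => `|x i|) (fun=> 1 : R).
under eq_bigr do rewrite mulr1.
have -> : \sum_(i < n) (1 : R) ^+ 2 = n%:R by rewrite sumr_const card_ord expr1n.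
have -> : \sum_i `|x i| ^+ 2 = \sum_i x i ^+ 2.
  by apply: eq_bigr => i _; rewrite real_normK ?num_real.
by rewrite mulrC.
Qed.

Lemma sum_mul_le n (a x : 'I_n -> R) c : (forall i, `|a i| <= c) ->
  `|\sum_i a i * x i| <= c * (Num.sqrt n%:R * Num.sqrt (\sum_i x i ^+ 2)).
Proof.
case: n a x => [|n] a x ac; first by rewrite !big_ord0 normr0 sqrtr0 !mulr0.
apply: le_trans (ler_norm_sum _ _ _) _.
have c0 : 0 <= c by apply: le_trans (ac ord0).
apply: (@le_trans _ _ (\sum_i c * `|x i|)).
  by apply: ler_sum => i _; rewrite normrM ler_wpM2r.
by rewrite -mulr_sumr ler_wpM2l// sum_norm_le.
Qed.

Definition grid T n (f : R -> R) (i : 'I_n) : R :=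
  f (i.+1%:R * (T / n%:R)) - f (i%:R * (T / n%:R)).

Lemma grid_time T n i : 0 < T -> (i <= n)%N -> (0 < n)%N ->
  0 <= i%:R * (T / n%:R) <= T.
Proof.
move=> T0 ip n0; have n0' : (0 : R) < n%:R by rewrite ltr0n.
apply/andP; split; first by rewrite mulr_ge0// divr_ge0// ltW.
by rewrite mulrCA ler_piMr ?(ltW T0)// ler_pdivrMr// mul1r ler_nat.
Qed.

Lemma le_sqrt_nat (a : R) n : ((Num.truncn (a ^+ 2)).+1 <= n)%N -> a <= Num.sqrt n%:R.
Proof.
move=> an; apply: (@le_trans _ _ `|a|); first exact: ler_norm.
rewrite -sqrtr_sqr ler_wsqrtr// (@le_trans _ _ (Num.truncn (a ^+ 2)).+1%:R) ?ler_nat//.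
by rewrite ltW// truncnS_gt.
Qed.

Lemma div_le_trunc (a c : R) n : 0 < c -> ((Num.truncn (a / c)).+1 <= n)%N -> (0 < n)%N ->
  a / n%:R <= c.
Proof.
move=> c0 an n0; rewrite ler_pdivrMr ?ltr0n// mulrC -ler_pdivrMr//.
by rewrite (@le_trans _ _ (Num.truncn (a / c)).+1%:R) ?ler_nat// ltW// truncnS_gt.
Qed.

(* Replacing [b] by a step function with [m] steps, Abel summation reduces the sum
   to increments of [N] over the steps and the error is a small multiple of
   [sqrt (\sum grid N ^+ 2)]. *)
Lemma cross_vanish T D b N e : 0 < T -> uniform_C1 T D b ->
  {within `[0, T], continuous N} -> 0 < e ->
  exists n0, forall n, (n0 <= n)%N -> (0 < n)%N ->
    Num.sqrt n%:R * `|\sum_i @grid T n D i * grid T N i| <=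
      e * (1 + Num.sqrt (\sum_i @grid T n N i ^+ 2)).
Proof.
move=> T0 [cb hD] cN e0.
(* There are two approximation errors, of D by its slope and of the slope by a step function, each
   of size eps h per increment. As n h = T, each amounts to half of e times the root of the sum of
   squares. *)
pose eps := e / (2 * T); have eps0 : 0 < eps by rewrite divr_gt0// mulr_gt0.
have [d1 d10 h1] := hD _ eps0.
have [d2 d20 h2] := segment_unif cb eps0.
have [B B0 hB] := segment_bounded cb; have [S S0 hS] := segment_bounded cN.
pose m := (Num.truncn (T / d2)).+1.
have m0 : (0 : R) < m%:R by rewrite ltr0n.
have Tm : T / m%:R <= d2.
  by rewrite ler_pdivrMr// mulrC -ler_pdivrMr// ltW// truncnS_gt.
pose A := T * (B * S * (2 + 2 * m%:R)).
have A0 : 0 < A by rewrite !mulr_gt0// addr_gt0// mulr_gt0.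
pose n1 := (Num.truncn (T / d1)).+1; pose n2 := (Num.truncn ((A / e) ^+ 2)).+1.
exists (maxn n1 n2) => n; rewrite geq_max => /andP[nn1 nn2] n0.
have n0' : (0 : R) < n%:R by rewrite ltr0n.
have sn0 : 0 < Num.sqrt (n%:R : R) by rewrite sqrtr_gt0.
have snn : Num.sqrt n%:R * Num.sqrt n%:R = n%:R :> R by rewrite -expr2 sqr_sqrtr// ltW.
set h := T / n%:R; have h0 : 0 < h by rewrite divr_gt0.
have hd1 : h <= d1 by exact: div_le_trunc.
have hA : A / Num.sqrt n%:R <= e.
  by rewrite ler_pdivrMr// mulrC -ler_pdivrMr// le_sqrt_nat.
pose k i := ((m * i) %/ n)%N.
pose phi j := b (T * (j%:R / m%:R)).
pose x i := @grid T n N i; pose V := \sum_i x i ^+ 2.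
pose sV := Num.sqrt V; have sV0 : 0 <= sV by exact: sqrtr_ge0.
have tn i (Hi : (i <= n)%N) : 0 <= i%:R * h <= T by exact: grid_time.
have kn : k n = m by rewrite /k mulnK.
have kS i : (k i <= k i.+1)%N by rewrite leq_div2r// leq_mul2l leqnSn orbT.
have jm j : (j <= m)%N -> 0 <= T * (j%:R / m%:R) <= T.
  move=> hj; apply/andP; split; first by rewrite mulr_ge0 ?(ltW T0)// divr_ge0.
  by rewrite ler_piMr ?(ltW T0)// ler_pdivrMr// mul1r ler_nat.
have phiB j : (j <= m)%N -> `|phi j| <= B by move=> hj; exact/hB/jm.
have NS i : (i <= n)%N -> `|N (i%:R * h)| <= S by move=> hi; exact/hS/tn.
have ab := @abel_step phi k (fun i => N (i%:R * h)) B S m n (ltW B0) phiB NS kS.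
rewrite kn leqnn in ab; have {}ab := ab isT.
have bphi (i : 'I_n) : `|b (i%:R * h) - phi (k i)| <= eps.
  have kim : (k i <= m)%N by rewrite -kn; apply: leq_div2r; rewrite leq_mul2l ltnW ?orbT.
  apply: h2; [exact: jm|by apply: tn; rewrite ltnW|].
  apply: le_trans Tm.
  have E : i%:R * h - T * ((k i)%:R / m%:R) = T / m%:R * ((m * i)%:R / n%:R - (k i)%:R).
    by rewrite natrM /h; field; rewrite !gt_eqF.
  rewrite E normrM (gtr0_norm (_ : 0 < T / m%:R)) ?divr_gt0//.
  rewrite ler_piMr ?(ltW (divr_gt0 T0 m0))// (divn_eq (m * i) n) -/(k i) natrD natrM.
  rewrite mulrDl mulfK ?gt_eqF// addrAC subrr add0r ger0_norm ?divr_ge0//.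
  by rewrite ler_pdivrMr// mul1r ler_nat ltnW// ltn_mod.
have t1 : `|\sum_i (@grid T n D i - h * b (i%:R * h)) * x i| <= eps * h * (Num.sqrt n%:R * sV).
  apply: sum_mul_le => i.
  have /andP[a1 a2] := tn i (ltnW (ltn_ord i)); have /andP[_ a3] := tn i.+1 (ltn_ord i).
  have E : i.+1%:R * h - i%:R * h = h by rewrite -mulrBl -natrB// subSnn mul1r.
  have := h1 (i%:R * h) (i.+1%:R * h) a1 _ a3 _; rewrite E; apply => //.
  by rewrite ler_pM2r// ler_nat.
have t2 : `|\sum_(i < n) (b (i%:R * h) - phi (k i)) * x i| <= eps * (Num.sqrt n%:R * sV).
  exact: sum_mul_le.
have t3 : `|\sum_(i < n) phi (k i) * x i| <= B * S * (2 + 2 * m%:R).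
  rewrite -[X in `|X|](subrK (phi m * N (n%:R * h))).
  apply: le_trans (ler_normD _ _) _; apply: le_trans (lerD ab (_ : _ <= B * S)) _.
    by rewrite normrM ler_pM ?phiB ?NS.
  by rewrite le_eqVlt; apply/orP; left; apply/eqP; ring.
have -> : \sum_i @grid T n D i * grid T N i =
    \sum_i (@grid T n D i - h * b (i%:R * h)) * x i +
    h * (\sum_(i < n) (b (i%:R * h) - phi (k i)) * x i + \sum_(i < n) phi (k i) * x i).
  by rewrite -big_split /= mulr_sumr -big_split /=; apply: eq_bigr => i _; rewrite -/(x i); ring.
apply: (@le_trans _ _ (Num.sqrt n%:R * (eps * h * (Num.sqrt n%:R * sV) +
    h * (eps * (Num.sqrt n%:R * sV) + B * S * (2 + 2 * m%:R))))).
  rewrite ler_pM2l//; apply: le_trans (ler_normD _ _) _; apply: lerD => //.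
  rewrite normrM (gtr0_norm h0) ler_pM2l//; apply: le_trans (ler_normD _ _) _.
  exact: lerD.
have -> : Num.sqrt n%:R * (eps * h * (Num.sqrt n%:R * sV) +
    h * (eps * (Num.sqrt n%:R * sV) + B * S * (2 + 2 * m%:R))) =
   e * sV + A / Num.sqrt n%:R.
  rewrite /h /A /eps; move: (Num.sqrt (n%:R : R)) snn sn0 => u; move: (n%:R : R) => r <- u0.
  by field; rewrite !gt_eqF.
by rewrite mulrDr mulr1 addrC lerD2r.
Qed.

(** Here absolute values suffice: both increments are of order 1/n, so the sum is of order 1/n. *)
Lemma drift_vanish T D b D' b' e : 0 < T -> uniform_C1 T D b -> uniform_C1 T D' b' -> 0 < e ->
  exists n0, forall n, (n0 <= n)%N -> (0 < n)%N ->
    Num.sqrt n%:R * `|\sum_i @grid T n D i * grid T D' i| <= e.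
Proof.
move=> T0 H H' e0.
have bd F f : uniform_C1 T F f -> exists2 K, 0 < K & exists n0, forall n (i : 'I_n), (n0 <= n)%N ->
    `|grid T F i| <= K * (T / n%:R).
  move=> [cf hF]; have [d d0 h1] := hF _ ltr01; have [B B0 hB] := segment_bounded cf.
  exists (B + 1); first by rewrite addr_gt0.
  exists (Num.truncn (T / d)).+1 => n i nn.
  have n0 : (0 < n)%N by apply: leq_trans nn.
  have n0' : (0 : R) < n%:R by rewrite ltr0n.
  set h := T / n%:R; have h0 : 0 < h by rewrite divr_gt0.
  have hd : h <= d by exact: div_le_trunc.
  have ti := grid_time T0 (ltnW (ltn_ord i)) n0; have /andP[a1 _] := ti.
  have /andP[_ a3] := grid_time T0 (ltn_ord i) n0.
  have E : i.+1%:R * h - i%:R * h = h by rewrite -mulrBl -natrB// subSnn mul1r.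
  have := h1 (i%:R * h) (i.+1%:R * h) a1 _ a3 _; rewrite E mul1r.
  rewrite ler_pM2r// ler_nat leqnSn => /(_ isT hd) h2.
  rewrite /grid -/h -[X in `|X|](subrK (h * f (i%:R * h))).
  apply: le_trans (ler_normD _ _) _; rewrite mulrDl mul1r addrC; apply: lerD => //.
  by rewrite normrM (gtr0_norm h0) mulrC ler_pM2r// hB.
have [K K0 [n1 h1]] := bd _ _ H; have [K' K0' [n2 h2]] := bd _ _ H'.
pose A := T ^+ 2 * (K * K'); have A0 : 0 < A by rewrite !mulr_gt0// exprn_gt0.
pose n3 := (Num.truncn ((A / e) ^+ 2)).+1.
exists (maxn n1 (maxn n2 n3)) => n; rewrite !geq_max => /and3P[nn1 nn2 nn3] n0.
have n0' : (0 : R) < n%:R by rewrite ltr0n.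
have sn0 : 0 < Num.sqrt (n%:R : R) by rewrite sqrtr_gt0.
have snn : Num.sqrt n%:R * Num.sqrt n%:R = n%:R :> R by rewrite -expr2 sqr_sqrtr// ltW.
have hA : A / Num.sqrt n%:R <= e.
  by rewrite ler_pdivrMr// mulrC -ler_pdivrMr// le_sqrt_nat.
apply: le_trans hA.
apply: (@le_trans _ _ (Num.sqrt n%:R * (n%:R * (K * (T / n%:R) * (K' * (T / n%:R)))))).
  rewrite ler_pM2l//; apply: le_trans (ler_norm_sum _ _ _) _.
  rewrite [leRHS]mulr_natl -[X in _ *+ X](card_ord n) -sumr_const; apply: ler_sum => i _.
  by rewrite normrM ler_pM// ?h1 ?h2.
rewrite le_eqVlt; apply/orP; left; apply/eqP.
rewrite /A; move: (Num.sqrt (n%:R : R)) snn sn0 => u; move: (n%:R : R) => r <- u0.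
by field; rewrite gt_eqF.
Qed.

End UniformOnSegment.

(** * The chi-squared law and its Laplace transform *)

Section Dilation.
Context (R : realType).
Local Notation mu := (@lebesgue_measure R).
Local Open Scope ereal_scope.

Lemma measurable_dilate (c : R) :
  measurable_fun setT ((fun x => c * x)%R : measurableTypeR R -> measurableTypeR R).
Proof. exact: mulrl_measurable. Qed.

Lemma lebesgue_measure_dilate (c : R) (A : set R) : (0 < c)%R -> measurable A ->
  mu A = c%:E * pushforward mu ((fun x => c * x)%R : measurableTypeR R -> measurableTypeR R) A.
Proof.
move=> c0 mA.
pose f : {mfun measurableTypeR R >-> measurableTypeR R} :=
  HB.pack ((fun x => c * x)%R : measurableTypeR R -> measurableTypeR R)
   (isMeasurableFun.Build _ _ _ _ _ (measurable_dilate c)).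
have -> : c%:E * pushforward mu (fun x => c * x)%R A =
  mscale (NngNum (ltW c0)) (pushforward mu f) A by [].
apply: lebesgue_measure_unique => //= _ [[a b]] _ <-.
rewrite /= /mscale /= /pushforward.
rewrite (_ : _ @^-1` _ = `](a / c)%R, (b / c)%R]%classic); last first.
  apply/seteqP; split=> x /=; rewrite !in_itv/= ltr_pdivrMr// ler_pdivlMr// mulrC//.
rewrite !lebesgue_measure_itv/= !lte_fin ltr_pM2r ?invr_gt0//.
case: ifP => _; last by rewrite mule0.
by rewrite -!EFinB -EFinM; congr EFin; field; rewrite gt_eqF.
Qed.

Lemma integral_dilate (c : R) (f : R -> \bar R) : (0 < c)%R ->
  measurable_fun setT f -> (forall x, 0 <= f x) ->
  \int[mu]_x f x = c%:E * \int[mu]_x f (c * x)%R.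
Proof.
move=> c0 mf f0.
pose g : {mfun measurableTypeR R >-> measurableTypeR R} :=
  HB.pack ((fun x => c * x)%R : measurableTypeR R -> measurableTypeR R)
   (isMeasurableFun.Build _ _ _ _ _ (measurable_dilate c)).
have -> : \int[mu]_x f x =
    \int[mscale (NngNum (ltW c0)) (pushforward mu g)]_x f x.
  move=> m; apply: eq_measure_integral => //= A mA _.
  exact: lebesgue_measure_dilate.
rewrite ge0_integral_mscale//= ge0_integral_pushforward//.
exact: measurable_dilate.
Qed.

End Dilation.

Section GammaKernel.
Context (R : realType).
Local Notation mu := (@lebesgue_measure R).

(** Extended by 0 to the whole line, so that changes of scale take place under integrals over the
    full line. *)
Definition gamma_ker (a x : R) : R :=
  if 0 < x then x `^ (a - 1) * expR (- x) else 0.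

Lemma gamma_ker_ge0 a x : 0 <= gamma_ker a x.
Proof.
by rewrite /gamma_ker; case: ifP => // _; rewrite mulr_ge0 ?powR_ge0 ?expR_ge0.
Qed.

Lemma measurable_gamma_ker a : measurable_fun setT (gamma_ker a).
Proof.
apply: measurable_fun_ifT => //.
- exact: measurable_fun_ltr.
- apply: measurable_funM; first exact: measurable_powR.
  by apply: measurableT_comp => //; exact: measurableT_comp.
Qed.

Lemma integral_gamma_ker a :
  (\int[mu]_x (gamma_ker a x)%:E =
   \int[mu]_(x in `]0%R, +oo[) (x `^ (a - 1) * expR (- x))%:E)%E.
Proof.
rewrite [RHS]integral_mkcond; apply: eq_integral => x _.
rewrite /gamma_ker patchE mem_setE in_itv/= andbT.
by case: ifP.
Qed.

(** Raise y <= (k + 1) exp (y / (k + 1)) to the power k. *)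
Lemma expR_pow_bound (k : nat) (y : R) : 0 <= y -> y ^+ k * expR (- y) <= k.+1%:R ^+ k.
Proof.
move=> y0.
have k0 : (0 : R) < k.+1%:R by rewrite ltr0n.
rewrite expRN ler_pdivrMr ?expR_gt0//.
have -> : expR y = expR (y / k.+1%:R) ^+ k.+1.
  by rewrite -expRM_natl; congr expR; field; rewrite addrC -natr1 in k0 *; rewrite gt_eqF.
have h : y <= k.+1%:R * expR (y / k.+1%:R).
  rewrite -ler_pdivrMl// mulrC.
  by have := expR_ge1Dx (y / k.+1%:R); apply: le_trans; rewrite lerDr.
apply: (@le_trans _ _ ((k.+1%:R * expR (y / k.+1%:R)) ^+ k)).
  by rewrite lerXn2r ?nnegrE// mulr_ge0 ?expR_ge0// ltW.
rewrite exprMn; apply: ler_wpM2l; first by rewrite exprn_ge0 ?ltW.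
rewrite exprS ler_peMl ?exprn_ge0 ?expR_ge0//.
rewrite -expR0 ler_expR divr_ge0// ltW//.
Qed.

(** The derivative of - (1 + sqrt x)^-1 for x > 0. It behaves like x^(-1/2) at 0 and x^(-3/2) at
    infinity, hence is an integrable majorant, with an explicit primitive, for all Gamma kernels of
    shape at least 1/2, including the case of one degree of freedom. *)
Definition inv_sqrt_tail (x : R) : R := (2 * Num.sqrt x)^-1 / (1 + Num.sqrt x) ^+ 2.

Lemma inv_sqrt_tail_ge0 x : 0 <= inv_sqrt_tail x.
Proof. by rewrite divr_ge0 ?sqr_ge0// invr_ge0 mulr_ge0 ?sqrtr_ge0. Qed.

Lemma inv_sqrt_tail_cvg (x : R) : 0 < x -> {for x, continuous inv_sqrt_tail}.
Proof.
move=> x0; apply: cvgM.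
  apply: cvgV; first by rewrite mulf_neq0// gt_eqF// sqrtr_gt0.
  by apply: cvgM; [exact: cvg_cst|exact: sqrt_continuous].
have h : {for x, continuous (fun y : R => 1 + Num.sqrt y)}.
  by apply: cvgD; [exact: cvg_cst|exact: sqrt_continuous].
apply: cvgV; first by rewrite expf_neq0// gt_eqF// ltr_pwDl// sqrtr_ge0.
by under eq_fun do rewrite expr2; rewrite expr2; apply: cvgM.
Qed.

Lemma measurable_inv_sqrt_tail :
  measurable_fun (`]0%R, +oo[%classic : set R) inv_sqrt_tail.
Proof.
apply: open_continuous_measurable_fun => // x; rewrite inE/= in_itv/= andbT.
exact: inv_sqrt_tail_cvg.
Qed.

Lemma integral_inv_sqrt_tail (a : R) : 0 < a ->
  (\int[mu]_(x in `[a, +oo[) (inv_sqrt_tail x)%:E <= 1)%E.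
Proof.
move=> a0.
pose F (x : R) : R := - (1 + Num.sqrt x)^-1.
have s1 (x : R) : 1 + Num.sqrt x != 0 by rewrite gt_eqF// ltr_pwDl// sqrtr_ge0.
have dF (x : R) : 0 < x -> is_derive x (1 : R) F (inv_sqrt_tail x).
  move=> x0; rewrite /F.
  have d1 : is_derive x (1 : R) Num.sqrt (2 * Num.sqrt x)^-1 by exact: is_derive1_sqrt.
  have d2 : is_derive x (1 : R) (fun y : R => 1 + Num.sqrt y) (2 * Num.sqrt x)^-1.
    have d0 := @is_deriveD _ _ _ _ _ x 1 _ _ (is_derive_cst (1 : R) x 1) d1.
    by apply: is_derive_eq; rewrite add0r.
  have d3 := @is_deriveV _ (fun y : R => 1 + Num.sqrt y) x _ 1 (s1 x) d2.
  have d4 := @is_deriveN _ _ _ _ _ _ _ d3.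
  by apply: is_derive_eq; rewrite /inv_sqrt_tail /GRing.scale/= mulNr opprK mulrC.
have Fc (x : R) : {for x, continuous F}.
  apply: cvgN; apply: cvgV => //; apply: cvgD; first exact: cvg_cst.
  exact: sqrt_continuous.
rewrite (@ge0_continuous_FTC2y _ _ F a 0).
- by rewrite /F sub0e -EFinN opprK lee_fin invf_le1 ?lerDl ?ltr_pwDl ?sqrtr_ge0.
- by move=> x _; exact: inv_sqrt_tail_ge0.
- apply: continuous_in_subspaceT => x; rewrite inE/= in_itv/= andbT => ax.
  by apply: inv_sqrt_tail_cvg; apply: lt_le_trans ax.
- rewrite -oppr0; apply: cvgN.
  apply/cvgrPdist_lt => e e0; near=> x.
  have sx : 0 < 1 + Num.sqrt x by rewrite ltr_pwDl ?sqrtr_ge0.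
  rewrite sub0r normrN gtr0_norm ?invr_gt0//.
  rewrite -[ltRHS]invrK ltf_pV2 ?posrE ?invr_gt0//.
  rewrite -[e^-1]ger0_norm ?invr_ge0 ?ltW// -sqrtr_sqr.
  apply: (@le_lt_trans _ _ (Num.sqrt x)); last by rewrite ltrDr.
  by rewrite ler_sqrt.
- by move=> x ax; have := dF x (lt_trans a0 ax); case.
- exact/cvg_at_right_filter/Fc.
- move=> x; rewrite in_itv/= andbT => ax; rewrite derive1E.
  by have := dF x (lt_trans a0 ax); case.
Unshelve. all: by end_near. Qed.

Lemma integral_inv_sqrt_tail0 :
  (\int[mu]_(x in `]0%R, +oo[) (inv_sqrt_tail x)%:E <= 1)%E.
Proof.
pose A (n : nat) : set R := `[n.+1%:R^-1, +oo[%classic.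
have UA : \bigcup_n A n = `]0%R, +oo[%classic.
  apply/seteqP; split=> [x [n _]|x]; rewrite /A /= !in_itv/= !andbT.
    by move=> h; apply: lt_le_trans h; rewrite invr_gt0 ltr0n.
  move=> x0; exists (Num.truncn x^-1) => //=; rewrite in_itv/= andbT.
  rewrite -[leRHS]invrK lef_pV2 ?posrE ?invr_gt0 ?ltr0n//.
  by rewrite ltW// truncnS_gt.
have mA i : measurable_fun (A i) (EFin \o inv_sqrt_tail).
  apply/measurable_EFinP; apply: measurable_funS measurable_inv_sqrt_tail => //.
  by rewrite -UA; exact: bigcup_sup.
rewrite -UA.
have /cvg_lim <- // : (\int[mu]_(x in A n) (inv_sqrt_tail x)%:E @[n --> \oo] -->
  \int[mu]_(x in \bigcup_n A n) (inv_sqrt_tail x)%:E)%E.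
  apply: ge0_nondecreasing_set_cvg_integral => //.
  - apply/nondecreasing_seqP => n; rewrite subsetEset => x; rewrite /A/= !in_itv/= !andbT.
    by apply: le_trans; rewrite lef_pV2 ?posrE ?ltr0n// ler_nat.
  - by move=> i; exact: measurable_itv.
  - by move=> i x _; rewrite lee_fin inv_sqrt_tail_ge0.
apply: lime_le.
  apply: ereal_nondecreasing_is_cvgn.
  apply: ge0_nondecreasing_set_nondecreasing_integral => //.
  - apply/nondecreasing_seqP => n; rewrite subsetEset => x; rewrite /A/= !in_itv/= !andbT.
    by apply: le_trans; rewrite lef_pV2 ?posrE ?ltr0n// ler_nat.
  - by move=> i; exact: measurable_itv.
  - by move=> i x _; rewrite lee_fin inv_sqrt_tail_ge0.
by apply: nearW => n; apply: integral_inv_sqrt_tail; rewrite invr_gt0 ltr0n.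
Qed.


Lemma gamma_ker_le a : 2^-1 <= a ->
  exists2 C, 0 < C & forall x, 0 < x -> gamma_ker a x <= C * inv_sqrt_tail x.
Proof.
move=> a2; pose k := (Num.truncn (a + 1)).+1.
have ak : a + 1 <= k%:R by rewrite ltW// truncnS_gt.
exists (8 * (1 + k.+1%:R ^+ k)) => [|x x0].
  by rewrite mulr_gt0// ltr_pwDl// exprn_ge0.
rewrite /gamma_ker x0.
have s0 : 0 < Num.sqrt x by rewrite sqrtr_gt0.
(* The possible singularity at 0 is split off and matched with that of [inv_sqrt_tail]; what remains
   is bounded, separately on x <= 1 and x > 1. *)
have -> : x `^ (a - 1) = x `^ (a - 2^-1) * (Num.sqrt x)^-1.
  rewrite -powR12_sqrt ?ltW// -powRN -powRD ?(gt_eqF x0) ?implybT//.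
  by congr (_ `^ _); field.
rewrite /inv_sqrt_tail mulrAC ler_pdivrMr// !mulrA mulrAC ler_pdivlMr; last first.
  by rewrite exprn_gt0// addr_gt0.
set e := expR _.
have e0 : 0 < e by exact: expR_gt0.
suff h : x `^ (a - 2^-1) * e * (1 + Num.sqrt x) ^+ 2 <= 4 * (1 + k.+1%:R ^+ k).
  have -> : 8 * (1 + k.+1%:R ^+ k) / (2 * Num.sqrt x) * Num.sqrt x = 4 * (1 + k.+1%:R ^+ k).
    by field; rewrite gt_eqF.
  exact: h.
have h1 : (1 + Num.sqrt x) ^+ 2 <= 2 * (1 + x).
  have := sqr_sqrtr (ltW x0); have := sqr_ge0 (1 - Num.sqrt x); nra.
have b0 : 0 <= a - 2^-1 by lra.
have [x1|x1] := leP x 1.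
  have h2 : x `^ (a - 2^-1) <= 1.
    have := @ge0_ler_powR R _ b0 x 1; rewrite !nnegrE powR1; apply => //; exact: ltW.
  have h3 : e <= 1 by rewrite -expR0 ler_expR oppr_le0 ltW.
  have h4 : (1 + Num.sqrt x) ^+ 2 <= 4 by apply: le_trans h1 _; lra.
  apply: (@le_trans _ _ (1 * 4)).
    apply: ler_pM => //; first by rewrite mulr_ge0 ?powR_ge0// ltW.
    by apply: mulr_ile1 => //; [exact: powR_ge0|exact: ltW].
  by rewrite mul1r ler_peMr// lerDl exprn_ge0.
have h2 : x `^ (a - 2^-1) * x <= x ^+ k.
  rewrite -[X in _ * X](powRr1 (ltW x0)) -powRD ?(gt_eqF x0) ?implybT// -powR_mulrn ?(ltW x0)//.
  by apply: ler_powR; [exact: ltW|lra].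
have h3 := expR_pow_bound k (ltW x0).
apply: (@le_trans _ _ (x `^ (a - 2^-1) * e * (4 * x))).
  apply: ler_wpM2l; first by rewrite mulr_ge0 ?powR_ge0// ltW.
  by apply: le_trans h1 _; lra.
have -> : x `^ (a - 2^-1) * e * (4 * x) = 4 * (x `^ (a - 2^-1) * x * e) by ring.
rewrite ler_pM2l//; apply: (@le_trans _ _ (x ^+ k * e)); first by rewrite ler_pM2r.
by apply: le_trans h3 _; rewrite lerDr.
Qed.

Lemma integral_gamma_ker_lty a : 2^-1 <= a ->
  (\int[mu]_x (gamma_ker a x)%:E < +oo)%E.
Proof.
move=> a2; have [C C0 hC] := gamma_ker_le a2.
have -> : (\int[mu]_x (gamma_ker a x)%:E = \int[mu]_(x in `]0%R, +oo[) (gamma_ker a x)%:E)%E.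
  rewrite [RHS]integral_mkcond; apply: eq_integral => x _.
  rewrite patchE mem_setE in_itv/= andbT.
  by case: ifP => // /negbT; rewrite /gamma_ker => /negbTE ->.
apply: (@le_lt_trans _ _ (C%:E * \int[mu]_(x in `]0%R, +oo[) (inv_sqrt_tail x)%:E)%E).
  rewrite -ge0_integralZl//; last 3 first.
  - by apply/measurable_EFinP; exact: measurable_inv_sqrt_tail.
  - by move=> x _; rewrite lee_fin inv_sqrt_tail_ge0.
  - by rewrite lee_fin ltW.
  apply: ge0_le_integral => //.
  - by move=> x _; rewrite lee_fin gamma_ker_ge0.
  - apply/measurable_EFinP; apply: measurable_funS (measurable_gamma_ker a) => //.
  - apply: emeasurable_funM => //.
    by apply/measurable_EFinP; exact: measurable_inv_sqrt_tail.
  - by move=> x; rewrite /= in_itv/= andbT => x0; rewrite lee_fin hC.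
apply: (@le_lt_trans _ _ (C%:E * 1)%E).
  by rewrite lee_pmul2l// integral_inv_sqrt_tail0.
by rewrite mule1 ltry.
Qed.

(** [Gamma] is the real part taken by [fine], which would be 0 for an infinite integral; finiteness
    therefore has to come first. *)
Lemma EFin_Gamma (a : R) : 2^-1 <= a -> ((Gamma a)%:E = \int[mu]_x (gamma_ker a x)%:E)%E.
Proof.
move=> a2; rewrite /Gamma /Rintegral -integral_gamma_ker fineK//.
rewrite ge0_fin_numE ?integral_gamma_ker_lty// integral_ge0// => x _.
by rewrite lee_fin gamma_ker_ge0.
Qed.

Lemma Gamma_gt0 (a : R) : 2^-1 <= a -> 0 < Gamma a.
Proof.
move=> a2; rewrite -lte_fin EFin_Gamma//.
pose c : R := Num.min 1 (2 `^ (a - 1)) * expR (- 2).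
have c0 : 0 < c by rewrite mulr_gt0 ?expR_gt0// lt_min ltr01 powR_gt0.
apply: (@lt_le_trans _ _ (\int[mu]_(x in `[1%R, 2%R]) c%:E)%E).
  rewrite integral_cst//= lebesgue_measure_itv/= lte_fin ltr1n/= -EFinB -EFinM lte_fin mulr_gt0//; lra.
apply: (@le_trans _ _ (\int[mu]_(x in `[1%R, 2%R]) (gamma_ker a x)%:E)%E).
  apply: ge0_le_integral => //.
  - by move=> x _; rewrite lee_fin ltW.
  - by apply/measurable_EFinP; apply: measurable_funS (measurable_gamma_ker a).
  - move=> x; rewrite /= in_itv/= => /andP[x1 x2]; rewrite lee_fin /gamma_ker.
    have x0 : 0 < x by apply: lt_le_trans x1.
    rewrite x0; apply: ler_pM; rewrite ?expR_ge0 ?ler_expR ?lerN2//.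
    have [a1|a1] := leP 1 a.
      rewrite ge_min; apply/orP; left.
      have := @ge0_ler_powR R (a - 1) _ 1 x; rewrite !nnegrE powR1 subr_ge0.
      by apply => //; exact: ltW.
    rewrite ge_min; apply/orP; right.
    rewrite -[a - 1]opprK !(powRN _ (- (a - 1))) lef_pV2 ?posrE ?powR_gt0//.
    have := @ge0_ler_powR R (- (a - 1)) _ x 2; rewrite !nnegrE; apply => //; lra.
apply: ge0_subset_integral => //.
- by apply/measurable_EFinP; exact: measurable_gamma_ker.
- by move=> x _; rewrite lee_fin gamma_ker_ge0.
Qed.

End GammaKernel.

Section Chi2.
Context (R : realType) (k : nat).
Hypothesis k0 : (0 < k)%N.
Local Notation mu := (@lebesgue_measure R).
Local Notation a := (k%:R / 2 : R).

Lemma powR_subr1 (c b : R) : 0 < c -> c `^ b = c `^ (b - 1) * c.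
Proof.
move=> c0; have h : (b - 1 + 1 == 0) ==> (c != 0) by rewrite (gt_eqF c0) implybT.
by have := powRD h; rewrite subrK powRr1 ?ltW.
Qed.

Lemma half_df : 2^-1 <= a.
Proof.
have h : (1 : R) <= k%:R by rewrite ler1n.
by rewrite -[leLHS]mul1r ler_pM2r ?invr_gt0.
Qed.

Lemma chi2_pdf_ker x : chi2_pdf k x = (2 * Gamma a)^-1 * gamma_ker a (2^-1 * x).
Proof.
have G0 := Gamma_gt0 half_df.
rewrite /chi2_pdf /gamma_ker pmulr_rgt0 ?invr_gt0//.
case: ifP => x0; last by rewrite mulr0.
have -> : x `^ (a - 1) = 2 `^ (a - 1) * (2^-1 * x) `^ (a - 1).
  by rewrite -powRM ?mulrA ?mulfV ?mul1r// mulr_ge0// ltW.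
rewrite (@powR_subr1 2 a)//.
have p0 : (0 : R) < 2 `^ (a - 1) by exact: powR_gt0.
rewrite (_ : - x / 2 = - (2^-1 * x)); last by ring.
field.
by rewrite !gt_eqF.
Qed.

Lemma measurable_chi2_pdf : measurable_fun setT (@chi2_pdf R k).
Proof.
have -> : @chi2_pdf R k = fun x => (2 * Gamma a)^-1 * gamma_ker a (2^-1 * x).
  by apply/funext => x; exact: chi2_pdf_ker.
apply: measurable_funM => //.
apply: measurableT_comp; first exact: measurable_gamma_ker.
exact: measurable_funM.
Qed.

Lemma chi2_pdf_ge0 (x : R) : 0 <= chi2_pdf k x.
Proof.
by rewrite chi2_pdf_ker mulr_ge0 ?gamma_ker_ge0// invr_ge0 mulr_ge0// ltW// Gamma_gt0// half_df.
Qed.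

(** Multiplying the density by exp (- l x) only changes the scale of the Gamma kernel, from 1/2 to
    (1 + 2 l)/2, and a dilation restores it. *)
Lemma chi2_laplace (l : R) : 0 <= l ->
  (\int[mu]_x (expR (- (l * x)) * chi2_pdf k x)%:E = (chi2_mgf k%:R l)%:E)%E.
Proof.
move=> l0; have G0 := Gamma_gt0 half_df.
pose c := 1 + 2 * l; have c0 : 0 < c by rewrite /c; lra.
have cd0 : 0 < c / 2 by rewrite divr_gt0.
have cp : 0 < c `^ (a - 1) by exact: powR_gt0.
pose K := (2 * Gamma a)^-1 * (c `^ (a - 1))^-1.
have K0 : 0 <= K by rewrite mulr_ge0 // invr_ge0 ltW// mulr_gt0.
have fE x : expR (- (l * x)) * chi2_pdf k x = K * gamma_ker a (c / 2 * x).
  rewrite chi2_pdf_ker /gamma_ker !pmulr_rgt0 ?invr_gt0//.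
  case: ifP => x0; last by rewrite !mulr0.
  rewrite (_ : c / 2 * x = c * (2^-1 * x)); last by rewrite mulrA.
  rewrite powRM ?(ltW c0)//; last by rewrite mulr_ge0// ltW.
  have -> : expR (- (c * (2^-1 * x))) = expR (- (2^-1 * x)) * expR (- (l * x)).
    by rewrite -expRD; congr expR; rewrite /c; field.
  by rewrite /K; field; rewrite !gt_eqF.
under eq_integral do rewrite fE EFinM.
have mg : measurable_fun setT (fun x : R => (gamma_ker a x)%:E).
  by apply/measurable_EFinP; exact: measurable_gamma_ker.
rewrite ge0_integralZl//; last 2 first.
- apply: (measurableT_comp mg); exact: measurable_funM.
- by move=> x _; rewrite lee_fin gamma_ker_ge0.
have := EFin_Gamma half_df; rewrite (integral_dilate cd0)//; last first.
  by move=> x; rewrite lee_fin gamma_ker_ge0.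
move=> /(congr1 (fun z => ((c / 2)^-1)%:E * z)%E).
rewrite muleA -!EFinM mulVf ?gt_eqF// mul1e => <-.
rewrite -EFinM; congr EFin; rewrite /K /chi2_mgf -/c.
have -> : expR (- (a * ln c)) = (c `^ a)^-1 by rewrite expRN /powR gt_eqF.
rewrite (@powR_subr1 c a)//.
field.
by rewrite !gt_eqF.
Qed.

End Chi2.

(** * From Laplace transforms to distribution functions *)

Section LaplaceCdf.
Context (R : realType).
Local Notation mu := (@lebesgue_measure R).

Lemma onem_expn_le (t : R) n : 0 <= t <= 1 -> (1 - t) ^+ n * (1 + n%:R * t) <= 1.
Proof.
move=> /andP[t0 t1].
have h : 1 + n%:R * t <= (1 + t) ^+ n.
  elim: n => [|n IH]; first by rewrite mul0r addr0 expr0.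
  rewrite exprS; apply: (@le_trans _ _ ((1 + t) * (1 + n%:R * t))).
    rewrite -natr1; have : 0 <= n%:R * t * t by rewrite !mulr_ge0.
    by move=> ?; lra.
  by rewrite ler_pM2l// ltr_pwDl.
apply: (@le_trans _ _ ((1 - t) ^+ n * (1 + t) ^+ n)).
  by apply: ler_wpM2l h; rewrite exprn_ge0// subr_ge0.
rewrite -exprMn exprn_ile1//; nra.
Qed.

Lemma onem_expn_ge (t : R) n : 0 <= t <= 1 -> 1 - n%:R * t <= (1 - t) ^+ n.
Proof.
move=> /andP[t0 t1]; elim: n => [|n IH]; first by rewrite mul0r subr0 expr0.
rewrite exprS; apply: (@le_trans _ _ ((1 - t) * (1 - n%:R * t))).
  rewrite -natr1; have : 0 <= n%:R * t * t by rewrite !mulr_ge0.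
  by move=> ?; lra.
by rewrite ler_wpM2l// subr_ge0.
Qed.

(* With [M = truncn (expR (N * a))], [(1 - expR (- (N * y))) ^+ M] is close to
   [expR (- expR (N * (a - y)))], a smoothed indicator of [y > a]. *)
Lemma smooth_step (a d e : R) : 0 < d -> 0 < e ->
  exists (N : R) (M : nat), 0 < N /\ forall y, 0 <= y ->
    (y <= a - d -> (1 - expR (- (N * y))) ^+ M <= e) /\
    (a + d <= y -> 1 - e <= (1 - expR (- (N * y))) ^+ M).
Proof.
(* As N d = 1 / e, exp (- N d) is at most 1 / (1 + 1 / e), hence at most e. *)
move=> d0 e0; pose N := (d * e)^-1; have N0 : 0 < N by rewrite invr_gt0 mulr_gt0.
have Nd : expR (- (N * d)) <= e.
  rewrite expRN invf_ple ?posrE ?expR_gt0//.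
  apply: le_trans (expR_ge1Dx _).
  by rewrite /N invfM [_ * d]mulrC mulVKf ?gt_eqF// lerDr.
(* For a <= 0 the constant 1, obtained with exponent 0, will do: no y >= 0 satisfies y <= a - d. *)
have [a0|a0] := ltP 0 a; last first.
  exists N, 0%N; split => // y y0; rewrite expr0; split=> h; last by rewrite gerBl ltW.
  by exfalso; lra.
exists N, (Num.truncn (expR (N * a))); split => // y y0.
have /andP[M1 M2] := truncn_itv (expR_ge0 (N * a)).
set M := Num.truncn _ in M1 M2 *; set t := expR _.
have t0 : 0 < t by exact: expR_gt0.
have t1 : t <= 1 by rewrite -expR0 ler_expR oppr_le0 mulr_ge0// ltW.
have t01 : 0 <= t <= 1 by rewrite ltW.
split=> h.
  have := onem_expn_le M t01.
  have Mt : expR (N * d) <= 1 + M%:R * t.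
    have : expR (N * d) <= M.+1%:R * t.
      apply: (@le_trans _ _ (expR (N * a) * t)); last by rewrite ler_pM2r// ltW.
      rewrite -expRD ler_expR -mulrBr ler_pM2l//; lra.
    by rewrite -natr1 mulrDl mul1r; lra.
  have q0 : 0 < 1 + M%:R * t by apply: lt_le_trans Mt; exact: expR_gt0.
  rewrite -ler_pdivlMr// => H; apply: le_trans H _; apply: le_trans Nd.
  by rewrite div1r expRN lef_pV2 ?posrE ?expR_gt0.
apply: le_trans (onem_expn_ge M t01); rewrite lerD2l lerN2.
apply: le_trans Nd; apply: (@le_trans _ _ (expR (N * a) * t)).
  by rewrite ler_pM2r.
rewrite -expRD ler_expR -mulrN -mulrN -mulrDr ler_pM2l//; lra.
Qed.


Definition leb_ind (x y : R) : R := (y <= x)%R%:R.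

Lemma leb_ind_homo (x h y : R) : 0 <= h -> leb_ind x y <= leb_ind (x + h) y.
Proof.
move=> h0; rewrite /leb_ind; have [y1|y1] := leP y x; last exact: ler0n.
by rewrite (_ : y <= x + h)//; apply: le_trans y1 _; lra.
Qed.

Lemma smooth_step_ind (x h e : R) : 0 < h -> 0 < e ->
  exists (N : R) (M : nat), 0 < N /\ forall y, 0 <= y ->
    leb_ind x y <= 1 + e - (1 - expR (- (N * y))) ^+ M /\
    1 - e - leb_ind (x + h) y <= (1 - expR (- (N * y))) ^+ M.
Proof.
move=> h0 e0; have h2 : 0 < h / 2 by rewrite divr_gt0.
have [N [M [N0 H]]] := smooth_step (x + h / 2) h2 e0.
exists N, M; split => // y y0; have [H1 H2] := H y y0.
have s01 : 0 <= (1 - expR (- (N * y))) ^+ M <= 1.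
  have e1 : expR (- (N * y)) <= 1 by rewrite -expR0 ler_expR oppr_le0 mulr_ge0// ltW.
  by rewrite exprn_ge0 ?exprn_ile1 ?subr_ge0// gerBl expR_ge0.
rewrite /leb_ind; split.
  have [yx|yx] := leP y x; rewrite /= ?mulr1n ?mulr0n; last by lra.
  by have := H1; rewrite addrK => /(_ yx); lra.
have [yx|yx] := leP y (x + h); rewrite /= ?mulr1n ?mulr0n; first by lra.
have : x + h / 2 + h / 2 <= y by lra.
by move=> /H2; lra.
Qed.

(** The J's are integrals against the limit density and the E's expectations under [P]. The suffixes
    m, x, p refer to the indicators of y <= x - h, y <= x and y <= x + h, and 1, 2 to the two
    smoothed steps; [E] is the expectation of the indicator at x. *)
Lemma cdf_sandwich (e Jm Jx Jp J1 J2 E E1 E2 : R) :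
  Jp - Jm <= e / 4 -> 1 - e / 4 - Jp <= J1 -> J2 <= 1 + e / 4 - Jm ->
  Jm <= Jx -> Jx <= Jp -> E <= 1 + e / 4 - E1 -> 1 - e / 4 - E <= E2 ->
  `|J1 - E1| <= e / 4 -> `|J2 - E2| <= e / 4 -> `|Jx - E| <= e.
Proof. by rewrite !ler_norml => *; lra. Qed.

Section Density.
Context (d : measure_display) (T : measurableType d) (P : probability T R).
Variables (f : R -> R) (X : nat -> T -> R).
Hypotheses (mf : measurable_fun setT f) (f0 : forall x, 0 <= f x).
Hypotheses (fneg : forall x, x < 0 -> f x = 0).
Hypothesis (f1 : (\int[mu]_x (f x)%:E = 1)%E).
Hypothesis mX : forall n, measurable_fun setT (X n).
Hypothesis X0 : forall n w, 0 <= X n w.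

Let J (g : R -> R) : R := \int[mu]_x (g x * f x).
Let ji (g : R -> R) : Prop := mu.-integrable setT (EFin \o (fun x => g x * f x)).

Lemma density_intg : mu.-integrable setT (EFin \o f).
Proof.
apply/integrableP; split; first exact/measurable_EFinP.
under eq_integral do rewrite /= ger0_norm//.
by rewrite f1 ltry.
Qed.

Lemma density_bounded (g : R -> R) (C : R) : measurable_fun setT g ->
  (forall x, 0 <= x -> `|g x| <= C) -> ji g.
Proof.
move=> mg gC; rewrite /ji.
apply: le_integrable (integrableZl measurableT C density_intg) => //.
  by apply/measurable_EFinP; exact: measurable_funM.
move=> x _ /=; rewrite lee_fin !normrM.
have [x0|x0] := ltP x 0; first by rewrite fneg// normr0 !mulr0.
by rewrite ler_wpM2r// (le_trans (gC x x0))// ler_norm.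
Qed.

Lemma density_le g h : ji g -> ji h -> (forall x, 0 <= x -> g x <= h x) -> J g <= J h.
Proof.
move=> gi hi gh; apply: le_Rintegral => // x _.
have [x0|x0] := ltP x 0; first by rewrite fneg// !mulr0.
by rewrite ler_wpM2r// gh.
Qed.

Hypothesis lapX : forall l, 0 <= l ->
  ex P (fun w => expR (- (l * X n w))) @[n --> \oo] --> J (fun x => expR (- (l * x))).

(** The extra factor exp (- c N x) closes the family under the recursion [stepS]. Convergence of
    Laplace transforms then propagates to all powers by induction on [k], without a binomial
    expansion. *)
Let step (N : R) k c (x : R) : R :=
  (1 - expR (- (N * x))) ^+ k * expR (- (c%:R * N * x)).

Let mexp (l : R) : measurable_fun setT (fun x : R => expR (- (l * x))).
Proof. by apply: measurableT_comp => //; apply: measurableT_comp => //; exact: measurable_funM. Qed.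

Let mstep N k c : measurable_fun setT (step N k c).
Proof.
apply: measurable_funM; last exact: mexp.
by apply: measurable_funX; apply: measurable_funB => //; exact: mexp.
Qed.

Let step_bnd N k c x : 0 < N -> 0 <= x -> 0 <= step N k c x <= 1.
Proof.
move=> N0 x0.
have e01 (l : R) : 0 <= l -> 0 <= expR (- (l * x)) <= 1.
  by move=> l0; rewrite expR_ge0 -expR0 ler_expR oppr_le0 mulr_ge0.
have /andP[a0 a1] := e01 N (ltW N0).
have /andP[b0 b1] := e01 (c%:R * N) (mulr_ge0 (ler0n _ _) (ltW N0)).
rewrite /step mulr_ge0 ?exprn_ge0 ?subr_ge0//= mulr_ile1 ?exprn_ge0 ?subr_ge0//.
by rewrite exprn_ile1 ?subr_ge0// gerBl.
Qed.

Let step_norm N k c x : 0 < N -> 0 <= x -> `|step N k c x| <= 1.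
Proof. by move=> N0 x0; have /andP[? ?] := step_bnd k c N0 x0; rewrite ger0_norm. Qed.

Let stepS N k c x : step N k.+1 c x = step N k c x - step N k c.+1 x.
Proof.
rewrite /step exprSr (_ : c.+1%:R * N * x = c%:R * N * x + N * x); last first.
  by rewrite -natr1; ring.
by rewrite opprD expRD; ring.
Qed.

Let stepX_intg N k c n : 0 < N -> intg P (fun w => step N k c (X n w)).
Proof.
move=> N0; apply: (@intg_bounded _ _ _ _ _ 1) => [|w]; last by rewrite step_norm.
exact: measurableT_comp (mstep N k c) (mX n).
Qed.

Let step_cvg N k c : 0 < N ->
  ex P (fun w => step N k c (X n w)) @[n --> \oo] --> J (step N k c).
Proof.
move=> N0; elim: k c => [|k IH] c.
  have E0 x : step N 0 c x = expR (- (c%:R * N * x)) by rewrite /step expr0 mul1r.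
  have -> : step N 0 c = fun x => expR (- (c%:R * N * x)) by apply/funext.
  by apply: lapX; rewrite mulr_ge0// ltW.
have -> : J (step N k.+1 c) = J (step N k c) - J (step N k c.+1).
  rewrite /J -RintegralB//; last 2 first.
  - by apply: (density_bounded (mstep N k c)) => x x0; exact: (step_norm k c N0 x0).
  - by apply: (density_bounded (mstep N k c.+1)) => x x0; exact: (step_norm k c.+1 N0 x0).
  by apply: eq_Rintegral => x _; rewrite stepS mulrBl.
have -> : (fun n => ex P (fun w => step N k.+1 c (X n w))) =
    (fun n => ex P (fun w => step N k c (X n w)) - ex P (fun w => step N k c.+1 (X n w))).
  apply/funext => n; rewrite -exB; [|exact: stepX_intg|exact: stepX_intg].
  by congr (ex P _); apply/funext => w; rewrite stepS.
exact: cvgB.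
Qed.

Local Notation ind := leb_ind.

Let mind x : measurable_fun setT (ind x).
Proof.
have -> : ind x = \1_(`]-oo, x]%classic : set R).
  by apply/funext => y; rewrite indicE mem_setE in_itv/=.
exact: measurable_indic.
Qed.

Let ind_norm x y : `|ind x y| <= 1.
Proof. by rewrite /leb_ind; case: (y <= x); rewrite ?normr1 ?normr0. Qed.

Lemma ex_ind x n : ex P (fun w => ind x (X n w)) = fine (P (X n @^-1` `]-oo, x])).
Proof.
have mA : measurable (X n @^-1` `]-oo, x]).
  by rewrite -[_ @^-1` _]setTI; exact: mX.
rewrite /ex /Rintegral -[X in P X]setIT -(integral_indic P measurableT mA).
congr fine; apply: eq_integral => w _; rewrite indicE /leb_ind.
by congr ((nat_of_bool _)%:R%:E); apply/idP/idP; rewrite inE/= in_itv.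
Qed.

Lemma J_ind x : J (ind x) = fine (\int[mu]_(y in `]-oo, x]) (f y)%:E)%E.
Proof.
rewrite /J /Rintegral [in RHS]integral_mkcond; congr fine; apply: eq_integral => y _.
rewrite patchE mem_setE in_itv/= /leb_ind.
by case: ifP; rewrite (mul1r, mul0r).
Qed.

Let ji_ind x : ji (ind x).
Proof. by apply: (@density_bounded _ 1) => // y _; exact: ind_norm. Qed.

(** The limit law has a density: by absolute continuity of the integral, a short interval around x
    carries little mass. *)
Lemma J_ind_cont (x e : R) : 0 < e -> exists2 h, 0 < h & J (ind (x + h)) - J (ind (x - h)) <= e.
Proof.
move=> e0; have [b [b0 hb]] := integral_normr_continuous density_intg e0.
pose h := b / 4; have h0 : 0 < h by rewrite divr_gt0.
exists h => //.
pose A : set R := `](x - h), (x + h)]%classic.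
have mA : measurable A by exact: measurable_itv.
have Ab : (mu A < b%:E)%E.
  rewrite /A lebesgue_measure_itv/= lte_fin; case: ifP => _; last by rewrite lte_fin.
  by rewrite -EFinB lte_fin /h; lra.
apply: le_trans (ltW (hb _ mA Ab)).
rewrite /J -RintegralB//; [|exact: ji_ind|exact: ji_ind].
rewrite [leRHS]Rintegral_mkcond le_eqVlt; apply/orP; left; apply/eqP.
apply: eq_Rintegral => y _; rewrite patchE mem_setE in_itv/= /leb_ind -mulrBl ger0_norm//.
have [y1|y1] := leP y (x - h).
  have -> : y <= x + h by apply: le_trans y1 _; lra.
  by rewrite subrr mul0r.
by case: (y <= x + h); rewrite subr0 (mul1r, mul0r).
Qed.

Lemma J_cstB c g : ji g -> ji (fun y => c - g y) /\ J (fun y => c - g y) = c - J g.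
Proof.
move=> gi; have ci : mu.-integrable setT (EFin \o (fun x => c * f x)).
  exact: (integrableZl measurableT c density_intg).
have E : (fun x => (c - g x) * f x) = (fun x => c * f x - g x * f x).
  by apply/funext => x; rewrite mulrBl.
rewrite /ji /J E; split.
  by have := integrableB measurableT ci gi.
rewrite RintegralB//; congr (_ - _).
rewrite RintegralZl//; last exact: density_intg.
by rewrite /Rintegral f1 mulr1.
Qed.

Lemma cdf_limit (x : R) :
  P (X n @^-1` `]-oo, x]) @[n --> \oo] --> (\int[mu]_(y in `]-oo, x]) (f y)%:E)%E.
Proof.
have fin : (\int[mu]_(y in `]-oo, x]) (f y)%:E)%E \is a fin_num.
  apply: integrable_fin_num => //.
  by apply: integrableS density_intg.
rewrite -(fineK fin) -J_ind.
have -> : (fun n => P (X n @^-1` `]-oo, x])) = (fun n => (ex P (fun w => ind x (X n w)))%:E).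
  apply/funext => n; rewrite ex_ind fineK// fin_num_measure//.
  by rewrite -[_ @^-1` _]setTI; exact: mX.
apply: cvg_EFin; first by apply: nearW.
apply/cvgrPdist_le => e e0.
have e4 : 0 < e / 4 by rewrite divr_gt0.
have [h h0 hJ] := J_ind_cont x e4.
have [N [M [N0 hi]]] := smooth_step_ind x h0 e4.
have [N' [M' [N0' lo]]] := smooth_step_ind (x - h) h0 e4; rewrite subrK in lo.
have c1 := @step_cvg N M 0 N0; have c2 := @step_cvg N' M' 0 N0'.
have S0 (N1 : R) k y : step N1 k 0 y = (1 - expR (- (N1 * y))) ^+ k.
  by rewrite /step !mul0r oppr0 expR0 mulr1.
have intI n : intg P (fun w => ind x (X n w)).
  by apply: (@intg_bounded _ _ _ _ _ 1) => // ; exact: measurableT_comp (mind x) (mX n).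
have jst N1 k : 0 < N1 -> ji (step N1 k 0).
  by move=> ?; apply: (density_bounded (mstep N1 k 0)) => y y0; exact: step_norm.
have Jle1 : J (step N M 0) >= 1 - e / 4 - J (ind (x + h)).
  have [i1 <-] := J_cstB (1 - e / 4) (ji_ind (x + h)).
  by apply: density_le => // [|y y0]; [exact: jst|rewrite S0; case: (hi y y0)].
have Jle2 : J (step N' M' 0) <= 1 + e / 4 - J (ind (x - h)).
  have [i1 <-] := J_cstB (1 + e / 4) (ji_ind (x - h)).
  apply: density_le => // [|y y0]; first exact: jst.
  by rewrite S0 lerBrDr addrC -lerBrDr; case: (lo y y0).
have E1 n : ex P (fun w => ind x (X n w)) <= 1 + e / 4 - ex P (fun w => step N M 0 (X n w)).
  rewrite -[1 + e / 4](ex_cst P) -exB; [|exact: intg_cst|exact: stepX_intg].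
  apply: le_ex => //; first by apply: intgB; [exact: intg_cst|exact: stepX_intg].
  by move=> w; rewrite S0; case: (hi _ (X0 n w)).
have E2 n : 1 - e / 4 - ex P (fun w => ind x (X n w)) <= ex P (fun w => step N' M' 0 (X n w)).
  rewrite -[1 - e / 4](ex_cst P) -exB//; last exact: intg_cst.
  apply: le_ex => //; [|exact: stepX_intg|].
    by apply: intgB => //; exact: intg_cst.
  by move=> w; rewrite S0; case: (lo _ (X0 n w)).
have m1 : J (ind (x - h)) <= J (ind x).
  by apply: density_le => // y _; have := leb_ind_homo (x - h) y (ltW h0); rewrite subrK.
have m2 : J (ind x) <= J (ind (x + h)).
  by apply: density_le => // y _; exact: leb_ind_homo (ltW h0).
have /cvgrPdist_le/(_ _ e4) q1 := c1.
have /cvgrPdist_le/(_ _ e4) q2 := c2.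
apply: filterS2 q1 q2 => n n1 n2.
exact: cdf_sandwich hJ Jle1 Jle2 m1 m2 (E1 n) (E2 n) n1 n2.
Qed.

End Density.

End LaplaceCdf.

(** * Normal moments and Gaussian quadratic scores *)

Section NormalMoments.
Context (R : realType).
Local Notation mu := (@lebesgue_measure R).
Variable s : R.
Hypothesis s0 : 0 < s.
Local Notation nd := (normal_pdf 0 s).

Lemma normal_pdf_exp (r x : R) : 0 < r ->
  normal_pdf 0 r x = normal_peak r * expR (- ((2 * r ^+ 2)^-1 * x ^+ 2)).
Proof.
move=> r0; rewrite normal_pdfE ?gt_eqF// /normal_fun subr0.
by congr (_ * expR _); rewrite mulNr mulr_natl mulrC.
Qed.

Lemma is_derive_normal_pdf x : is_derive x (1 : R) nd (nd x * - (x / s ^+ 2)).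
Proof.
pose c := (2 * s ^+ 2)^-1.
have h1 : is_derive x (1 : R) (fun t : R => - (c * t ^+ 2)) (- (2 * c * x)).
  have h := is_derive_affine 0 (- c) (is_derive_sqr (is_derive_id x 1)).
  have -> : (fun t : R => - (c * t ^+ 2)) = (fun t => 0 + - c * t ^+ 2).
    by apply/funext => t; rewrite add0r mulNr.
  by apply: (is_derive_eq h); ring.
have h2 := is_derive1_comp (f := @expR R) (g := fun t : R => - (c * t ^+ 2)) (is_derive_expR _) h1.
have h3 := is_derive_affine 0 (normal_peak s) h2.
have -> : nd = (fun t => 0 + normal_peak s * (expR \o (fun t : R => - (c * t ^+ 2))) t).
  by apply/funext => t; rewrite add0r normal_pdf_exp.
apply: (is_derive_eq h3); rewrite add0r /GRing.scale /= /c; field.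
by rewrite gt_eqF.
Qed.

(** Domination by a multiple of the normal density of scale 2 s, which spends only a quarter of the
    exponent; part of the rest absorbs the power of x. *)
Lemma normal_pow_intg k : mu.-integrable setT (EFin \o (fun x => x ^+ k * nd x)).
Proof.
have s2 : 0 < 2 * s by rewrite mulr_gt0.
have p2 : 0 < normal_peak (2 * s) by rewrite normal_peak_gt0// gt_eqF.
have p1 : 0 < normal_peak s by rewrite normal_peak_gt0// gt_eqF.
have q0 : 0 <= 8 * s ^+ 2 by rewrite mulr_ge0// sqr_ge0.
pose C := 1 + (8 * s ^+ 2) ^+ k * k.+1%:R ^+ k.
pose K := normal_peak s * C / normal_peak (2 * s).
have Kn := integrableZl measurableT K (integrable_normal_pdf 0 (2 * s)).
apply: le_integrable Kn => //.
  apply/measurable_EFinP; apply: measurable_funM; last exact: measurable_normal_pdf.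
  exact: measurable_funX.
move=> x _ /=; rewrite lee_fin.
rewrite [leRHS]ger0_norm; last first.
  rewrite mulr_ge0 ?normal_pdf_ge0// /K divr_ge0 ?(ltW p2)// mulr_ge0 ?(ltW p1)//.
  by rewrite /C addr_ge0// mulr_ge0// exprn_ge0.
rewrite normrM (ger0_norm (normal_pdf_ge0 _ _ _)) !normal_pdf_exp//.
pose u := (2 * (2 * s) ^+ 2)^-1 * x ^+ 2.
have u0 : 0 <= u by rewrite mulr_ge0 ?sqr_ge0// invr_ge0 mulr_ge0 ?sqr_ge0.
have ux : x ^+ 2 = 8 * s ^+ 2 * u by rewrite /u; field; rewrite gt_eqF.
rewrite -/u (_ : (2 * s ^+ 2)^-1 * x ^+ 2 = 4 * u); last first.
  by rewrite ux; field; rewrite gt_eqF.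
have -> : K * (normal_peak (2 * s) * expR (- u)) = normal_peak s * (C * expR (- u)).
  by rewrite /K; field; rewrite gt_eqF.
rewrite mulrCA ler_pM2l//.
have e1 : expR (- (4 * u)) <= expR (- u) * expR (- u).
  by rewrite -expRD ler_expR; lra.
apply: (@le_trans _ _ (`|x ^+ k| * (expR (- u) * expR (- u)))).
  by apply: ler_wpM2l.
rewrite mulrA ler_wpM2r ?expR_ge0//.
have hx : `|x ^+ k| <= 1 + (x ^+ 2) ^+ k.
  rewrite exprAC; have := sqr_ge0 (`|x ^+ k| - 1).
  by rewrite -[(x ^+ k) ^+ 2]real_normK ?num_real//; nra.
apply: (@le_trans _ _ ((1 + (x ^+ 2) ^+ k) * expR (- u))).
  by rewrite ler_wpM2r ?expR_ge0.
rewrite ux exprMn mulrDl mul1r lerD//; first by rewrite -expR0 ler_expR oppr_le0.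
rewrite -mulrA; apply: ler_wpM2l; last exact: expR_pow_bound.
exact: exprn_ge0.
Qed.

Lemma is_derive_pow k x : is_derive x (1 : R) (fun t : R => t ^+ k) (k%:R * x ^+ k.-1).
Proof.
elim: k => [|k IH].
  have -> : (fun t : R => t ^+ 0) = cst 1 by apply/funext => t; rewrite expr0.
  by apply: (is_derive_eq (is_derive_cst (1 : R) x 1)); rewrite mul0r.
have -> : (fun t : R => t ^+ k.+1) = (fun t => t * t ^+ k).
  by apply/funext => t; rewrite exprS.
apply: (is_derive_eq (is_derive_mul (is_derive_id x 1) IH)) => /=.
by case: k {IH} => [|k] /=; rewrite ?expr0 ?exprS -?natr1; ring.
Qed.

Lemma normal_pow_decay k : exists C, forall x, 1 <= `|x| ->
  `|x ^+ k * nd x| <= C * `|x|^-1.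
Proof.
pose c := (2 * s ^+ 2)^-1.
have c0 : 0 < c by rewrite invr_gt0 mulr_gt0// exprn_gt0.
have p1 : 0 < normal_peak s by rewrite normal_peak_gt0// gt_eqF.
exists (normal_peak s * ((c ^+ k.+1)^-1 * k.+2%:R ^+ k.+1)) => x x1.
have x0 : 0 < `|x| by apply: lt_le_trans x1.
rewrite normrM (ger0_norm (normal_pdf_ge0 _ _ _)) normal_pdf_exp// -/c.
rewrite mulrCA -mulrA ler_pM2l// ler_pdivlMr//.
have u0 : 0 <= c * x ^+ 2 by rewrite mulr_ge0 ?sqr_ge0// ltW.
rewrite ler_pdivlMl ?exprn_gt0//; apply: le_trans (expR_pow_bound k.+1 u0).
rewrite [_ * expR _ * _]mulrAC mulrA; apply: ler_wpM2r; first exact: expR_ge0.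
rewrite exprMn ler_pM2l ?exprn_gt0//.
rewrite normrX -exprSr -[x ^+ 2]real_normK ?num_real// -exprM.
by rewrite ler_weXn2l// leq_pmull.
Qed.

Definition normal_moment k : R := \int[mu]_x (x ^+ k * nd x).

(* The integral over the line of the derivative of [x ^+ k * nd x] vanishes. *)
Lemma normal_moment_rec k :
  normal_moment k.+1 = s ^+ 2 * (k%:R * normal_moment k.-1).
Proof.
pose F x := x ^+ k * nd x.
pose F' x := k%:R * (x ^+ k.-1 * nd x) - (s ^+ 2)^-1 * (x ^+ k.+1 * nd x).
have dF x : is_derive x (1 : R) F (F' x).
  have h := is_derive_mul (is_derive_pow k x) (is_derive_normal_pdf x).
  apply: (is_derive_eq h); rewrite /F' (exprS x k).
  by move: (x ^+ k) (x ^+ k.-1) (nd x) => a b c; field; rewrite gt_eqF.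
have i1 : mu.-integrable setT (EFin \o (fun x => k%:R * (x ^+ k.-1 * nd x))).
  exact: (integrableZl measurableT k%:R (normal_pow_intg k.-1)).
have i2 : mu.-integrable setT (EFin \o (fun x => (s ^+ 2)^-1 * (x ^+ k.+1 * nd x))).
  exact: (integrableZl measurableT (s ^+ 2)^-1 (normal_pow_intg k.+1)).
have iF : mu.-integrable setT (EFin \o F').
  exact: (integrableB measurableT i1 i2).
have ndc : continuous nd by apply: continuous_normal_pdf; rewrite gt_eqF.
have F'c : continuous F'.
  move=> x; apply: cvgB; apply: cvgM; try exact: cvg_cst.
  - by apply: cvgM; [exact: exprn_continuous|exact: ndc].
  - by apply: cvgM; [exact: exprn_continuous|exact: ndc].
have Fc : continuous F.
  by move=> x; apply: cvgM; [exact: exprn_continuous|exact: ndc].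
suff : \int[mu]_x F' x = 0.
  rewrite RintegralB// RintegralZl//; last exact: normal_pow_intg.
  rewrite RintegralZl//; last exact: normal_pow_intg.
  rewrite -!/(normal_moment _) => /eqP; rewrite subr_eq0 => /eqP ->.
  by rewrite mulVKf// gt_eqF ?exprn_gt0.
pose A n : set R := `[- n.+1%:R, n.+1%:R]%classic.
have H n : (\int[mu]_x ((F' \_ (A n)) x)%:E)%E = (F n.+1%:R - F (- n.+1%:R))%:E.
  transitivity (\int[mu]_(x in A n) (F' x)%:E)%E.
    rewrite [RHS]integral_mkcond; apply: eq_integral => x _.
    by rewrite !patchE; case: ifP.
  rewrite /A (@continuous_FTC2 _ F' F)//.
  - by rewrite (@lt_trans _ _ 0) ?oppr_lt0 ?ltr0n.
  - by apply: continuous_subspaceT => x; exact: F'c.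
  - split.
    + by move=> x _; have := dF x; case.
    + exact/cvg_at_right_filter/Fc.
    + exact/cvg_at_left_filter/Fc.
  - by move=> x _; rewrite derive1E; have := dF x; case.
have mF' : measurable_fun setT F' by apply/measurable_EFinP; exact: measurable_int iF.
have mr n : measurable_fun setT (fun x => ((F' \_ (A n)) x)%:E).
  apply/measurable_EFinP; apply/(measurable_restrictT F'); first exact: measurable_itv.
  exact: measurable_funTS.
have cr : {ae mu, forall x, setT x -> (fun n => ((F' \_ (A n)) x)%:E) @ \oo --> (EFin \o F') x}.
  apply: aeW => x _; apply: cvg_near_cst; near=> n.
  rewrite patchE ifT// inE /A/= in_itv/= -ler_norml.
  near: n; exists (Num.truncn `|x|) => // n /= hn.
  apply: (@le_trans _ _ (Num.truncn `|x|).+1%:R); first by rewrite ltW// truncnS_gt.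
  by rewrite ler_nat ltnS.
have br : {ae mu, forall x n, setT x -> (`|((F' \_ (A n)) x)%:E| <= (abse \o (EFin \o F')) x)%E}.
  apply: aeW => x n _ /=; rewrite lee_fin patchE.
  by case: ifP; rewrite // normr0.
have [_ _ dc] := @dominated_convergence _ _ _ mu setT measurableT _ _ _ mr (measurable_int _ iF) cr (integrable_abse iF) br.
have {dc} : (fun n => (F n.+1%:R - F (- n.+1%:R))%:E) @ \oo --> (\int[mu]_x F' x)%:E.
  have -> : ((\int[mu]_x F' x)%:E = \int[mu]_x (F' x)%:E)%E.
    by rewrite /Rintegral fineK// integrable_fin_num.
  by under eq_fun do rewrite -H.
move=> /fine_cvgP[_ /= c1].
have c2 : (fun n => F n.+1%:R - F (- n.+1%:R)) @ \oo --> (0 : R).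
  have [C hC] := normal_pow_decay k.
  apply: (@squeeze_cvgr _ _ _ _ (fun n => - (2 * C * n.+1%:R^-1)) (fun n => 2 * C * n.+1%:R^-1)).
  - apply: nearW => n; rewrite -ler_norml.
    apply: le_trans (ler_normB _ _) _.
    have n1 : 1 <= `|n.+1%:R : R| by rewrite normr_nat ler1n.
    have := hC n.+1%:R n1; have := hC (- n.+1%:R); rewrite normrN => /(_ n1).
    by rewrite normr_nat -/(F _) -/(F _) -mulrA mulrDl !mul1r; exact: (fun h1 h2 => lerD h2 h1).
  - rewrite -oppr0 -[X in - X](mulr0 (2 * C)); apply: cvgN; apply: cvgM; first exact: cvg_cst.
    exact: cvg_harmonic.
  - rewrite -[X in _ --> X](mulr0 (2 * C)); apply: cvgM; first exact: cvg_cst.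
    exact: cvg_harmonic.
exact: (cvg_unique _ c1 c2).
Unshelve. all: by end_near. Qed.


(** The Radon-Nikodym derivative of the normal law equals the explicit density almost everywhere,
    since both have the same integral over every measurable set. *)
Lemma normal_ge0_integral (g : R -> R) : measurable_fun setT g -> (forall x, 0 <= g x) ->
  (\int[normal_prob 0 s]_x (g x)%:E = \int[mu]_x (g x * nd x)%:E)%E.
Proof.
move=> mg g0; have dom := normal_prob_dominates 0 s.
rewrite -(Radon_Nikodym_SigmaFinite.change_of_variables dom)//; last first.
  exact/measurable_EFinP.
have mnd : measurable_fun setT (fun x => (nd x)%:E).
  by apply/measurable_EFinP; exact: measurable_normal_pdf.
have RNi := Radon_Nikodym_SigmaFinite.f_integrable dom.
under [RHS]eq_integral do rewrite EFinM.
have mgE : measurable_fun setT (fun x => (g x)%:E) by exact/measurable_EFinP.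
apply: ae_eq_integral => //.
- by apply: emeasurable_funM => //; exact: measurable_int RNi.
- exact: emeasurable_funM.
apply: ae_eqe_mul2l; apply: integral_ae_eq => // E _ mE.
by rewrite -Radon_Nikodym_SigmaFinite.f_integral.
Qed.

Section NormalLaw.
Context (d : measure_display) (T : measurableType d) (P : probability T R).
Variable X : T -> R.
Hypothesis mX : measurable_fun setT X.
Hypothesis lawX : forall A : set R, measurable A -> P (X @^-1` A) = normal_prob 0 s A.

Lemma normal_law_ge0 (g : R -> R) : measurable_fun setT g -> (forall x, 0 <= g x) ->
  (\int[P]_w (g (X w))%:E = \int[mu]_x (g x * nd x)%:E)%E.
Proof.
move=> mg g0; rewrite -normal_ge0_integral//.
have mX' : measurable_fun setT (X : T -> measurableTypeR R) by [].
pose X' : {mfun T >-> measurableTypeR R} :=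
  HB.pack (X : T -> measurableTypeR R) (isMeasurableFun.Build _ _ _ _ _ mX').
transitivity (\int[distribution P X']_x (g x)%:E)%E.
  rewrite ge0_integral_pushforward//; first exact/measurable_EFinP.
  by move=> x _; rewrite lee_fin.
rewrite (@eq_measure_integral _ _ _ setT (normal_prob 0 s) (distribution P X'))// => A mA _.
exact: (lawX mA).
Qed.

Lemma normal_law_intg (g : R -> R) : measurable_fun setT g ->
  mu.-integrable setT (EFin \o (fun x => g x * nd x)) -> intg P (fun w => g (X w)).
Proof.
move=> mg gi; apply/integrableP; split.
  by apply/measurable_EFinP; exact: measurableT_comp mg mX.
under eq_integral do rewrite /= -/(abse (g _)%:E).
have ma : measurable_fun setT (fun x => `|g x|) by exact: measurableT_comp.
rewrite (normal_law_ge0 ma) => [|x]; last exact: normr_ge0.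
have := integrableP _ _ _ gi => -[_]; congr (_ < _)%E.
by apply: eq_integral => x _ /=; rewrite normrM (ger0_norm (normal_pdf_ge0 _ _ _)).
Qed.

Lemma normal_law_ex (g : R -> R) : measurable_fun setT g ->
  mu.-integrable setT (EFin \o (fun x => g x * nd x)) ->
  ex P (fun w => g (X w)) = \int[mu]_x (g x * nd x).
Proof.
move=> mg gi.
have ma : measurable_fun setT (fun x => `|g x|) by exact: measurableT_comp.
have ai : mu.-integrable setT (EFin \o (fun x => `|g x| * nd x)).
  have := integrable_norm gi; congr (_.-integrable _ (EFin \o _)); apply/funext => x /=.
  by rewrite normrM (ger0_norm (normal_pdf_ge0 _ _ _)).
have E (h : R -> R) : measurable_fun setT h -> (forall x, 0 <= h x) ->
    ex P (fun w => h (X w)) = \int[mu]_x (h x * nd x).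
  by move=> mh h0; rewrite /ex /Rintegral normal_law_ge0.
have xa := normal_law_intg ma ai; have xg := normal_law_intg mg gi.
(* Only nonnegative functions are covered so far; g is the difference of g + |g| and |g|. *)
have := E (fun x => g x + `|g x|) (measurable_funD mg ma) _.
rewrite exD//.
under eq_Rintegral do rewrite mulrDl.
rewrite RintegralD// -(E _ ma)//.
by move=> H; apply: (@addIr _ (ex P (fun w => `|g (X w)|))); apply: H => x; have := ler_norm (- g x); rewrite normrN; lra.
Qed.

Lemma normal_law_pow k : intg P (fun w => X w ^+ k) /\
  ex P (fun w => X w ^+ k) = normal_moment k.
Proof.
have mk : measurable_fun setT (fun x : R => x ^+ k) by exact: measurable_funX.
by split; [exact: (normal_law_intg mk (normal_pow_intg k))|
           exact: (normal_law_ex mk (normal_pow_intg k))].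
Qed.

Lemma normal_moment0 : normal_moment 0 = 1.
Proof. by have [_ <-] := normal_law_pow 0; under eq_fun do rewrite expr0; exact: ex_cst. Qed.

End NormalLaw.

End NormalMoments.

Section SigmaMeasurableOps.
Context (d : measure_display) (T : measurableType d) (R : realType).
Variable G : set_system T.
Implicit Types U V : T -> R.

Lemma smeas_cst (r : R) : smeas G (fun=> r).
Proof. exact: measurable_cst. Qed.

Lemma smeasB U V : smeas G U -> smeas G V -> smeas G (fun w => U w - V w).
Proof. exact: measurable_funB. Qed.

Lemma smeasM U V : smeas G U -> smeas G V -> smeas G (fun w => U w * V w).
Proof. exact: measurable_funM. Qed.

Lemma smeas_sum (I : finType) (F : I -> T -> R) :
  (forall i, smeas G (F i)) -> smeas G (fun w => \sum_i F i w).
Proof. by move=> h; apply: measurable_sum. Qed.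

End SigmaMeasurableOps.

Section Wick.
Context (d : measure_display) (T : measurableType d) (R : realType).
Variable P : probability T R.
Variables (I : finType) (X : I -> T -> R) (s : R).
Hypothesis s0 : 0 < s.
Hypothesis mX : forall i, measurable_fun setT (X i).
Hypothesis indX : forall E : I -> set R, (forall i, measurable (E i)) ->
  fine (P (\bigcap_i (X i @^-1` E i))) = \prod_i fine (P (X i @^-1` E i)).
Hypothesis lawX : forall i (A : set R), measurable A ->
  P (X i @^-1` A) = normal_prob 0 s A.

Definition stdn (i : I) (w : T) : R := s^-1 * X i w.
Local Notation Z := stdn.

Lemma stdn_meas i : measurable_fun setT (Z i).
Proof. exact: measurable_funM. Qed.

Lemma stdn_smeas (J : pred I) i : J i -> smeas (cyl X J) (Z i).
Proof. by move=> Ji; apply: smeasM; [exact: smeas_cst|exact: smeas_cyl]. Qed.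

Lemma stdn_pow i k : intg P (fun w => Z i w ^+ k) /\
  ex P (fun w => Z i w ^+ k) = s^-1 ^+ k * normal_moment s k.
Proof.
have [h1 h2] := normal_law_pow s0 (mX i) (@lawX i) k.
have -> : (fun w => Z i w ^+ k) = (fun w => s^-1 ^+ k * X i w ^+ k).
  by apply/funext => w; rewrite exprMn.
by rewrite exZ// h2; split=> //; exact: intgZ.
Qed.

Lemma stdn_moments i : [/\ ex P (Z i) = 0, ex P (fun w => Z i w ^+ 2) = 1,
  ex P (fun w => Z i w ^+ 4) = 3 & ex P (fun w => Z i w ^+ 6) = 15].
Proof.
have m0 := normal_moment0 s0 (mX i) (@lawX i).
have m1 : normal_moment s 1 = 0 by rewrite normal_moment_rec// mul0r mulr0.
have m2 : normal_moment s 2 = s ^+ 2 by rewrite normal_moment_rec//= m0 !mulr1.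
have m4 : normal_moment s 4 = 3 * s ^+ 4 by rewrite normal_moment_rec//= m2; ring.
have m6 : normal_moment s 6 = 15 * s ^+ 6 by rewrite normal_moment_rec//= m4; ring.
have E k : ex P (fun w => Z i w ^+ k) = s^-1 ^+ k * normal_moment s k by case: (stdn_pow i k).
have sn0 : s != 0 by rewrite gt_eqF.
rewrite !E m2 m4 m6; split; try by field.
have -> : Z i = fun w => Z i w ^+ 1 by apply/funext => w; rewrite expr1.
by rewrite E m1 mulr0.
Qed.

Lemma stdn_intg2 i j : intg P (fun w => Z i w * Z j w).
Proof.
have h k : intg P (fun w => Z k w ^+ 2) by case: (stdn_pow k 2).
by apply: intgM => //; exact: stdn_meas.
Qed.

Lemma stdn_intg22 i j : intg P (fun w => (Z i w * Z j w) ^+ 2).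
Proof.
have [i4 _] := stdn_pow i 4; have [j4 _] := stdn_pow j 4.
apply: (le_intg _ _ (intgD i4 j4)).
  by apply: measurable_funX; apply: measurable_funM; exact: stdn_meas.
move=> w; rewrite ger0_norm ?sqr_ge0//.
have := sqr_ge0 (Z i w ^+ 2 - Z j w ^+ 2).
have : 0 <= (Z i w * Z j w) ^+ 2 by exact: sqr_ge0.
by move: (Z i w) (Z j w) => a b; rewrite sqrrB -!exprM !exprMn; lra.
Qed.

Lemma stdn_intg4 i j k l : intg P (fun w => Z i w * Z j w * (Z k w * Z l w)).
Proof.
apply: intgM; [| |exact: stdn_intg22|exact: stdn_intg22];
  by apply: measurable_funM; exact: stdn_meas.
Qed.

Lemma stdn_intg3 i j k : intg P (fun w => Z i w * (Z j w * Z k w)).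
Proof.
apply: intgM; [exact: stdn_meas| | |exact: stdn_intg22].
  by apply: measurable_funM; exact: stdn_meas.
by case: (stdn_pow i 2).
Qed.

Lemma stdn_split i (V : T -> R) U : smeas (cyl X (pred1 i)) U -> smeas (cyl X (predC (pred1 i))) V ->
  intg P U -> intg P V -> ex P (fun w => U w * V w) = ex P U * ex P V.
Proof.
move=> hU hV iU iV; have := @ex_mul_smeas _ _ _ P _ _ U V (cyl_indep mX indX (J := pred1 i)) hU hV iU iV.
by case.
Qed.

(** An index that occurs only once factors out by independence, with mean 0. *)
Lemma stdn_single i j k l : i != j -> i != k -> i != l ->
  ex P (fun w => Z i w * (Z j w * (Z k w * Z l w))) = 0.
Proof.
move=> ij ik il; have [m1 _ _ _] := stdn_moments i.
rewrite (stdn_split (i := i) (U := Z i)) ?m1 ?mul0r//.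
- by apply: stdn_smeas => /=.
- by apply: smeasM; [|apply: smeasM]; apply: stdn_smeas; rewrite /= eq_sym.
- by case: (stdn_pow i 1) => h _; move: h; under eq_fun do rewrite expr1.
- exact: stdn_intg3.
Qed.

Lemma stdn_cov2 i j : ex P (fun w => Z i w * Z j w) = (i == j)%:R.
Proof.
have [m1 m2 _ _] := stdn_moments i.
have i1 k : intg P (Z k) by case: (stdn_pow k 1) => h _; move: h; under eq_fun do rewrite expr1.
case: eqVneq => [<-|ij]; first by under eq_fun do rewrite -expr2; exact: m2.
rewrite (stdn_split (i := i) (U := Z i)) ?m1 ?mul0r//.
  by apply: stdn_smeas => /=.
by apply: stdn_smeas; rewrite /= eq_sym.
Qed.

Lemma stdn_pair i k : i != k -> ex P (fun w => Z i w ^+ 2 * Z k w ^+ 2) = 1.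
Proof.
move=> ik; have [_ m2 _ _] := stdn_moments i; have [_ m2' _ _] := stdn_moments k.
rewrite (stdn_split (i := i) (U := fun w => Z i w ^+ 2)) ?m2 ?m2' ?mul1r//.
- by under eq_fun do rewrite expr2; apply: smeasM; apply: stdn_smeas => /=.
- by under eq_fun do rewrite expr2; apply: smeasM; apply: stdn_smeas; rewrite /= eq_sym.
- by case: (stdn_pow i 2).
- by case: (stdn_pow k 2).
Qed.

(** Isserlis' formula. The proof runs through the coincidence patterns of the indices: those with an
    isolated index vanish, two distinct pairs give 1, and four equal indices give the fourth moment
    3. *)
Lemma wick i j k l : ex P (fun w => Z i w * Z j w * (Z k w * Z l w)) =
  (i == j)%:R * (k == l)%:R + (i == k)%:R * (j == l)%:R + (i == l)%:R * (j == k)%:R.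
Proof.
have re F G : (forall w, F w = G w) -> ex P F = ex P G.
  by move=> h; congr (ex P _); apply/funext.
have single F a b c e : a != b -> a != c -> a != e ->
    (forall w, F w = Z a w * (Z b w * (Z c w * Z e w))) -> ex P F = 0.
  by move=> h1 h2 h3 /re ->; exact: stdn_single.
have pair F a b : a != b -> (forall w, F w = Z a w ^+ 2 * Z b w ^+ 2) -> ex P F = 1.
  by move=> h1 /re ->; exact: stdn_pair.
have quad F a : (forall w, F w = Z a w ^+ 4) -> ex P F = 3.
  by move=> /re ->; have [] := stdn_moments a.
have tE : true%:R = 1 :> R by [].
have fE : false%:R = 0 :> R by [].
have [<-{j}|ij] := eqVneq i j.
  have [<-{l}|kl] := eqVneq k l.
    have [<-{k}|ik] := eqVneq i k.
      by transitivity (3 : R); [apply: (quad _ i) => // w; ring|rewrite ?tE; ring].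
    transitivity (1 : R); first by apply: (pair _ i k) => // w; ring.
    by rewrite ?tE ?fE; ring.
  have [ik|ik] := eqVneq i k.
    have li : l != i by rewrite eq_sym ik.
    transitivity (0 : R); first by apply: (single _ l i i i) => // w; rewrite -ik; ring.
    by rewrite [i == l]eq_sym (negbTE li) fE; ring.
  have ki : k != i by rewrite eq_sym.
  transitivity (0 : R); first by apply: (single _ k i i l) => // w; ring.
  by rewrite ?fE; ring.
have ji : j != i by rewrite eq_sym.
have [ik|ik] := eqVneq i k.
  have [<-{l}|jl] := eqVneq j l.
    transitivity (1 : R); first by apply: (pair _ i j) => // w; rewrite -ik; ring.
    by rewrite -?ik ?(negbTE ij) ?(negbTE ji) ?tE ?fE; ring.
  transitivity (0 : R); first by apply: (single _ j i i l) => // w; rewrite -ik; ring.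
  by rewrite -?ik (negbTE ji) fE; ring.
have [il|il] := eqVneq i l.
  have [jk|jk] := eqVneq j k.
    transitivity (1 : R); first by apply: (pair _ i j) => // w; rewrite -il -jk; ring.
    by rewrite -?il -?jk ?(negbTE ji) ?(negbTE ij) ?tE ?fE; ring.
  transitivity (0 : R); first by apply: (single _ j i i k) => // w; rewrite -il; ring.
  by rewrite -?il ?(negbTE ji) ?fE; ring.
transitivity (0 : R); first by apply: (single _ i j k l) => // w; ring.
by rewrite ?fE; ring.
Qed.

End Wick.

(** * The orthogonal projector onto symmetric matrices *)

Section SymProjector.
Context (R : realType) (p : nat).
Implicit Types A : 'M[R]_p.

Definition sym_proj : 'M[R]_(p * p) := 2^-1 *: (1%:M + lin_mx (@trmx R p p)).
Local Notation Ps := sym_proj.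

Lemma mxvec_sym_proj A : mxvec A *m Ps = 2^-1 *: mxvec (A + A^T).
Proof.
rewrite -scalemxAr mulmxDr mulmx1 mul_vec_lin.
by congr (_ *: _); rewrite [RHS]linearD.
Qed.

Lemma mxvec_sym_id A : A^T = A -> mxvec A *m Ps = mxvec A.
Proof.
move=> At; rewrite mxvec_sym_proj At linearD /=; apply/rowP => k; rewrite [LHS]mxE [X in _ * X]mxE.
by field.
Qed.

Lemma sym_projE a b c e : Ps (mxvec_index a b) (mxvec_index c e) =
  2^-1 * (((a == c) && (b == e))%:R + ((a == e) && (b == c))%:R).
Proof.
have -> : Ps (mxvec_index a b) (mxvec_index c e) =
    (mxvec (delta_mx a b) *m Ps) 0 (mxvec_index c e).
  rewrite mxvec_delta -rowE.
  by rewrite [RHS]mxE.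
rewrite mxvec_sym_proj mxE mxvecE !mxE.
by rewrite ![c == _]eq_sym ![e == _]eq_sym.
Qed.

Lemma tr_sym_proj : Ps^T = Ps.
Proof.
apply/matrixP => i j; case/mxvec_indexP: i => a b; case/mxvec_indexP: j => c e.
rewrite mxE !sym_projE ![c == _]eq_sym ![e == _]eq_sym.
by rewrite [(b == c) && _]andbC.
Qed.

Lemma sum_mxvec (f : 'I_(p * p) -> R) : \sum_k f k = \sum_a \sum_b f (mxvec_index a b).
Proof.
rewrite pair_bigA /= (reindex _ (curry_mxvec_bij p p)) /=.
by apply: eq_bigr => -[a b] _.
Qed.

Lemma trace_sym_proj : \tr Ps = (p * p.+1)%:R / 2.
Proof.
rewrite /mxtrace sum_mxvec.
under eq_bigr => a _ do under eq_bigr => b _ do rewrite sym_projE !eqxx /=.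
under eq_bigr => a _ do rewrite -mulr_sumr big_split /= sumr_const card_ord.
rewrite -mulr_sumr big_split /= sumr_const card_ord.
have -> : \sum_(a < p) \sum_(b < p) ((a == b) && (b == a))%:R = p%:R :> R.
  rewrite -[in RHS](card_ord p) -sum1_card natr_sum; apply: eq_bigr => a _.
  rewrite (bigD1 a)//= eqxx big1 ?addr0// => b ba.
  by rewrite (negbTE ba) andbF.
by rewrite -mulrnA -natrD mulnS addnC mulrC.
Qed.

End SymProjector.

Lemma cube_add (R : realType) (a b : R) : 0 <= a -> 0 <= b -> (a + b) ^+ 3 <= 4 * (a ^+ 3 + b ^+ 3).
Proof.
move=> a0 b0; rewrite -subr_ge0.
have -> : 4 * (a ^+ 3 + b ^+ 3) - (a + b) ^+ 3 = 3 * ((a + b) * (a - b) ^+ 2) by ring.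
by rewrite mulr_ge0// mulr_ge0 ?addr_ge0 ?sqr_ge0.
Qed.

Lemma sum_cube (R : realType) (I : Type) (r : seq I) (b : I -> R) : (forall i, 0 <= b i) ->
  (\sum_(i <- r) b i) ^+ 3 <= 4 ^+ size r * \sum_(i <- r) b i ^+ 3.
Proof.
move=> b0; elim: r => [|i r IH]; first by rewrite !big_nil mulr0 expr0n.
rewrite !big_cons; apply: le_trans (cube_add (b0 i) (sumr_ge0 _ (fun j _ => b0 j))) _.
rewrite /= (exprS 4) -mulrA ler_pM2l// mulrDr lerD//.
by rewrite ler_peMl ?exprn_ge0// exprn_ege1// ler1n.
Qed.

Section GaussArray.
Context (d : measure_display) (T : measurableType d) (R : realType).
Variable P : probability T R.
Variables (p n : nat) (C : finType) (X : 'I_n * C -> T -> R) (s : R).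
Hypothesis s0 : 0 < s.
Hypothesis mX : forall i, measurable_fun setT (X i).
Hypothesis indX : forall E : 'I_n * C -> set R, (forall i, measurable (E i)) ->
  fine (P (\bigcap_i (X i @^-1` E i))) = \prod_i fine (P (X i @^-1` E i)).
Hypothesis lawX : forall i (A : set R), measurable A ->
  P (X i @^-1` A) = normal_prob 0 s A.
Variable o : 'I_p -> C -> R.
Hypothesis oo : forall a b, \sum_c o a c * o b c = (a == b)%:R.
Local Notation Z := (stdn X s).

(** The rows of [o] are orthonormal, so this is a standard Gaussian vector. Its law is never
    identified: the moments needed are computed by expanding in the independent coordinates [Z]. *)
Definition gvec (i : 'I_n) (w : T) : 'cV[R]_p := \col_a \sum_c o a c * Z (i, c) w.

Definition gmat (i : 'I_n) (w : T) : 'M[R]_p := gvec i w *m (gvec i w)^T - 1%:M.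

Lemma gmatE i w a b : gmat i w a b =
  \sum_c \sum_e o a c * o b e * (Z (i, c) w * Z (i, e) w - (c == e)%:R).
Proof.
rewrite /gmat !mxE big_ord1 !mxE -(oo a b).
rewrite big_distrlr /= -sumrB; apply: eq_bigr => c _.
have -> : o a c * o b c = \sum_e o a c * o b e * (c == e)%:R.
  rewrite (bigD1 c)//= eqxx mulr1 big1 ?addr0// => e ec.
  by rewrite eq_sym (negbTE ec) mulr0.
by rewrite -sumrB; apply: eq_bigr => e _; ring.
Qed.

Lemma gmat_sym i w : (gmat i w)^T = gmat i w.
Proof. by rewrite /gmat linearB /= trmx_mul trmxK trmx1. Qed.

Let W (i : 'I_n) (ce : C * C) (w : T) : R :=
  Z (i, ce.1) w * Z (i, ce.2) w - (ce.1 == ce.2)%:R.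

Let Wi i x : intg P (W i x).
Proof. by apply: intgB; [exact: stdn_intg2|exact: intg_cst]. Qed.

Let Wm i x : ex P (W i x) = 0.
Proof.
rewrite exB; [|exact: stdn_intg2|exact: intg_cst].
rewrite (stdn_cov2 s0 mX indX lawX) ex_cst /= xpair_eqE eqxx /=.
by rewrite subrr.
Qed.

Let WW i x y : intg P (fun w => W i x w * W i y w) /\
  ex P (fun w => W i x w * W i y w) =
   (x.1 == y.1)%:R * (x.2 == y.2)%:R + (x.1 == y.2)%:R * (x.2 == y.1)%:R.
Proof.
pose Q4 w := Z (i, x.1) w * Z (i, x.2) w * (Z (i, y.1) w * Z (i, y.2) w).
have i4 : intg P Q4 by exact: (stdn_intg4 s0 mX lawX).
have i2 a b : intg P (fun w => Z (i, a) w * Z (i, b) w) by exact: (stdn_intg2 s0 mX lawX).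
have E : (fun w => W i x w * W i y w) = (fun w => Q4 w -
   ((y.1 == y.2)%:R * (Z (i, x.1) w * Z (i, x.2) w) +
    ((x.1 == x.2)%:R * (Z (i, y.1) w * Z (i, y.2) w) - (x.1 == x.2)%:R * (y.1 == y.2)%:R))).
  by apply/funext => w; rewrite /W /Q4; ring.
rewrite E.
have j1 := intgZ ((y.1 == y.2)%:R) (i2 x.1 x.2).
have j2 := intgZ ((x.1 == x.2)%:R) (i2 y.1 y.2).
have j3 := intgB j2 (intg_cst P ((x.1 == x.2)%:R * (y.1 == y.2)%:R)).
have j4 := intgD j1 j3.
split; first exact: intgB.
rewrite exB// exD// exB//; last exact: intg_cst.
rewrite ex_cst !exZ// /Q4 (wick s0 mX indX lawX).
by rewrite !(stdn_cov2 s0 mX indX lawX) !xpair_eqE !eqxx /=; ring.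
Qed.

(* Normalised so that the covariance is the projector onto symmetric matrices. *)
Definition uvec (i : 'I_n) (w : T) : 'rV[R]_(p * p) :=
  (Num.sqrt 2)^-1 *: mxvec (gmat i w).

Lemma gmat_pair i w a b : gmat i w a b = \sum_ce o a ce.1 * o b ce.2 * W i ce w.
Proof. by rewrite gmatE pair_bigA. Qed.

Let gE i a b :
  (fun w => gmat i w a b) = (fun w => \sum_ce o a ce.1 * o b ce.2 * W i ce w).
Proof. by apply/funext => w; exact: gmat_pair. Qed.

Let gi i a b : intg P (fun w => gmat i w a b).
Proof. by rewrite gE; apply: intg_sum => c; apply: intgZ; exact: Wi. Qed.

Lemma uvecE i w a b : uvec i w 0 (mxvec_index a b) = (Num.sqrt 2)^-1 * gmat i w a b.
Proof. by rewrite mxE mxvecE. Qed.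

Lemma gmat_mean i a b : ex P (fun w => gmat i w a b) = 0.
Proof.
rewrite gE ex_sum => [|ce]; last by apply: intgZ; exact: Wi.
by rewrite big1// => ce _; rewrite exZ ?Wm ?mulr0//; exact: Wi.
Qed.

Lemma gmat_cov i a b a' b' :
  intg P (fun w => gmat i w a b * gmat i w a' b') /\
  ex P (fun w => gmat i w a b * gmat i w a' b') =
    (a == a')%:R * (b == b')%:R + (a == b')%:R * (b == a')%:R.
Proof.
have E : (fun w => gmat i w a b * gmat i w a' b') = (fun w =>
    \sum_x \sum_y (o a x.1 * o b x.2 * (o a' y.1 * o b' y.2)) * (W i x w * W i y w)).
  apply/funext => w; rewrite !gmat_pair big_distrlr /=; apply: eq_bigr => x _.
  by apply: eq_bigr => y _; ring.
have I1 x y : intg P (fun w => (o a x.1 * o b x.2 * (o a' y.1 * o b' y.2)) * (W i x w * W i y w)).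
  by apply: intgZ; case: (WW i x y).
rewrite E; split; first by apply: intg_sum => x; exact: intg_sum.
rewrite ex_sum => [|x]; last exact: intg_sum.
under eq_bigr => x _ do rewrite ex_sum//.
have J1 x y : ex P (fun w => (o a x.1 * o b x.2 * (o a' y.1 * o b' y.2)) * (W i x w * W i y w)) =
    (o a x.1 * o b x.2 * (o a' y.1 * o b' y.2)) *
    ((x.1 == y.1)%:R * (x.2 == y.2)%:R + (x.1 == y.2)%:R * (x.2 == y.1)%:R).
  by case: (WW i x y) => h <-; exact: exZ.
under eq_bigr => x _ do under eq_bigr => y _ do rewrite J1.
pose h (x y : C * C) := o a x.1 * o b x.2 * (o a' y.1 * o b' y.2).
have pick x z : \sum_y (y == z)%:R * h x y = h x z.
  rewrite (bigD1 z)//= eqxx mul1r big1 ?addr0// => y /negbTE ->.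
  by rewrite mul0r.
(* For a given pair x, the fourth moments leave two partners y: x itself and x with its indices
   exchanged. *)
have inner x : \sum_y o a x.1 * o b x.2 * (o a' y.1 * o b' y.2) *
    ((x.1 == y.1)%:R * (x.2 == y.2)%:R + (x.1 == y.2)%:R * (x.2 == y.1)%:R) =
    h x x + h x (x.2, x.1).
  rewrite -!pick -big_split /=; apply: eq_bigr => y _.
  rewrite /h; case: x y => x1 x2 [y1 y2] /=; rewrite !xpair_eqE.
  rewrite ![y1 == _]eq_sym ![y2 == _]eq_sym.
  by case: (x1 == y1); case: (x2 == y2); case: (x1 == y2); case: (x2 == y1) => /=; ring.
under eq_bigr => x _ do rewrite inner.
rewrite big_split /= -(oo a a') -(oo b b') -(oo a b') -(oo b a').
by congr (_ + _); rewrite big_distrlr /= pair_bigA; apply: eq_bigr => x _; rewrite /h /=; ring.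
Qed.

Lemma uvec_cov i k l : intg P (fun w => uvec i w 0 k * uvec i w 0 l) /\
  ex P (fun w => uvec i w 0 k * uvec i w 0 l) = sym_proj R p k l.
Proof.
case/mxvec_indexP: k => a b; case/mxvec_indexP: l => a' b'.
have [gi2 ge] := gmat_cov i a b a' b'.
have -> : (fun w => uvec i w 0 (mxvec_index a b) * uvec i w 0 (mxvec_index a' b')) =
    (fun w => 2^-1 * (gmat i w a b * gmat i w a' b')).
  by apply/funext => w; rewrite !uvecE mulrACA -invfM -expr2 sqr_sqrtr.
split; first exact: intgZ.
by rewrite exZ// ge sym_projE -!natrM !mulnb.
Qed.

Lemma uvec_sym i w : uvec i w *m sym_proj R p = uvec i w.
Proof. by rewrite -scalemxAl mxvec_sym_id// gmat_sym. Qed.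

Lemma gvec_smeas (J : pred ('I_n * C)) i a : (forall c, J (i, c)) ->
  smeas (cyl X J) (fun w => gvec i w a 0).
Proof.
move=> hJ; under eq_fun do rewrite mxE.
apply: smeas_sum => c; apply: smeasM; first exact: smeas_cst.
by apply: stdn_smeas; exact: hJ.
Qed.

Lemma uvec_smeas (J : pred ('I_n * C)) i k : (forall c, J (i, c)) ->
  smeas (cyl X J) (fun w => uvec i w 0 k).
Proof.
move=> hJ; case/mxvec_indexP: k => a b.
have -> : (fun w => uvec i w 0 (mxvec_index a b)) = (fun w => (Num.sqrt 2)^-1 *
    (gvec i w a 0 * gvec i w b 0 - (a == b)%:R)).
  apply/funext => w; rewrite uvecE /gmat; congr (_ * _).
  by rewrite mxE [X in X + _]mxE big_ord1 [X in _ * X]mxE [X in _ + X]mxE [X in - X]mxE.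
apply: smeasM; first exact: smeas_cst.
by apply: smeasB; [apply: smeasM; exact: gvec_smeas|exact: smeas_cst].
Qed.

Section Projected.
Variable Pi : 'M[R]_(p * p).
Hypothesis (PiT : Pi^T = Pi) (PiPi : Pi *m Pi = Pi).
Hypothesis PiS : sym_proj R p *m Pi = Pi *m sym_proj R p.

Definition xivec (i : 'I_n) (w : T) : 'rV[R]_(p * p) := uvec i w *m Pi.

Lemma xivec_cov i k l : intg P (fun w => xivec i w 0 k * xivec i w 0 l) /\
  ex P (fun w => xivec i w 0 k * xivec i w 0 l) = (sym_proj R p *m Pi) k l.
Proof.
have E : (fun w => xivec i w 0 k * xivec i w 0 l) = (fun w =>
   \sum_x \sum_y Pi x k * Pi y l * (uvec i w 0 x * uvec i w 0 y)).
  apply/funext => w; rewrite !mxE big_distrlr /=; apply: eq_bigr => x _.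
  by apply: eq_bigr => y _; ring.
have I1 x y : intg P (fun w => Pi x k * Pi y l * (uvec i w 0 x * uvec i w 0 y)).
  by apply: intgZ; case: (uvec_cov i x y).
rewrite E; split; first by apply: intg_sum => x; exact: intg_sum.
rewrite ex_sum => [|x]; last exact: intg_sum.
under eq_bigr => x _ do rewrite ex_sum//.
have J1 x y : ex P (fun w => Pi x k * Pi y l * (uvec i w 0 x * uvec i w 0 y)) =
    Pi x k * Pi y l * sym_proj R p x y.
  by case: (uvec_cov i x y) => h <-; exact: exZ.
under eq_bigr => x _ do under eq_bigr => y _ do rewrite J1.
have -> : sym_proj R p *m Pi = Pi^T *m (sym_proj R p *m Pi).
  by rewrite PiT PiS mulmxA PiPi.
rewrite mxE; apply: eq_bigr => x _; rewrite mxE [in RHS]mxE mulr_sumr.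
by apply: eq_bigr => y _; ring.
Qed.

Lemma xivec_mean i k : ex P (fun w => xivec i w 0 k) = 0.
Proof.
have ui x : intg P (fun w => uvec i w 0 x) /\ ex P (fun w => uvec i w 0 x) = 0.
  case/mxvec_indexP: x => a b; under eq_fun do rewrite uvecE; split; first exact: intgZ.
  by rewrite exZ// gmat_mean mulr0.
have -> : (fun w => xivec i w 0 k) = (fun w => \sum_x Pi x k * uvec i w 0 x).
  by apply/funext => w; rewrite mxE; apply: eq_bigr => x _; rewrite mulrC.
rewrite ex_sum => [|x]; last by apply: intgZ; case: (ui x).
by rewrite big1// => x _; case: (ui x) => h1 h2; rewrite exZ// h2 mulr0.
Qed.

Lemma xivec_smeas (J : pred ('I_n * C)) i k : (forall c, J (i, c)) ->
  smeas (cyl X J) (fun w => xivec i w 0 k).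
Proof.
move=> hJ; under eq_fun do rewrite mxE.
apply: smeas_sum => x; apply: smeasM; last exact: smeas_cst.
exact: uvec_smeas.
Qed.

Lemma xivec_range i w : xivec i w *m (sym_proj R p *m Pi) = xivec i w.
Proof.
by rewrite PiS /xivec -mulmxA (mulmxA Pi) PiPi -PiS mulmxA uvec_sym.
Qed.

Lemma fro_gvec i w : fro (gvec i w) <= p%:R * \sum_c Z (i, c) w ^+ 2.
Proof.
have -> : fro (gvec i w) = \sum_a (\sum_c o a c * Z (i, c) w) ^+ 2.
  by apply: eq_bigr => a _; rewrite big_ord1 mxE.
apply: (@le_trans _ _ (\sum_(a < p) \sum_c Z (i, c) w ^+ 2)).
  apply: ler_sum => a _; apply: le_trans (sum_cauchy_schwarz _ _) _.
  have -> : \sum_c o a c ^+ 2 = 1.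
    transitivity (\sum_c o a c * o a c); last by rewrite oo eqxx.
    by apply: eq_bigr => c _; rewrite expr2.
  by rewrite mul1r.
by rewrite sumr_const card_ord -[_ *+ p]mulr_natl.
Qed.

(** 15 is the sixth moment of a standard normal variable, and the powers of 4 come from cubing sums.
    The bound does not depend on n. *)
Definition cube_const : R :=
  nf Pi ^+ 3 * (4 * (nf (1%:M : 'M[R]_p) ^+ 3 + p%:R ^+ 3 * (4 ^+ #|C| * (#|C|%:R * 15)))).

Lemma xivec_cube i : intg P (fun w => nf (xivec i w) ^+ 3) /\
  ex P (fun w => nf (xivec i w) ^+ 3) <= cube_const.
Proof.
pose D w := nf Pi ^+ 3 * (4 * (nf (1%:M : 'M[R]_p) ^+ 3 +
  p%:R ^+ 3 * (4 ^+ #|C| * \sum_c Z (i, c) w ^+ 6))).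
have z6 c := stdn_pow s0 mX lawX (i, c) 6.
have iS : intg P (fun w => \sum_c Z (i, c) w ^+ 6).
  by apply: intg_sum => c; case: (z6 c).
have iD : intg P D.
  apply: intgZ; apply: intgZ; apply: intgD; first exact: intg_cst.
  by apply: intgZ; apply: intgZ.
have eD : ex P D = cube_const.
  rewrite /D exZ; last first.
    by apply: intgZ; apply: intgD; [exact: intg_cst|apply: intgZ; exact: intgZ].
  rewrite exZ; last by apply: intgD; [exact: intg_cst|apply: intgZ; exact: intgZ].
  rewrite exD; [|exact: intg_cst|by apply: intgZ; exact: intgZ].
  rewrite ex_cst exZ; last exact: intgZ.
  rewrite exZ// ex_sum => [|c]; last by case: (z6 c).
  have -> : \sum_c ex P (fun w => Z (i, c) w ^+ 6) = #|C|%:R * 15.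
    rewrite [RHS]mulr_natl -sumr_const; apply: eq_bigr => c _.
    by have [_ _ _ ->] := stdn_moments s0 mX lawX (i, c).
  by [].
have le3 w : nf (xivec i w) ^+ 3 <= D w.
  have y0 : 0 <= \sum_c Z (i, c) w ^+ 2 by apply: sumr_ge0 => c _; exact: sqr_ge0.
  have h1 : nf (xivec i w) <= nf Pi * (nf (1%:M : 'M[R]_p) + p%:R * \sum_c Z (i, c) w ^+ 2).
    apply: le_trans (nfM _ _) _; rewrite mulrC ler_wpM2l ?nf_ge0//.
    rewrite /uvec nfZ mxvec_nf; apply: (@le_trans _ _ (nf (gmat i w))).
      rewrite ler_piMl ?nf_ge0// ger0_norm ?invr_ge0 ?sqrtr_ge0//.
      rewrite invf_le1 ?sqrtr_gt0// -[leLHS]sqrtr1 ler_sqrt// ler1n//.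
    apply: le_trans (nfB _ _) _; rewrite addrC lerD2l.
    apply: le_trans (nfM _ _) _; rewrite nf_trmx -expr2 sqr_nf.
    exact: fro_gvec.
  have h0 : 0 <= nf (1%:M : 'M[R]_p) by exact: nf_ge0.
  have h2 : 0 <= p%:R * \sum_c Z (i, c) w ^+ 2 by rewrite mulr_ge0.
  have h3 : nf (xivec i w) ^+ 3 <=
      (nf Pi * (nf (1%:M : 'M[R]_p) + p%:R * \sum_c Z (i, c) w ^+ 2)) ^+ 3.
    by rewrite lerXn2r ?nnegrE ?nf_ge0// mulr_ge0 ?nf_ge0// addr_ge0.
  apply: le_trans h3 _; rewrite exprMn /D ler_wpM2l ?exprn_ge0 ?nf_ge0//.
  apply: le_trans (cube_add h0 h2) _; rewrite ler_pM2l// lerD2l exprMn.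
  rewrite ler_wpM2l ?exprn_ge0// cardE -big_enum.
  have -> : \sum_(c in C) Z (i, c) w ^+ 6 = \sum_(c <- enum C) Z (i, c) w ^+ 2 ^+ 3.
    by rewrite big_enum; apply: eq_bigr => c _; rewrite -exprM.
  by apply: sum_cube => c; exact: sqr_ge0.
have mxi k : measurable_fun setT (fun w => xivec i w 0 k).
  exact: smeas_measurable (cyl_measurable mX (J := xpredT)) (xivec_smeas _ _).
have mn : measurable_fun setT (fun w => nf (xivec i w) ^+ 3).
  apply: measurable_funX; apply: measurableT_comp; last exact: measurable_fro.
  by apply: continuous_measurable_fun; exact: sqrt_continuous.
have iN : intg P (fun w => nf (xivec i w) ^+ 3).
  apply: (le_intg mn _ iD) => w; rewrite ger0_norm ?exprn_ge0 ?nf_ge0//; exact: le3.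
by split=> //; rewrite -eD; exact: le_ex.
Qed.

Lemma xivec_array : clt_array P xivec (sym_proj R p *m Pi) cube_const.
Proof.
split.
- move=> i; exists (cyl X (fun x => x.1 == i)), (cyl X (predC (fun x => x.1 == i))); split.
  + exact: cyl_measurable.
  + exact: cyl_measurable.
  + exact: cyl_indep.
  + by move=> j; apply: xivec_smeas => c /=.
  + by move=> k j ki; apply: xivec_smeas => c /=.
- by move=> i j; have [h _] := xivec_cov i j j; move: h; under eq_fun do rewrite -expr2.
- exact: xivec_mean.
- by move=> i j k; have [_] := xivec_cov i j k.
- exact: xivec_cube.
- exact: xivec_range.
Qed.

End Projected.

End GaussArray.

(** The row space of [J] consists of symmetric matrices, so the projector onto it is fixed by
    [sym_proj] on both sides; its trace q is subtracted from that of [sym_proj]. *)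
Lemma sym_resid_proj (R : realType) (p q : nat) (J : 'M[R]_(q, p * p)) :
  J *m J^T \in unitmx -> J *m sym_proj R p = J ->
  sym_proj R p *m resid_proj J = resid_proj J *m sym_proj R p /\
  \tr (sym_proj R p *m resid_proj J) = (p * p.+1)%:R / 2 - q%:R.
Proof.
move=> Ju JS.
have SJ : sym_proj R p *m J^T = J^T by rewrite -[in RHS]JS trmx_mul tr_sym_proj.
have E1 : sym_proj R p *m resid_proj J = sym_proj R p - J^T *m invmx (J *m J^T) *m J.
  by rewrite /resid_proj mulmxBr mulmx1 !mulmxA SJ.
split.
  by rewrite E1 /resid_proj mulmxBl mul1mx -!mulmxA JS.
rewrite E1 raddfB /= trace_sym_proj -mulmxA mxtrace_mulC -mulmxA mulVmx//.
by rewrite mxtrace1.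
Qed.

(** * Joint independence of the increments of the driving noise *)

Section WienerIncrements.
Context (d : measure_display) (T : measurableType d) (R : realType).
Variable P : probability T R.

Lemma mutually_independent_all (I : finType) (G : I -> set_system T) (A : I -> set T) :
  mutually_independent P G -> (forall i, G i (A i)) ->
  fine (P (\bigcap_i A i)) = \prod_i fine (P (A i)).
Proof.
move=> GI GA; have := GI [set: I]%SET A (fun i _ => GA i).
have -> : \bigcap_(i in [set i | i \in [set: I]%SET]) A i = \bigcap_i A i.
  by apply/seteqP; split => w H i _; apply: H => //=; rewrite inE.
by move=> ->; apply: eq_bigl => i; rewrite inE.
Qed.

Definition gen_sys (J : Type) (D : set J) (X : J -> T -> R) : set_system T :=
  \bigcup_(j in D) preimage_set_system setT (X j) measurable.

Lemma gen_sys_smeas (J : Type) (D : set J) (X : J -> T -> R) j : D j ->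
  smeas (gen_sys D X) (X j).
Proof.
move=> Dj _ A mA; rewrite setTI; apply: sub_sigma_algebra.
by exists j => //; exists A => //; rewrite setTI.
Qed.

Lemma sigma_bigcap (G : set_system T) (I : finType) (A : I -> set T) :
  (forall i, <<s G>> (A i)) -> <<s G>> (\bigcap_i A i).
Proof.
move=> h; have := @fin_bigcap_measurable _ (g_sigma_algebraType G) I setT A.
by apply => // i _; exact: h.
Qed.

Variables (n : nat) (h : R).
Hypothesis h0 : 0 < h.

Definition incr1 (W : R -> T -> R) (i : 'I_n) (w : T) : R :=
  W (i.+1%:R * h) w - W (i%:R * h) w.

Lemma wiener1_incr_indep (W : R -> T -> R) (E : 'I_n -> set R) : wiener1 P W ->
  (forall i, measurable (E i)) ->
  fine (P (\bigcap_i incr1 W i @^-1` E i)) = \prod_i fine (P (incr1 W i @^-1` E i)).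
Proof.
move=> [_ _ _ ind] mE.
have := ind n (fun i => i%:R * h); rewrite mul0r => /(_ (lexx 0)).
have hm : {homo (fun i : nat => i%:R * h) : i j / (i <= j)%N >-> i <= j}.
  by move=> i j ij; rewrite ler_pM2r// ler_nat.
move=> /(_ hm) hI; apply: (mutually_independent_all hI) => i.
by apply: smeas_preimage; [exact: (@gen_sys_smeas unit setT _ tt)|exact: mE].
Qed.

Definition incr (r : nat) (W : R -> T -> 'cV[R]_r) (i : 'I_n) (c : 'I_r) (w : T) : R :=
  W (i.+1%:R * h) w c 0 - W (i%:R * h) w c 0.

Let time0 i : 0 <= i%:R * h. Proof. by rewrite mulr_ge0// ltW. Qed.

Lemma wiener_incr_indep r (W : R -> T -> 'cV[R]_r) (E : 'I_n -> 'I_r -> set R) :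
  wiener P W -> (forall i c, measurable (E i c)) ->
  process_sigma W (\bigcap_c \bigcap_i incr W i c @^-1` E i c) /\
  fine (P (\bigcap_c \bigcap_i incr W i c @^-1` E i c)) =
  \prod_c \prod_i fine (P (incr W i c @^-1` E i c)).
Proof.
move=> [W1 WI] mE; split.
  apply: sigma_bigcap => c; apply: sigma_bigcap => i; apply: smeas_preimage => //.
  rewrite /incr; apply: smeasB; [exact: (@gen_sys_smeas (R * 'I_r)%type _ (fun ti w => W ti.1 w ti.2 0) (i.+1%:R * h, c) (time0 _))|
                     exact: (@gen_sys_smeas (R * 'I_r)%type _ (fun ti w => W ti.1 w ti.2 0) (i%:R * h, c) (time0 _))].
rewrite (mutually_independent_all WI) => [|c].
  by apply: eq_bigr => c _; exact: (wiener1_incr_indep (W1 c)).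
apply: sigma_bigcap => i; apply: smeas_preimage => //.
rewrite /incr; apply: smeasB; [exact: (@gen_sys_smeas R _ (fun t w => W t w c 0) (i.+1%:R * h) (time0 _))|
                   exact: (@gen_sys_smeas R _ (fun t w => W t w c 0) (i%:R * h) (time0 _))].
Qed.

Lemma incr_meas r (W : R -> T -> 'cV[R]_r) i c : wiener P W -> measurable_fun setT (incr W i c).
Proof. by move=> [W1 _]; have [mW _ _ _] := W1 c; apply: measurable_funB; exact: mW. Qed.

Lemma incr_law r (W : R -> T -> 'cV[R]_r) i c (A : set R) : wiener P W -> measurable A ->
  P (incr W i c @^-1` A) = normal_prob 0 (Num.sqrt h) A.
Proof.
move=> [W1 _] mA; have [_ _ law _] := W1 c.
have := law (i%:R * h) (i.+1%:R * h) A (time0 i) _ mA.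
rewrite -mulrBl -natrB// subSnn mul1r; apply.
by rewrite ltr_pM2r// ltr_nat.
Qed.

Variables (r1 r2 r3 r4 : nat) (W1 : R -> T -> 'cV[R]_r1) (W2 : R -> T -> 'cV[R]_r2)
  (W3 : R -> T -> 'cV[R]_r3) (W4 : R -> T -> 'cV[R]_r4).
Hypotheses (hW1 : wiener P W1) (hW2 : wiener P W2) (hW3 : wiener P W3) (hW4 : wiener P W4).
Hypothesis hW : independent4 P W1 W2 W3 W4.

Definition noise : finType := ('I_r1 + ('I_r2 + ('I_r3 + 'I_r4)))%type.

Definition noise_incr (x : 'I_n * noise) : T -> R :=
  match x.2 with
  | inl c => incr W1 x.1 c
  | inr (inl c) => incr W2 x.1 c
  | inr (inr (inl c)) => incr W3 x.1 c
  | inr (inr (inr c)) => incr W4 x.1 c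
  end.

Lemma noise_incr_meas x : measurable_fun setT (noise_incr x).
Proof. by case: x => i [c|[c|[c|c]]]; exact: incr_meas. Qed.

Lemma noise_incr_law x (A : set R) : measurable A ->
  P (noise_incr x @^-1` A) = normal_prob 0 (Num.sqrt h) A.
Proof. by case: x => i [c|[c|[c|c]]]; exact: incr_law. Qed.

(** Three levels of independence are composed: between the four processes, between the components of
    each process, and between the increments of each component. *)
Lemma noise_incr_indep (E : 'I_n * noise -> set R) : (forall x, measurable (E x)) ->
  fine (P (\bigcap_x (noise_incr x @^-1` E x))) =
  \prod_x fine (P (noise_incr x @^-1` E x)).
Proof.
move=> mE.
pose E1 i (c : 'I_r1) := E (i, inl c).
pose E2 i (c : 'I_r2) := E (i, inr (inl c)).
pose E3 i (c : 'I_r3) := E (i, inr (inr (inl c))).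
pose E4 i (c : 'I_r4) := E (i, inr (inr (inr c))).
have [s1 f1] := wiener_incr_indep hW1 (fun i c => mE (i, inl c)).
have [s2 f2] := wiener_incr_indep hW2 (fun i c => mE (i, inr (inl c))).
have [s3 f3] := wiener_incr_indep hW3 (fun i c => mE (i, inr (inr (inl c)))).
have [s4 f4] := wiener_incr_indep hW4 (fun i c => mE (i, inr (inr (inr c)))).
pose D1 := \bigcap_c \bigcap_i incr W1 i c @^-1` E1 i c.
pose D2 := \bigcap_c \bigcap_i incr W2 i c @^-1` E2 i c.
pose D3 := \bigcap_c \bigcap_i incr W3 i c @^-1` E3 i c.
pose D4 := \bigcap_c \bigcap_i incr W4 i c @^-1` E4 i c.
have -> : \bigcap_x (noise_incr x @^-1` E x) =
    \bigcap_(k : 'I_4) nth set0 [:: D1; D2; D3; D4] k.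
  apply/seteqP; split => w H.
    by move=> [[|[|[|[|//]]]] k4] _ /= c _ i _; [exact: (H (i, inl c))|
      exact: (H (i, inr (inl c)))|exact: (H (i, inr (inr (inl c))))|
      exact: (H (i, inr (inr (inr c))))].
  have H1 := H (@Ordinal 4 0 isT) Logic.I; have H2 := H (@Ordinal 4 1 isT) Logic.I.
  have H3 := H (@Ordinal 4 2 isT) Logic.I; have H4 := H (@Ordinal 4 3 isT) Logic.I.
  by case=> i [c|[c|[c|c]]] _; [exact: (H1 c _ i)|exact: (H2 c _ i)|
    exact: (H3 c _ i)|exact: (H4 c _ i)].
rewrite (mutually_independent_all hW); last by case=> [[|[|[|[|//]]]] k4].
rewrite !big_ord_recl big_ord0 /= mulr1 f1 f2 f3 f4.
transitivity (\prod_(c : noise) \prod_(i < n) fine (P (noise_incr (i, c) @^-1` E (i, c)))).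
  by rewrite !big_sumType.
by rewrite exchange_big /= pair_bigA; apply: eq_bigr => -[].
Qed.

End WienerIncrements.

(** * Differentiability of the covariance structure *)

Section MatrixDiff.
Context (R : realType) (q : nat).
Variable theta : 'rV[R]_q.
Implicit Types (m n p : nat) (u : 'rV[R]_q).

Definition difsum m n (DF : 'I_q -> 'M[R]_(m, n)) u : 'M[R]_(m, n) :=
  \sum_j u 0 j *: DF j.

(** Frechet differentiability with the partial derivatives [DF] as data. The uniform remainder is
    the form used in [argmin_expansion], and [has_diff_derive] identifies [DF] with the directional
    derivatives that make up [Delta]. *)
Definition has_diff m n (F : 'rV[R]_q -> 'M[R]_(m, n)) (DF : 'I_q -> 'M[R]_(m, n)) :=
  forall e : R, 0 < e -> exists2 d : R, 0 < d & forall u, nf u <= d ->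
    nf (F (theta + u) - F theta - difsum DF u) <= e * nf u.

Definition diffable m n (F : 'rV[R]_q -> 'M[R]_(m, n)) := exists DF, has_diff F DF.

Lemma difsum_bound m n (DF : 'I_q -> 'M[R]_(m, n)) : exists2 C : R, 0 < C &
  forall u, nf (difsum DF u) <= C * nf u.
Proof.
exists (1 + \sum_j nf (DF j)).
  by rewrite ltr_pwDl// sumr_ge0// => j _; exact: nf_ge0.
move=> u; have h : nf (difsum DF u) <= \sum_j `|u 0 j| * nf (DF j).
  rewrite /difsum; elim/big_rec2: _ => [|j x y _ xy]; first by rewrite nf0.
  by apply: le_trans (nfD _ _) _; rewrite nfZ lerD2l.
apply: le_trans h _; rewrite mulrDl mul1r mulr_suml.
apply: (@le_trans _ _ (\sum_j nf (DF j) * nf u)); last by rewrite lerDr nf_ge0.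
by apply: ler_sum => j _; rewrite mulrC ler_wpM2l ?nf_ge0 ?nf_entry.
Qed.

Lemma has_diff_lip m n (F : 'rV[R]_q -> 'M[R]_(m, n)) DF : has_diff F DF ->
  exists C d : R, [/\ 0 < C, 0 < d & forall u, nf u <= d -> nf (F (theta + u) - F theta) <= C * nf u].
Proof.
move=> h; have [d d0 hd] := h 1 ltr01; have [C C0 hC] := difsum_bound DF.
exists (1 + C), d; split=> // [|u ud]; first by rewrite addr_gt0.
rewrite -[X in nf X](subrK (difsum DF u)) mulrDl.
by apply: le_trans (nfD _ _) _; apply: lerD => //; exact: hd.
Qed.

Lemma has_diff_cst m n (A : 'M[R]_(m, n)) : has_diff (fun=> A) (fun=> 0).
Proof.
move=> e e0; exists 1 => // u _; rewrite /difsum big1 => [|j _]; last exact: scaler0.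
by rewrite subrr subr0 nf0 mulr_ge0 ?nf_ge0// ltW.
Qed.

Lemma has_diffD m n (F G : 'rV[R]_q -> 'M[R]_(m, n)) DF DG : has_diff F DF -> has_diff G DG ->
  has_diff (fun t => F t + G t) (fun j => DF j + DG j).
Proof.
move=> hF hG e e0; have e2 : 0 < e / 2 by rewrite divr_gt0.
have [d d0 hd] := hF _ e2; have [d' d0' hd'] := hG _ e2.
exists (Num.min d d'); first by rewrite lt_min d0.
move=> u; rewrite le_min => /andP[u1 u2].
have -> : difsum (fun j => DF j + DG j) u = difsum DF u + difsum DG u.
  by rewrite /difsum -big_split /=; apply: eq_bigr => j _; rewrite scalerDr.
rewrite [X in nf X](_ : _ = (F (theta + u) - F theta - difsum DF u) +
   (G (theta + u) - G theta - difsum DG u)); last first.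
  by apply/matrixP => a b; rewrite !mxE; ring.
apply: le_trans (nfD _ _) _; apply: le_trans (lerD (hd u u1) (hd' u u2)) _.
by rewrite -mulrDl -splitr.
Qed.

Lemma difsumM m n p (DF : 'I_q -> 'M[R]_(m, n)) (DG : 'I_q -> 'M[R]_(n, p)) A B u :
  difsum (fun j => DF j *m B + A *m DG j) u = difsum DF u *m B + A *m difsum DG u.
Proof.
rewrite /difsum mulmx_suml mulmx_sumr -big_split /=; apply: eq_bigr => j _.
by rewrite scalerDr -scalemxAl -scalemxAr.
Qed.

Lemma has_diffM m n p (F : 'rV[R]_q -> 'M[R]_(m, n)) (G : 'rV[R]_q -> 'M[R]_(n, p)) DF DG :
  has_diff F DF -> has_diff G DG ->
  has_diff (fun t => F t *m G t) (fun j => DF j *m G theta + F theta *m DG j).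
Proof.
move=> hF hG e e0.
have [CF [dF [CF0 dF0 lF]]] := has_diff_lip hF; have [CG [dG [CG0 dG0 lG]]] := has_diff_lip hG.
have e3 : 0 < e / 3 by rewrite divr_gt0.
have gF : 0 < nf (F theta) + 1 by rewrite ltr_wpDl ?nf_ge0.
have gG : 0 < nf (G theta) + 1 by rewrite ltr_wpDl ?nf_ge0.
have [d d0 hd] := hF _ (divr_gt0 e3 gG); have [d' d0' hd'] := hG _ (divr_gt0 e3 gF).
pose r := Num.min (Num.min d d') (Num.min (Num.min dF dG) (e / 3 / (CF * CG))).
exists r; first by rewrite !lt_min d0 d0' dF0 dG0 divr_gt0// mulr_gt0.
move=> u; rewrite !le_min => /andP[/andP[u1 u2] /andP[/andP[u3 u4] u5]].
have u0 := nf_ge0 u.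
rewrite difsumM.
rewrite [X in nf X](_ : _ = (F (theta + u) - F theta - difsum DF u) *m G theta +
   F theta *m (G (theta + u) - G theta - difsum DG u) +
   (F (theta + u) - F theta) *m (G (theta + u) - G theta)); last first.
  rewrite !mulmxBl !mulmxBr; move: (F _ *m G _) (F theta *m _) (F _ *m G theta) => a b c.
  by apply/matrixP => i j; rewrite !mxE; ring.
have k1 : nf ((F (theta + u) - F theta - difsum DF u) *m G theta) <= e / 3 * nf u.
  apply: le_trans (nfM _ _) _; apply: (@le_trans _ _ (e / 3 / (nf (G theta) + 1) * nf u * (nf (G theta) + 1))).
    by apply: ler_pM; rewrite ?nf_ge0 ?hd// lerDl.
  by rewrite mulrAC divfK ?gt_eqF.
have k2 : nf (F theta *m (G (theta + u) - G theta - difsum DG u)) <= e / 3 * nf u.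
  apply: le_trans (nfM _ _) _; apply: (@le_trans _ _ ((nf (F theta) + 1) * (e / 3 / (nf (F theta) + 1) * nf u))).
    by apply: ler_pM; rewrite ?nf_ge0 ?hd'// lerDl.
  by rewrite mulrA [_ * (e / 3 / _)]mulrC divfK ?gt_eqF.
have k3 : nf ((F (theta + u) - F theta) *m (G (theta + u) - G theta)) <= e / 3 * nf u.
  apply: le_trans (nfM _ _) _; apply: (@le_trans _ _ (CF * nf u * (CG * nf u))).
    by apply: ler_pM; rewrite ?nf_ge0 ?lF ?lG.
  rewrite mulrA; apply: ler_wpM2r => //; rewrite mulrAC -ler_pdivlMl ?mulr_gt0//.
  by rewrite mulrC.
apply: le_trans (nfD _ _) _; apply: le_trans (lerD (nfD _ _) k3) _.
by apply: le_trans (lerD (lerD k1 k2) (lexx _)) _; rewrite -!mulrDl; lra.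
Qed.

Lemma has_diff_tr m n (F : 'rV[R]_q -> 'M[R]_(m, n)) DF : has_diff F DF ->
  has_diff (fun t => (F t)^T) (fun j => (DF j)^T).
Proof.
move=> h e e0; have [d d0 hd] := h e e0; exists d => // u ud.
rewrite (_ : _ - _ = (F (theta + u) - F theta - difsum DF u)^T) ?nf_trmx ?hd//.
apply/matrixP => a b; rewrite !mxE /difsum !summxE; congr (_ - _).
by apply: eq_bigr => j _; rewrite !mxE.
Qed.

Lemma nf_inv_near1 n (A : 'M[R]_n) : nf (A - 1%:M) <= 1 / 2 ->
  A \in unitmx /\ nf (invmx A) <= 2 * nf (1%:M : 'M[R]_n).
Proof.
move=> h; have inj (v : 'rV[R]_n) : v *m A = 0 -> v = 0.
  move=> vA; have : v = v *m (1%:M - A) by rewrite mulmxBr vA mulmx1 subr0.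
  move=> /(congr1 (@nf R 1 n)) E; apply: nf_eq0; apply/eqP; rewrite eq_le nf_ge0 andbT.
  have := nfM v (1%:M - A); rewrite -E nf_distC => h1.
  by have := ler_wpM2l (nf_ge0 v) h; lra.
have Au : A \in unitmx.
  rewrite -row_free_unit -kermx_eq0; apply/eqP/row_matrixP => i.
  by rewrite row0; apply: inj; rewrite -row_mul mulmx_ker row0.
split=> //; have : invmx A = 1%:M - (A - 1%:M) *m invmx A.
  by rewrite mulmxBl mul1mx mulmxV// opprB addrC subrK.
move=> /(congr1 (@nf R n n)) E.
have := nfB 1%:M ((A - 1%:M) *m invmx A); rewrite -E => h1.
have h2 := nfM (A - 1%:M) (invmx A); have := ler_wpM2r (nf_ge0 (invmx A)) h.
by lra.
Qed.

(** With G = F(theta)^-1, E the increment of F and H = 1 + G E, one has H^-1 = 1 - G E + H^-1 (G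
    E)^2. The last term is quadratic in u because H^-1 stays bounded near the identity. *)
Lemma has_diff_inv n (F : 'rV[R]_q -> 'M[R]_n) DF : has_diff F DF -> F theta \in unitmx ->
  has_diff (fun t => invmx (F t)) (fun j => - (invmx (F theta) *m DF j *m invmx (F theta))).
Proof.
move=> hF Fu e e0; have [C [dF [C0 dF0 lF]]] := has_diff_lip hF.
pose G := invmx (F theta); pose g := nf G + 1.
have g0 : 0 < g by rewrite ltr_wpDl ?nf_ge0.
have Gg : nf G <= g by rewrite lerDl.
pose c := 2 * nf (1%:M : 'M[R]_n); have c0 : 0 <= c by rewrite mulr_ge0 ?nf_ge0.
have e2 : 0 < e / 2 by rewrite divr_gt0.
have gg : 0 < g * g by rewrite mulr_gt0.
have [d d0 hd] := hF _ (divr_gt0 e2 gg).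
pose A := (c + 1) * (g * (C * g) * (C * g)).
have A0 : 0 < A by rewrite !mulr_gt0// ltr_wpDl.
pose r := Num.min (Num.min d dF) (Num.min (1 / 2 / (g * C)) (e / 2 / A)).
exists r; first by rewrite !lt_min d0 dF0 !divr_gt0// ?mulr_gt0.
move=> u; rewrite !le_min => /andP[/andP[u1 u2] /andP[u3 u4]].
have u0 := nf_ge0 u.
pose E := F (theta + u) - F theta.
have hE : nf E <= C * nf u by exact: lF.
have hE2 : nf (E - difsum DF u) <= e / 2 / (g * g) * nf u by exact: hd.
have FE : F (theta + u) = F theta *m (1%:M + G *m E).
  by rewrite mulmxDr mulmx1 mulmxA mulmxV// mul1mx /E [RHS]addrC subrK.
clearbody E.
have GE : nf (G *m E) <= 1 / 2.
  apply: le_trans (nfM _ _) _; apply: (@le_trans _ _ (g * (C * nf u))).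
    by apply: ler_pM; rewrite ?nf_ge0.
  by rewrite mulrA mulrC -ler_pdivlMr ?mulr_gt0.
have [Hu Hn] : (1%:M + G *m E) \in unitmx /\ nf (invmx (1%:M + G *m E)) <= c.
  by apply: nf_inv_near1; rewrite addrAC subrr add0r.
set H := 1%:M + G *m E in Hu Hn FE *.
have iF : invmx (F (theta + u)) = invmx H *m G by rewrite FE invmx_mul.
have iH : invmx H = 1%:M - G *m E + invmx H *m (G *m E *m (G *m E)).
  have : invmx H *m (H *m (1%:M - G *m E)) = 1%:M - G *m E by rewrite mulmxA mulVmx// mul1mx.
  have -> : H *m (1%:M - G *m E) = 1%:M - G *m E *m (G *m E).
    by rewrite mulmxDl !mulmxBr !mul1mx !mulmx1 addrA subrK.
  by rewrite mulmxBr mulmx1 => <-; rewrite subrK.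
have dE : difsum (fun j => - (G *m DF j *m G)) u = - (G *m difsum DF u *m G).
  rewrite /difsum mulmx_sumr mulmx_suml -sumrN; apply: eq_bigr => j _.
  by rewrite scalerN -scalemxAr -scalemxAl.
rewrite -/G dE iF [in X in nf X]iH.
rewrite [X in nf X](_ : _ = invmx H *m (G *m E *m (G *m E)) *m G - G *m (E - difsum DF u) *m G); last first.
  rewrite mulmxBr !mulmxBl mulmxDl mulmxBl mul1mx.
  move: (invmx H *m _ *m G) (G *m E *m G) (G *m _ *m G) => x y z.
  by apply/matrixP => i j; rewrite !mxE; ring.
have k1 : nf (G *m (E - difsum DF u) *m G) <= e / 2 * nf u.
  apply: le_trans (nfM _ _) _; apply: (@le_trans _ _ (g * (e / 2 / (g * g) * nf u) * g)).
    apply: ler_pM; rewrite ?nf_ge0//; apply: le_trans (nfM _ _) _.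
    by apply: ler_pM; rewrite ?nf_ge0.
  by rewrite le_eqVlt; apply/orP; left; apply/eqP; field; rewrite gt_eqF.
have k2 : nf (invmx H *m (G *m E *m (G *m E)) *m G) <= e / 2 * nf u.
  apply: (@le_trans _ _ ((c + 1) * (g * (C * nf u) * (g * (C * nf u))) * g)).
    apply: le_trans (nfM _ _) _; apply: ler_pM; rewrite ?nf_ge0//.
    apply: le_trans (nfM _ _) _; apply: ler_pM; rewrite ?nf_ge0//.
      by apply: le_trans Hn _; rewrite lerDl.
    have GE2 : nf (G *m E) <= g * (C * nf u).
      by apply: le_trans (nfM _ _) _; apply: ler_pM; rewrite ?nf_ge0.
    by apply: le_trans (nfM _ _) _; apply: ler_pM; rewrite ?nf_ge0.
  rewrite (_ : _ * g = A * nf u * nf u); last by rewrite /A; ring.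
  by apply: ler_wpM2r => //; rewrite mulrC -ler_pdivlMr.
apply: le_trans (nfB _ _) _; apply: le_trans (lerD k2 k1) _.
by rewrite -mulrDl -splitr.
Qed.

Lemma has_diff_entry m n (A : 'M[R + 'I_q]_(m, n)) :
  has_diff (fun t => map_mx (entry_val t) A)
    (fun j => \matrix_(a, b) (if A a b is inr k then (k == j)%:R else 0)).
Proof.
move=> e e0; exists 1 => // u _.
rewrite (_ : _ - _ = 0) ?nf0 ?mulr_ge0 ?nf_ge0 ?(ltW e0)//.
apply/matrixP => a b; rewrite !mxE /difsum summxE.
under eq_bigr do rewrite !mxE.
case: (A a b) => [c|k] /=.
  by rewrite big1 ?subrr ?subr0// => j _; rewrite mulr0.
rewrite (bigD1 k)//= eqxx mulr1 big1 => [|j jk]; last by rewrite eq_sym (negbTE jk) mulr0.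
by rewrite mxE addr0 addrAC subrr add0r subrr.
Qed.

Lemma diffable_block m1 m2 n1 n2 (F11 : 'rV[R]_q -> 'M[R]_(m1, n1)) (F12 : 'rV[R]_q -> 'M[R]_(m1, n2))
    (F21 : 'rV[R]_q -> 'M[R]_(m2, n1)) (F22 : 'rV[R]_q -> 'M[R]_(m2, n2)) :
  diffable F11 -> diffable F12 -> diffable F21 -> diffable F22 ->
  diffable (fun t => block_mx (F11 t) (F12 t) (F21 t) (F22 t)).
Proof.
move=> [D11 h11] [D12 h12] [D21 h21] [D22 h22].
exists (fun j => block_mx (D11 j) (D12 j) (D21 j) (D22 j)) => e e0.
have e4 : 0 < e / 2 by rewrite divr_gt0.
have [d1 d10 H1] := h11 _ e4; have [d2 d20 H2] := h12 _ e4.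
have [d3 d30 H3] := h21 _ e4; have [d4 d40 H4] := h22 _ e4.
exists (Num.min (Num.min d1 d2) (Num.min d3 d4)); first by rewrite !lt_min d10 d20 d30.
move=> u; rewrite !le_min => /andP[/andP[u1 u2] /andP[u3 u4]].
have -> : difsum (fun j => block_mx (D11 j) (D12 j) (D21 j) (D22 j)) u =
    block_mx (difsum D11 u) (difsum D12 u) (difsum D21 u) (difsum D22 u).
  rewrite /difsum; elim: (index_enum _) => [|j s IH]; first by rewrite !big_nil block_mx0.
  by rewrite !big_cons IH scale_block_mx add_block_mx.
rewrite !opp_block_mx !add_block_mx.
rewrite -(@ler_pXn2r _ 2)// ?nnegrE ?nf_ge0// ?mulr_ge0 ?nf_ge0 ?(ltW e0)//.
rewrite sqr_nf fro_block -!sqr_nf.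
have sq m n (A : 'M[R]_(m, n)) : nf A <= e / 2 * nf u -> nf A ^+ 2 <= (e * nf u) ^+ 2 / 4.
  move=> h; have -> : (e * nf u) ^+ 2 / 4 = (e / 2 * nf u) ^+ 2 by field.
  by rewrite lerXn2r ?nnegrE ?nf_ge0// mulr_ge0 ?nf_ge0// ltW.
have := sq _ _ _ (H1 u u1); have := sq _ _ _ (H2 u u2).
have := sq _ _ _ (H3 u u3); have := sq _ _ _ (H4 u u4).
by lra.
Qed.

End MatrixDiff.

Section DiffConsequences.
Context (R : realType) (q : nat).
Variable theta : 'rV[R]_q.

Lemma diffable_cvg m n (F : 'rV[R]_q -> 'M[R]_(m, n)) : diffable theta F ->
  {for theta, continuous F}.
Proof.
move=> [DF hF]; have [C [d [C0 d0 lF]]] := has_diff_lip hF.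
have C1 : 0 < C * (1 * q)%:R + 1 by rewrite ltr_wpDl// mulr_ge0 ?(ltW C0).
have FF : Filter (nbhs theta) by exact: nbhs_filter.
apply/(@cvgrPdist_le _ _ _ _ FF) => e e0.
have ed : 0 < Num.min (e / (C * (1 * q)%:R + 1)) (d / ((1 * q)%:R + 1)).
  by rewrite lt_min !divr_gt0// ltr_wpDl.
near=> t; have ht : `|t - theta| <= Num.min (e / (C * (1 * q)%:R + 1)) (d / ((1 * q)%:R + 1)).
  by rewrite distrC; near: t; exact: cvgr_dist_le ed.
move: ht; rewrite le_min => /andP[h1 h2].
rewrite distrC; apply: le_trans (norm_le_nf _) _.
have nt := nf_le_norm (t - theta).
have tE : t = theta + (t - theta) by rewrite addrC subrK.
rewrite tE; apply: le_trans (lF _ _) _.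
  apply: le_trans nt _; apply: (@le_trans _ _ (((1 * q)%:R + 1) * `|t - theta|)).
    by rewrite ler_wpM2r// lerDl.
  by rewrite mulrC -ler_pdivlMr// ltr_wpDl.
apply: (@le_trans _ _ ((C * (1 * q)%:R + 1) * `|t - theta|)); last first.
  by rewrite mulrC -ler_pdivlMr.
apply: (@le_trans _ _ (C * ((1 * q)%:R * `|t - theta|))); first by rewrite ler_pM2l.
by rewrite mulrA ler_wpM2r// lerDl.
Unshelve. all: by end_near. Qed.

Lemma nf_delta j : nf (delta_mx 0 j : 'rV[R]_q) = 1.
Proof.
rewrite /nf fro_sum (bigD1 (0, j))//= mxE !eqxx expr1n big1 ?addr0 ?sqrtr1// => -[i k] /=.
by rewrite xpair_eqE mxE ord1 eqxx /= => /negbTE ->; rewrite expr0n.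
Qed.

Lemma difsum_delta m n (DF : 'I_q -> 'M[R]_(m, n)) (h : R) j :
  difsum DF (h *: delta_mx 0 j) = h *: DF j.
Proof.
rewrite /difsum (bigD1 j)//= !mxE !eqxx mulr1 big1 ?addr0// => k kj.
by rewrite !mxE (negbTE kj) andbF mulr0 scale0r.
Qed.

Lemma has_diff_derive m n (F : 'rV[R]_q -> 'M[R]_(m, n)) DF a b j : has_diff theta F DF ->
  'D_(delta_mx 0 j) (fun t => F t a b) theta = DF j a b.
Proof.
move=> hF; rewrite /derive; apply: cvg_lim => //.
apply/cvgrPdist_le => e e0; have [d d0 hd] := hF e e0.
near=> h.
have h0 : h != 0 by near: h; exact: nbhs_dnbhs_neq.
have hle : `|h| <= d.
  by near: h; exact: dnbhs0_le.
have u1 : nf (h *: delta_mx 0 j : 'rV[R]_q) <= d by rewrite nfZ nf_delta mulr1.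
have := hd _ u1; rewrite nfZ nf_delta mulr1.
rewrite difsum_delta.
set D := _ - _ - _ => hD.
have := le_trans (nf_entry D a b) hD; rewrite /D !mxE => h1.
rewrite /= (addrC _ theta) -[_ *: (_ - _)]/(h^-1 * _).
have hp : 0 < `|h| by rewrite normr_gt0.
rewrite -(ler_pM2l hp) -normrM [leRHS]mulrC.
by rewrite mulrBr mulrA mulfV// mul1r distrC.
Unshelve. all: by end_near. Qed.

(** Antisymmetrising the first order remainder at a step h cancels the values of F and leaves h
    (DF^T - DF), which is therefore o(h). *)
Lemma has_diff_sym n (F : 'rV[R]_q -> 'M[R]_n) DF j : has_diff theta F DF ->
  (exists2 r : R, 0 < r & forall u, nf u <= r -> (F (theta + u))^T = F (theta + u)) ->
  (DF j)^T = DF j.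
Proof.
move=> hF [r r0 hr].
have F0 : (F theta)^T = F theta by have := hr 0; rewrite addr0; apply; rewrite nf0 ltW.
apply/eqP; rewrite -subr_eq0; apply/eqP/nf_eq0/eqP; rewrite eq_le nf_ge0 andbT.
apply/ler_addgt0Pl => e e0; rewrite addr0.
have e2 : 0 < e / 2 by rewrite divr_gt0.
have [d d0 hd] := hF _ e2.
pose h := Num.min d r; have h0 : 0 < h by rewrite lt_min d0.
have nu : nf (h *: delta_mx 0 j : 'rV[R]_q) = h by rewrite nfZ nf_delta mulr1 gtr0_norm.
have := hd (h *: delta_mx 0 j); rewrite nu difsum_delta ge_min lexx => /(_ isT).
have := hr (h *: delta_mx 0 j); rewrite nu ge_min lexx orbT => /(_ isT) Fs.
set A := _ - _ - _ => hA.
have AE : A - A^T = h *: ((DF j)^T - DF j).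
  rewrite /A; move: Fs F0; move: (F (theta + _)) (F theta) => X Y XT YT.
  apply/matrixP => a b; have Xs : X b a = X a b by rewrite -[in RHS]XT mxE.
  have Ys : Y b a = Y a b by rewrite -[in RHS]YT mxE.
  by rewrite !mxE Xs Ys; ring.
have := nfB A A^T; rewrite AE nf_trmx nfZ gtr0_norm// => h1.
rewrite -(ler_pM2l h0); apply: le_trans h1 _; apply: le_trans (lerD hA hA) _.
by rewrite -mulrDl -splitr mulrC.
Qed.

End DiffConsequences.

Section Diffable.
Context (R : realType) (q : nat).
Variable theta : 'rV[R]_q.
Local Notation diffable := (@diffable R q theta).

Lemma diffableD m n (F G : 'rV[R]_q -> 'M[R]_(m, n)) : diffable F -> diffable G ->
  diffable (fun t => F t + G t).
Proof. by move=> [DF hF] [DG hG]; exists (fun j => DF j + DG j); exact: has_diffD. Qed.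

Lemma diffableM m n p (F : 'rV[R]_q -> 'M[R]_(m, n)) (G : 'rV[R]_q -> 'M[R]_(n, p)) :
  diffable F -> diffable G -> diffable (fun t => F t *m G t).
Proof. by move=> [DF hF] [DG hG]; eexists; exact: has_diffM hF hG. Qed.

Lemma diffable_tr m n (F : 'rV[R]_q -> 'M[R]_(m, n)) : diffable F -> diffable (fun t => (F t)^T).
Proof. by move=> [DF hF]; eexists; exact: has_diff_tr hF. Qed.

Lemma diffable_inv n (F : 'rV[R]_q -> 'M[R]_n) : diffable F -> F theta \in unitmx ->
  diffable (fun t => invmx (F t)).
Proof. by move=> [DF hF] Fu; eexists; exact: has_diff_inv hF Fu. Qed.

Lemma diffable_entry m n (A : 'M[R + 'I_q]_(m, n)) : diffable (fun t => map_mx (entry_val t) A).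
Proof. by eexists; exact: has_diff_entry. Qed.

Lemma Sigma_diffable (p1 p2 k1 k2 : nat) (M : sem (R + 'I_q) p1 p2 k1 k2) :
  sem_Psi (sem_at M theta) \in unitmx -> diffable (Sigma M).
Proof.
move=> Pu; rewrite /Sigma /sem_cov /=.
have hL1 := diffable_entry (sem_L1 M); have hL2 := diffable_entry (sem_L2 M).
have hG := diffable_entry (sem_Gamma M); have hP := diffable_inv (diffable_entry (sem_Psi M)) Pu.
have hSx := diffable_entry (sem_Sxi M); have hSd := diffable_entry (sem_Sdelta M).
have hSe := diffable_entry (sem_Seps M); have hSz := diffable_entry (sem_Szeta M).
have h12 := diffableM (diffableM (diffableM (diffableM hL1 hSx) (diffable_tr hG)) (diffable_tr hP)) (diffable_tr hL2).
apply: diffable_block => //.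
- exact: diffableD (diffableM (diffableM hL1 hSx) (diffable_tr hL1)) hSd.
- exact: diffable_tr h12.
- apply: diffableD => //.
  exact: diffableM (diffableM (diffableM (diffableM hL2 hP)
    (diffableD (diffableM (diffableM hG hSx) (diffable_tr hG)) hSz)) (diffable_tr hP)) (diffable_tr hL2).
Qed.

End Diffable.

(** * Positive definiteness of the model covariance *)

Section SemCov.
Context (R : realType).

Lemma psd_congr m n (A : 'M[R]_(m, n)) (S : 'M[R]_n) : psd S -> psd (A *m S *m A^T).
Proof.
move=> [St Sx]; split; first by rewrite !trmx_mul trmxK St mulmxA.
by move=> x; have := Sx (A^T *m x); rewrite trmx_mul trmxK !mulmxA.
Qed.

Lemma psdD_posdef n (A B : 'M[R]_n) : psd A -> posdef B -> posdef (A + B).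
Proof.
move=> [At Ax] [Bt Bx]; split; first by rewrite linearD /= At Bt.
by move=> x x0; rewrite mulmxDr mulmxDl mxE ltr_wpDl// Bx.
Qed.

Lemma posdef_diag m n (A : 'M[R]_m) (B : 'M[R]_n) : posdef A -> posdef B ->
  posdef (block_mx A 0 0 B).
Proof.
move=> [At Ax] [Bt Bx]; split; first by rewrite tr_block_mx At Bt !trmx0.
move=> x; rewrite -[x]vsubmxK; set u := usubmx x; set v := dsubmx x => x0.
rewrite tr_col_mx mul_row_block !mulmx0 addr0 add0r mul_row_col mxE.
have [u0|u0] := eqVneq u 0.
  rewrite u0 trmx0 !mul0mx mxE add0r; apply: Bx.
  by apply: contraNneq x0 => v0; rewrite u0 v0 col_mx0.
apply: ltr_wpDr; last exact: Ax.
have [->|v0] := eqVneq v 0; first by rewrite trmx0 !mul0mx mxE.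
exact/ltW/Bx.
Qed.

(** The covariance split according to its independent latent sources. The xi and zeta parts are
    positive semidefinite and the block diagonal error part is positive definite. *)
Lemma sem_cov_decomp (p1 p2 k1 k2 : nat) (N : sem R p1 p2 k1 k2) :
  (sem_Sxi N)^T = sem_Sxi N ->
  let A := col_mx (sem_L1 N) (sem_L2 N *m invmx (sem_Psi N) *m sem_Gamma N) in
  let A4 := col_mx (0 : 'M[R]_(p1, k2)) (sem_L2 N *m invmx (sem_Psi N)) in
  sem_cov N = A *m sem_Sxi N *m A^T + A4 *m sem_Szeta N *m A4^T +
    block_mx (sem_Sdelta N) 0 0 (sem_Seps N).
Proof.
move=> Sx A A4; rewrite /sem_cov /A /A4 !tr_col_mx (mul_col_mx _ _ (sem_Sxi N)) (mul_col_mx _ _ (sem_Szeta N)) !mul_col_row.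
rewrite !trmx_mul !trmxK Sx trmx0 !mul0mx !mulmx0 !add_block_mx !addr0 !mulmxA.
congr block_mx.
by rewrite mulmxDr !mulmxDl !mulmxA.
Qed.

Lemma posdef_sem_cov (p1 p2 k1 k2 : nat) (N : sem R p1 p2 k1 k2) :
  sem_admissible N -> posdef (sem_cov N).
Proof.
move=> [_ _ _ [px pz] [pd pe]]; rewrite sem_cov_decomp; last by case: px.
rewrite -addrA; apply: psdD_posdef; first exact: psd_congr.
by apply: psdD_posdef; [exact: psd_congr|exact: posdef_diag].
Qed.

End SemCov.

Section Vech.
Context (R : realType) (p : nat).

Lemma vech_entry (i : 'I_(p * p.+1)./2) : exists a b, forall A : 'M[R]_p, vech A i 0 = A a b.
Proof.
pose s : seq ('I_p * 'I_p) := [seq ((i : 'I_p), (j : 'I_p)) | j <- enum 'I_p, i <- [seq i : 'I_p <- enum 'I_p | (j <= i)%N]].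
have E (A : 'M[R]_p) : vech_seq A = [seq A x.1 x.2 | x <- s].
  by rewrite /vech_seq /s map_allpairs.
have sz : size s = (p * p.+1)./2 by rewrite -(size_vech_seq (0 : 'M[R]_p)) E size_map.
case: p i s E sz => [|p'] i s E sz; first by case: i.
exists (nth (ord0, ord0) s i).1, (nth (ord0, ord0) s i).2 => A.
by rewrite mxE E (nth_map (ord0, ord0))// sz.
Qed.

End Vech.

Lemma row_indep_gram (R : realType) (q n : nat) (J : 'M[R]_(q, n)) :
  (forall v : 'rV[R]_q, v *m J = 0 -> v = 0) -> J *m J^T \in unitmx.
Proof.
move=> Jinj; rewrite -row_free_unit -kermx_eq0; apply/eqP/row_matrixP => i.
rewrite row0; set v := row i _; apply: Jinj.
have vJ : v *m (J *m J^T) = 0 by rewrite /v -row_mul mulmx_ker row0.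
apply: trmx_inj; rewrite trmx0; apply: mulmx_tr_inj.
by rewrite trmxK trmx_mul mulmxA -(mulmxA v) vJ mul0mx.
Qed.

Lemma normalized_model (R : realType) (p1 p2 k1 k2 q : nat) (Theta : set 'rV[R]_q)
    (M : sem (R + 'I_q) p1 p2 k1 k2) (theta0 : 'rV[R]_q) (K : 'M[R]_(p1 + p2)) :
  sem_model Theta M -> Theta° theta0 -> \rank (Delta M theta0) = q ->
  K \in unitmx -> Sigma M theta0 = K *m K^T ->
  let Sg t := invmx K *m Sigma M t *m (invmx K)^T in
  [/\ forall t, Theta t -> posdef (Sg t),
      forall t, Theta t -> {for t, continuous Sg},
      Sg theta0 = 1%:M &
      exists E : 'I_q -> 'M[R]_(p1 + p2), let J := \matrix_j mxvec (E j) in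
        [/\ forall j, (E j)^T = E j, J *m J^T \in unitmx &
        forall e : R, 0 < e -> exists2 d : R, 0 < d &
          forall t, nf (t - theta0) <= d ->
            nf (mxvec (Sg t - 1%:M) - (t - theta0) *m J) <= e * nf (t - theta0)]].
Proof.
move=> [_ adm] int0 rk Ku KE Sg.
have T0 : Theta theta0 by exact: interior_subset.
have KVu : invmx K \in unitmx by rewrite unitmx_inv.
have SP t : Theta t -> posdef (Sigma M t) by move=> /adm; exact: posdef_sem_cov.
have dS t : Theta t -> diffable t (Sigma M).
  by move=> /adm[_ _ Pu _ _]; exact: Sigma_diffable.
have dSg t : Theta t -> diffable t Sg.
  move=> /dS h; have c A : diffable t (fun=> A : 'M[R]_(p1 + p2)).
    by exists (fun=> 0); exact: has_diff_cst.
  by apply: diffableM => //; exact: diffableM.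
have Sg0 : Sg theta0 = 1%:M.
  by rewrite /Sg KE !mulmxA mulVmx// mul1mx -trmx_mul mulVmx// trmx1.
split; [by move=> t /SP h; exact: posdef_congr|by move=> t /dSg; exact: diffable_cvg|exact: Sg0|].
have [DS hS] := dS _ T0.
pose E j := invmx K *m DS j *m (invmx K)^T.
have hSg : has_diff theta0 Sg E.
  have h1 := has_diffM (has_diff_cst theta0 (invmx K)) hS.
  have h2 := has_diffM h1 (has_diff_cst theta0 (invmx K)^T).
  move=> e e0; have [d d0 hd] := h2 e e0; exists d => // u /hd.
  congr (nf (_ - _ - difsum _ u) <= _); apply/funext => j.
  by rewrite mul0mx add0r mulmx0 addr0.
have [r r0 hr] := interior_shift int0.
have Et j : (E j)^T = E j.
  apply: (has_diff_sym j hSg); exists r => // u ur.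
  have /SP/posdef_tr h : Theta (theta0 + u) by apply: hr; rewrite addrC addKr.
  by rewrite /Sg !trmx_mul trmxK h mulmxA.
exists E; split; first exact: Et.
(* A linear relation between the rows of J becomes one between the derivatives of Sigma after
   undoing the conjugation, and then, read at the entries kept by [vech], a null vector of [Delta],
   which rank q excludes. *)
- apply: row_indep_gram => v vJ.
  have vE : \sum_j v 0 j *: E j = 0.
    apply: (can_inj (@mxvecK R _ _)); rewrite linear0 linear_sum /= -[RHS]vJ.
    apply/rowP => k; rewrite summxE mxE; apply: eq_bigr => j _.
    by rewrite linearZ mxE [in RHS]mxE.
  have vD : \sum_j v 0 j *: DS j = 0.
    have : invmx K *m (\sum_j v 0 j *: DS j) *m (invmx K)^T = 0.
      rewrite -[RHS]vE mulmx_sumr mulmx_suml; apply: eq_bigr => j _.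
      by rewrite -scalemxAr -scalemxAl.
    move=> /(congr1 (fun A => K *m A *m K^T)); rewrite mulmx0 mul0mx !mulmxA mulmxV// mul1mx.
    by rewrite -mulmxA -trmx_mul mulmxV// trmx1 mulmx1.
  have Dv : Delta M theta0 *m v^T = 0.
    apply/matrixP => i k; rewrite ord1 !mxE.
    have [a [b hab]] := vech_entry R i.
    have /matrixP/(_ a b) := vD; rewrite summxE [RHS]mxE => vDab.
    rewrite -[RHS]vDab; apply: eq_bigr => j _.
    rewrite !mxE mulrC; congr (_ * _).
    have := has_diff_derive a b j hS.
    have -> : (fun t => Sigma M t a b) = (fun t => vech (Sigma M t) i 0).
      by apply/funext => t; rewrite hab.
    exact.
  have Dfree : row_free (Delta M theta0)^T by rewrite /row_free mxrank_tr rk.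
  apply: (row_free_inj Dfree); rewrite mul0mx.
  by rewrite -[v]trmxK -trmx_mul Dv trmx0.
- move=> e e0; have [d d0 hd] := hSg e e0; exists d => // t td.
  have := hd _ td; rewrite [theta0 + _]addrC subrK Sg0 -(mxvec_nf (_ - _ - _)).
  rewrite linearB /=; congr (nf (_ - _) <= _).
  rewrite /difsum linear_sum /=; apply/rowP => k; rewrite summxE mxE; apply: eq_bigr => j _.
  by rewrite linearZ [LHS]mxE; congr (_ * _); rewrite [RHS]mxE.
Qed.

(** * Quadratic variation of the observed process *)

Section GridGram.
Context (R : realType) (p : nat) (T : R).
Hypothesis T0 : 0 < T.

Definition grid_gram n (U V : 'I_p -> R -> R) : 'M[R]_p :=
  \matrix_(a, b) \sum_i @grid R T n (U a) i * grid T (V b) i.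

Definition grid_var n (N : 'I_p -> R -> R) : R := \sum_a \sum_i @grid R T n (N a) i ^+ 2.

Lemma gridD n (U V : R -> R) (i : 'I_n) : grid T (fun t => U t + V t) i = grid T U i + grid T V i.
Proof. by rewrite /grid; ring. Qed.

Lemma grid_gramDD n (D N : 'I_p -> R -> R) :
  grid_gram n (fun a t => D a t + N a t) (fun a t => D a t + N a t) - grid_gram n N N =
  grid_gram n D N + (grid_gram n D N)^T + grid_gram n D D.
Proof.
apply/matrixP => a b; rewrite !mxE -sumrB -!big_split /=; apply: eq_bigr => i _.
by rewrite !gridD; ring.
Qed.

(** The variation of the noise stays on the right side because no pathwise bound on it is available;
    it is controlled later, on the event where the normalised sum is bounded. *)
Lemma grid_remainder (D b N : 'I_p -> R -> R) (e : R) :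
  (forall a, uniform_C1 T (D a) (b a)) -> (forall a, {within `[0, T], continuous (N a)}) -> 0 < e ->
  exists n0, forall n, (n0 <= n)%N -> (0 < n)%N ->
    Num.sqrt n%:R * nf (grid_gram n (fun a t => D a t + N a t) (fun a t => D a t + N a t) -
      grid_gram n N N) <= e * (1 + Num.sqrt (grid_var n N)).
Proof.
move=> hD hN e0.
pose c : R := 3 * (p * p)%:R + 1; have c0 : 0 < c by rewrite ltr_wpDl.
pose f := e / c; have f0 : 0 < f by rewrite divr_gt0.
(* The thresholds depend on the pair of coordinates; their maximum serves all pairs. *)
have fin (Q : 'I_p * 'I_p -> nat -> Prop) :
    (forall x, exists n0, forall n, (n0 <= n)%N -> (0 < n)%N -> Q x n) ->
    exists n0, forall n, (n0 <= n)%N -> (0 < n)%N -> forall x, Q x n.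
  move=> h; pose g x := proj1_sig (cid (h x)).
  exists (\max_x g x) => n nn n0 x; apply: (proj2_sig (cid (h x))) => //.
  by apply: leq_trans nn; exact: (leq_bigmax (F := g)).
have [n1 h1] := fin _ (fun x => cross_vanish T0 (hD x.1) (hN x.2) f0).
have [n2 h2] := fin _ (fun x => drift_vanish T0 (hD x.1) (hD x.2) f0).
exists (maxn n1 n2) => n; rewrite geq_max => /andP[nn1 nn2] n0.
rewrite grid_gramDD.
set V := grid_var n N; have sV : 0 <= Num.sqrt V by exact: sqrtr_ge0.
have Va a : Num.sqrt (\sum_i @grid R T n (N a) i ^+ 2) <= Num.sqrt V.
  rewrite ler_wsqrtr// /V /grid_var (bigD1 a)//= lerDl.
  by apply: sumr_ge0 => k _; apply: sumr_ge0 => i _; exact: sqr_ge0.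
have s0 : 0 <= Num.sqrt (n%:R : R) by exact: sqrtr_ge0.
apply: (@le_trans _ _ (\sum_(a < p) \sum_(b < p) 3 * f * (1 + Num.sqrt V))).
  apply: le_trans (ler_wpM2l s0 (nf_le_sum _)) _; rewrite mulr_sumr; apply: ler_sum => a _.
  rewrite mulr_sumr; apply: ler_sum => k _; rewrite !mxE.
  have k1 := h1 n nn1 n0 (a, k); have k2 := h1 n nn1 n0 (k, a); have k3 := h2 n nn2 n0 (a, k).
  rewrite /= in k1 k2 k3.
  have k1' : Num.sqrt n%:R * `|\sum_i @grid R T n (D a) i * grid T (N k) i| <= f * (1 + Num.sqrt V).
    by apply: le_trans k1 _; rewrite ler_pM2l// lerD2l.
  have k2' : Num.sqrt n%:R * `|\sum_i @grid R T n (D k) i * grid T (N a) i| <= f * (1 + Num.sqrt V).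
    by apply: le_trans k2 _; rewrite ler_pM2l// lerD2l.
  have k3' : Num.sqrt n%:R * `|\sum_i @grid R T n (D a) i * grid T (D k) i| <= f * (1 + Num.sqrt V).
    by apply: le_trans k3 _; rewrite ler_peMr ?(ltW f0)// lerDl.
  apply: le_trans (ler_wpM2l s0 (ler_normD _ _)) _; rewrite mulrDr.
  apply: le_trans (lerD (ler_wpM2l s0 (ler_normD _ _)) (lexx _)) _; rewrite mulrDr.
  apply: le_trans (lerD (lerD k1' k2') k3') _.
  by rewrite le_eqVlt; apply/orP; left; apply/eqP; ring.
rewrite !sumr_const !card_ord -mulrnA -[_ *+ (p * p)]mulr_natl.
rewrite mulrA ler_wpM2r ?addr_ge0// /f mulrCA [leLHS]mulrA mulrA -mulrA mulrCA.
rewrite (_ : _ * _ = e * ((3 * (p * p)%:R) / c)); last by field; rewrite gt_eqF.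
by rewrite ler_piMr ?(ltW e0)// ler_pdivrMr// mul1r lerDl.
Qed.

Lemma quad_var_congr (m : nat) (A : 'M[R]_(p, m)) n (x : R -> 'cV[R]_m) :
  A *m quad_var T n x *m A^T =
  T^-1 *: grid_gram n (fun a t => (A *m x t) a 0) (fun a t => (A *m x t) a 0).
Proof.
rewrite /quad_var -scalemxAr -scalemxAl; congr (_ *: _).
rewrite big_add1 /= big_mkord mulmx_sumr mulmx_suml.
apply/matrixP => a b; rewrite summxE mxE; apply: eq_bigr => i _.
set v := _ - _.
rewrite (_ : A *m (v *m v^T) *m A^T = (A *m v) *m (A *m v)^T); last by rewrite trmx_mul !mulmxA.
have E c : (A *m v) c 0 = grid T (fun t => (A *m x t) c 0) i.
  by rewrite /v mulmxBr [LHS]mxE [X in _ + X]mxE.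
by rewrite [LHS]mxE big_ord1 [X in _ * X]mxE !E.
Qed.

End GridGram.

Lemma psd_unit_posdef (R : realType) n (Q : 'M[R]_n) : psd Q -> Q \in unitmx -> posdef Q.
Proof.
move=> [QT Q0] Qu; split=> // x x0; rewrite lt_neqAle Q0 andbT eq_sym.
apply/eqP => xQx; move/eqP: x0; apply.
have key (t : R) : 0 <= 2 * t * fro (Q *m x) + t ^+ 2 * ((Q *m x)^T *m Q *m (Q *m x)) 0 0.
  have := Q0 (x + t *: (Q *m x)).
  have E1 : (x^T *m Q *m (Q *m x)) 0 0 = fro (Q *m x).
    by rewrite -fro_trmx fro_tr trmxK /mxtrace big_ord1 trmx_mul QT.
  have E2 : ((Q *m x)^T *m Q *m x) 0 0 = fro (Q *m x).
    by rewrite -fro_trmx fro_tr trmxK /mxtrace big_ord1 -mulmxA.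
  have -> : (x + t *: (Q *m x))^T = x^T + t *: (Q *m x)^T by apply/matrixP => i j; rewrite !mxE.
  rewrite !(mulmxDl, mulmxDr) -!scalemxAl -!scalemxAr.
  move: E1 E2 xQx.
  set a := x^T *m Q *m _; set b := _ *m Q *m x; set c := _ *m Q *m x; set dd := _ *m _ *m (Q *m x).
  clearbody a b c dd; move=> E1 E2 E3; rewrite !mxE E1 E2 E3; set f := fro _; set k := dd 0 0.
  by rewrite (_ : _ + _ = 2 * t * f + t ^+ 2 * k)//; ring.
set f := fro (Q *m x) in key; set c := (_ *m _ *m _) 0 0 in key.
have f0 : 0 <= f by exact: fro_ge0.
have c0 : 0 <= c by exact: Q0.
(* A negative multiple of f makes the expression negative unless f = 0. The denominator is c + 1
   because c may vanish. *)
have := key (- (f / (c + 1))).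
rewrite (_ : _ + _ = - (f ^+ 2 * (c + 2) / (c + 1) ^+ 2)); last by field; rewrite gt_eqF ?ltr_wpDl.
rewrite oppr_ge0 pmulr_lle0 ?invr_gt0 ?exprn_gt0 ?ltr_wpDl// pmulr_lle0 ?ltr_wpDl// => h.
have /eqP : f ^+ 2 = 0 by apply/eqP; rewrite eq_le h sqr_ge0.
rewrite sqrf_eq0 => /eqP /fro_eq0 h0.
by rewrite -[x](mulKmx Qu) h0 mulmx0.
Qed.

Lemma contrast_ge0 (R : realType) n (Q S : 'M[R]_n) : psd Q -> posdef S -> 0 <= contrast Q S.
Proof.
move=> Qp Sp; rewrite /contrast; case: ifP => Qu; last exact: sqr_ge0.
exact: qlik_ge0 (psd_unit_posdef Qp Qu) Sp.
Qed.

(** [inf] is a genuine lower bound only of a set bounded below, which nonnegativity of the contrast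
    guarantees here. *)
Lemma min_contrastP (R : realType) (p1 p2 k1 k2 q : nat) (Theta : set 'rV[R]_q)
    (M : sem (R + 'I_q) p1 p2 k1 k2) (Q : 'M[R]_(p1 + p2)) (theta : 'rV[R]_q) :
  sem_model Theta M -> psd Q -> min_contrast Theta M Q theta ->
  Theta theta /\ forall theta', Theta theta' ->
    contrast Q (Sigma M theta) <= contrast Q (Sigma M theta').
Proof.
move=> [_ hM] Qp [hth ->]; split=> // t ht; apply: ge_inf; last by exists t.
by exists 0 => _ [u /hM/posdef_sem_cov hu <-]; exact: contrast_ge0.
Qed.

Lemma posdef_uncongr (R : realType) n (K Q : 'M[R]_n) : K \in unitmx ->
  posdef (invmx K *m Q *m (invmx K)^T) -> posdef Q.
Proof.
move=> Ku /(posdef_congr Ku); rewrite !mulmxA mulmxV// mul1mx -mulmxA -trmx_mul.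
by rewrite mulmxV// trmx1 mulmx1.
Qed.

Lemma statistic_expansion (R : realType) (p1 p2 k1 k2 q : nat) (Theta : set 'rV[R]_q)
    (M : sem (R + 'I_q) p1 p2 k1 k2) (theta0 : 'rV[R]_q) (K : 'M[R]_(p1 + p2)) :
  compact Theta -> sem_model Theta M -> Theta° theta0 -> \rank (Delta M theta0) = q ->
  (forall theta1 theta2, Theta theta1 -> Theta theta2 ->
     Sigma M theta1 = Sigma M theta2 -> theta1 = theta2) ->
  K \in unitmx -> Sigma M theta0 = K *m K^T ->
  let nrm Q := invmx K *m Q *m (invmx K)^T in
  exists J : 'M[R]_(q, (p1 + p2) * (p1 + p2)),
    [/\ J *m J^T \in unitmx, J *m sym_proj R (p1 + p2) = J &
    forall e C : R, 0 < e -> 0 < C -> exists n0 : nat, forall n Q theta,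
      (n0 <= n)%N -> psd Q -> nf (Num.sqrt n%:R *: (nrm Q - 1%:M)) <= C ->
      min_contrast Theta M Q theta ->
      `|n%:R * contrast Q (Sigma M theta) -
        fro (mxvec (Num.sqrt n%:R *: (nrm Q - 1%:M)) *m resid_proj J) / 2| <= e].
Proof.
move=> hc hM hi hr hid Ku SK nrm.
have [hpos hcont Sg1 [E]] := normalized_model hM hi hr Ku SK.
set J := \matrix_j mxvec (E j); case=> ET Ju hd.
have Th0 : Theta theta0 by exact: interior_subset.
exists J; split=> //.
  apply/row_matrixP => j; rewrite row_mul !rowK; exact: mxvec_sym_id.
move=> e C e0 C0.
have Sinj theta : Theta theta -> nrm (Sigma M theta) = 1%:M -> theta = theta0.
  move=> ht h; apply: hid => //; rewrite SK.
  have := congr1 (fun A => K *m A *m K^T) h.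
  rewrite /nrm !mulmxA mulmxV// mul1mx mulmx1 -mulmxA -trmx_mul mulmxV//.
  by rewrite trmx1 mulmx1.
have [s0 s00 H] := argmin_expansion hc hi hpos hcont Sg1 Sinj hd Ju e0 C0.
(* The second entry keeps the normalised Q at distance less than 1 from the identity, hence positive
   definite, so that the contrast is the likelihood one. *)
pose s1 := Num.max s0 (C + 1).
exists (Num.truncn (s1 ^+ 2)).+1 => n Q theta nn Qp hQ hmin.
have hs : s1 <= Num.sqrt n%:R by exact: le_sqrt_nat.
have [ss0 ss1] : s0 <= Num.sqrt n%:R /\ C + 1 <= Num.sqrt n%:R.
  by move: hs; rewrite /s1 ge_max => /andP.
have QT : (nrm Q)^T = nrm Q by rewrite /nrm !trmx_mul trmxK (proj1 Qp) mulmxA.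
have nQ : posdef (nrm Q).
  apply: posdef_near1 => //.
  have sp : 0 < Num.sqrt (n%:R : R) by apply: lt_le_trans s00 ss0.
  rewrite -(ltr_pM2l sp) mulr1; apply: le_lt_trans (_ : C < _).
    by move: hQ; rewrite nfZ ger0_norm// sqrtr_ge0.
  by apply: lt_le_trans ss1; rewrite ltrDl.
have Qpos := posdef_uncongr Ku nQ; have Qu := posdef_unit Qpos.
have cE t : Theta t -> contrast Q (Sigma M t) = qlik (nrm Q) (nrm (Sigma M t)).
  move=> /(proj2 hM)/posdef_sem_cov Sp; rewrite /contrast Qu.
  by rewrite qlik_congr ?unitmx_inv.
have [ht hle] := min_contrastP hM Qp hmin.
have := H (Num.sqrt n%:R) (nrm Q) theta ss0 QT hQ ht.
rewrite sqr_sqrtr ?ler0n// cE//; apply.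
by move=> t' ht'; rewrite -(cE _ ht) -(cE _ ht'); exact: hle.
Qed.

Lemma psd_quad_var (R : realType) (p : nat) (T : R) n (x : R -> 'cV[R]_p) :
  0 < T -> psd (quad_var T n x).
Proof.
move=> T0; rewrite /quad_var; split.
  rewrite linearZ /= raddf_sum; congr (_ *: _); apply: eq_bigr => i _.
  by rewrite [LHS]trmx_mul trmxK.
move=> y; rewrite -scalemxAr -scalemxAl mxE mulr_ge0 ?invr_ge0 ?(ltW T0)//.
rewrite mulmx_sumr mulmx_suml summxE; apply: sumr_ge0 => i _.
set v := _ - _.
rewrite (_ : _ *m _ *m _ = (y^T *m v) *m (v^T *m y)); last by rewrite !mulmxA.
rewrite mxE big_ord1 (_ : (v^T *m y) 0 0 = (y^T *m v) 0 0) -?expr2 ?sqr_ge0//.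
by rewrite -[in LHS](trmxK y) -trmx_mul mxE.
Qed.


(** * Measurability of the statistic *)

Section MatrixMeasurability.
Context (d : measure_display) (T : measurableType d) (R : realType).

Definition mxmeas m n (A : T -> 'M[R]_(m, n)) : Prop :=
  forall i j, measurable_fun setT (fun w => A w i j).

(** Writing 1 / f as f exp (- ln f^2) also gives the value 0 where f vanishes, in agreement with the
    convention for the inverse of 0. *)
Lemma measurable_funVr (f : T -> R) : measurable_fun setT f ->
  measurable_fun setT (fun w => (f w)^-1).
Proof.
move=> mf.
have -> : (fun w => (f w)^-1) = (fun w => f w * expR (- ln (f w ^+ 2))).
  apply/funext => w; have [->|f0] := eqVneq (f w) 0; first by rewrite invr0 mul0r.
  have f20 : 0 < f w ^+ 2 by rewrite exprn_even_gt0.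
  by rewrite expRN lnK ?posrE// expr2 invfM mulrA divff// mul1r.
apply: measurable_funM => //; apply: measurableT_comp => //.
apply: measurable_funN; apply: measurableT_comp => //; exact: measurable_funX.
Qed.

Lemma measurable_mulmx m n p (A : T -> 'M[R]_(m, n)) (B : T -> 'M[R]_(n, p)) :
  mxmeas A -> mxmeas B -> mxmeas (fun w => A w *m B w).
Proof.
move=> mA mB i j; under eq_fun do rewrite mxE.
by apply: measurable_sum => k; exact: measurable_funM.
Qed.

Lemma measurable_addmx m n (A B : T -> 'M[R]_(m, n)) :
  mxmeas A -> mxmeas B -> mxmeas (fun w => A w + B w).
Proof. by move=> mA mB i j; under eq_fun do rewrite mxE; exact: measurable_funD. Qed.

Lemma measurable_trmx m n (A : T -> 'M[R]_(m, n)) : mxmeas A -> mxmeas (fun w => (A w)^T).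
Proof. by move=> mA i j; under eq_fun do rewrite mxE; exact: mA. Qed.

Lemma measurable_det n (A : T -> 'M[R]_n) : mxmeas A -> measurable_fun setT (fun w => \det (A w)).
Proof.
move=> mA; apply: measurable_sum => s; apply: measurable_funM => //.
by apply: measurable_prod => i _.
Qed.

Lemma measurable_mxtrace n (A : T -> 'M[R]_n) : mxmeas A -> measurable_fun setT (fun w => \tr (A w)).
Proof. by move=> mA; apply: measurable_sum. Qed.

Lemma measurable_invmx n (A : T -> 'M[R]_n) : (forall w, A w \in unitmx) -> mxmeas A ->
  mxmeas (fun w => invmx (A w)).
Proof.
move=> Au mA i j; under eq_fun do rewrite /invmx Au mxE.
apply: measurable_funM; first exact/measurable_funVr/measurable_det.
under eq_fun do rewrite mxE /cofactor.
apply: measurable_funM => //; apply: measurable_det => k l.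
by do 2 under eq_fun do rewrite mxE; exact: mA.
Qed.

Lemma measurable_block_mx m1 m2 n1 n2 (A : T -> 'M[R]_(m1, n1)) (B : T -> 'M[R]_(m1, n2))
    (C : T -> 'M[R]_(m2, n1)) (D : T -> 'M[R]_(m2, n2)) :
  mxmeas A -> mxmeas B -> mxmeas C -> mxmeas D -> mxmeas (fun w => block_mx (A w) (B w) (C w) (D w)).
Proof.
move=> mA mB mC mD i j; under eq_fun do rewrite mxE.
by case: fintype.split => k; under eq_fun do rewrite mxE; case: fintype.split => l;
  [exact: mA|exact: mB|exact: mC|exact: mD].
Qed.

Lemma measurable_Sigma (p1 p2 k1 k2 q : nat) (M : sem (R + 'I_q) p1 p2 k1 k2)
    (theta : T -> 'rV[R]_q) : mxmeas theta ->
  (forall w, sem_Psi (sem_at M (theta w)) \in unitmx) -> mxmeas (fun w => Sigma M (theta w)).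
Proof.
move=> mt Pu.
have me m n (A : 'M[R + 'I_q]_(m, n)) : mxmeas (fun w => map_mx (entry_val (theta w)) A).
  move=> i j; under eq_fun do rewrite mxE.
  by case: (A i j) => [c|k] /=; [exact: measurable_cst|exact: mt].
have mP : mxmeas (fun w => invmx (sem_Psi (sem_at M (theta w)))).
  by apply: measurable_invmx => //; exact: me.
have mS12 : mxmeas (fun w => let N := sem_at M (theta w) in
    sem_L1 N *m sem_Sxi N *m (sem_Gamma N)^T *m (invmx (sem_Psi N))^T *m (sem_L2 N)^T).
  apply: measurable_mulmx; last by apply: measurable_trmx; exact: me.
  apply: measurable_mulmx; last exact: measurable_trmx.
  apply: measurable_mulmx; last by apply: measurable_trmx; exact: me.
  by apply: measurable_mulmx; exact: me.
apply: measurable_block_mx.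
- apply: measurable_addmx; last exact: me.
  apply: measurable_mulmx; last by apply: measurable_trmx; exact: me.
  by apply: measurable_mulmx; exact: me.
- exact: mS12.
- exact: measurable_trmx.
- apply: measurable_addmx; last exact: me.
  apply: measurable_mulmx; last by apply: measurable_trmx; exact: me.
  apply: measurable_mulmx; last exact: measurable_trmx.
  apply: measurable_mulmx; first by apply: measurable_mulmx => //; exact: me.
  apply: measurable_addmx; last exact: me.
  apply: measurable_mulmx; last by apply: measurable_trmx; exact: me.
  by apply: measurable_mulmx; exact: me.
Qed.

Lemma measurable_contrast n (Q S : T -> 'M[R]_n) : mxmeas Q -> mxmeas S ->
  (forall w, S w \in unitmx) -> measurable_fun setT (fun w => contrast (Q w) (S w)).
Proof.
move=> mQ mS Su; apply: measurable_fun_ifT.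
- apply: (measurable_fun_bool false).
  rewrite (_ : _ @^-1` _ = (fun w => \det (Q w)) @^-1` [set 0]).
    have := measurable_det mQ measurableT (measurable_set1 (0 : R)); by rewrite setTI.
  apply/seteqP; split => w /=; rewrite unitmxE unitfE.
    by move=> /negbFE/eqP.
  by move=> ->; rewrite eqxx.
- apply: measurable_funB => //; apply: measurable_funD.
    by apply: measurable_funB; apply: measurableT_comp => //; exact: measurable_det.
  by apply: measurable_mxtrace; apply: measurable_mulmx => //; exact: measurable_invmx.
- apply: measurable_funX; apply: measurableT_comp.
    by apply: continuous_measurable_fun; exact: sqrt_continuous.
  apply: measurable_sum => i; apply: measurable_funX.
  have [a [b E]] := vech_entry R i.
  under eq_fun do rewrite mxE [X in _ + X]mxE !E.
  by apply: measurable_funB.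
Qed.

Lemma measurable_quad_var n (h : R) (X : R -> T -> 'cV[R]_n) k :
  (forall t, 0 <= t <= h -> random_vector (X t)) -> 0 < h ->
  mxmeas (fun w => quad_var h k (X^~ w)).
Proof.
move=> mX h0 i j; have [->|k0] := posnP k.
  under eq_fun do rewrite /quad_var big_geq// scaler0 mxE; exact: measurable_cst.
under eq_fun do rewrite /quad_var mxE summxE big_add1 big_mkord.
apply: measurable_funM => //; apply: measurable_sum => l.
have tm m : (m <= k)%N -> random_vector (X (m%:R * (h / k%:R))).
  move=> mk; apply: mX; exact: grid_time.
under eq_fun do rewrite mxE big_ord1 [X in _ * X]mxE.
have mD a : measurable_fun setT (fun w =>
    (X (l.+1%:R * (h / k%:R)) w - X (l.+1.-1%:R * (h / k%:R)) w) a 0).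
  under eq_fun do rewrite mxE [X in _ + X]mxE.
  have lk : (l < k)%N by exact: ltn_ord.
  by apply: measurable_funB; [exact: tm lk a|exact: tm (ltnW lk) a].
by apply: measurable_funM; exact: mD.
Qed.

End MatrixMeasurability.

Lemma expRN_lip (R : realType) (a b : R) : 0 <= a -> 0 <= b ->
  `|expR (- a) - expR (- b)| <= `|a - b| /\ `|expR (- a) - expR (- b)| <= 1.
Proof.
wlog ab : a b / a <= b => [H a0 b0|a0 b0].
  have [ab|ba] := leP a b; first exact: H.
  by rewrite distrC [`|a - b|]distrC; apply: H => //; exact: ltW.
rewrite distrC ler0_norm ?subr_le0 ?ler_expR ?lerN2// opprB.
rewrite distrC ger0_norm ?subr_ge0//.
have h1 : expR (- a) <= 1 by rewrite expR_le1// oppr_le0.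
have h2 : 0 <= expR (- b) by exact: expR_ge0.
split; last by lra.
have -> : expR (- b) = expR (- a) * expR (- (b - a)) by rewrite -expRD; congr expR; ring.
have h3 : 1 + - (b - a) <= expR (- (b - a)) by exact: expR_ge1Dx.
have := ler_wpM2l (expR_ge0 (- a)) h3.
have ba : 0 <= b - a by rewrite subr_ge0.
have := ler_wpM2r ba h1.
set u := expR (- a); set v := u * _; lra.
Qed.

(** * Limit law of the statistic *)

Section Slutsky.
Context (d : measure_display) (T : measurableType d) (R : realType).
Variable P : probability T R.

Lemma ex_vanish (rho : nat -> T -> R) (e : R) :
  (forall n, measurable_fun setT (rho n)) -> (forall n w, 0 <= rho n w <= 1) ->
  {ae P, forall w, rho ^~ w @ \oo --> (0 : R)} -> 0 < e ->
  exists n0, forall n, (n0 <= n)%N -> ex P (rho n) <= e.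
Proof.
move=> mr r01 rc e0.
have mr' n : measurable_fun setT (EFin \o rho n) by exact/measurable_EFinP.
have rc' : {ae P, forall w, setT w -> (EFin \o rho n) w @[n --> \oo] --> ((fun=> 0%E) : T -> \bar R) w}.
  by apply: filterS rc => w h _; apply: cvg_EFin => //; exact: nearW.
have rb : {ae P, forall w n, setT w -> (`|(EFin \o rho n) w| <= (EFin \o (fun=> 1%R)) w)%E}.
  by apply: aeW => w n _ /=; rewrite lee_fin ger0_norm; case/andP: (r01 n w).
have [_ _] := @dominated_convergence _ _ _ P setT measurableT _ _ _ mr' (measurable_cst _) rc' (intg_cst P 1) rb.
rewrite integral0.
have fin n : (\int[P]_w (EFin \o rho n) w)%E = (ex P (rho n))%:E.
  rewrite /ex /Rintegral fineK//; apply: integrable_fin_num => //.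
  apply: (@intg_bounded _ _ _ P _ 1) => // w; by rewrite ger0_norm; case/andP: (r01 n w).
under eq_fun do rewrite fin.
move=> /fine_cvgP[_ /= /cvgrPdist_le /(_ _ e0)[n0 _ h]]; exists n0 => n nn.
by have := h n nn; rewrite /= sub0r normrN; apply: le_trans; exact: ler_norm.
Qed.

(** The difference of the two exponentials is at most e/3 + |Y|^2 / K2 + rho / g: it is bounded by 1
    where |Y|^2 > K2 or rho > g, and is small elsewhere by the closeness of S and X. Both extra
    terms have mean at most e/3, by the second moment of Y and by [ex_vanish]. *)
Lemma slutsky_laplace (m : nat -> nat) (Y : forall n, T -> 'rV[R]_(m n)) (S X rho : nat -> T -> R) (C l e : R) :
  (forall n, measurable_fun setT (S n)) -> (forall n, measurable_fun setT (X n)) ->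
  (forall n w, 0 <= S n w) -> (forall n w, 0 <= X n w) ->
  (forall n, (0 < n)%N -> intg P (fun w => fro (Y n w)) /\ ex P (fun w => fro (Y n w)) = C) ->
  (forall n, measurable_fun setT (rho n)) -> (forall n w, 0 <= rho n w <= 1) ->
  {ae P, forall w, rho ^~ w @ \oo --> (0 : R)} ->
  (forall f K, 0 < f -> 0 < K -> exists n0, exists2 g, 0 < g & forall n w, (n0 <= n)%N -> (0 < n)%N ->
    nf (Y n w) <= K -> rho n w <= g -> `|S n w - X n w| <= f) ->
  0 <= l -> 0 < e ->
  exists n0, forall n, (n0 <= n)%N -> (0 < n)%N ->
    `|ex P (fun w => expR (- (l * S n w))) - ex P (fun w => expR (- (l * X n w)))| <= e.
Proof.
move=> mS mX S0 X0 YC mr r01 rc H l0 e0.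
have C0 : 0 <= C by have [_ <-] := YC 1%N isT; apply: ex_ge0 => w; exact: fro_ge0.
pose f := e / (3 * (l + 1)); have f0 : 0 < f by rewrite divr_gt0// mulr_gt0// ltr_wpDl.
pose K2 := 3 * (C + 1) / e; have K20 : 0 < K2 by rewrite divr_gt0// mulr_gt0// ltr_wpDl.
have K0 : 0 < Num.sqrt K2 by rewrite sqrtr_gt0.
have [n1 [g g0 H1]] := H f (Num.sqrt K2) f0 K0.
have ge0 : 0 < g * (e / 3) by rewrite mulr_gt0// divr_gt0.
have [n2 H2] := ex_vanish mr r01 rc ge0.
exists (maxn n1 n2) => n; rewrite geq_max => /andP[nn1 nn2] n0.
have [Yi Ye] := YC n n0.
have mE (Z : T -> R) : measurable_fun setT Z -> (forall w, 0 <= Z w) ->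
    intg P (fun w => expR (- (l * Z w))).
  move=> mZ Z0; apply: (@intg_bounded _ _ _ P _ 1).
    apply: measurableT_comp => //; apply: measurable_funN; exact: measurable_funM.
  by move=> w; rewrite ger0_norm ?expR_ge0// expR_le1// oppr_le0 mulr_ge0.
have i1 := mE _ (mS n) (S0 n); have i2 := mE _ (mX n) (X0 n).
have ir : intg P (rho n).
  by apply: (@intg_bounded _ _ _ P _ 1) => // w; rewrite ger0_norm; case/andP: (r01 n w).
rewrite -exB//.
have iA := intgZ K2^-1 Yi; have iB := intgZ g^-1 ir.
have iD := intgD (intgD (intg_cst P (e / 3)) iA) iB.
apply: le_trans (ex_le_abs (intgB i1 i2) iD _) _; last first.
  rewrite exD//; last by apply: intgD => //; exact: intg_cst.
  rewrite exD//; last exact: intg_cst.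
  rewrite ex_cst (exZ _ Yi) (exZ _ ir) Ye.
  have h1 : K2^-1 * C <= e / 3.
    rewrite mulrC ler_pdivrMr// /K2 (_ : e / 3 * _ = C + 1); first by rewrite lerDl.
    by field; rewrite gt_eqF.
  have h2 : g^-1 * ex P (rho n) <= e / 3 by rewrite mulrC ler_pdivrMr// mulrC H2.
  by apply: le_trans (lerD (lerD (lexx _) h1) h2) _; rewrite le_eqVlt; apply/orP; left; apply/eqP; field.
move=> w; have [e1 e2] := expRN_lip (mulr_ge0 l0 (S0 n w)) (mulr_ge0 l0 (X0 n w)).
have [r0 _] := andP (r01 n w).
have tA : 0 <= K2^-1 * fro (Y n w) by rewrite mulr_ge0 ?fro_ge0// invr_ge0 ltW.
have tB : 0 <= g^-1 * rho n w by rewrite mulr_ge0// invr_ge0 ltW.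
have e3 : 0 <= e / 3 by rewrite divr_ge0// ltW.
have [hK|hK] := leP (nf (Y n w)) (Num.sqrt K2); last first.
  apply: le_trans e2 _; apply: (@le_trans _ _ (K2^-1 * fro (Y n w))).
    rewrite mulrC ler_pdivlMr// mul1r -[K2]sqr_sqrtr ?(ltW K20)// -sqr_nf.
    by rewrite lerXn2r ?nnegrE ?sqrtr_ge0 ?nf_ge0// ltW.
  by rewrite -addrA addrCA lerDl addr_ge0.
have [hg|hg] := leP (rho n w) g; last first.
  apply: le_trans e2 _; apply: (@le_trans _ _ (g^-1 * rho n w)).
    by rewrite mulrC ler_pdivlMr// mul1r ltW.
  by rewrite lerDr addr_ge0.
apply: le_trans e1 _; apply: (@le_trans _ _ (e / 3)).
  rewrite -mulrBr normrM (ger0_norm l0).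
  apply: le_trans (ler_wpM2l l0 (H1 n w nn1 n0 hK hg)) _.
  have l1 : 0 < l + 1 by rewrite ltr_wpDl.
  rewrite (_ : l * f = e / 3 * (l / (l + 1))); last by rewrite /f; field; rewrite gt_eqF.
  by rewrite ler_piMr// ler_pdivrMr// mul1r lerDl.
by rewrite -addrA lerDl addr_ge0.
Qed.

End Slutsky.

Lemma sqr_close (R : realType) (a b h k : R) : `|a - b| <= h -> 0 <= a -> 0 <= b -> b <= k ->
  h <= 1 -> `|a ^+ 2 / 2 - b ^+ 2 / 2| <= h * (2 * k + 1) / 2.
Proof.
move=> ab a0 b0 bk h1; have h0 : 0 <= h by exact: le_trans ab.
have -> : a ^+ 2 / 2 - b ^+ 2 / 2 = (a - b) * ((a + b) / 2) by field.
rewrite normrM [X in _ * X]ger0_norm ?divr_ge0 ?addr_ge0// -mulrA.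
apply: ler_pM => //; first by rewrite divr_ge0 ?addr_ge0.
rewrite ler_pM2r ?invr_gt0//; have := ler_norm (a - b); lra.
Qed.

(** A value at most 1/2 shows that the truncation at 1 is not active. *)
Lemma min1_le (R : realType) (z g : R) : Num.min 1 z <= 1 / 2 -> Num.min 1 z <= g -> z <= g.
Proof. by rewrite /Num.min; case: ifP => // _; lra. Qed.

Section LimitLaw.
Context (R : realType) (d : measure_display) (Omega : measurableType d)
  (P : probability Omega R).
Variables (r1 r2 r3 r4 : nat) (W1 : R -> Omega -> 'cV[R]_r1) (W2 : R -> Omega -> 'cV[R]_r2)
  (W3 : R -> Omega -> 'cV[R]_r3) (W4 : R -> Omega -> 'cV[R]_r4).
Hypotheses (hW1 : wiener P W1) (hW2 : wiener P W2) (hW3 : wiener P W3) (hW4 : wiener P W4).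
Hypothesis hW : independent4 P W1 W2 W3 W4.
Variable T : R.
Hypothesis T0 : 0 < T.
Local Notation C := (noise r1 r2 r3 r4).
Variables (p : nat) (o : 'I_p -> C -> R).
Hypothesis oo : forall a b, \sum_c o a c * o b c = (a == b)%:R.

Definition noise_path (c : C) (t : R) (w : Omega) : R :=
  match c with
  | inl c => W1 t w c 0
  | inr (inl c) => W2 t w c 0
  | inr (inr (inl c)) => W3 t w c 0
  | inr (inr (inr c)) => W4 t w c 0
  end.

Definition mixed_noise (w : Omega) (a : 'I_p) (t : R) : R := \sum_c o a c * noise_path c t w.
Local Notation N := mixed_noise.

Definition noise_score n : 'I_n -> Omega -> 'rV[R]_(p * p) :=
  uvec (noise_incr (n := n) (T / n%:R) W1 W2 W3 W4) (Num.sqrt (T / n%:R)) o.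

Definition noise_sum n (w : Omega) : 'rV[R]_(p * p) := nsum (@noise_score n) w.

Lemma grid_mixed_noise n w a (i : 'I_n) : grid T (N w a) i =
  \sum_c o a c * noise_incr (T / n%:R) W1 W2 W3 W4 (i, c) w.
Proof.
rewrite /grid /N -sumrB; apply: eq_bigr => c _; rewrite -mulrBr; congr (_ * _).
by case: c => [c|[c|[c|c]]].
Qed.

Lemma measurable_mixed_noise a t : 0 <= t -> measurable_fun setT (fun w => N w a t).
Proof.
move=> t0; apply: measurable_sum => c; apply: measurable_funM => //.
have h r (W : R -> Omega -> 'cV[R]_r) k : wiener P W -> measurable_fun setT (fun w => W t w k 0).
  by case=> /(_ k)[mW _ _ _] _; exact: mW.
by case: c => [c|[c|[c|c]]]; exact: h.
Qed.

(** For the noise alone, the normalised quadratic variation is exactly a normalised sum of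
    independent scores. The factor sqrt 2 is the one removed in [uvec]. *)
Lemma noise_sum_gram n w : (0 < n)%N ->
  mxvec (Num.sqrt n%:R *: (T^-1 *: grid_gram T n (N w) (N w) - 1%:M)) =
  Num.sqrt 2 *: noise_sum n w.
Proof.
move=> n0; have n0' : (0 : R) < n%:R by rewrite ltr0n.
have s0 : Num.sqrt (n%:R : R) != 0 by rewrite gt_eqF// sqrtr_gt0.
have s20 : Num.sqrt (2 : R) != 0 by rewrite gt_eqF// sqrtr_gt0.
apply/rowP => k; case/mxvec_indexP: k => a b; rewrite mxvecE.
rewrite /noise_sum /nsum; rewrite [RHS]mxE [X in _ * X]mxE summxE.
under eq_bigr => i _ do rewrite uvecE.
rewrite -mulr_sumr mulrCA (mulrA (Num.sqrt 2)) divff// mul1r.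
have E (i : 'I_n) : gmat (noise_incr (T / n%:R) W1 W2 W3 W4) (Num.sqrt (T / n%:R)) o i w a b =
    n%:R / T * (grid T (N w a) i * grid T (N w b) i) - (a == b)%:R.
  rewrite /gmat [LHS]mxE [X in X + _]mxE big_ord1 [X in _ * X]mxE [X in _ + X]mxE [X in - X]mxE.
  congr (_ - _); rewrite !mxE !grid_mixed_noise.
  have F e : \sum_c o e c * stdn (noise_incr (T / n%:R) W1 W2 W3 W4) (Num.sqrt (T / n%:R)) (i, c) w =
      (Num.sqrt (T / n%:R))^-1 * \sum_c o e c * noise_incr (T / n%:R) W1 W2 W3 W4 (i, c) w.
    by rewrite mulr_sumr; apply: eq_bigr => c _; rewrite /stdn mulrCA.
  rewrite !F mulrACA -invfM -expr2 sqr_sqrtr ?divr_ge0 ?(ltW T0) ?(ltW n0')//.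
  by rewrite invf_div.
under eq_bigr => i _ do rewrite E.
rewrite sumrB -mulr_sumr sumr_const card_ord -(mulr_natl (a == b)%:R n).
rewrite [LHS]mxE [X in _ * X]mxE [X in _ * (X + _)]mxE [X in _ * (_ * X + _)]mxE.
rewrite [X in _ * (_ + X)]mxE [X in _ * (_ - X)]mxE.
set g := \sum_i _; set u := (a == b)%:R.
have := sqr_sqrtr (ltW n0'); move: s0; set s := Num.sqrt (n%:R : R) => s0 <-.
have T0' : T != 0 by rewrite gt_eqF.
by field; rewrite ?s0 ?T0'.
Qed.

Variables (q : nat) (J : 'M[R]_(q, p * p)).
Hypotheses (Ju : J *m J^T \in unitmx) (JS : J *m sym_proj R p = J).
Local Notation Pi := (resid_proj J).
Local Notation dof := ((p * p.+1)%:R / 2 - q%:R : R).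
Hypothesis dof0 : 0 <= dof.

Lemma noise_step_gt0 n : (0 < n)%N -> 0 < T / n%:R.
Proof. by move=> n0; rewrite divr_gt0// ltr0n. Qed.

Lemma noise_score_array n (Q : 'M[R]_(p * p)) : (0 < n)%N -> Q^T = Q -> Q *m Q = Q ->
  sym_proj R p *m Q = Q *m sym_proj R p ->
  clt_array P (fun i w => @noise_score n i w *m Q) (sym_proj R p *m Q) (cube_const C Q).
Proof.
move=> n0 QT QQ QS; have h0 := noise_step_gt0 n0.
have s0 : 0 < Num.sqrt (T / n%:R) by rewrite sqrtr_gt0.
apply: (@xivec_array _ _ _ P p n C _ _ s0) => //.
- by move=> x; apply: (noise_incr_meas h0 hW1 hW2 hW3 hW4 x).
- by move=> E mE; exact: noise_incr_indep.
- by move=> x A mA; exact: noise_incr_law.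
Qed.

(** The case Q = 1 of the array, whose covariance has trace p (p + 1) / 2. This second moment gives
    boundedness in probability. *)
Lemma noise_sum_fro n : (0 < n)%N -> intg P (fun w => fro (noise_sum n w)) /\
  ex P (fun w => fro (noise_sum n w)) = (p * p.+1)%:R / 2.
Proof.
move=> n0; have := @noise_score_array n 1%:M n0 (trmx1 _ _) (mulmx1 _).
rewrite mulmx1 mul1mx => /(_ erefl) h.
have := ex_fro_nsum n0 h; rewrite trace_sym_proj.
have -> // : (fun w => fro (nsum (fun i w => @noise_score n i w *m 1%:M) w)) =
  (fun w => fro (noise_sum n w)).
by apply/funext => w; rewrite /noise_sum /nsum; under eq_bigr do rewrite mulmx1.
Qed.

Lemma nsum_proj n (w : Omega) (Q : 'M[R]_(p * p)) :
  nsum (fun i w => @noise_score n i w *m Q) w = noise_sum n w *m Q.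
Proof. by rewrite /noise_sum /nsum -scalemxAl mulmx_suml. Qed.

Lemma noise_sum_meas n : mxmeas (@noise_sum n).
Proof.
have [->|n0] := posnP n => i j; rewrite ord1.
  under eq_fun do rewrite /noise_sum /nsum big_ord0 scaler0 mxE; exact: measurable_cst.
have := @noise_score_array n 1%:M n0 (trmx1 _ _) (mulmx1 _).
rewrite mulmx1 mul1mx => /(_ erefl) h.
have := nsum_meas h j; under eq_fun do rewrite nsum_proj mulmx1.
done.
Qed.

Lemma noise_sum_laplace (l e : R) : 0 < l -> 0 < e -> exists n0, forall n, (n0 <= n)%N -> (0 < n)%N ->
  `|ex P (fun w => expR (- (l * fro (noise_sum n w *m Pi)))) - chi2_mgf dof l| <= e.
Proof.
move=> l0 e0; have [cS trE] := sym_resid_proj Ju JS.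
have D0 : 0 <= \tr (sym_proj R p *m Pi) by rewrite trE.
have [n0 H] := @laplace_limit _ _ _ P _ (sym_proj R p *m Pi) (cube_const C Pi) l e D0 l0 e0.
exists n0 => n nn np; have := H n _ nn (@noise_score_array n Pi np (proj_tr _) (proj_idem Ju) cS).
by rewrite trE; under eq_fun do rewrite nsum_proj.
Qed.

Variable X : Omega -> 'I_p -> R -> R.
Hypothesis mX : forall a t, 0 <= t <= T -> measurable_fun setT (fun w => X w a t).
Hypothesis hX : {ae P, forall w, exists b : 'I_p -> R -> R, forall a,
  uniform_C1 T (fun t => X w a t - N w a t) (b a) /\ {within `[0, T], continuous (N w a)}}.

(* Truncated at 1, so that almost sure convergence implies convergence in mean. *)
Definition grid_err n w : R := Num.min 1
  (Num.sqrt n%:R * nf (grid_gram T n (X w) (X w) - grid_gram T n (N w) (N w)) /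
    (1 + Num.sqrt (grid_var T n (N w)))).

Let den0 n w : 0 < 1 + Num.sqrt (grid_var T n (N w)).
Proof. by rewrite ltr_pwDl ?sqrtr_ge0. Qed.

Lemma grid_err01 n w : 0 <= grid_err n w <= 1.
Proof.
rewrite /grid_err ge_min lexx le_min ler01 /= andbT.
by rewrite divr_ge0 ?(ltW (den0 _ _))// mulr_ge0 ?sqrtr_ge0 ?nf_ge0.
Qed.

Lemma measurable_grid n a (i : 'I_n) (Z : Omega -> 'I_p -> R -> R) :
  (forall a t, 0 <= t <= T -> measurable_fun setT (fun w => Z w a t)) ->
  measurable_fun setT (fun w => grid T (Z w a) i).
Proof.
move=> mZ; have n0 : (0 < n)%N by apply: leq_ltn_trans (ltn_ord i).
by apply: measurable_funB; apply: mZ; apply: grid_time => //; rewrite ltnW.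
Qed.

Lemma measurable_gram n (Z : Omega -> 'I_p -> R -> R) :
  (forall a t, 0 <= t <= T -> measurable_fun setT (fun w => Z w a t)) ->
  mxmeas (fun w => grid_gram T n (Z w) (Z w)).
Proof.
move=> mZ a b; under eq_fun do rewrite mxE.
by apply: measurable_sum => i; apply: measurable_funM; exact: measurable_grid.
Qed.

Let mN a t : 0 <= t <= T -> measurable_fun setT (fun w => N w a t).
Proof. by case/andP=> t0 _; exact: measurable_mixed_noise. Qed.

Lemma measurable_grid_err n : measurable_fun setT (grid_err n).
Proof.
apply: measurable_minr => //.
have msq (f : Omega -> R) : measurable_fun setT f -> measurable_fun setT (fun w => Num.sqrt (f w)).
  by move=> mf; apply: measurableT_comp => //; apply: continuous_measurable_fun; exact: sqrt_continuous.
apply: measurable_funM; last first.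
  apply: measurable_funVr; apply: measurable_funD => //; apply: msq.
  apply: measurable_sum => a; apply: measurable_sum => i; apply: measurable_funX.
  exact: measurable_grid.
apply: measurable_funM => //; apply: msq.
apply: measurable_sum => a; apply: measurable_sum => b; apply: measurable_funX.
under eq_fun do rewrite mxE [X in _ + X]mxE.
by apply: measurable_funB; exact: measurable_gram.
Qed.

Lemma grid_err_cvg : {ae P, forall w, grid_err ^~ w @ \oo --> (0 : R)}.
Proof.
apply: filterS hX => w [b hb]; apply/cvgrPdist_le => e e0.
have [n0 H] := grid_remainder T0 (fun a => proj1 (hb a)) (fun a => proj2 (hb a)) e0.
exists (maxn n0 1) => // n /=; rewrite geq_max => /andP[nn np].
rewrite sub0r normrN ger0_norm; last by case/andP: (grid_err01 n w).
rewrite /grid_err ge_min; apply/orP; right; rewrite ler_pdivrMr//.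
have := H n nn np; rewrite (_ : (fun a t => X w a t - N w a t + N w a t) = X w)//.
by apply/funext => a; apply/funext => t; rewrite subrK.
Qed.

(** The variation of the noise is T tr G, and tr G = p + tr (G - 1), where |G - 1| is controlled by
    the normalised sum. *)
Lemma grid_var_bound n w (K : R) : (0 < n)%N -> nf (noise_sum n w) <= K ->
  grid_var T n (N w) <= T * (p%:R + nf (1%:M : 'M[R]_p) * (Num.sqrt 2 * K)).
Proof.
move=> n0 hK; set G := T^-1 *: grid_gram T n (N w) (N w).
have -> : grid_var T n (N w) = T * \tr G.
  rewrite /G linearZ /= mulrA divff ?gt_eqF// mul1r.
  by apply: eq_bigr => a _; rewrite mxE; apply: eq_bigr => i _; rewrite expr2.
rewrite ler_pM2l// -[G](subrK 1%:M) mxtraceD mxtrace1 addrC lerD2l.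
apply: le_trans (ler_norm _) _; rewrite -[_ - _]mul1mx.
apply: le_trans (nf_trace _ _) _; rewrite ler_wpM2l ?nf_ge0//.
have n1 : 1 <= Num.sqrt (n%:R : R) by rewrite -[leLHS]sqrtr1 ler_wsqrtr// ler1n.
apply: (@le_trans _ _ (nf (Num.sqrt n%:R *: (G - 1%:M)))).
  by rewrite nfZ ger0_norm ?sqrtr_ge0// ler_peMl ?nf_ge0.
rewrite -mxvec_nf noise_sum_gram// nfZ ger0_norm ?sqrtr_ge0//.
by rewrite ler_wpM2l ?sqrtr_ge0.
Qed.

(** The expansion of [S] is assumed only where [G] is bounded, uniformly in the sample point. This
    matches the events of [slutsky_laplace]: a bounded noise sum and a small [grid_err] keep [G],
    vectorised, within h <= 1 of sqrt 2 times the noise sum. *)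
Lemma limit_law (S : nat -> Omega -> R) (l : R) :
  let G n w := Num.sqrt n%:R *: (T^-1 *: grid_gram T n (X w) (X w) - 1%:M) in
  (forall n, measurable_fun setT (S n)) -> (forall n w, 0 <= S n w) ->
  (forall e K, 0 < e -> 0 < K -> exists n0, forall n w, (n0 <= n)%N -> (0 < n)%N ->
    nf (G n w) <= K -> `|S n w - fro (mxvec (G n w) *m Pi) / 2| <= e) ->
  0 < l -> (fun n => ex P (fun w => expR (- (l * S n w)))) @ \oo --> chi2_mgf dof l.
Proof.
move=> G mS S0 HS l0; apply/cvgrPdist_le => e e0.
have mZ n : measurable_fun setT (fun w => fro (noise_sum n w *m Pi)).
  apply: measurable_fro => j; apply: measurable_mulmx; first exact: noise_sum_meas.
  by move=> i k; exact: measurable_cst.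
have e20 : 0 < e / 2 by rewrite divr_gt0.
have [n1 H1] := noise_sum_laplace l0 e20.
have cond f K : 0 < f -> 0 < K -> exists n0, exists2 g, 0 < g & forall n w, (n0 <= n)%N -> (0 < n)%N ->
    nf (noise_sum n w) <= K -> grid_err n w <= g -> `|S n w - fro (noise_sum n w *m Pi)| <= f.
  move=> f0 K0; pose k := Num.sqrt 2 * K.
  have k0 : 0 < k by rewrite mulr_gt0// sqrtr_gt0.
  (* On the event considered, [V] bounds the denominator of [grid_err], so a [grid_err] of at most h
     T / V makes the scaled difference of the two Gram matrices at most h T. *)
  pose V := 1 + Num.sqrt (T * (p%:R + nf (1%:M : 'M[R]_p) * k)).
  have V0 : 0 < V by rewrite ltr_pwDl ?sqrtr_ge0.
  pose h : R := Num.min 1 (f / (2 * k + 1)).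
  have k20 : 0 < 2 * k + 1 by rewrite addr_gt0// mulr_gt0.
  have h0 : 0 < h by rewrite lt_min ltr01 divr_gt0.
  have h1 : h <= 1 by rewrite /h ge_min lexx.
  have hf : h * (2 * k + 1) / 2 <= f / 2.
    by rewrite ler_pM2r ?invr_gt0// -ler_pdivlMr// /h ge_min lexx orbT.
  have f20 : 0 < f / 2 by rewrite divr_gt0.
  have k10 : 0 < k + 1 by rewrite addr_gt0.
  have [n2 H2] := HS (f / 2) (k + 1) f20 k10.
  exists n2; exists (Num.min (1 / 2) (h * T / V)).
    by rewrite lt_min !divr_gt0// mulr_gt0.
  move=> n w nn np hK; rewrite le_min => /andP[g1 g2].
  have e1 : Num.sqrt n%:R * nf (grid_gram T n (X w) (X w) - grid_gram T n (N w) (N w)) <= h * T.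
    have : Num.sqrt n%:R * nf (grid_gram T n (X w) (X w) - grid_gram T n (N w) (N w)) /
        (1 + Num.sqrt (grid_var T n (N w))) <= h * T / V.
      exact: min1_le g1 g2.
    rewrite ler_pdivrMr// => /le_trans; apply.
    have hT0 : 0 <= h * T by rewrite mulr_ge0// ltW.
    rewrite -(mulrA (h * T)) ler_piMr// mulrC ler_pdivrMr// mul1r.
    by rewrite lerD2l ler_wsqrtr// grid_var_bound.
  pose x := mxvec (G n w); pose y := Num.sqrt 2 *: noise_sum n w.
  have nxy : nf (x - y) <= h.
    rewrite /x /y -noise_sum_gram// -linearB /= mxvec_nf /G -scalerBr.
    rewrite opprB addrA subrK -scalerBr !nfZ ger0_norm ?sqrtr_ge0//.
    rewrite ger0_norm ?invr_ge0 ?(ltW T0)// mulrCA mulrC ler_pdivrMr//.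
  have ny : nf y <= k by rewrite /y nfZ ger0_norm ?sqrtr_ge0// ler_wpM2l ?sqrtr_ge0.
  have nG : nf (G n w) <= k + 1.
    rewrite -mxvec_nf -/x -[x](subrK y) addrC; apply: le_trans (nfD _ _) _.
    by apply: lerD => //; exact: le_trans h1.
  have H3 := H2 n w nn np nG; rewrite -/x in H3.
  (* The factor 1/2 of the expansion cancels the square of sqrt 2, leaving the squared length of a
     sum whose covariance is a projector. *)
  have yE : fro (noise_sum n w *m Pi) = fro (y *m Pi) / 2.
    rewrite /y -scalemxAl froZ sqr_sqrtr// mulrC mulrA mulVf ?mul1r//.
  rewrite yE.
  have d1 : `|nf (x *m Pi) - nf (y *m Pi)| <= h.
    apply: le_trans (nf_sub _ _) _; rewrite -mulmxBl.
    exact: le_trans (nf_proj Ju _) nxy.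
  have d2 : nf (y *m Pi) <= k by exact: le_trans (nf_proj Ju _) ny.
  have d3 := sqr_close d1 (nf_ge0 _) (nf_ge0 _) d2 h1.
  rewrite !sqr_nf in d3.
  rewrite (splitr f); apply: le_trans (ler_distD (fro (x *m Pi) / 2) _ _) _.
  by apply: lerD => //; exact: le_trans d3 hf.
have [n2 H2] := @slutsky_laplace _ _ _ P (fun=> (p * p)%N) noise_sum S _ grid_err _ l _
  mS mZ S0 (fun n w => fro_ge0 _) noise_sum_fro measurable_grid_err grid_err01
  grid_err_cvg cond (ltW l0) e20.
exists (maxn 1 (maxn n1 n2)) => // n /=; rewrite !geq_max => /and3P[np nn1 nn2].
rewrite distrC [leRHS]splitr.
apply: le_trans (ler_distD (ex P (fun w => expR (- (l * fro (noise_sum n w *m Pi))))) _ _) _.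
by apply: lerD; [exact: H2|exact: H1].
Qed.

End LimitLaw.

(** * The observed path as noise plus a C^1 path *)

Section ObservedPath.
Context (R : realType) (dd : measure_display) (Omega : measurableType dd)
  (P : probability Omega R).
Variable T : R.
Hypothesis T0 : 0 < T.

Lemma uniform_C1_ext (D D' b : R -> R) : (forall t, 0 <= t <= T -> D t = D' t) ->
  uniform_C1 T D b -> uniform_C1 T D' b.
Proof.
move=> DD [cb h]; split=> // e /h[d d0 H]; exists d => // s t s0 st tT td.
rewrite -!DD; [exact: H|by rewrite s0 (le_trans st)|by rewrite (le_trans s0)].
Qed.

Lemma wiener_path_cont r (W : R -> Omega -> 'cV[R]_r) : wiener P W ->
  {ae P, forall w, forall c, {within `[0, T], continuous (fun t => W t w c 0)}}.
Proof.
move=> [W1 _]; apply: filter_forall => c; have [_ h _ _] := W1 c.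
apply: filterS h => w [_ h]; apply: continuous_subspaceW h.
by apply: subset_itvl; rewrite bnd_simp.
Qed.

Definition noise_drift_split k r (S : 'M[R]_(k, r)) (W : R -> Omega -> 'cV[R]_r)
    (Y : R -> Omega -> 'cV[R]_k) (w : Omega) : Prop :=
  (forall c, {within `[0, T], continuous (fun t => W t w c 0)}) /\
  exists b : 'I_k -> R -> R, forall j,
    uniform_C1 T (fun t => Y t w j 0 - (S *m W t w) j 0) (b j).

(** Once the noise S W is subtracted, what remains of the solution is c plus the integral of B along
    a continuous path, hence C^1. *)
Lemma additive_noise_path k r (B : 'cV[R]_k -> 'cV[R]_k) (S : 'M[R]_(k, r)) c W Y :
  wiener P W -> sde_solution P T B S c W Y -> regular_drift B ->
  {ae P, forall w, noise_drift_split S W Y w}.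
Proof.
move=> hW [_ hY] [_ hB]; apply: filterS2 (wiener_path_cont hW) hY => w cW [cY EY]; split=> //.
exists (fun j t => B (Y t w) j 0) => j.
have E t : 0 <= t <= T -> Y t w j 0 - (S *m W t w) j 0 =
    c j 0 + \int[lebesgue_measure]_(s in `[0, t]) B (Y s w) j 0.
  by move=> tT; rewrite (EY t tT) [X in X - _]mxE addrK [LHS]mxE [X in _ + X]mxE.
apply: uniform_C1_int.
  have [_ /(_ [::] isT)[cB _]] := hB j.
  by move=> t; apply: (cvg_comp _ (fun y : 'cV[R]_k => B y j 0) (cY t)); exact: cB.
move=> t tT; rewrite (E t tT) (E 0); last by rewrite lexx ltW.
by rewrite set_itv1 Rintegral_set1 addr0.
Qed.

Variables (r1 r2 r3 r4 p : nat).

Definition mix_coef (N1 : 'M[R]_(p, r1)) (N2 : 'M[R]_(p, r2)) (N3 : 'M[R]_(p, r3))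
    (N4 : 'M[R]_(p, r4)) (a : 'I_p) (c : noise r1 r2 r3 r4) : R :=
  match c with
  | inl c => N1 a c
  | inr (inl c) => N2 a c
  | inr (inr (inl c)) => N3 a c
  | inr (inr (inr c)) => N4 a c
  end.

Lemma mix_coef_gram N1 N2 N3 N4 a b :
  \sum_c mix_coef N1 N2 N3 N4 a c * mix_coef N1 N2 N3 N4 b c =
  (N1 *m N1^T + (N2 *m N2^T + (N3 *m N3^T + N4 *m N4^T))) a b.
Proof.
have E r (N : 'M[R]_(p, r)) : (N *m N^T) a b = \sum_c N a c * N b c.
  by rewrite mxE; apply: eq_bigr => c _; rewrite mxE.
by rewrite [RHS]mxE [X in _ + X]mxE [X in _ + (_ + X)]mxE !E !big_sumType.
Qed.

Variables (W1 : R -> Omega -> 'cV[R]_r1) (W2 : R -> Omega -> 'cV[R]_r2)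
  (W3 : R -> Omega -> 'cV[R]_r3) (W4 : R -> Omega -> 'cV[R]_r4).

Lemma mixed_noiseE N1 N2 N3 N4 w a t :
  mixed_noise W1 W2 W3 W4 (mix_coef N1 N2 N3 N4) w a t =
  (N1 *m W1 t w) a 0 + ((N2 *m W2 t w) a 0 + ((N3 *m W3 t w) a 0 + (N4 *m W4 t w) a 0)).
Proof. by rewrite !mxE /mixed_noise !big_sumType. Qed.

Lemma continuous_mixed_noise (o : 'I_p -> noise r1 r2 r3 r4 -> R) w a :
  (forall c, {within `[0, T], continuous (fun t => W1 t w c 0)}) ->
  (forall c, {within `[0, T], continuous (fun t => W2 t w c 0)}) ->
  (forall c, {within `[0, T], continuous (fun t => W3 t w c 0)}) ->
  (forall c, {within `[0, T], continuous (fun t => W4 t w c 0)}) ->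
  {within `[0, T], continuous (mixed_noise W1 W2 W3 W4 o w a)}.
Proof.
move=> h1 h2 h3 h4; rewrite /mixed_noise.
have h c : {within `[0, T], continuous (fun t => o a c * noise_path W1 W2 W3 W4 c t w)}.
  move=> x; apply: cvgM; first exact: cvg_cst.
  by move: x; case: c => [c|[c|[c|c]]]; [exact: h1|exact: h2|exact: h3|exact: h4].
elim: (index_enum _) => [|c s IH].
  have -> : (fun t => \sum_(c <- [::]) o a c * noise_path W1 W2 W3 W4 c t w) = fun=> 0.
    by apply/funext => t; rewrite big_nil.
  by move=> x; exact: cvg_cst.
have -> : (fun t => \sum_(c0 <- c :: s) o a c0 * noise_path W1 W2 W3 W4 c0 t w) =
    fun t => o a c * noise_path W1 W2 W3 W4 c t w + \sum_(c0 <- s) o a c0 * noise_path W1 W2 W3 W4 c0 t w.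
  by apply/funext => t; rewrite big_cons.
by move=> x; apply: cvgD; [exact: h|exact: IH].
Qed.

Variables (k1 k2 k3 k4 : nat) (M1 : 'M[R]_(p, k1)) (M2 : 'M[R]_(p, k2))
  (M3 : 'M[R]_(p, k3)) (M4 : 'M[R]_(p, k4)).
Variables (B1 : 'cV[R]_k1 -> 'cV[R]_k1) (B2 : 'cV[R]_k2 -> 'cV[R]_k2)
  (B3 : 'cV[R]_k3 -> 'cV[R]_k3) (B4 : 'cV[R]_k4 -> 'cV[R]_k4).
Variables (S1 : 'M[R]_(k1, r1)) (S2 : 'M[R]_(k2, r2)) (S3 : 'M[R]_(k3, r3)) (S4 : 'M[R]_(k4, r4)).
Variables (c1 : 'cV[R]_k1) (c2 : 'cV[R]_k2) (c3 : 'cV[R]_k3) (c4 : 'cV[R]_k4).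
Variables (Y1 : R -> Omega -> 'cV[R]_k1) (Y2 : R -> Omega -> 'cV[R]_k2)
  (Y3 : R -> Omega -> 'cV[R]_k3) (Y4 : R -> Omega -> 'cV[R]_k4).
Hypotheses (hW1 : wiener P W1) (hW2 : wiener P W2) (hW3 : wiener P W3) (hW4 : wiener P W4).
Hypotheses (hY1 : sde_solution P T B1 S1 c1 W1 Y1) (hY2 : sde_solution P T B2 S2 c2 W2 Y2)
  (hY3 : sde_solution P T B3 S3 c3 W3 Y3) (hY4 : sde_solution P T B4 S4 c4 W4 Y4).
Hypotheses (hB1 : regular_drift B1) (hB2 : regular_drift B2)
  (hB3 : regular_drift B3) (hB4 : regular_drift B4).

Lemma observed_path (Z : R -> Omega -> 'cV[R]_p) :
  (forall t w, 0 <= t <= T ->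
    Z t w = M1 *m Y1 t w + (M2 *m Y2 t w + (M3 *m Y3 t w + M4 *m Y4 t w))) ->
  let o := mix_coef (M1 *m S1) (M2 *m S2) (M3 *m S3) (M4 *m S4) in
  {ae P, forall w, exists b : 'I_p -> R -> R, forall a,
    uniform_C1 T (fun t => Z t w a 0 - mixed_noise W1 W2 W3 W4 o w a t) (b a) /\
    {within `[0, T], continuous (mixed_noise W1 W2 W3 W4 o w a)}}.
Proof.
move=> hZ o.
have h1 := additive_noise_path hW1 hY1 hB1.
have h234 : {ae P, forall w, [/\ noise_drift_split S2 W2 Y2 w, noise_drift_split S3 W3 Y3 w &
    noise_drift_split S4 W4 Y4 w]}.
  by apply: filterS3 (additive_noise_path hW2 hY2 hB2) (additive_noise_path hW3 hY3 hB3)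
    (additive_noise_path hW4 hY4 hB4) => w e2 e3 e4; split.
apply: filterS2 h1 h234 => w [e1 [b1 f1]] [[e2 [b2 f2]] [e3 [b3 f3]] [e4 [b4 f4]]].
have g k r (M : 'M[R]_(p, k)) (S : 'M[R]_(k, r)) (Y : R -> Omega -> 'cV[R]_k)
    (W : R -> Omega -> 'cV[R]_r) (b : 'I_k -> R -> R) a :
    (forall j, uniform_C1 T (fun t => Y t w j 0 - (S *m W t w) j 0) (b j)) ->
    uniform_C1 T (fun t => (M *m Y t w) a 0 - (M *m S *m W t w) a 0) (fun t => \sum_j M a j * b j t).
  move=> h; have := uniform_C1_sum (fun j => uniform_C1Z (M a j) (h j)).
  apply: uniform_C1_ext => t _; rewrite -mulmxA [X in X - _]mxE [X in _ - X]mxE -sumrB.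
  by apply: eq_bigr => j _; rewrite mulrBr.
exists (fun a t => \sum_j M1 a j * b1 j t + (\sum_j M2 a j * b2 j t +
  (\sum_j M3 a j * b3 j t + \sum_j M4 a j * b4 j t))) => a; split; last first.
  exact: continuous_mixed_noise.
have := uniform_C1D (g _ _ M1 _ _ _ _ a f1) (uniform_C1D (g _ _ M2 _ _ _ _ a f2)
  (uniform_C1D (g _ _ M3 _ _ _ _ a f3) (g _ _ M4 _ _ _ _ a f4))).
apply: uniform_C1_ext => t tT; rewrite mixed_noiseE (hZ t w tT).
rewrite [X in _ = X - _]mxE [X in _ = _ + X - _]mxE [X in _ = _ + (_ + X) - _]mxE.
ring.
Qed.

End ObservedPath.

Lemma chi2_limit (R : realType) (dd : measure_display) (Omega : measurableType dd)
    (P : probability Omega R) (k : nat) (X : nat -> Omega -> R) : (0 < k)%N ->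
  (forall n, measurable_fun setT (X n)) -> (forall n w, 0 <= X n w) ->
  (forall l, 0 < l -> (fun n => ex P (fun w => expR (- (l * X n w)))) @ \oo --> chi2_mgf k%:R l) ->
  cvg_in_distribution P X (@chi2_prob R k).
Proof.
move=> k0 mX X0 lapX x _; apply: cdf_limit => //.
- exact: measurable_chi2_pdf.
- exact: chi2_pdf_ge0.
- by move=> y y0; rewrite /chi2_pdf ltNge (ltW y0).
- have := chi2_laplace k0 (lexx (0 : R)); rewrite /chi2_mgf mulr0 addr0 ln1 mulr0 oppr0 expR0.
  by under eq_integral do rewrite mul0r oppr0 expR0 mul1r.
- move=> l l0; rewrite /Rintegral chi2_laplace//=.
  have [->|lp] := eqVneq l 0; last by apply: lapX; rewrite lt_neqAle eq_sym lp.
  under eq_fun do under eq_fun do rewrite mul0r oppr0 expR0.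
  rewrite /chi2_mgf mulr0 addr0 ln1 mulr0 oppr0 expR0.
  by under eq_fun do rewrite ex_cst; exact: cvg_cst.
Qed.

(** * The observed vector as a linear image of the latent ones *)

Section SemObservation.
Context (R : realType) (p1 p2 k1 k2 r1 r2 r3 r4 : nat).
Variables (L1 : 'M[R]_(p1, k1)) (L2 : 'M[R]_(p2, k2)) (G : 'M[R]_(k2, k1)) (Psi : 'M[R]_k2).
Hypothesis Psiu : Psi \in unitmx.

(** These four matrices are the loadings of the observation on the four latent processes, after eta
    has been eliminated through the inverse of [Psi]. *)
Definition load_xi : 'M[R]_(p1 + p2, k1) := col_mx L1 (L2 *m invmx Psi *m G).
Definition load_delta : 'M[R]_(p1 + p2, p1) := col_mx 1%:M 0.
Definition load_eps : 'M[R]_(p1 + p2, p2) := col_mx 0 1%:M.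
Definition load_zeta : 'M[R]_(p1 + p2, k2) := col_mx 0 (L2 *m invmx Psi).

Lemma sem_observation (xi : 'cV[R]_k1) (delta : 'cV[R]_p1) (eps : 'cV[R]_p2) (zeta eta : 'cV[R]_k2) :
  Psi *m eta = G *m xi + zeta ->
  col_mx (L1 *m xi + delta) (L2 *m eta + eps) =
  load_xi *m xi + (load_delta *m delta + (load_eps *m eps + load_zeta *m zeta)).
Proof.
move=> h; have -> : eta = invmx Psi *m (G *m xi + zeta) by rewrite -h mulKmx.
rewrite !mul_col_mx !add_col_mx !mul1mx !mul0mx !addr0 !add0r !mulmxDr !mulmxA.
by congr col_mx; rewrite -addrA; congr (_ + _); rewrite addrC.
Qed.

Lemma sem_cov_loads (S1 : 'M[R]_(k1, r1)) (S2 : 'M[R]_(p1, r2)) (S3 : 'M[R]_(p2, r3))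
    (S4 : 'M[R]_(k2, r4)) :
  sem_cov (Sem L1 L2 G Psi (S1 *m S1^T) (S2 *m S2^T) (S3 *m S3^T) (S4 *m S4^T)) =
  (load_xi *m S1) *m (load_xi *m S1)^T + ((load_delta *m S2) *m (load_delta *m S2)^T +
    ((load_eps *m S3) *m (load_eps *m S3)^T + (load_zeta *m S4) *m (load_zeta *m S4)^T)).
Proof.
rewrite sem_cov_decomp /=; last by rewrite trmx_mul trmxK.
have E m n (A : 'M[R]_(p1 + p2, m)) (S : 'M[R]_(m, n)) :
    A *m S *m (A *m S)^T = A *m (S *m S^T) *m A^T by rewrite trmx_mul !mulmxA.
rewrite !E -addrA; congr (_ + _); rewrite addrC [RHS]addrA; congr (_ + _).
rewrite /load_delta /load_eps !mul_col_mx !tr_col_mx !mul_mx_row !mul1mx !mul0mx.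
rewrite !trmx1 !trmx0 !mulmx1 !mulmx0 add_col_mx !add_row_mx !addr0 !add0r.
by [].
Qed.

End SemObservation.

(** The truncated half is exact because p (p + 1) is even. *)
Lemma half_dof (R : realType) (p q : nat) : (q <= (p * p.+1)./2)%N ->
  (p * p.+1)%:R / 2 - q%:R = ((p * p.+1)./2 - q)%:R :> R.
Proof.
move=> h; rewrite natrB//; congr (_ - _).
have ev : ~~ odd (p * p.+1) by rewrite oddM /= andbN.
by rewrite -[in LHS](even_halfK ev) -muln2 natrM mulfK// pnatr_eq0.
Qed.

Theorem theorem3
  (R : realType) (dd : measure_display) (Omega : measurableType dd)
  (P : probability Omega R)
  (p1 p2 k1 k2 r1 r2 r3 r4 q : nat)
  (hp1 : (1 <= p1)%N) (hp2 : (1 <= p2)%N)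
  (hk1 : (1 <= k1 <= p1)%N) (hk2 : (1 <= k2 <= p2)%N)
  (hr1 : (1 <= r1)%N) (hr2 : (1 <= r2)%N)
  (hr3 : (1 <= r3)%N) (hr4 : (1 <= r4)%N)
  (hdf : (q < ((p1 + p2) * (p1 + p2).+1)./2)%N)
  (T : R) (hT : 0 < T)
  (* driving noise *)
  (W1 : R -> Omega -> 'cV[R]_r1) (W2 : R -> Omega -> 'cV[R]_r2)
  (W3 : R -> Omega -> 'cV[R]_r3) (W4 : R -> Omega -> 'cV[R]_r4)
  (hW1 : wiener P W1) (hW2 : wiener P W2)
  (hW3 : wiener P W3) (hW4 : wiener P W4)
  (hW : independent4 P W1 W2 W3 W4)
  (* true model *)
  (B1 : 'cV[R]_k1 -> 'cV[R]_k1) (B2 : 'cV[R]_p1 -> 'cV[R]_p1)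
  (B3 : 'cV[R]_p2 -> 'cV[R]_p2) (B4 : 'cV[R]_k2 -> 'cV[R]_k2)
  (S1 : 'M[R]_(k1, r1)) (S2 : 'M[R]_(p1, r2))
  (S3 : 'M[R]_(p2, r3)) (S4 : 'M[R]_(k2, r4))
  (c1 : 'cV[R]_k1) (c2 : 'cV[R]_p1) (c3 : 'cV[R]_p2) (c4 : 'cV[R]_k2)
  (xi : R -> Omega -> 'cV[R]_k1) (delta : R -> Omega -> 'cV[R]_p1)
  (eps : R -> Omega -> 'cV[R]_p2) (zeta : R -> Omega -> 'cV[R]_k2)
  (hxi : sde_solution P T B1 S1 c1 W1 xi)
  (hdelta : sde_solution P T B2 S2 c2 W2 delta)
  (heps : sde_solution P T B3 S3 c3 W3 eps)
  (hzeta : sde_solution P T B4 S4 c4 W4 zeta)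
  (hS2 : posdef (S2 *m S2^T)) (hS3 : posdef (S3 *m S3^T))
  (L1 : 'M[R]_(p1, k1)) (L2 : 'M[R]_(p2, k2))
  (G : 'M[R]_(k2, k1)) (B : 'M[R]_k2)
  (hL1 : \rank L1 = k1)
  (hB : forall i, B i i = 0) (hPsi : 1%:M - B \in unitmx)
  (* observations *)
  (eta : R -> Omega -> 'cV[R]_k2) (X : R -> Omega -> 'cV[R]_(p1 + p2))
  (heta : forall (t : R) w, 0 <= t <= T ->
     eta t w = B *m eta t w + G *m xi t w + zeta t w)
  (hX : forall (t : R) w, 0 <= t <= T ->
     X t w = col_mx (L1 *m xi t w + delta t w) (L2 *m eta t w + eps t w))
  (* parametric model and estimator *)
  (Theta : set 'rV[R]_q) (hTconv : convex_set Theta) (hTcomp : compact Theta)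
  (M : sem (R + 'I_q) p1 p2 k1 k2) (hM : sem_model Theta M)
  (thetahat : nat -> Omega -> 'rV[R]_q)
  (hmeas : forall n j, measurable_fun setT (fun w => thetahat n w 0 j))
  (hmin : forall n w, (0 < n)%N ->
     min_contrast Theta M (quad_var T n (X^~ w)) (thetahat n w))
  (* assumptions *)
  (hB1 : regular_drift B1) (hB2 : regular_drift B2)
  (hB3 : regular_drift B3) (hB4 : regular_drift B4)
  (hmxi : bounded_moments P T xi) (hmdelta : bounded_moments P T delta)
  (hmeps : bounded_moments P T eps) (hmzeta : bounded_moments P T zeta)
  (theta0 : 'rV[R]_q) (htheta0 : Theta° theta0)
  (H0 : sem_cov (Sem L1 L2 G (1%:M - B) (S1 *m S1^T) (S2 *m S2^T)
                   (S3 *m S3^T) (S4 *m S4^T)) = Sigma M theta0)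
  (hident : forall theta1 theta2, Theta theta1 -> Theta theta2 ->
     Sigma M theta1 = Sigma M theta2 -> theta1 = theta2)
  (hrank : \rank (Delta M theta0) = q) :
  cvg_in_distribution P
    (fun n w =>
       n%:R * contrast (quad_var T n (X^~ w)) (Sigma M (thetahat n w)))
    (@chi2_prob R (((p1 + p2) * (p1 + p2).+1)./2 - q)).
Proof.
set p := (p1 + p2)%N.
have Th0 : Theta theta0 by exact: interior_subset.
have S0pos : posdef (Sigma M theta0) by exact: posdef_sem_cov (proj2 hM _ Th0).
have [K Ku SK] := cholesky S0pos; pose Ki := invmx K.
have [J [Ju JS hexp]] := statistic_expansion hTcomp hM htheta0 hrank hident Ku SK.
pose A1 := Ki *m load_xi L1 L2 G (1%:M - B).
pose A2 := Ki *m load_delta R p1 p2.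
pose A3 := Ki *m load_eps R p1 p2.
pose A4 := Ki *m load_zeta p1 L2 (1%:M - B).
pose o := mix_coef (A1 *m S1) (A2 *m S2) (A3 *m S3) (A4 *m S4).
(* Orthonormality of the mixing coefficients restates K^-1 Sigma_0 K^-T = 1, and it is here that
   [H0] enters. *)
have oo a b : \sum_c o a c * o b c = (a == b)%:R.
  rewrite mix_coef_gram.
  have E m n (A : 'M[R]_(p, m)) (S : 'M[R]_(m, n)) :
      (Ki *m A *m S) *m (Ki *m A *m S)^T = Ki *m ((A *m S) *m (A *m S)^T) *m Ki^T.
    by rewrite !trmx_mul !mulmxA.
  rewrite /A1 /A2 /A3 /A4 !E -!mulmxDl -!mulmxDr -(sem_cov_loads L1 L2 G (1%:M - B)) H0 SK.
  rewrite /Ki !mulmxA mulVmx// mul1mx -trmx_mul mulVmx// trmx1.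
  by rewrite mxE.
have hZ t w : 0 <= t <= T -> Ki *m X t w =
    A1 *m xi t w + (A2 *m delta t w + (A3 *m eps t w + A4 *m zeta t w)).
  move=> tT; rewrite (hX t w tT) (@sem_observation _ _ _ _ _ L1 L2 G _ hPsi _ _ _ (zeta t w)).
    by rewrite !mulmxDr !mulmxA.
  by apply/eqP; rewrite mulmxBl mul1mx subr_eq {1}(heta t w tT) -addrA addrC.
have hpath := observed_path hT hW1 hW2 hW3 hW4 hxi hdelta heps hzeta hB1 hB2 hB3 hB4 hZ.
have mZ a t : 0 <= t <= T -> measurable_fun setT (fun w => (Ki *m X t w) a 0).
  move=> tT; under eq_fun do rewrite hZ//.
  have mk m (A : 'M[R]_(p, m)) (Y : R -> Omega -> 'cV[R]_m) : random_vector (Y t) ->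
      mxmeas (fun w => A *m Y t w).
    move=> mY; apply: measurable_mulmx; first by move=> i j; exact: measurable_cst.
    by move=> i j; rewrite ord1; exact: mY.
  have m1 := mk _ A1 _ (proj1 hxi t tT); have m2 := mk _ A2 _ (proj1 hdelta t tT).
  have m3 := mk _ A3 _ (proj1 heps t tT); have m4 := mk _ A4 _ (proj1 hzeta t tT).
  by apply: measurable_addmx => //; apply: measurable_addmx => //; apply: measurable_addmx.
(* The equations give measurability of the normalised observation as a linear image of the latent
   vectors; multiplying by K returns to [X]. *)
have mX t : 0 <= t <= T -> random_vector (X t).
  move=> tT a; under eq_fun do rewrite -[X t _](mulKVmx Ku).
  apply: measurable_mulmx; first by move=> i j; exact: measurable_cst.
  by move=> i j; rewrite ord1; exact: mZ.
have psdQ n w : psd (quad_var T n (X^~ w)) by exact: psd_quad_var.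
have adm n w : (0 < n)%N -> sem_admissible (sem_at M (thetahat n w)).
  by move=> n0; apply: (proj2 hM); case: (hmin n w n0).
pose S n w := n%:R * contrast (quad_var T n (X^~ w)) (Sigma M (thetahat n w)).
have mS n : measurable_fun setT (S n).
  (* At n = 0 the estimator is not assumed to minimise anything or to lie in [Theta]; the factor n
     makes the statistic 0. *)
  have [->|n0] := posnP n.
    have -> : S 0%N = fun=> 0 by apply/funext => w; rewrite /S mul0r.
    exact: measurable_cst.
  apply: measurable_funM => //; apply: measurable_contrast.
  - exact: measurable_quad_var.
  - apply: measurable_Sigma; first by move=> i j; rewrite ord1; exact: hmeas.
    by move=> w; case: (adm n w n0).
  - by move=> w; apply/posdef_unit/posdef_sem_cov/adm.
have S0 n w : 0 <= S n w.
  have [->|n0] := posnP n; first by rewrite /S mul0r.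
  by rewrite mulr_ge0// contrast_ge0//; exact/posdef_sem_cov/adm.
have dE : (p * p.+1)%:R / 2 - q%:R = ((p * p.+1)./2 - q)%:R :> R.
  by apply: half_dof; exact: ltnW.
have d0 : 0 <= (p * p.+1)%:R / 2 - q%:R :> R by rewrite dE.
apply: (@chi2_limit _ _ _ _ _ S); [by rewrite subn_gt0|exact: mS|exact: S0|].
move=> l l0; rewrite -dE.
apply: (limit_law hW1 hW2 hW3 hW4 hW hT oo Ju JS d0 (X := fun w a t => (Ki *m X t w) a 0) mZ hpath mS S0 _ l0).
move=> e C e0 C0; have [n0 h] := hexp e C e0 C0; exists n0 => n w nn np hC.
have := h n (quad_var T n (X^~ w)) (thetahat n w) nn (psdQ n w).
by rewrite -/Ki quad_var_congr => /(_ hC (hmin n w np)).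
Qed.
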